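(* Let $h\in C(\mathbb{R})$, $h\not\equiv0$, be square-integrable and continuously differentiable with square-integrable derivative $h'$, and let $\rho(x)=\int_{\mathbb{R}}h(y-x)h(y)\,dy$, $x\in\mathbb{R}$. Suppose that $\rho(x)\to0$ as $|x|\to\infty$, and for $\theta\ge1$ put $\rho_\theta(x)=\rho(\theta x)$. Let $m\ge1$. For each $\theta\ge1$ let $\{(x_1^\theta(t),\dots,x_m^\theta(t)):t\ge0\}$ be an $m$-system of interacting Brownian motions with interaction parameter $\rho_\theta(\cdot)$ and initial state $(a_1^\theta,\dots,a_m^\theta)\in\mathbb{R}^m$. If $a_i^\theta\to b_i\in\mathbb{R}$ as $\theta\to\infty$ for each $1\le i\le m$, then, as $\theta\to\infty$, the law of $\{(x_1^\theta(t),\dots,x_m^\theta(t)):t\ge0\}$ on $C([0,\infty),\mathbb{R}^m)$ converges weakly to that of the $m$-system of coalescing Brownian motions with speed $\rho(0)$ starting from $(b_1,\dots,b_m)$.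
   Context: Interacting Brownian motions: let $g\in C(\mathbb{R})$ be square-integrable and continuously differentiable with square-integrable derivative, and let $W(ds,dy)$ be a time-space white noise on $[0,\infty)\times\mathbb{R}$ based on Lebesgue measure. For each $a\in\mathbb{R}$ the equation $x(t)=a+\int_0^t\int_{\mathbb{R}}g(y-x(s))\,W(ds,dy)$, $t\ge0$, has a unique solution $\{x(a,t):t\ge0\}$. For $(a_1,\dots,a_m)\in\mathbb{R}^m$, the process $\{(x(a_1,t),\dots,x(a_m,t)):t\ge0\}$ (all solutions driven by the same white noise) is a diffusion process generated by $\frac12\sum_{i,j=1}^m r(x_i-x_j)\frac{\partial^2}{\partial x_i\partial x_j}$, where $r(x)=\int_{\mathbb{R}}g(y-x)g(y)\,dy$; it is called an $m$-system of interacting Brownian motions ($m$-SIBM) with interaction parameter $r(\cdot)$ and initial state $(a_1,\dots,a_m)$. The interaction parameter $\rho_\theta$ corresponds to $g(x)=\sqrt{\theta}\,h(\theta x)$. Coalescing Brownian motions: a Brownian motion with speed $\rho_0$ is a real Brownian motion with quadratic variation $\rho_0t$. An $m$-dimensional continuous process $\{(y_1(t),\dots,y_m(t))\}$ is an $m$-system of coalescing Brownian motions with speed $\rho_0>0$ if each $y_i$ is a Brownian motion with speed $\rho_0$ and, for $i\ne j$, $|y_i-y_j|$ is a Brownian motion with speed $2\rho_0$ stopped at the origin (all relative to the common filtration of the system); equivalently the $y_i$ are continuous local martingales with $\langle y_i,y_j\rangle(t)=\rho_0\,(t-t\wedge\tau_{ij})$ for $1\le i,j\le m$, where $\tau_{ij}=\inf\{t\ge0:y_i(t)=y_j(t)\}$.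 The path space $C([0,\infty),\mathbb{R}^m)$ carries the topology of locally uniform convergence. *)

(* Defs.v *)
From HB Require Import structures.
From mathcomp Require Import all_boot all_order all_algebra.
From mathcomp Require Import all_classical all_reals all_analysis.
Set Implicit Arguments.
Unset Strict Implicit.
Unset Printing Implicit Defensive.
Import Order.TTheory GRing.Theory Num.Theory.
Import numFieldNormedType.Exports.
Local Open Scope classical_set_scope.
Local Open Scope ring_scope.

Definition halfline (R : realType) : set R := [set t : R | 0 <= t].
Arguments halfline R : clear implicits.

Definition path_space (R : realType) (m : nat) : Type :=
  continuousType (set_type (halfline R)) 'rV[R]_m.

HB.instance Definition _ (R : realType) (m : nat) :=
  Choice.on (path_space R m).

(* Uniform convergence on all compact subsets of [0,oo), which is the same as
   locally uniform convergence since [0,oo) is locally compact. *)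
HB.instance Definition _ (R : realType) (m : nat) :=
  Topological.copy (path_space R m)
    (initial_topology (fun f : path_space R m =>
       (f : {family compact, set_type (halfline R) -> 'rV[R]_m}))).

Definition zero_path (R : realType) (m : nat) : path_space R m :=
  mkcts (@cst_continuous (set_type (halfline R)) 'rV[R]_m 0).

HB.instance Definition _ (R : realType) (m : nat) :=
  isPointed.Build (path_space R m) (zero_path R m).

Definition borel_paths (R : realType) (m : nat) :=
  g_sigma_algebraType (@open (path_space R m)).

Lemma max0_halfline (R : realType) (t : R) : Num.max 0 t \in halfline R.
Proof. by rewrite inE /halfline /= le_max lexx. Qed.

(* Only times [0 <= t] matter; the truncation makes [coord] total in [t]. *)
Definition coord (R : realType) (m : nat) (T : Type)
    (X : T -> path_space R m) (i : 'I_m) (t : R) (w : T) : R :=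
  X w (exist _ (Num.max 0 t) (max0_halfline t)) 0 i.

Definition weakly_converges (R : realType) (m : nat)
    (mu : R -> probability (borel_paths R m) R)
    (nu : probability (borel_paths R m) R) : Prop :=
  forall phi : path_space R m -> R,
    continuous phi -> (exists K : R, forall f, `|phi f| <= K) ->
    ((\int[mu theta]_f (phi f)%:E)%E @[theta --> +oo%R]
       --> (\int[nu]_f (phi f)%:E)%E).

Section stochastic_basis.
Context {R : realType} {d : measure_display} {T : measurableType d}.
Variable P : probability T R.
Implicit Types (F : R -> set (set T)) (W : set (R * R) -> T -> R).

Definition is_filtration F : Prop :=
  [/\ forall t, 0 <= t -> sigma_algebra setT (F t),
      forall t, 0 <= t -> F t `<=` measurable &
      forall s t, 0 <= s -> s <= t -> F s `<=` F t].

Definition measurable_wrt (G : set (set T)) (Z : T -> R) : Prop :=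
  forall B : set R, measurable B -> G (Z @^-1` B).

Definition adapted F (x : R -> T -> R) : Prop :=
  forall t, 0 <= t -> measurable_wrt (F t) (x t).

(* [Z] has law N(0, v). The case [v = 0] is separate because [normal_prob]
   with zero standard deviation is not a Dirac mass in the library. *)
Definition centered_gaussian (Z : T -> R) (v : R) : Prop :=
  forall B : set R, measurable B ->
    P (Z @^-1` B) = if v == 0 then \d_(0 : R) B
                    else normal_prob 0 (Num.sqrt v) B.

(* The sigma-algebra [G] and the variables [Z 0, ..., Z (n-1)] are mutually
   independent; subfamilies are covered by taking [E = setT] or [B i = setT]. *)
Definition independent_of (G : set (set T)) (n : nat) (Z : 'I_n -> T -> R) :
    Prop :=
  forall (E : set T) (B : 'I_n -> set R), G E -> (forall i, measurable (B i)) ->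
    P (E `&` \bigcap_i (Z i @^-1` B i)) =
    (P E * \prod_(i < n) P (Z i @^-1` B i))%E.

Definition lebesgue2 : set (R * R) -> \bar R :=
  (@lebesgue_measure R \x @lebesgue_measure R)%E.

Definition noise_set (I : set R) (A : set (R * R)) : Prop :=
  [/\ measurable A, A `<=` I `*` setT & (lebesgue2 A < +oo)%E].

(* A white noise based on Lebesgue measure, relative to the filtration [F]:
   the noise before [t] is known at [t], that after [t] is independent of
   [F t]. *)
Record is_white_noise F W : Prop := {
  white_noise_measurable : forall A, noise_set `[0, +oo[ A ->
    measurable_fun setT (W A);
  white_noise_gaussian : forall A, noise_set `[0, +oo[ A ->
    centered_gaussian (W A) (fine (lebesgue2 A));
  white_noise_additive : forall A B, noise_set `[0, +oo[ A ->
    noise_set `[0, +oo[ B -> A `&` B = set0 ->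
    {ae P, forall w, W (A `|` B) w = W A w + W B w};
  white_noise_independent : forall (n : nat) (A : 'I_n -> set (R * R)),
    (forall i, noise_set `[0, +oo[ (A i)) -> trivIset setT A ->
    independent_of [set setT] (fun i => W (A i));
  white_noise_adapted : forall t A, 0 <= t -> noise_set `[0, t] A ->
    measurable_wrt (F t) (W A);
  white_noise_future : forall t (n : nat) (A : 'I_n -> set (R * R)), 0 <= t ->
    (forall i, noise_set `]t, +oo[ (A i)) -> trivIset setT A ->
    independent_of (F t) (fun i => W (A i)) }.

(* The elementary integrand (s, y, w) |-> Z(w) 1_(a,b](s) 1_A(y). *)
Record elementary : Type := Elementary {
  el_start : R; el_end : R; el_space : set R; el_coef : T -> R }.

Definition is_predictable F (e : elementary) : Prop :=
  [/\ 0 <= el_start e,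
      measurable (el_space e) /\ (lebesgue_measure (el_space e) < +oo)%E,
      measurable_wrt (F (el_start e)) (el_coef e) &
      exists K : R, forall w, `|el_coef e w| <= K].

Definition simple_eval (n : nat) (f : 'I_n -> elementary) (s y : R) (w : T) :
    R :=
  \sum_(k < n) el_coef (f k) w * \1_(`]el_start (f k), el_end (f k)]) s
                              * \1_(el_space (f k)) y.

Definition simple_integral W (n : nat) (f : 'I_n -> elementary) (t : R)
    (w : T) : R :=
  \sum_(k < n) el_coef (f k) w *
    W (`]el_start (f k), Num.min (el_end (f k)) t] `*` el_space (f k)) w.

(* [I] is (a version of) the stochastic integral of [G(s, y)] with respect to
   [W(ds, dy)] over [0,t] x R, defined by L^2 approximation by simple
   predictable integrands. *)
Definition is_noise_integral F W (G : R -> R -> T -> R) (t : R) (I : T -> R) :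
    Prop :=
  exists (N : nat -> nat) (f : forall n, 'I_(N n) -> elementary),
  [/\ forall n k, is_predictable F (f n k),
      (\int[P]_w \int[lebesgue_measure]_(s in `[0%R, t]) \int[lebesgue_measure]_y
         ((simple_eval (f n) s y w - G s y w) ^+ 2)%:E)%E @[n --> \oo]
        --> 0%E &
      (\int[P]_w ((simple_integral W (f n) t w - I w) ^+ 2)%:E)%E @[n --> \oo]
        --> 0%E].

Definition solves_noise_equation F W (g : R -> R) (a : R) (x : R -> T -> R) :
    Prop :=
  adapted F x /\
  forall t, 0 <= t ->
    is_noise_integral F W (fun s y w => g (y - x s w)) t (fun w => x t w - a).

End stochastic_basis.

Definition square_integrable (R : realType) (f : R -> R) : Prop :=
  (@lebesgue_measure R).-integrable setT (EFin \o (fun y => f y ^+ 2)).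

Definition C1_square_integrable (R : realType) (g : R -> R) : Prop :=
  [/\ continuous g, forall y, derivable g y 1, continuous (derive1 g),
      square_integrable g & square_integrable (derive1 g)].

Definition autocorrelation (R : realType) (g : R -> R) (x : R) : R :=
  Rintegral (@lebesgue_measure R) setT (fun y => g (y - x) * g y).

Definition is_interacting_BM (R : realType) (m : nat) (d : measure_display)
    (T : measurableType d) (P : probability T R) (r : R -> R) (a : 'I_m -> R)
    (X : T -> path_space R m) : Prop :=
  exists (g : R -> R) (F : R -> set (set T)) (W : set (R * R) -> T -> R),
  [/\ C1_square_integrable g,
      forall x, r x = autocorrelation g x,
      is_filtration F,
      is_white_noise P F W &
      forall i, solves_noise_equation P F W g (a i) (coord X i)].

Definition is_BM (R : realType) (d : measure_display)
    (T : measurableType d) (P : probability T R) (F : R -> set (set T)) (c : R)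
    (B : R -> T -> R) : Prop :=
  [/\ adapted F B,
      forall w, {within halfline R, continuous (B ^~ w)},
      forall s t, 0 <= s -> s < t ->
        centered_gaussian P (fun w => B t w - B s w) (c * (t - s)) &
      forall s t, 0 <= s -> s < t ->
        independent_of P (F s) (fun (_ : 'I_1) w => B t w - B s w)].

(* [ereal_inf set0 = +oo]: the origin may never be hit. *)
Definition hitting_time0 (R : realType) (z : R -> R) : \bar R :=
  ereal_inf [set t%:E | t in [set t : R | 0 <= t /\ z t = 0]].

Definition stopped_at0 (R : realType) (z : R -> R) (t : R) : R :=
  z (fine (mine t%:E (hitting_time0 z))).

(* [F] is the common filtration of the system. A Brownian motion [B] extending
   |y_i - y_j| past the origin can always be found on the same filtered space:
   continue with sqrt 2 times the increments of y_i. *)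
Definition is_coalescing_BM (R : realType) (m : nat) (d : measure_display)
    (T : measurableType d) (P : probability T R) (c : R) (b : 'I_m -> R)
    (Y : T -> path_space R m) : Prop :=
  exists F : R -> set (set T),
  [/\ is_filtration F,
      forall i, {ae P, forall w, coord Y i 0 w = b i},
      forall i, is_BM P F c (coord Y i) &
      forall i j, i != j -> exists2 B : R -> T -> R,
        is_BM P F (2 * c) B &
        {ae P, forall w, forall t, 0 <= t ->
           `|coord Y i t w - coord Y j t w| = stopped_at0 (B ^~ w) t}].

(* Main.v *)
Require Import Defs.
From HB Require Import structures.
From mathcomp Require Import all_boot all_order all_algebra perm.
From mathcomp Require Import all_classical all_reals all_analysis.
From mathcomp Require Import measurable_realfun ring lra.
Set Implicit Arguments.
Unset Strict Implicit.
Unset Printing Implicit Defensive.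
Import Order.TTheory GRing.Theory Num.Theory.
Import numFieldNormedType.Exports.
Local Open Scope classical_set_scope.
Local Open Scope ring_scope.

(** Away from collisions an interacting system with parameter rho (theta x) is
    nearly a system of independent Brownian motions of speed c = rho 0, and two
    particles that meet cannot cross, because the variance of their difference D
    grows at the rate 2 (rho 0 - rho (theta D)) = O(D ^ 2). The proof makes this
    quantitative with the explicit transition probabilities of coalescing Brownian
    motions. For ordered x and y, Warren's formula gives the probability that the
    particles started from x are below y after time tau as a determinant of
    Gaussian distribution functions, [coalescing_cdf]. As a function of x and tau
    it solves the heat equation, and its mixed second derivative in x i and x j is
    a determinant with two equal rows where x i = x j, hence O(|x i - x j|)
    ([cdf_expansion]).

    Ito's formula in the mean, [ito_bound], is derived from the definition of the
    noise integral by replacing the integrands by simple ones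
    ([simple_approximation]) and expanding along a fine grid ([taylor_grid]).
    Applied to the determinant along an interacting system it leaves only products
    of a mixed derivative and rho (theta (x i - x j)): the first factor is small
    where the particles are close, the second elsewhere ([interacting_drift]).
    Along coalescing Brownian motions the determinant is a martingale, since the
    mixed derivative vanishes at the pairs that have met and each pair meets only
    once ([coalescing_mean]). Both systems keep the order of their particles
    ([solution_order], [stopped_difference]). In both, therefore, the law of the
    particles given the past is asymptotically the determinant ([flow_step]).
    These common properties are gathered in [flow_family], and peeling off one
    time after the other shows that they determine the finite-dimensional
    distributions ([flow_agreement]). The parameters theta are split according to
    the permutation that puts the starting points in order
    ([finite_dimensional_convergence]).

    Path space requires no further estimate, because every single particle is
    exactly a Brownian motion of speed c in law: the oscillations of its path have
    the same mean for all theta as for the limit ([mean_oscillation_law]). A bounded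
    continuous functional is the increasing limit of inf-convolutions that are
    Lipschitz for the uniform distance on [0, N] ([envelope]) and that depend, up to
    these oscillations, on finitely many times only ([lower_semicontinuity]). *)

(** * Integrable and square-integrable real functions *)

Definition L1 d (T : measurableType d) (R : realType)
    (mu : {measure set T -> \bar R}) (f : T -> R) : Prop :=
  mu.-integrable setT (EFin \o f).

Definition L2 d (T : measurableType d) (R : realType)
    (mu : {measure set T -> \bar R}) (f : T -> R) : Prop :=
  measurable_fun setT f /\ L1 mu (fun x => f x ^+ 2).

Section integrable_functions.
Context d (T : measurableType d) (R : realType).
Variable mu : {measure set T -> \bar R}.
Implicit Types f g : T -> R.

Lemma L1_measurable f : L1 mu f -> measurable_fun setT f.
Proof. by move=> /integrableP[/measurable_EFinP]. Qed.

Lemma L1D f g : L1 mu f -> L1 mu g -> L1 mu (fun x => f x + g x).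
Proof. by move=> f1 g1; have := integrableD measurableT f1 g1. Qed.

Lemma L1B f g : L1 mu f -> L1 mu g -> L1 mu (fun x => f x - g x).
Proof. by move=> f1 g1; have := integrableB measurableT f1 g1. Qed.

Lemma L1Z k f : L1 mu f -> L1 mu (fun x => k * f x).
Proof. by move=> f1; have := integrableZl measurableT k f1. Qed.

Lemma L1_sum (I : Type) (r : seq I) (P : pred I) (h : I -> T -> R) :
  (forall i, P i -> L1 mu (h i)) -> L1 mu (fun x => \sum_(i <- r | P i) h i x).
Proof.
move=> h1; have := integrable_sum measurableT r h1.
by apply: eq_integrable => // x _ /=; rewrite sumEFin.
Qed.

Lemma L1_le f g : measurable_fun setT f -> L1 mu g ->
  (forall x, `|f x| <= g x) -> L1 mu f.
Proof.
move=> mf g1 fg; apply: (le_integrable measurableT _ _ g1).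
  exact/measurable_EFinP.
by move=> x _ /=; rewrite lee_fin (le_trans (fg x))// ler_norm.
Qed.

Lemma L1_abs f : L1 mu f -> L1 mu (fun x => `|f x|).
Proof. by move=> f1; have := integrable_norm f1. Qed.

Lemma L1_Mbdd K f g : measurable_fun setT f -> (forall x, `|f x| <= K) ->
  L1 mu g -> L1 mu (fun x => f x * g x).
Proof.
move=> mf fK g1; have mg := L1_measurable g1.
apply: (@L1_le _ (fun x => K * `|g x|)).
- exact: measurable_funM.
- exact/L1Z/L1_abs.
- by move=> x; rewrite normrM ler_wpM2r.
Qed.

Lemma eq_L1 f g : f =1 g -> L1 mu f -> L1 mu g.
Proof. by move=> /funext ->. Qed.

Lemma int_ext f g : f =1 g -> \int[mu]_x f x = \int[mu]_x g x.
Proof. by move=> fg; apply: eq_Rintegral => x _. Qed.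

Lemma intD f g : L1 mu f -> L1 mu g ->
  \int[mu]_x (f x + g x) = \int[mu]_x f x + \int[mu]_x g x.
Proof. exact: RintegralD. Qed.

Lemma intB f g : L1 mu f -> L1 mu g ->
  \int[mu]_x (f x - g x) = \int[mu]_x f x - \int[mu]_x g x.
Proof. exact: RintegralB. Qed.

Lemma intZ k f : L1 mu f -> \int[mu]_x (k * f x) = k * \int[mu]_x f x.
Proof. exact: RintegralZl. Qed.

Lemma int0 : \int[mu]_x (0 : R) = 0.
Proof. by rewrite Rintegral_cst// mul0r. Qed.

Lemma int_sum (I : Type) (r : seq I) (P : pred I) (h : I -> T -> R) :
  (forall i, P i -> L1 mu (h i)) ->
  \int[mu]_x (\sum_(i <- r | P i) h i x) = \sum_(i <- r | P i) \int[mu]_x h i x.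
Proof.
move=> h1; elim: r => [|i r IH].
  by rewrite big_nil -[RHS]int0; apply: int_ext => x; rewrite big_nil.
rewrite big_cons; case: ifPn => Pi; last first.
  by rewrite -IH; apply: int_ext => x; rewrite big_cons (negbTE Pi).
rewrite -IH -intD; [|exact: h1|exact: L1_sum].
by apply: int_ext => x; rewrite big_cons Pi.
Qed.

Lemma int_le f g : L1 mu f -> L1 mu g -> (forall x, f x <= g x) ->
  \int[mu]_x f x <= \int[mu]_x g x.
Proof. by move=> f1 g1 fg; apply: le_Rintegral. Qed.

Lemma int_ge0 f : (forall x, 0 <= f x) -> 0 <= \int[mu]_x f x.
Proof. by move=> f0; apply: Rintegral_ge0. Qed.

Lemma abs_int_le f : L1 mu f -> `|\int[mu]_x f x| <= \int[mu]_x `|f x|.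
Proof. exact: le_normr_Rintegral. Qed.

Lemma abs_int_le_bound f g : L1 mu f -> L1 mu g -> (forall x, `|f x| <= g x) ->
  `|\int[mu]_x f x| <= \int[mu]_x g x.
Proof.
by move=> f1 g1 fg; apply: (le_trans (abs_int_le f1)); exact: int_le (L1_abs f1) _ _.
Qed.

Lemma int_EFin f : L1 mu f -> (\int[mu]_x (f x)%:E)%E = (\int[mu]_x f x)%:E.
Proof. by move=> f1; rewrite /Rintegral fineK// integrable_fin_num. Qed.

Lemma ae_eq_int f g : measurable_fun setT f -> measurable_fun setT g ->
  {ae mu, forall x, f x = g x} -> \int[mu]_x f x = \int[mu]_x g x.
Proof.
move=> mf mg fg; congr fine; apply: ae_eq_integral => //.
- exact/measurable_EFinP.
- exact/measurable_EFinP.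
- by apply: filterS fg => x fgx _ /=; rewrite fgx.
Qed.

Lemma ae_eq_L1 f g : measurable_fun setT g ->
  {ae mu, forall x, f x = g x} -> L1 mu f -> L1 mu g.
Proof.
move=> mg fg f1; have mf := L1_measurable f1.
apply/integrableP; split; first exact/measurable_EFinP.
have /integrableP[_] := f1; apply: le_lt_trans.
rewrite le_eqVlt; apply/orP; left; apply/eqP.
apply: ae_eq_integral => //.
- by apply: measurableT_comp => //; exact/measurable_EFinP.
- by apply: measurableT_comp => //; exact/measurable_EFinP.
- by apply: filterS fg => x fgx _ /=; rewrite fgx.
Qed.

Lemma L1_ge0P f (e : R) : measurable_fun setT f -> (forall x, 0 <= f x) ->
  (\int[mu]_x (f x)%:E <= e%:E)%E -> L1 mu f /\ \int[mu]_x f x <= e.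
Proof.
move=> mf f0 fe; have f1 : L1 mu f.
  apply/integrableP; split; first exact/measurable_EFinP.
  apply: le_lt_trans (ltry e); apply: le_trans fe.
  rewrite le_eqVlt; apply/orP; left; apply/eqP.
  by apply: eq_integral => x _ /=; rewrite ger0_norm.
by split=> //; rewrite -lee_fin -int_EFin.
Qed.

Lemma L2M f g : L2 mu f -> L2 mu g -> L1 mu (fun x => f x * g x).
Proof.
move=> [mf f2] [mg g2]; apply: (@L1_le _ (fun x => f x ^+ 2 + g x ^+ 2)).
- exact: measurable_funM.
- exact: L1D.
- move=> x; rewrite normrM.
  have := sqr_ge0 (`|f x| - `|g x|); have := sqr_ge0 `|f x|.
  have := sqr_ge0 `|g x|.
  rewrite -(real_normK (num_real (f x))) -(real_normK (num_real (g x))).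
  move: (`|f x|) (`|g x|) => a b; nra.
Qed.

Lemma L2D f g : L2 mu f -> L2 mu g -> L2 mu (fun x => f x + g x).
Proof.
move=> f2 g2; split; first by apply: measurable_funD; case: f2 g2 => ? _ [].
apply: (@eq_L1 (fun x => f x ^+ 2 + 2 * (f x * g x) + g x ^+ 2)).
  by move=> x; ring.
apply: L1D; last by case: g2.
by apply: L1D; [case: f2|exact/L1Z/L2M].
Qed.

Lemma L2Z k f : L2 mu f -> L2 mu (fun x => k * f x).
Proof.
move=> f2; split; first by apply: measurable_funM => //; case: f2.
apply: (@eq_L1 (fun x => k ^+ 2 * f x ^+ 2)); first by move=> x; ring.
by apply: L1Z; case: f2.
Qed.

Lemma eq_L2 f g : f =1 g -> L2 mu f -> L2 mu g.
Proof. by move=> /funext ->. Qed.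

Lemma L2B f g : L2 mu f -> L2 mu g -> L2 mu (fun x => f x - g x).
Proof.
move=> f2 g2; apply: (@eq_L2 (fun x => f x + (-1) * g x)).
  by move=> x; ring.
exact/L2D/L2Z.
Qed.

Lemma L2_Mbdd K f g : measurable_fun setT f -> (forall x, `|f x| <= K) ->
  L2 mu g -> L2 mu (fun x => f x * g x).
Proof.
move=> mf fK [mg g2]; split; first exact: measurable_funM.
apply: (@eq_L1 (fun x => f x ^+ 2 * g x ^+ 2)); first by move=> x; ring.
apply: (@L1_Mbdd (K ^+ 2)) => //; first exact: measurable_funX.
by move=> x; rewrite normrX lerXn2r// ?nnegrE// (le_trans _ (fK x)).
Qed.

Lemma L2_0 : L2 mu (fun=> 0).
Proof.
split=> //; apply: (@eq_L1 (fun=> 0)); first by move=> x; rewrite expr0n.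
exact: integrable0.
Qed.

(** [2 |ab| <= k^-1 a^2 + k b^2] in integrated form: it does the work of the
    Cauchy-Schwarz inequality, with [k] free to be optimised. *)
Lemma int_young (k : R) f g : 0 < k -> L2 mu f -> L2 mu g ->
  \int[mu]_x `|f x * g x| <=
    k^-1 * \int[mu]_x f x ^+ 2 + k * \int[mu]_x g x ^+ 2.
Proof.
move=> k0 f2 g2; have f2' := f2.2; have g2' := g2.2; rewrite -(intZ k^-1 f2') -(intZ k g2').
rewrite -intD; [|by apply: L1Z; case: f2|by apply: L1Z; case: g2].
apply: int_le; first exact/L1_abs/L2M.
  by apply: L1D; apply: L1Z; [case: f2|case: g2].
move=> x; rewrite normrM -(real_normK (num_real (f x))).
rewrite -(real_normK (num_real (g x))).
move: (`|f x|) (`|g x|) (normr_ge0 (f x)) (normr_ge0 (g x)) => a b a0 b0.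
have -> : k^-1 * a ^+ 2 + k * b ^+ 2 = k^-1 * (a ^+ 2 + (k * b) ^+ 2).
  by field; rewrite gt_eqF.
rewrite [leRHS]mulrC ler_pdivlMr//.
have : 0 <= (a - k * b) ^+ 2 by exact: sqr_ge0.
have : 0 <= a * (k * b) by rewrite !mulr_ge0// ltW.
by nra.
Qed.

End integrable_functions.

Section probability_integrals.
Context d (T : measurableType d) (R : realType) (P : probability T R).
Implicit Types f g : T -> R.

Lemma L1_cst (k : R) : L1 P (fun=> k).
Proof. exact: finite_measure_integrable_cst. Qed.

Lemma L1_bdd K f : measurable_fun setT f -> (forall x, `|f x| <= K) -> L1 P f.
Proof. by move=> mf fK; apply: L1_le (L1_cst K) _. Qed.

Lemma int_cst (k : R) : \int[P]_x k = k.
Proof. rewrite Rintegral_cst// [X in fine X](_ : _ = 1%E) ?mulr1//.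
exact: probability_setT. Qed.

Lemma L2_L1 f : L2 P f -> L1 P f.
Proof.
move=> [mf f2]; apply: (@L1_le _ _ _ _ _ (fun x => 1 + f x ^+ 2)) => //.
  by apply: L1D => //; exact: L1_cst.
move=> x; rewrite -(real_normK (num_real (f x))).
by have := sqr_ge0 (`|f x| - 1); have := normr_ge0 (f x); nra.
Qed.

Lemma int_bdd K f : measurable_fun setT f -> (forall x, `|f x| <= K) ->
  `|\int[P]_x f x| <= K.
Proof.
move=> mf fK; rewrite -[leRHS]int_cst.
by apply: abs_int_le_bound => //; [exact: L1_bdd fK|exact: L1_cst].
Qed.

(** Jensen's inequality for the square. *)
Lemma sqr_int_abs_le f : L2 P f ->
  (\int[P]_x `|f x|) ^+ 2 <= \int[P]_x f x ^+ 2.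
Proof.
move=> f2; set m := \int[P]_x `|f x|.
have f1 : L1 P (fun x => `|f x|) by exact/L1_abs/L2_L1.
have : 0 <= \int[P]_x ((`|f x| - m) ^+ 2) by apply: int_ge0 => x; exact: sqr_ge0.
have -> : \int[P]_x ((`|f x| - m) ^+ 2) =
          \int[P]_x (f x ^+ 2 + ((- 2 * m) * `|f x| + m ^+ 2)).
  apply: int_ext => x; rewrite -(real_normK (num_real (f x))); ring.
rewrite intD; [|by case: f2|by apply: L1D; [exact: L1Z|exact: L1_cst]].
rewrite intD; [|exact: L1Z|exact: L1_cst].
by rewrite intZ// int_cst -/m; nra.
Qed.

End probability_integrals.

(** * Measurability with respect to a sub-sigma-algebra, and independence *)

Section sub_sigma_algebra.
Context d (T : measurableType d) (R : realType).
Variable G : set (set T).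
Hypothesis sG : sigma_algebra setT G.
Implicit Types Z : T -> R.

Local Notation TG := (g_sigma_algebraType G).

Lemma measurable_wrtP Z : measurable_wrt G Z <-> measurable_fun setT (Z : TG -> R).
Proof.
split=> [mZ _ B mB|mZ B mB].
  by rewrite setTI; apply: sub_sigma_algebra; exact: mZ.
have := mZ measurableT B mB; rewrite setTI.
by rewrite /measurable/= sigma_algebra_id.
Qed.

Lemma wrt_cst (k : R) : measurable_wrt G (fun=> k).
Proof. by apply/measurable_wrtP; exact: measurable_cst. Qed.

Lemma eq_wrt Z1 Z2 : Z1 =1 Z2 -> measurable_wrt G Z1 -> measurable_wrt G Z2.
Proof. by move=> /funext ->. Qed.

Lemma wrtD Z1 Z2 : measurable_wrt G Z1 -> measurable_wrt G Z2 ->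
  measurable_wrt G (fun w => Z1 w + Z2 w).
Proof. by rewrite !measurable_wrtP; exact: measurable_funD. Qed.

Lemma wrtM Z1 Z2 : measurable_wrt G Z1 -> measurable_wrt G Z2 ->
  measurable_wrt G (fun w => Z1 w * Z2 w).
Proof. by rewrite !measurable_wrtP; exact: measurable_funM. Qed.

Lemma wrt_sum (I : Type) (r : seq I) (Z : I -> T -> R) :
  (forall i, measurable_wrt G (Z i)) ->
  measurable_wrt G (fun w => \sum_(i <- r) Z i w).
Proof.
move=> mZ; apply/measurable_wrtP; apply: measurable_sum => i.
by apply/measurable_wrtP.
Qed.

Lemma wrt_prod (I : Type) (r : seq I) (Z : I -> T -> R) :
  (forall i, measurable_wrt G (Z i)) ->
  measurable_wrt G (fun w => \prod_(i <- r) Z i w).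
Proof.
move=> mZ; elim: r => [|i r IH].
  by apply: eq_wrt (wrt_cst 1) => w; rewrite big_nil.
by apply: eq_wrt (wrtM (mZ i) IH) => w; rewrite big_cons.
Qed.

Lemma wrt_comp (h : R -> R) Z : measurable_fun setT h -> measurable_wrt G Z ->
  measurable_wrt G (fun w => h (Z w)).
Proof.
by move=> mh /measurable_wrtP mZ; apply/measurable_wrtP; exact: measurableT_comp.
Qed.

End sub_sigma_algebra.

Lemma wrt_sub d (T : measurableType d) (R : realType) (G H : set (set T))
  (Z : T -> R) : G `<=` H -> measurable_wrt G Z -> measurable_wrt H Z.
Proof. by move=> GH mZ B mB; exact/GH/mZ. Qed.

Lemma wrt_measurable d (T : measurableType d) (R : realType) (G : set (set T))
  (Z : T -> R) : G `<=` measurable -> measurable_wrt G Z -> measurable_fun setT Z.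
Proof. by move=> GH mZ _ B mB; rewrite setTI; exact/GH/mZ. Qed.

Section independence.
Context d (T : measurableType d) (R : realType) (P : probability T R).
Implicit Types (zeta Z : T -> R) (h : R -> R).

(** The joint law of [zeta] and [Z] agrees with the product of the two laws on
    rectangles, hence everywhere, and the product formula is Fubini's. *)
Lemma independent_int (G : set (set T)) zeta Z h :
  G `<=` measurable -> measurable_wrt G zeta -> measurable_fun setT Z ->
  measurable_fun setT h -> independent_of P G (fun _ : 'I_1 => Z) ->
  L1 P zeta -> L1 P (fun w => h (Z w)) ->
  L1 P (fun w => zeta w * h (Z w)) /\
  \int[P]_w (zeta w * h (Z w)) = (\int[P]_w zeta w) * \int[P]_w h (Z w).
Proof.
move=> GM Gz mZ mh indep z1 h1.
have mz := wrt_measurable GM Gz.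
have mzZ : measurable_fun setT (fun w => (zeta w, Z w)).
  exact/measurable_fun_pairP.
pose zf : {mfun T >-> R} := mfun_Sub (mem_set mz).
pose Zf : {mfun T >-> R} := mfun_Sub (mem_set mZ).
pose zZf : {mfun T >-> (R * R)%type} := mfun_Sub (mem_set mzZ).
pose JM := distribution P zZf.
pose m1 := distribution P zf; pose m2 := distribution P Zf.
have prodE X : measurable X -> (m1 \x m2)%E X = JM X.
  apply: product_measure_unique => A B mA mB.
  have := @indep (zeta @^-1` A) (fun _ => B) (Gz _ mA) (fun _ => mB).
  rewrite big_ord1 => <-; rewrite /JM/= /distribution /pushforward/=; congr (P _).
  apply/seteqP; split=> w /=.
    by move=> [zA ZB]; split=> // i _.
  by move=> [zA ZB]; split=> //; exact: (ZB ord0).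
have int_eq (f : R * R -> \bar R) : (\int[m1 \x m2]_p f p = \int[JM]_p f p)%E.
  by apply: eq_measure_integral => A mA _; exact: prodE.
have mf : measurable_fun setT (fun p : R * R => (p.1 * h p.2)%:E).
  apply/measurable_EFinP; apply: measurable_funM => //.
  exact: measurableT_comp.
have int1 (f : R -> \bar R) : measurable_fun setT f -> (forall x, 0 <= f x)%E ->
    (\int[m1]_x f x = \int[P]_w f (zeta w))%E.
  by move=> mf' f0; rewrite ge0_integral_distribution.
have int2 (f : R -> \bar R) : measurable_fun setT f -> (forall x, 0 <= f x)%E ->
    (\int[m2]_x f x = \int[P]_w f (Z w))%E.
  by move=> mf' f0; rewrite ge0_integral_distribution.
have i1 : m1.-integrable setT (EFin : R -> _).
  have := z1; rewrite /L1 => /integrableP[_ zoo].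
  apply/integrableP; split; first exact/measurable_EFinP.
  by rewrite int1//; apply: measurableT_comp => //; exact/measurable_EFinP.
have i2 : m2.-integrable setT (EFin \o h).
  have := h1; rewrite /L1 => /integrableP[_ zoo].
  apply/integrableP; split; first exact/measurable_EFinP.
  by rewrite int2//; apply: measurableT_comp => //; exact/measurable_EFinP.
have fub : (m1 \x m2)%E.-integrable setT (fun p : R * R => (p.1 * h p.2)%:E).
  apply/integrable12ltyP => //.
  have -> : (\int[m1]_x \int[m2]_y `|(x * h y)%:E| =
      \int[m1]_x (`|x%:E| * \int[m2]_y `|(h y)%:E|))%E.
    apply: eq_integral => x _; rewrite -ge0_integralZl//.
      by apply: eq_integral => y _; rewrite EFinM abseM.
    by apply/measurableT_comp => //; exact/measurable_EFinP.
  rewrite ge0_integralZr//; last 2 first.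
  - by apply/measurableT_comp => //; exact/measurable_EFinP.
  - exact: integral_ge0.
  rewrite lte_mul_pinfty//; first exact: integral_ge0.
    have /integrableP[_ lt1] := i1.
    by rewrite ge0_fin_numE//; exact: integral_ge0.
  by have /integrableP[_ lt2] := i2.
have fubJ : JM.-integrable setT (fun p : R * R => (p.1 * h p.2)%:E).
  apply/integrableP; split => //.
  by rewrite -int_eq; have /integrableP[] := fub.
have mzh : measurable_fun setT (fun w => zeta w * h (Z w)).
  by apply: measurable_funM => //; exact: measurableT_comp.
have iP : L1 P (fun w => zeta w * h (Z w)).
  apply/integrableP; split; first exact/measurable_EFinP.
  have /integrableP[_] := fubJ.
  rewrite (ge0_integral_distribution zZf)//.
  exact: measurableT_comp.
split => //; apply: EFin_inj; rewrite -int_EFin//.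
have := integral_distribution (X := zZf) mf iP => /= <-.
rewrite -int_eq -integral12_prod_meas1//.
rewrite EFinM -(int_EFin z1) -(int_EFin h1).
have z1' := z1; have h1' := h1.
have -> : (\int[P]_w (zeta w)%:E = \int[m1]_x x%:E)%E.
  by rewrite (integral_distribution (X := zf))//; exact/measurable_EFinP.
have -> : (\int[P]_w (h (Z w))%:E = \int[m2]_x (h x)%:E)%E.
  by rewrite (integral_distribution (X := Zf))//; exact/measurable_EFinP.
have fin2 := integrable_fin_num measurableT i2.
transitivity (\int[m1]_x (x%:E * \int[m2]_y (h y)%:E))%E.
  apply: eq_integral => x _; rewrite /fubini_F/= -integralZl//.
rewrite -(fineK fin2) integralZr//.
Qed.

End independence.

Lemma int_dct d (T : measurableType d) (R : realType)
    (mu : {measure set T -> \bar R}) (f_ : nat -> T -> R) (f g : T -> R) :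
  (forall n, measurable_fun setT (f_ n)) ->
  (forall x, f_ n x @[n --> \oo] --> f x) ->
  L1 mu g -> (forall n x, `|f_ n x| <= g x) ->
  L1 mu f /\ \int[mu]_x f_ n x @[n --> \oo] --> \int[mu]_x f x.
Proof.
move=> mf_ f_f g1 f_g.
have mf : measurable_fun setT f by apply: (measurable_fun_cvg mf_) => x _.
have f_1 n : L1 mu (f_ n) by exact: L1_le g1 _.
have [] := @dominated_convergence _ _ _ mu setT measurableT
  (fun n => EFin \o f_ n) (EFin \o f) (EFin \o g).
- by move=> n; exact/measurable_EFinP.
- exact/measurable_EFinP.
- by apply: aeW => x _; apply: cvg_comp (f_f x) _; exact: cvg_id.
- exact: g1.
- by apply: aeW => x n _ /=; rewrite lee_fin.
move=> f1 _ h; split => //.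
have := h; rewrite /comp/= (int_EFin f1) => /fine_cvgP[_].
exact.
Qed.

Section gaussian_moments.
Context (R : realType).
Implicit Types x s : R.
Local Notation leb := (@lebesgue_measure R).

Lemma int_derivative_eq0 (G g : R -> R) :
  (forall x, is_derive x 1 G (g x)) -> continuous g -> L1 leb g ->
  G x @[x --> +oo] --> 0 -> G x @[x --> -oo] --> 0 -> \int[leb]_x g x = 0.
Proof.
move=> Gg cg g1 Gp Gm.
pose I n : set R := `[- n.+1%:R, n.+1%:R]%classic.
have mg := L1_measurable g1.
have mI n : measurable (I n) by exact: measurable_itv.
have lim1 : \int[leb]_x (g x * \1_(I n) x) @[n --> \oo] --> \int[leb]_x g x.
  have [] // := @int_dct _ _ _ leb (fun n x => g x * \1_(I n) x) g
    (fun x => `|g x|).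
  - by move=> n; apply: measurable_funM => //; exact: (measurable_indic (mI n)).
  - move=> x; apply: cvg_near_cst.
    near=> n; rewrite indicE mem_set ?mulr1//.
    rewrite /I/= in_itv/= -ler_norml.
    rewrite (@le_trans _ _ n%:R)//; last by rewrite ler_nat.
    by near: n; exact: nbhs_infty_ger.
  - exact: L1_abs.
  - move=> n x; rewrite normrM ler_piMr// indicE.
    by case: (_ \in _); rewrite ?normr1 ?normr0.
have FTC n : \int[leb]_x (g x * \1_(I n) x) = G n.+1%:R - G (- n.+1%:R).
  have lt : - n.+1%:R < n.+1%:R :> R by rewrite gtrN.
  rewrite -[RHS]/(fine ((G n.+1%:R)%:E - (G (- n.+1%:R))%:E)%E).
  rewrite -(@continuous_FTC2 _ g G _ _ lt); last 3 first.
  - by apply: continuous_subspaceT.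
  - split.
    + by move=> x _; exact: ex_derive.
    + apply: cvg_at_right_filter; apply: differentiable_continuous.
      by apply/derivable1_diffP; exact: ex_derive.
    + apply: cvg_at_left_filter; apply: differentiable_continuous.
      by apply/derivable1_diffP; exact: ex_derive.
  - by move=> x _; rewrite derive1E; exact: derive_val.
  rewrite [in RHS]integral_mkcond; congr fine; apply: eq_integral => x _.
  by rewrite /patch indicE; case: ifPn => _; rewrite ?mulr1 ?mulr0.
have lim2 : \int[leb]_x (g x * \1_(I n) x) @[n --> \oo] --> (0 - 0 : R).
  rewrite (_ : (fun n => _) = fun n => G n.+1%:R - G (- n.+1%:R)); last first.
    by apply/funext => n; exact: FTC.
  have cn : (n.+1%:R : R) @[n --> \oo] --> +oo.
    by rewrite (cvg_shiftS (fun n => n%:R : R)); exact: cvgr_idn.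
  apply: cvgB; first exact: (cvg_comp _ _ cn Gp).
  apply: (cvg_comp (fun n => - n.+1%:R) G _ Gm).
  by apply: (cvg_comp _ _ cn); rewrite ninfty.
rewrite subr0 in lim2.
exact: (cvg_unique _ lim1 lim2).
Unshelve. all: by end_near.
Qed.

Lemma is_derive_normal_pdf s x : s != 0 ->
  is_derive x 1 (normal_pdf 0 s) (- (x / s ^+ 2) * normal_pdf 0 s x).
Proof.
move=> s0; rewrite normal_pdfE//.
apply: is_derive_eq.
rewrite !scaler0 add0r subr0 /normal_fun subr0 /GRing.scale/= subr0 !mulr1.
by field.
Qed.

(** The quartic factor is absorbed by passing to twice the standard
    deviation. *)
Lemma normal_pdf_quartic s x : 0 < s ->
  x ^+ 4 * normal_pdf 0 s x <= 32 * s ^+ 4 * normal_pdf 0 (2 * s) x.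
Proof.
move=> s0; rewrite !normal_pdfE ?gt_eqF// ?mulr_gt0//.
have s20 : 2 * s != 0 by rewrite mulf_neq0 ?gt_eqF.
have -> : normal_peak s = 2 * normal_peak (2 * s).
  rewrite /normal_peak.
  have -> : (2 * s) ^+ 2 * pi *+ 2 = 2 ^+ 2 * (s ^+ 2 * pi *+ 2) :> R.
    by ring.
  by rewrite sqrtrM ?sqr_ge0// sqrtr_sqr normr_nat invfM mulVKf.
have -> : normal_fun 0 s x =
    normal_fun 0 (2 * s) x * expR (- (3 / 8 * (x / s) ^+ 2)).
  by rewrite /normal_fun -expRD subr0; congr expR; field; rewrite gt_eqF.
set w := 3 / 8 * (x / s) ^+ 2.
have w0 : 0 <= w by rewrite mulr_ge0 ?sqr_ge0.
have xw : x ^+ 4 = 64 / 9 * s ^+ 4 * w ^+ 2.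
  by rewrite /w; field; rewrite gt_eqF.
have we : w ^+ 2 * expR (- w) <= 2.
  rewrite expRN ler_pdivrMr ?expR_gt0//.
  have := @expR_ge1Dxn R w 1 w0; rewrite (_ : 2`!%:R = 2 :> R)//; lra.
set A := normal_peak (2 * s); set B := normal_fun 0 (2 * s) x.
have A0 : 0 <= A by exact: normal_peak_ge0.
have B0 : 0 <= B by exact: normal_fun_ge0.
rewrite xw.
have -> : 64 / 9 * s ^+ 4 * w ^+ 2 * (2 * A * (B * expR (- w))) =
  (w ^+ 2 * expR (- w)) * (128 / 9 * (s ^+ 4 * A * B)) by field.
have s4 : 0 <= s ^+ 4 * A * B by rewrite !mulr_ge0// ?exprn_ge0// ltW.
apply: (@le_trans _ _ (2 * (128 / 9 * (s ^+ 4 * A * B)))).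
  by apply: ler_wpM2r we; rewrite mulr_ge0.
rewrite -!mulrA in s4 *; lra.
Qed.

Lemma L1_normal_pdf s : L1 leb (normal_pdf 0 s).
Proof. exact: integrable_normal_pdf. Qed.

Lemma int_normal_pdf s : \int[leb]_x normal_pdf 0 s x = 1.
Proof. by rewrite /Rintegral integral_normal_pdf. Qed.

Lemma L1_quartic_normal_pdf s : 0 < s ->
  L1 leb (fun x => x ^+ 4 * normal_pdf 0 s x).
Proof.
move=> s0; apply: (@L1_le _ (measurableTypeR R) R leb (fun x => x ^+ 4 * normal_pdf 0 s x)
  (fun x => 32 * s ^+ 4 * normal_pdf 0 (2 * s) x)).
- by apply: measurable_funM; [exact: measurable_funX|exact: measurable_normal_pdf].
- exact/L1Z/L1_normal_pdf.
- move=> x; rewrite ger0_norm ?normal_pdf_quartic//.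
  by rewrite mulr_ge0 ?normal_pdf_ge0// exprn_even_ge0.
Qed.

Lemma int_quartic_normal_pdf s : 0 < s ->
  \int[leb]_x (x ^+ 4 * normal_pdf 0 s x) <= 32 * s ^+ 4.
Proof.
move=> s0; have p4 := L1_quartic_normal_pdf s0.
have l := L1Z (32 * s ^+ 4) (L1_normal_pdf (2 * s)).
have le := int_le p4 l (fun x => normal_pdf_quartic x s0).
apply: (le_trans le); rewrite (intZ _ (L1_normal_pdf (2 * s))).
by rewrite int_normal_pdf mulr1.
Qed.

Lemma L1_power_normal_pdf s k : 0 < s -> (k <= 4)%N ->
  L1 leb (fun x => x ^+ k * normal_pdf 0 s x).
Proof.
move=> s0 k4; apply: (@L1_le _ (measurableTypeR R) R leb (fun x => x ^+ k * normal_pdf 0 s x)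
  (fun x => normal_pdf 0 s x + x ^+ 4 * normal_pdf 0 s x)).
- by apply: measurable_funM; [exact: measurable_funX|exact: measurable_normal_pdf].
- by apply: L1D; [exact: L1_normal_pdf|exact: L1_quartic_normal_pdf].
- move=> x; have p0 := normal_pdf_ge0 0 s x.
  rewrite normrM (ger0_norm p0) -[X in _ <= X + _]mul1r -mulrDl.
  apply: ler_wpM2r => //; rewrite normrX.
  rewrite -[X in _ + X]ger0_norm ?exprn_even_ge0// normrX.
  move: (`|x|) (normr_ge0 x) => a a0.
  have [a1|a1] := leP a 1.
    by rewrite (le_trans (exprn_ile1 _ a0 a1))// lerDl exprn_ge0.
  by rewrite (le_trans (ler_weXn2l (ltW a1) k4))// lerDr.
Qed.

Lemma cvg_monomial_normal_pdf s k : 0 < s -> (k < 4)%N ->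
  x ^+ k * normal_pdf 0 s x @[x --> +oo] --> (0 : R) /\
  x ^+ k * normal_pdf 0 s x @[x --> -oo] --> (0 : R).
Proof.
move=> s0 k4; have s20 : 2 * s != 0 by rewrite mulf_neq0 ?gt_eqF.
pose C := 32 * s ^+ 4 * normal_peak (2 * s) : R.
have C0 : 0 <= C by rewrite !mulr_ge0 ?exprn_ge0 ?normal_peak_ge0// ltW.
have bound (x : R) : 1 <= `|x| -> `|x ^+ k * normal_pdf 0 s x| <= C / `|x|.
  move=> x1; have x0 : 0 < `|x| by exact: lt_le_trans x1.
  rewrite ler_pdivlMr// normrM normrX (ger0_norm (normal_pdf_ge0 _ _ _)).
  rewrite mulrAC -exprSr.
  apply: (@le_trans _ _ (x ^+ 4 * normal_pdf 0 s x)).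
    apply: ler_wpM2r; first exact: normal_pdf_ge0.
    rewrite -[leRHS]ger0_norm ?exprn_even_ge0// normrX.
    exact: ler_weXn2l.
  apply: (le_trans (normal_pdf_quartic _ s0)); apply: ler_wpM2l.
    by rewrite mulr_ge0// exprn_ge0// ltW.
  exact: normal_pdf_ub.
have small e : 0 < e -> forall x : R, 1 + C / e <= `|x| ->
    `|x ^+ k * normal_pdf 0 s x| < e.
  move=> e0 x xe; have Ce : 0 <= C / e by rewrite divr_ge0// ltW.
  have x1 : 1 <= `|x| by lra.
  have x0 : 0 < `|x| by exact: lt_le_trans x1.
  rewrite (le_lt_trans (bound x x1))// ltr_pdivrMr// mulrC -ltr_pdivrMr//; lra.
split; apply/cvgr0Pnorm_lt => e e0; near=> x; apply: small => //.
  by rewrite (le_trans _ (ler_norm _))//; near: x; exact: nbhs_pinfty_ge.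
rewrite -normrN (le_trans _ (ler_norm _))// lerNr.
near: x; apply: nbhs_ninfty_le; exact: num_real.
Unshelve. all: by end_near.
Qed.

Lemma continuous_normal_pdf0 s : s != 0 -> continuous (normal_pdf 0 s).
Proof. exact: continuous_normal_pdf. Qed.

Lemma int_id_normal_pdf s : 0 < s -> \int[leb]_x (x * normal_pdf 0 s x) = 0.
Proof.
move=> s0; have sn0 : s != 0 by rewrite gt_eqF.
have [p m] := @cvg_monomial_normal_pdf s 0 s0 isT.
apply: (@int_derivative_eq0 (fun x => - s ^+ 2 * (x ^+ 0 * normal_pdf 0 s x))
  (fun x => x * normal_pdf 0 s x)).
- move=> x; have d := is_derive_normal_pdf x sn0.
  rewrite (_ : (fun _ => _) = fun x => - s ^+ 2 * normal_pdf 0 s x); last first.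
    by apply/funext => y; rewrite expr0 mul1r.
  have d2 := is_deriveZ (- s ^+ 2) d.
  by apply: (is_derive_eq d2); rewrite /GRing.scale/=; field.
- move=> x; apply: cvgM; first exact: cvg_id.
  exact: continuous_normal_pdf.
- have := @L1_power_normal_pdf s 1 s0 isT.
  by apply: eq_L1 => x; rewrite expr1.
- by have := cvgM (cvg_cst (- s ^+ 2)) p; rewrite mulr0; exact.
- by have := cvgM (cvg_cst (- s ^+ 2)) m; rewrite mulr0; exact.
Qed.

Lemma int_sqr_normal_pdf s : 0 < s ->
  \int[leb]_x (x ^+ 2 * normal_pdf 0 s x) = s ^+ 2.
Proof.
move=> s0; have sn0 : s != 0 by rewrite gt_eqF.
have [p m] := @cvg_monomial_normal_pdf s 1 s0 isT.
have L2 := @L1_power_normal_pdf s 2 s0 isT.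
have zero : \int[leb]_x (x ^+ 2 * normal_pdf 0 s x - s ^+ 2 * normal_pdf 0 s x) = 0.
  apply: (@int_derivative_eq0 (fun x => - s ^+ 2 * (x ^+ 1 * normal_pdf 0 s x))
    (fun x => x ^+ 2 * normal_pdf 0 s x - s ^+ 2 * normal_pdf 0 s x)).
  - move=> x; have d := is_derive_normal_pdf x sn0.
    have d2 := is_deriveZ (- s ^+ 2) (is_deriveM (is_derive_id x 1) d).
    by apply: (is_derive_eq d2); rewrite /GRing.scale/= ?mulr1; field.
  - move=> x; apply: cvgB; apply: cvgM.
    + exact: exprn_continuous.
    + exact: continuous_normal_pdf.
    + exact: cvg_cst.
    + exact: continuous_normal_pdf.
  - by apply: L1B => //; exact/L1Z/L1_normal_pdf.
  - by have := cvgM (cvg_cst (- s ^+ 2)) p; rewrite mulr0; exact.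
  - by have := cvgM (cvg_cst (- s ^+ 2)) m; rewrite mulr0; exact.
move: zero; rewrite intB//; last exact/L1Z/L1_normal_pdf.
by rewrite intZ ?int_normal_pdf; [lra|exact: L1_normal_pdf].
Qed.

End gaussian_moments.

Section density.
Import HBNNSimple.
Context d (T : measurableType d) (R : realType).
Variables (mu nu : {measure set T -> \bar R}) (f : T -> R).
Hypothesis mf : measurable_fun setT f.
Hypothesis f0 : forall x, 0 <= f x.
Hypothesis nuE : forall A, measurable A -> nu A = (\int[mu]_(x in A) (f x)%:E)%E.

Let nu_indic A : measurable A ->
  nu A = (\int[mu]_x ((\1_A x)%:E * (f x)%:E))%E.
Proof.
move=> mA; rewrite nuE// integral_mkcond; apply: eq_integral => x _.
by rewrite patchE indicE; case: ifPn => _; rewrite ?mul1e ?mul0e.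
Qed.

Let nu_nnsfun (g : {nnsfun T >-> R}) :
  (\int[nu]_x (g x)%:E = \int[mu]_x ((g x)%:E * (f x)%:E))%E.
Proof.
have gE x : (g x)%:E = (\sum_(k \in range g) k%:E * (\1_(g @^-1` [set k]) x)%:E)%E.
  by rewrite fsumEFin //= fimfunE.
under eq_integral do rewrite gE.
rewrite ge0_integral_fsum//; last 2 first.
- by move=> r; apply/measurable_EFinP; apply: measurable_funM.
- by move=> r x _; rewrite nnfun_muleindic_ge0.
have gfE x : ((g x)%:E * (f x)%:E =
    \sum_(k \in range g) (k%:E * (\1_(g @^-1` [set k]) x)%:E * (f x)%:E))%E.
  by rewrite gE ge0_mule_fsuml// => r; exact: nnfun_muleindic_ge0.
under [RHS]eq_integral do rewrite gfE.
rewrite ge0_integral_fsum//; last 2 first.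
- move=> r; apply: emeasurable_funM; apply/measurable_EFinP => //.
  exact: measurable_funM.
- by move=> r x _; rewrite mule_ge0 ?nnfun_muleindic_ge0// lee_fin.
apply: eq_fsbigr => r; rewrite inE => -[x _ gx].
have r0 : 0 <= r by rewrite -gx.
rewrite ge0_integralZl//; last exact/measurable_EFinP.
rewrite integral_indic// setIT nu_indic//.
rewrite -ge0_integralZl//; last 2 first.
- by apply: emeasurable_funM; apply/measurable_EFinP.
- by move=> y _; rewrite mule_ge0 ?lee_fin.
by apply: eq_integral => y _; rewrite muleA.
Qed.

Lemma ge0_integral_density (g : T -> \bar R) : measurable_fun setT g ->
  (forall x, 0 <= g x)%E -> (\int[nu]_x g x = \int[mu]_x (g x * (f x)%:E))%E.
Proof.
move=> mg g0; pose g_ := nnsfun_approx measurableT mg.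
have -> : (\int[nu]_x g x = limn (fun n => \int[nu]_x (g_ n x)%:E))%E.
  rewrite -monotone_convergence//; last 3 first.
  - by move=> n; exact/measurable_EFinP.
  - by move=> n x _; rewrite lee_fin.
  - by move=> x _ m n mn; rewrite lee_fin; exact/lefP/nd_nnsfun_approx.
  apply: eq_integral => x _; apply/esym/cvg_lim => //.
  exact: cvg_nnsfun_approx.
have -> : (\int[mu]_x (g x * (f x)%:E) =
    limn (fun n => \int[mu]_x ((g_ n x)%:E * (f x)%:E)))%E.
  rewrite -monotone_convergence//; last 3 first.
  - by move=> n; apply: emeasurable_funM; exact/measurable_EFinP.
  - by move=> n x _; rewrite mule_ge0// lee_fin.
  - move=> x _ m n mn; apply: lee_wpmul2r; rewrite lee_fin//.
    exact/lefP/nd_nnsfun_approx.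
  apply: eq_integral => x _; apply/esym/cvg_lim => //.
  by apply: cvgeZr => //; exact: cvg_nnsfun_approx.
by congr (limn _); apply/funext => n; exact: nu_nnsfun.
Qed.

End density.

Section centered_gaussian.
Context d (T : measurableType d) (R : realType) (P : probability T R).
Implicit Types Z : T -> R.
Local Notation leb := (@lebesgue_measure R).

Lemma centered_gaussian_int_ge0 Z v (h : R -> R) : 0 < v ->
  measurable_fun setT Z -> centered_gaussian P Z v ->
  measurable_fun setT h -> (forall x, 0 <= h x) ->
  (\int[P]_w (h (Z w))%:E =
   \int[leb]_x (h x * normal_pdf 0 (Num.sqrt v) x)%:E)%E.
Proof.
move=> v0 mZ gZ mh h0.
have mZ' : @measurable_fun _ _ T (measurableTypeR R) setT Z by exact: mZ.
pose Zf := @mfun_Sub _ _ T (measurableTypeR R) Z (mem_set mZ').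
have <- : (\int[distribution P Zf]_x (h x)%:E = \int[P]_w (h (Z w))%:E)%E.
  by rewrite ge0_integral_distribution//; exact/measurable_EFinP.
rewrite (@ge0_integral_density _ _ _ leb _ (normal_pdf 0 (Num.sqrt v)))//.
- by apply: measurable_normal_pdf.
- by move=> x; exact: normal_pdf_ge0.
- by move=> A mA; rewrite /= /distribution /pushforward/= gZ// gt_eqF.
- exact/measurable_EFinP.
Qed.

Lemma centered_gaussian_ge0 Z v (h : R -> R) : 0 < v ->
  measurable_fun setT Z -> centered_gaussian P Z v ->
  measurable_fun setT h -> (forall x, 0 <= h x) ->
  L1 leb (fun x => h x * normal_pdf 0 (Num.sqrt v) x) ->
  L1 P (fun w => h (Z w)) /\ \int[P]_w h (Z w) =
    \int[leb]_x (h x * normal_pdf 0 (Num.sqrt v) x).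
Proof.
move=> v0 mZ gZ mh h0 h1.
have E := centered_gaussian_int_ge0 v0 mZ gZ mh h0.
have [] := @L1_ge0P _ _ _ P (fun w => h (Z w)) (\int[leb]_x (h x * normal_pdf 0 (Num.sqrt v) x)) _ _ _.
- exact: measurableT_comp.
- by [].
- by rewrite E int_EFin.
by move=> l1 _; split=> //; rewrite /Rintegral E.
Qed.

Lemma centered_gaussian0 Z : measurable_fun setT Z -> centered_gaussian P Z 0 ->
  {ae P, forall w, Z w = 0}.
Proof.
move=> mZ gZ; exists (Z @^-1` [set~ 0]); split.
- by rewrite -[X in measurable X]setTI; apply: mZ => //; exact: measurableC.
- rewrite gZ; last exact: measurableC.
  by rewrite eqxx diracE memNset//= => /(_ erefl).
- by [].
Qed.

Lemma centered_gaussian_moments Z v : 0 <= v -> measurable_fun setT Z ->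
    centered_gaussian P Z v ->
  [/\ L2 P Z, \int[P]_w Z w = 0, \int[P]_w Z w ^+ 2 = v,
      L1 P (fun w => Z w ^+ 4) & \int[P]_w Z w ^+ 4 <= 32 * v ^+ 2].
Proof.
rewrite le_eqVlt => /predU1P[<-|v0] mZ gZ.
  have Z0 := centered_gaussian0 mZ gZ.
  have pow k : L1 P (fun w => Z w ^+ k.+1) /\ \int[P]_w Z w ^+ k.+1 = 0.
    have ae : {ae P, forall w, 0 = Z w ^+ k.+1}.
      by apply: filterS Z0 => w ->; rewrite expr0n.
    have mk : measurable_fun setT (fun w => Z w ^+ k.+1) by exact: measurable_funX.
    split; first exact: ae_eq_L1 mk ae (L1_cst P 0).
    by rewrite -(@ae_eq_int _ _ _ P (fun=> 0))// int0.
  split; [by split=> //; exact: (pow 1%N).1| |exact: (pow 1%N).2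
    |exact: (pow 3%N).1|by rewrite (pow 3%N).2 expr0n mulr0].
  by rewrite -[RHS](pow 0%N).2; apply: int_ext => w; rewrite expr1.
set s := Num.sqrt v; have s0 : 0 < s by rewrite sqrtr_gt0.
have sv : s ^+ 2 = v by rewrite sqr_sqrtr// ltW.
have p1 := L1_power_normal_pdf s0 (isT : 1 <= 4)%N.
have p2 := L1_power_normal_pdf s0 (isT : 2 <= 4)%N.
have p4 := L1_power_normal_pdf s0 (isT : 4 <= 4)%N.
have mX k : measurable_fun setT (fun x : R => x ^+ k) by exact: measurable_funX.
have [l2 i2] := centered_gaussian_ge0 v0 mZ gZ (mX 2) (fun x => sqr_ge0 x) p2.
have e4 (x : R) : 0 <= x ^+ 4 by rewrite exprn_even_ge0.
have [l4 i4] := centered_gaussian_ge0 v0 mZ gZ (mX 4) e4 p4.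
have i2' : \int[P]_w Z w ^+ 2 = v by rewrite i2 int_sqr_normal_pdf.
have Z2 : L2 P Z by split.
have Z1 : L1 P Z by exact: L2_L1.
split => //.
- have hE (x : R) : (x + 1) ^+ 2 * normal_pdf 0 s x =
      x ^+ 2 * normal_pdf 0 s x + (2 * (x ^+ 1 * normal_pdf 0 s x) + normal_pdf 0 s x).
    ring.
  have q : L1 leb (fun x => 2 * (x ^+ 1 * normal_pdf 0 s x) + normal_pdf 0 s x).
    by apply: L1D; [exact: L1Z|exact: L1_normal_pdf].
  have ph : L1 leb (fun x => (x + 1) ^+ 2 * normal_pdf 0 s x).
    apply: (@eq_L1 _ _ _ leb (fun x => x ^+ 2 * normal_pdf 0 s x +
      (2 * (x ^+ 1 * normal_pdf 0 s x) + normal_pdf 0 s x))).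
      by move=> x; rewrite hE.
    exact: L1D.
  have m1 : measurable_fun setT (fun x : R => (x + 1) ^+ 2).
    by apply: measurable_funX; exact: measurable_funD.
  have [_] := centered_gaussian_ge0 v0 mZ gZ m1 (fun x => sqr_ge0 _) ph.
  rewrite (@int_ext _ _ _ leb _ _ hE) intD// intD; last 2 first.
  + exact: L1Z.
  + exact: L1_normal_pdf.
  rewrite intZ// int_normal_pdf int_sqr_normal_pdf// sv.
  under [X in 2 * X]int_ext do rewrite expr1.
  rewrite int_id_normal_pdf// mulr0 add0r.
  have -> : \int[P]_w (Z w + 1) ^+ 2 = \int[P]_w (Z w ^+ 2 + (2 * Z w + 1)).
    by apply: int_ext => w; ring.
  rewrite intD//; last by apply: L1D; [exact: L1Z|exact: L1_cst].
  rewrite intD; last 2 first.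
  + exact: L1Z.
  + exact: L1_cst.
  by rewrite intZ// int_cst i2'; lra.
- rewrite i4; have -> : v ^+ 2 = s ^+ 4 by rewrite -sv -exprM.
  exact: int_quartic_normal_pdf.
Qed.

End centered_gaussian.

Section independent_gaussian.
Context d (T : measurableType d) (R : realType) (P : probability T R).

Lemma independent_gaussian (G : set (set T)) (zeta Z : T -> R) v :
  G `<=` measurable -> measurable_wrt G zeta -> L1 P zeta -> 0 <= v ->
  measurable_fun setT Z -> centered_gaussian P Z v ->
  independent_of P G (fun _ : 'I_1 => Z) ->
  [/\ L1 P (fun w => zeta w * Z w), \int[P]_w (zeta w * Z w) = 0,
      L1 P (fun w => zeta w * Z w ^+ 2) &
      \int[P]_w (zeta w * Z w ^+ 2) = v * \int[P]_w zeta w].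
Proof.
move=> GM Gz z1 v0 mZ gZ indep.
have [Z2 m1 m2 _ _] := centered_gaussian_moments v0 mZ gZ.
have [a b] := independent_int (h := id) GM Gz mZ (@measurable_id _ _ _)
  indep z1 (L2_L1 Z2).
have [a' b'] := independent_int (h := fun x => x ^+ 2) GM Gz mZ
  (measurable_funX _ (@measurable_id _ _ _)) indep z1 Z2.2.
by split => //; rewrite ?b ?b' ?m1 ?m2 ?mulr0// mulrC.
Qed.

End independent_gaussian.

(** * Second moments of a white noise *)

Section white_noise.
Context d (T : measurableType d) (R : realType) (P : probability T R).
Variables (F : R -> set (set T)) (W : set (R * R) -> T -> R).
Hypotheses (filF : is_filtration F) (wn : is_white_noise P F W).
Implicit Types (zeta : T -> R) (A B C D : set (R * R)) (s t p q : R).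

Local Notation leb := (@lebesgue_measure R).

Definition area A : R := fine (lebesgue2 A).

Let sF t : 0 <= t -> sigma_algebra setT (F t).
Proof. by case: filF => h _ _; exact: h. Qed.

Let FM t : 0 <= t -> F t `<=` measurable.
Proof. by case: filF => _ h _; exact: h. Qed.

Let Fle s t : 0 <= s -> s <= t -> F s `<=` F t.
Proof. by case: filF => _ _ h; exact: h. Qed.

Lemma noise_set_sub (I J : set R) A B : I `<=` J -> measurable B -> B `<=` A ->
  noise_set I A -> noise_set J B.
Proof.
move=> IJ mB BA [mA AI Aoo]; split=> //.
  by move=> z /BA/AI[z1 z2]; split=> //; exact: IJ.
by apply: le_lt_trans Aoo; apply: le_measure => //; rewrite inE.
Qed.

Lemma future_noise_set t A : 0 <= t -> noise_set `]t, +oo[ A ->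
  noise_set `[0, +oo[ A.
Proof.
move=> t0 nA; have [mA _ _] := nA; apply: noise_set_sub nA => //.
by move=> x /=; rewrite !in_itv/= !andbT => /ltW; exact: le_trans.
Qed.

Lemma noise_setU I A B : noise_set I A -> noise_set I B -> noise_set I (A `|` B).
Proof.
move=> [mA AI Aoo] [mB BI Boo]; split; first exact: measurableU.
  by move=> z [/AI|/BI].
apply: (@le_lt_trans _ _ (lebesgue2 A + lebesgue2 B)%E).
  by rewrite /lebesgue2; exact: measureU2.
by rewrite lte_add_pinfty.
Qed.

Lemma lebesgue2_area I A : noise_set I A -> lebesgue2 A = (area A)%:E.
Proof.
by case=> mA _ Aoo; rewrite /area fineK// ge0_fin_numE// measure_ge0.
Qed.

Lemma area_ge0 A : 0 <= area A.
Proof. by rewrite fine_ge0// measure_ge0. Qed.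

Lemma areaU I A B : noise_set I A -> noise_set I B -> A `&` B = set0 ->
  area (A `|` B) = area A + area B.
Proof.
move=> nA nB AB; apply: EFin_inj; rewrite EFinD.
rewrite -(lebesgue2_area nA) -(lebesgue2_area nB).
rewrite -(lebesgue2_area (noise_setU nA nB)).
by case: nA nB => mA _ _ [mB _ _]; rewrite /lebesgue2 measureU.
Qed.

Lemma noise_moments A : noise_set `[0, +oo[ A ->
  [/\ L2 P (W A), \int[P]_w W A w = 0, \int[P]_w W A w ^+ 2 = area A,
      L1 P (fun w => W A w ^+ 4) & \int[P]_w W A w ^+ 4 <= 32 * area A ^+ 2].
Proof.
move=> nA; apply: centered_gaussian_moments.
- exact: area_ge0.
- exact: (white_noise_measurable wn nA).
- exact: (white_noise_gaussian wn nA).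
Qed.

Lemma noise_future t A zeta : 0 <= t -> noise_set `]t, +oo[ A ->
  measurable_wrt (F t) zeta -> L1 P zeta ->
  [/\ L1 P (fun w => zeta w * W A w), \int[P]_w (zeta w * W A w) = 0,
      L1 P (fun w => zeta w * W A w ^+ 2) &
      \int[P]_w (zeta w * W A w ^+ 2) = area A * \int[P]_w zeta w].
Proof.
move=> t0 nA mz z1; have nA' := future_noise_set t0 nA.
apply: (independent_gaussian (FM t0) mz z1 (area_ge0 A)).
- exact: (white_noise_measurable wn nA').
- exact: (white_noise_gaussian wn nA').
- apply: (white_noise_future wn (A := fun _ => A) t0) => //.
  by move=> i j _ _ _; rewrite !ord1.
Qed.

(** Polarisation: the cross term is read off from the squares, because the
    noise of a disjoint union is the sum of the noises. *)
Lemma noise_disjoint t A B zeta : 0 <= t ->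
  noise_set `]t, +oo[ A -> noise_set `]t, +oo[ B -> A `&` B = set0 ->
  measurable_wrt (F t) zeta -> L1 P zeta ->
  L1 P (fun w => zeta w * (W A w * W B w)) /\
  \int[P]_w (zeta w * (W A w * W B w)) = 0.
Proof.
move=> t0 nA nB AB mz z1.
have [_ _ lA iA] := noise_future t0 nA mz z1.
have [_ _ lB iB] := noise_future t0 nB mz z1.
have [_ _ lU iU] := noise_future t0 (noise_setU nA nB) mz z1.
have nA' := future_noise_set t0 nA; have nB' := future_noise_set t0 nB.
have ae := white_noise_additive wn nA' nB' AB.
have mA := white_noise_measurable wn nA'.
have mB := white_noise_measurable wn nB'.
have mzz := wrt_measurable (FM t0) mz.
have ae' : {ae P, forall w,
    2^-1 * (zeta w * W (A `|` B) w ^+ 2 - zeta w * W A w ^+ 2 - zeta w * W B w ^+ 2) =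
    zeta w * (W A w * W B w)}.
  by apply: filterS ae => w ->; field.
have l : L1 P (fun w => 2^-1 *
    (zeta w * W (A `|` B) w ^+ 2 - zeta w * W A w ^+ 2 - zeta w * W B w ^+ 2)).
  by apply: L1Z; apply: L1B => //; exact: L1B.
have mAB : measurable_fun setT (fun w => zeta w * (W A w * W B w)).
  by apply: measurable_funM => //; exact: measurable_funM.
split; first exact: ae_eq_L1 ae' l.
rewrite -(ae_eq_int (L1_measurable l) mAB ae').
rewrite intZ; last by apply: L1B => //; exact: L1B.
rewrite intB//; last exact: L1B.
rewrite intB// iU iA iB (areaU nA nB AB); ring.
Qed.

Lemma noise_split I C D : noise_set `[0, +oo[ C -> measurable D ->
  {ae P, forall w, W C w = W (C `&` D) w + W (C `\` D) w} /\
  (noise_set I C -> noise_set I (C `&` D) /\ noise_set I (C `\` D)).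
Proof.
move=> nC mD; have [mC _ _] := nC; split.
  have := white_noise_additive wn (A := C `&` D) (B := C `\` D).
  rewrite setUIDK; apply.
  - by apply: noise_set_sub nC => //; exact: measurableI.
  - by apply: noise_set_sub nC => //; exact: measurableD.
  - by rewrite setDE setIACA setICr setI0.
move=> nC'; split; apply: noise_set_sub nC' => //; first exact: measurableI.
exact: measurableD.
Qed.

Lemma noise_covariance t C D zeta : 0 <= t ->
  noise_set `]t, +oo[ C -> noise_set `]t, +oo[ D ->
  measurable_wrt (F t) zeta -> L1 P zeta ->
  L1 P (fun w => zeta w * (W C w * W D w)) /\
  \int[P]_w (zeta w * (W C w * W D w)) = area (C `&` D) * \int[P]_w zeta w.
Proof.
move=> t0 nC nD mz z1.
have nC' := future_noise_set t0 nC; have nD' := future_noise_set t0 nD.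
have [mC _ _] := nC; have [mD _ _] := nD.
have [aeC /(_ nC) [nI nCD]] := noise_split `]t, +oo[ nC' mD.
have [aeD /(_ nD) [_ nDC]] := noise_split `]t, +oo[ nD' mC.
have [_ _ lI iI] := noise_future t0 nI mz z1.
have d1 : (C `&` D) `&` (D `\` C) = set0.
  by apply/seteqP; split=> // z [[? ?] [? ?]].
have d2 : (C `&` D) `&` (C `\` D) = set0.
  by apply/seteqP; split=> // z [[? ?] [? ?]].
have d3 : (C `\` D) `&` (D `\` C) = set0.
  by apply/seteqP; split=> // z [[? ?] [? ?]].
have [l1 i1] := noise_disjoint t0 nI nDC d1 mz z1.
have [l2 i2] := noise_disjoint t0 nI nCD d2 mz z1.
have [l3 i3] := noise_disjoint t0 nCD nDC d3 mz z1.
pose f w := zeta w * W (C `&` D) w ^+ 2 +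
  (zeta w * (W (C `&` D) w * W (D `\` C) w) +
  (zeta w * (W (C `&` D) w * W (C `\` D) w) +
  zeta w * (W (C `\` D) w * W (D `\` C) w))).
have ae : {ae P, forall w, f w = zeta w * (W C w * W D w)}.
  apply: filterS2 aeC aeD => w -> ->.
  by rewrite (setIC D C) /f; ring.
have l4 := L1D l2 l3; have l5 := L1D l1 l4; have l : L1 P f by exact: L1D.
have mzz := wrt_measurable (FM t0) mz.
have m : measurable_fun setT (fun w => zeta w * (W C w * W D w)).
  apply: measurable_funM => //; apply: measurable_funM.
  - exact: (white_noise_measurable wn nC').
  - exact: (white_noise_measurable wn nD').
split; first exact: ae_eq_L1 ae l.
rewrite -(ae_eq_int (L1_measurable l) m ae) intD// intD// intD//.
by rewrite iI i1 i2 i3 !addr0.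
Qed.

End white_noise.

(** * Stochastic integrals of simple integrands *)

Lemma int_prod_sep d1 d2 (T1 : measurableType d1) (T2 : measurableType d2)
    (R : realType) (m1 : {sigma_finite_measure set T1 -> \bar R})
    (m2 : {sigma_finite_measure set T2 -> \bar R}) (a : T1 -> R) (b : T2 -> R) :
  L1 m1 a -> L1 m2 b ->
  (m1 \x m2)%E.-integrable setT (EFin \o (fun z => a z.1 * b z.2)) /\
  Rintegral (m1 \x m2)%E setT (fun z => a z.1 * b z.2) =
    (\int[m1]_x a x) * \int[m2]_y b y.
Proof.
move=> a1 b1.
have ma : measurable_fun setT (fun z : T1 * T2 => a z.1).
  by apply: measurableT_comp => //; exact: L1_measurable a1.
have mb : measurable_fun setT (fun z : T1 * T2 => b z.2).
  by apply: measurableT_comp => //; exact: L1_measurable b1.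
have mf : measurable_fun setT (EFin \o (fun z : T1 * T2 => a z.1 * b z.2)).
  by apply/measurable_EFinP; exact: measurable_funM.
have l : (m1 \x m2)%E.-integrable setT (EFin \o (fun z => a z.1 * b z.2)).
  apply/integrable12ltyP => //=.
  have -> : (\int[m1]_x \int[m2]_y `|(a x * b y)%:E| =
      \int[m1]_x (`|(a x)%:E| * \int[m2]_y `|(b y)%:E|))%E.
    apply: eq_integral => x _; rewrite -ge0_integralZl//.
      by apply: eq_integral => y _; rewrite EFinM abseM.
    apply/measurableT_comp => //; apply/measurable_EFinP.
    exact: L1_measurable b1.
  have /integrableP[_ b2] := b1; have /integrableP[ma1 a2] := a1.
  rewrite ge0_integralZr//; last 2 first.
  - exact: measurableT_comp.
  - exact: integral_ge0.
  rewrite lte_mul_pinfty//; first exact: integral_ge0.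
  by rewrite ge0_fin_numE//; exact: integral_ge0.
split=> //; apply: EFin_inj.
rewrite -int_EFin// -[LHS](integral12_prod_meas1 l) EFinM -(int_EFin a1).
rewrite -(int_EFin b1) (int_EFin b1) -integralZr//.
apply: eq_integral => x _; rewrite /fubini_F/=.
under eq_integral do rewrite EFinM.
by rewrite integralZl// (int_EFin b1).
Qed.

Lemma pow4D_le (R : realType) (a b : R) :
  (a + b) ^+ 4 <= 8 * (a ^+ 4 + b ^+ 4).
Proof.
have : (a + b) ^+ 2 <= 2 * (a ^+ 2 + b ^+ 2).
  by have := sqr_ge0 (a - b); nra.
have -> : (a + b) ^+ 4 = ((a + b) ^+ 2) ^+ 2 by rewrite -exprM.
have -> : a ^+ 4 = (a ^+ 2) ^+ 2 by rewrite -exprM.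
have -> : b ^+ 4 = (b ^+ 2) ^+ 2 by rewrite -exprM.
move: ((a + b) ^+ 2) (a ^+ 2) (b ^+ 2) (sqr_ge0 (a + b)) (sqr_ge0 a) (sqr_ge0 b).
move=> x u v x0 u0 v0 xuv; have := sqr_ge0 (u - v); nra.
Qed.

Section simple_integrals.
Context d (T : measurableType d) (R : realType) (P : probability T R).
Variables (F : R -> set (set T)) (W : set (R * R) -> T -> R).
Hypotheses (filF : is_filtration F) (wn : is_white_noise P F W).
Implicit Types (zeta : T -> R) (A B : set R) (s t p q : R).
Implicit Types e : elementary (T := T) (R := R).

Local Notation leb := (@lebesgue_measure R).

Let sF t : 0 <= t -> sigma_algebra setT (F t).
Proof. by case: filF => h _ _; exact: h. Qed.

Let FM t : 0 <= t -> F t `<=` measurable.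
Proof. by case: filF => _ h _; exact: h. Qed.

Let Fle s t : 0 <= s -> s <= t -> F s `<=` F t.
Proof. by case: filF => _ _ h; exact: h. Qed.

Definition strip p q A : set (R * R) := `]p, q]%classic `*` A.

Lemma strip_empty p q A : q <= p -> strip p q A = set0.
Proof.
move=> qp; apply/seteqP; split=> // -[x y] [/=]; rewrite in_itv/= => /andP[px xq].
by have := lt_le_trans px (le_trans xq qp); rewrite ltxx.
Qed.

Lemma lebesgue2_strip p q A : measurable A ->
  lebesgue2 (strip p q A) = ((Num.max 0 (q - p))%:E * leb A)%E.
Proof.
move=> mA; rewrite /lebesgue2 /strip product_measure1E//; congr (_ * _)%E.
transitivity (leb `]p, q]%classic); first by [].
have -> : leb `]p, q]%classic = (if (p%:E < q%:E) then q%:E - p%:E else 0)%E.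
  exact: lebesgue_measure_itv.
rewrite lte_fin; case: ltP => pq.
  by rewrite -EFinB max_r// subr_ge0 ltW.
by rewrite max_l// subr_le0.
Qed.

Lemma measurable_strip p q A : measurable A -> measurable (strip p q A).
Proof. by move=> mA; exact: measurableX. Qed.

Lemma strip_noise_set I p q A : measurable A -> (leb A < +oo)%E ->
  `]p, q] `<=` I -> noise_set I (strip p q A).
Proof.
move=> mA Aoo pqI; split; first exact: measurable_strip.
  by move=> z [/pqI].
rewrite lebesgue2_strip// lte_mul_pinfty//.
by rewrite lee_fin le_max lexx.
Qed.

Lemma stripI p q p' q' A B :
  strip p q A `&` strip p' q' B = strip (Num.max p p') (Num.min q q') (A `&` B).
Proof.
apply/seteqP; split=> -[x y]/=; rewrite /strip/= !in_itv/= gt_max le_min.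
  by move=> [[/andP[-> ->] ?] [/andP[-> ->] ?]].
by move=> [/andP[/andP[-> ->] /andP[-> ->]] []].
Qed.

(** The increment over [s, t] of the integral of one elementary integrand. The
    test [max (el_start e) s < t] only discards the noise of an empty set; it
    keeps the coefficient, known from [el_start e] on, out of [F t] when
    [t <= el_start e]. *)
Definition el_integral e s t (w : T) : R :=
  if Num.max (el_start e) s < t then el_coef e w *
    W (strip (Num.max (el_start e) s) (Num.min (el_end e) t) (el_space e)) w
  else 0.

Definition el_strip e s t : set (R * R) :=
  strip (Num.max (el_start e) s) (Num.min (el_end e) t) (el_space e).

Section one_elementary.
Variable e : elementary (T := T) (R := R).
Hypothesis pe : is_predictable F e.

Let p0 : 0 <= el_start e. Proof. by case: pe. Qed.
Let mA : measurable (el_space e). Proof. by case: pe => _ []. Qed.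
Let Aoo : (leb (el_space e) < +oo)%E. Proof. by case: pe => _ []. Qed.

Let pmax s : 0 <= Num.max (el_start e) s.
Proof. by rewrite le_max p0. Qed.

Lemma el_coef_wrt p : el_start e <= p -> measurable_wrt (F p) (el_coef e).
Proof. by move=> ep; apply: wrt_sub (Fle p0 ep) _; case: pe. Qed.

Lemma el_coef_measurable : measurable_fun setT (el_coef e).
Proof. exact: wrt_measurable (FM p0) (el_coef_wrt (lexx _)). Qed.

Lemma noise_set_el p q : 0 <= p ->
  [/\ noise_set `]p, +oo[ (strip p q (el_space e)),
      noise_set `[0, +oo[ (strip p q (el_space e)) &
      noise_set `[0, q] (strip p q (el_space e))].
Proof.
move=> pp; split; apply: strip_noise_set => // x /=; rewrite !in_itv/= ?andbT.
- by case/andP.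
- by case/andP => /ltW + _; exact: le_trans.
- by case/andP => /ltW /(le_trans pp) -> ->.
Qed.

Lemma el_integral_wrt s t : 0 <= t -> measurable_wrt (F t) (el_integral e s t).
Proof.
move=> t0; rewrite /el_integral; case: (boolP (Num.max (el_start e) s < t)) => lt; last exact: (wrt_cst (sF t0)).
apply: wrtM; first exact: sF.
  by apply: el_coef_wrt; move: lt; rewrite gt_max => /andP[/ltW].
apply: (white_noise_adapted wn t0).
have [_ _ n] := @noise_set_el (Num.max (el_start e) s) (Num.min (el_end e) t) (pmax s).
have [mS _ _] := n; apply: noise_set_sub n => // x /=; rewrite !in_itv/= => /andP[-> /=].
by rewrite le_min => /andP[].
Qed.

Lemma noise_empty p q A : q <= p -> {ae P, forall w, W (strip p q A) w = 0}.
Proof.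
move=> qp; rewrite strip_empty//.
have n0 : noise_set `[0, +oo[ (set0 : set (R * R)).
  by split=> //; rewrite /lebesgue2 measure0.
apply: centered_gaussian0; first exact: (white_noise_measurable wn).
have := white_noise_gaussian wn n0.
by rewrite /lebesgue2 measure0.
Qed.

Lemma el_integral_add s t : 0 <= s -> s <= t ->
  {ae P, forall w, el_integral e 0 t w = el_integral e 0 s w + el_integral e s t w}.
Proof.
move=> s0 st; rewrite /el_integral (max_l p0).
have [pt|tp] := ltP (el_start e) t; last first.
  apply: aeW => w; rewrite ifF ?ifF ?addr0//.
    by apply/negbTE; rewrite -leNgt le_max tp.
  by apply/negbTE; rewrite -leNgt (le_trans st).
have [ps|sp] := ltP (el_start e) s; last first.
  by apply: aeW => w; rewrite pt add0r.
case: (boolP (s < t)) => [st'|]; last first.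
  rewrite -leNgt => ts; have -> : s = t by apply/eqP; rewrite eq_le st.
  by apply: aeW => w; rewrite addr0.
have [_ n _] := @noise_set_el (el_start e) (Num.min (el_end e) s) p0.
have [_ n' _] := @noise_set_el s (Num.min (el_end e) t) s0.
have := white_noise_additive wn n n'.
have -> : strip (el_start e) (Num.min (el_end e) s) (el_space e) `|`
    strip s (Num.min (el_end e) t) (el_space e) =
    strip (el_start e) (Num.min (el_end e) t) (el_space e).
  apply/seteqP; split=> -[x y]/=; rewrite /strip/= !in_itv/= !le_min.
    move=> [[/andP[-> /andP[-> xs]] Ay]|[/andP[sx ->] Ay]]; split=> //.
      by rewrite (le_trans xs st).
    by rewrite (lt_trans ps sx).
  move=> [/andP[-> /andP[-> ->]] Ay] /=.
  by have [xs|sx] := leP x s; [left|right].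
move=> /(_ _) ae; apply: filterS (ae _) => [w ->|].
  by rewrite mulrDr.
apply/seteqP; split=> // -[x y][]; rewrite /strip/= !in_itv/= !le_min.
move=> [/andP[_ /andP[_ xs]] _] [/andP[sx _] _].
by have := lt_le_trans sx xs; rewrite ltxx.
Qed.

Lemma el_integralE t : 0 <= t -> {ae P, forall w, el_coef e w *
  W (strip (el_start e) (Num.min (el_end e) t) (el_space e)) w = el_integral e 0 t w}.
Proof.
move=> t0; rewrite /el_integral (max_l p0); case: (boolP (el_start e < t)) => [_|].
  exact: aeW.
rewrite -leNgt => tp.
have tp' : Num.min (el_end e) t <= el_start e by rewrite ge_min tp orbT.
by apply: filterS (noise_empty (el_space e) tp') => w ->; rewrite mulr0.
Qed.

Lemma el_integral_bound : exists C : R, 0 <= C /\ forall s t, 0 <= s -> s <= t ->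
  [/\ L2 P (el_integral e s t), L1 P (fun w => el_integral e s t w ^+ 4) &
      \int[P]_w el_integral e s t w ^+ 4 <= C * (t - s) ^+ 2].
Proof.
have [_ _ _ [K cK]] := pe.
pose L := fine (leb (el_space e)).
have L0 : 0 <= L by rewrite fine_ge0.
exists (K ^+ 4 * (32 * L ^+ 2)); split.
  by apply: mulr_ge0; [rewrite exprn_even_ge0|apply: mulr_ge0; rewrite ?sqr_ge0].
move=> s t s0 st.
have [_ n _] := @noise_set_el (Num.max (el_start e) s) (Num.min (el_end e) t) (pmax s).
have [W2 _ _ W4 i4] := noise_moments wn n.
have mc := el_coef_measurable.
have c4K w : `|el_coef e w ^+ 4| <= K ^+ 4.
  by rewrite normrX; apply: lerXn2r; rewrite ?nnegrE// (le_trans _ (cK w)).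
rewrite /el_integral; case: (boolP (Num.max (el_start e) s < t)) => _; last first.
  split; [exact: L2_0| |].
    by apply: eq_L1 (L1_cst P 0) => w; rewrite expr0n.
  under int_ext do rewrite expr0n.
  rewrite int0; apply: mulr_ge0; last exact: sqr_ge0.
  by apply: mulr_ge0; [rewrite exprn_even_ge0|apply: mulr_ge0; rewrite ?sqr_ge0].
split; first exact: L2_Mbdd mc cK W2.
  apply: (@eq_L1 _ _ _ _ (fun w => el_coef e w ^+ 4 *
    W (strip (Num.max (el_start e) s) (Num.min (el_end e) t) (el_space e)) w ^+ 4)).
    by move=> w; rewrite exprMn.
  by apply: L1_Mbdd c4K W4; exact: measurable_funX.
set Z := W _.
have aL : area (strip (Num.max (el_start e) s) (Num.min (el_end e) t) (el_space e))
    <= (t - s) * L.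
  rewrite /area lebesgue2_strip// fineM//; last by rewrite ge0_fin_numE.
  rewrite ler_wpM2r// ge_max subr_ge0 st/= lerB//.
    by rewrite ge_min lexx orbT.
  by rewrite le_max lexx orbT.
have l1 : L1 P (fun w => (el_coef e w * Z w) ^+ 4).
  apply: (@eq_L1 _ _ _ _ (fun w => el_coef e w ^+ 4 * Z w ^+ 4)).
    by move=> w; rewrite exprMn.
  by apply: L1_Mbdd c4K W4; exact: measurable_funX.
apply: (@le_trans _ _ (\int[P]_w (K ^+ 4 * Z w ^+ 4))).
  apply: int_le => // [|w]; first exact: L1Z.
  rewrite exprMn; apply: ler_wpM2r; first by rewrite exprn_even_ge0.
  exact: le_trans (ler_norm _) (c4K w).
rewrite intZ//; have K40 : 0 <= K ^+ 4 by rewrite exprn_even_ge0.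
move: (K ^+ 4) K40 => k k0; rewrite -mulrA; apply: ler_wpM2l => //.
apply: (le_trans i4); rewrite -mulrA -exprMn; apply: ler_wpM2l => //.
have aL' := area_ge0 (strip (Num.max (el_start e) s) (Num.min (el_end e) t) (el_space e)).
rewrite lerXn2r ?nnegrE//; last by rewrite mulrC.
by rewrite mulr_ge0// subr_ge0.
Qed.

Lemma el_integral_mean s t zeta K : 0 <= s -> measurable_wrt (F s) zeta ->
  (forall w, `|zeta w| <= K) ->
  L1 P (fun w => zeta w * el_integral e s t w) /\
  \int[P]_w (zeta w * el_integral e s t w) = 0.
Proof.
move=> s0 mz zK; rewrite /el_integral; case: (boolP (Num.max (el_start e) s < t)) => _; last first.
  split; first by apply: eq_L1 (L1_cst P 0) => w; rewrite mulr0.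
  by under int_ext do rewrite mulr0; rewrite int0.
have [n _ _] := @noise_set_el (Num.max (el_start e) s) (Num.min (el_end e) t) (pmax s).
have sm : s <= Num.max (el_start e) s by rewrite le_max lexx orbT.
have em : el_start e <= Num.max (el_start e) s by rewrite le_max lexx.
have mzc : measurable_wrt (F (Num.max (el_start e) s)) (fun w => zeta w * el_coef e w).
  by apply: wrtM; [exact: sF|exact: wrt_sub (Fle s0 sm) mz|exact: el_coef_wrt].
have [_ _ _ [K' cK']] := pe.
have l : L1 P (fun w => zeta w * el_coef e w).
  apply: (@L1_bdd _ _ _ _ (K * K')); first exact: wrt_measurable (FM (pmax s)) mzc.
  by move=> w; rewrite normrM ler_pM.
have [l1 i1 _ _] := noise_future filF wn (pmax s) n mzc l.
split; first by apply: eq_L1 l1 => w; rewrite mulrA.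
by under int_ext do rewrite mulrA.
Qed.

End one_elementary.

Lemma el_integral_cov_le e e' s t zeta K :
  is_predictable F e -> is_predictable F e' -> 0 <= s ->
  Num.max (el_start e) s <= Num.max (el_start e') s ->
  measurable_wrt (F s) zeta -> (forall w, `|zeta w| <= K) ->
  L1 P (fun w => zeta w * (el_integral e s t w * el_integral e' s t w)) /\
  \int[P]_w (zeta w * (el_integral e s t w * el_integral e' s t w)) =
  (\int[P]_w (zeta w * (el_coef e w * el_coef e' w))) *
    area (el_strip e s t `&` el_strip e' s t).
Proof.
move=> pe pe' s0; set p := Num.max (el_start e) s; set q := Num.max (el_start e') s.
move=> pq mz zK.
have [_ [mA Aoo] _ [Kc cK]] := pe; have [_ [mA' Aoo'] _ [Kc' cK']] := pe'.
have p0 : 0 <= p by rewrite le_max s0 orbT.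
have q0 : 0 <= q by rewrite le_max s0 orbT.
rewrite /el_integral /el_strip -/p -/q.
have trivial_case : t <= q -> area (strip p (Num.min (el_end e) t) (el_space e) `&`
    strip q (Num.min (el_end e') t) (el_space e')) = 0.
  move=> tq; rewrite stripI strip_empty ?/area /lebesgue2 ?measure0//.
  apply: (@le_trans _ _ t); first by rewrite !ge_min lexx !orbT.
  by rewrite (le_trans tq)// le_max lexx orbT.
case: (ltP q t) => qt; last first.
  rewrite trivial_case// mulr0; split.
    by apply: eq_L1 (L1_cst P 0) => w; rewrite !mulr0.
  by under int_ext do rewrite !mulr0; rewrite int0.
rewrite (le_lt_trans pq qt).
set r := Num.min (el_end e) t; set r' := Num.min (el_end e') t.
set A := el_space e; set A' := el_space e'.
pose S1 := strip p (Num.min r q) A; pose S2 := strip q r A; pose S' := strip q r' A'.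
have [_ n1 n1'] := noise_set_el pe (Num.min r q) p0.
have [n2 n2' _] := noise_set_el pe r q0.
have [n' n'' _] := noise_set_el pe' r' q0.
have splitS : strip p r A = S1 `|` S2.
  apply/seteqP; split=> -[x y]/=; rewrite /S1 /S2 /strip/= !in_itv/= !le_min.
    move=> [/andP[-> ->] Ay]/=; by have [xs|sx] := leP x q; [left|right].
  move=> [[/andP[-> /andP[-> _]] Ay]|[/andP[qx ->] Ay]]; split=> //.
  by rewrite (le_lt_trans pq qx).
have ae : {ae P, forall w, W (strip p r A) w = W S1 w + W S2 w}.
  rewrite splitS; apply: (white_noise_additive wn n1 n2').
  apply/seteqP; split=> // -[x y][]; rewrite /S1 /S2 /strip/= !in_itv/= !le_min.
  move=> [/andP[_ /andP[_ xs]] _] [/andP[sx _] _].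
  by have := lt_le_trans sx xs; rewrite ltxx.
have sq : s <= q by rewrite le_max lexx orbT.
have ep : el_start e <= p by rewrite le_max lexx.
have eq' : el_start e' <= q by rewrite le_max lexx.
have mz' : measurable_wrt (F q) zeta by exact: wrt_sub (Fle s0 sq) mz.
have mc : measurable_wrt (F q) (el_coef e).
  by apply: el_coef_wrt => //; exact: le_trans pq.
have mc' : measurable_wrt (F q) (el_coef e') by exact: el_coef_wrt.
have mzcc : measurable_wrt (F q) (fun w => zeta w * (el_coef e w * el_coef e' w)).
  by apply: wrtM => //; [exact: sF|apply: wrtM => //; exact: sF].
have bzcc w : `|zeta w * (el_coef e w * el_coef e' w)| <= K * (Kc * Kc').
  by rewrite !normrM !ler_pM// mulr_ge0.
have lzcc : L1 P (fun w => zeta w * (el_coef e w * el_coef e' w)).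
  by apply: L1_bdd bzcc; exact: wrt_measurable (FM q0) mzcc.
have mS1 : measurable_wrt (F q) (W S1).
  apply: (white_noise_adapted wn q0).
  have [mS _ _] := n1'; apply: noise_set_sub n1' => // x /=.
  by rewrite !in_itv/= le_min => /andP[-> /andP[_ ->]].
have [S12 _ _ _ _] := noise_moments wn n1.
have mX : measurable_wrt (F q) (fun w => zeta w * (el_coef e w * el_coef e' w) * W S1 w).
  by apply: wrtM => //; exact: sF.
have lX : L1 P (fun w => zeta w * (el_coef e w * el_coef e' w) * W S1 w).
  by apply: L1_Mbdd bzcc (L2_L1 S12); exact: wrt_measurable (FM q0) mzcc.
have [l1 i1 _ _] := noise_future filF wn q0 n' mX lX.
have [l2 i2] := noise_covariance filF wn q0 n2 n' mzcc lzcc.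
pose f w := zeta w * (el_coef e w * el_coef e' w) * W S1 w * W S' w +
  zeta w * (el_coef e w * el_coef e' w) * (W S2 w * W S' w).
have aef : {ae P, forall w, f w =
    zeta w * (el_coef e w * W (strip p r A) w * (el_coef e' w * W S' w))}.
  by apply: filterS ae => w ->; rewrite /f; ring.
have lf : L1 P f by exact: L1D.
have mf : measurable_fun setT (fun w =>
    zeta w * (el_coef e w * W (strip p r A) w * (el_coef e' w * W S' w))).
  have [_ nn _] := noise_set_el pe r p0.
  apply: measurable_funM; first exact: wrt_measurable (FM q0) mz'.
  apply: measurable_funM; apply: measurable_funM.
  - exact: el_coef_measurable.
  - exact: (white_noise_measurable wn nn).
  - exact: el_coef_measurable.
  - exact: (white_noise_measurable wn n'').
split; first exact: ae_eq_L1 aef lf.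
rewrite -(ae_eq_int (L1_measurable lf) mf aef) (intD l1 l2) i1 add0r i2 mulrC; congr (_ * _).
rewrite splitS setIUl (_ : S1 `&` S' = set0) ?set0U//.
rewrite stripI strip_empty//.
apply: (@le_trans _ _ q); first by rewrite !ge_min lexx ?orbT.
by rewrite le_max lexx orbT.
Qed.

Lemma el_integral_cov e e' s t zeta K :
  is_predictable F e -> is_predictable F e' -> 0 <= s ->
  measurable_wrt (F s) zeta -> (forall w, `|zeta w| <= K) ->
  L1 P (fun w => zeta w * (el_integral e s t w * el_integral e' s t w)) /\
  \int[P]_w (zeta w * (el_integral e s t w * el_integral e' s t w)) =
  (\int[P]_w (zeta w * (el_coef e w * el_coef e' w))) *
    area (el_strip e s t `&` el_strip e' s t).
Proof.
move=> pe pe' s0 mz zK.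
have [le|le] := leP (Num.max (el_start e) s) (Num.max (el_start e') s).
  exact: el_integral_cov_le zK.
have [l i] := el_integral_cov_le t pe' pe s0 (ltW le) mz zK.
split; first by apply: eq_L1 l => w; ring.
rewrite setIC -[LHS](_ : \int[P]_w (zeta w * (el_integral e' s t w * el_integral e s t w)) = _).
  rewrite i; congr (_ * _); apply: int_ext => w; ring.
by apply: int_ext => w; ring.
Qed.

End simple_integrals.

(** Planar Lebesgue measure as a sigma-finite measure, so that it can serve as
    second factor of a further product. *)
Definition planar (R : realType) :
    set (measurableTypeR R * measurableTypeR R)%type -> \bar R :=
  (@lebesgue_measure R \x @lebesgue_measure R)%E.

Arguments planar R : clear implicits.

HB.instance Definition _ (R : realType) := Measure.copy (planar R)
  (@lebesgue_measure R \x @lebesgue_measure R)%E.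

Lemma planar_sigma_finite (R : realType) : sigma_finite setT (planar R).
Proof.
have /sigma_finiteP[F [TF ndF Foo]] := sigma_finiteT (@lebesgue_measure R).
exists (fun n => F n `*` F n).
  rewrite -setXTT TF predeqE => -[x y]; split.
    move=> [/= [n _ Fnx] [k _ Gky]]; exists (maxn n k) => //; split.
    - by move: x Fnx; exact/subsetPset/ndF/leq_maxl.
    - by move: y Gky; exact/subsetPset/ndF/leq_maxr.
  by move=> [n _ []/= ? ?]; split; exists n.
move=> k; have [? ?] := Foo k.
split; first exact: measurableX.
by rewrite /planar product_measure1E// lte_mul_pinfty// ge0_fin_numE.
Qed.

HB.instance Definition _ (R : realType) :=
  Measure_isSigmaFinite.Build _ _ _ (planar R) (planar_sigma_finite R).

Section sums_of_elementary_integrals.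
Context d (T : measurableType d) (R : realType) (P : probability T R).
Variables (F : R -> set (set T)) (W : set (R * R) -> T -> R).
Hypotheses (filF : is_filtration F) (wn : is_white_noise P F W).
Implicit Types (zeta : T -> R) (s t : R).

Local Notation leb := (@lebesgue_measure R).
Local Notation mu3 := (P \x planar R)%E.

Let sF t : 0 <= t -> sigma_algebra setT (F t).
Proof. by case: filF => h _ _; exact: h. Qed.

Let FM t : 0 <= t -> F t `<=` measurable.
Proof. by case: filF => _ h _; exact: h. Qed.

(** The stochastic integral of the simple integrand [f] over the times from [s] to [t]. *)
Definition sint n (f : 'I_n -> elementary (T := T) (R := R)) s t (w : T) : R :=
  \sum_(k < n) el_integral W (f k) s t w.

Definition strip_eval n (f : 'I_n -> elementary (T := T) (R := R)) (z : T * (R * R)) : R :=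
  simple_eval f z.2.1 z.2.2 z.1.

Definition between s t (z : T * (R * R)) : R := \1_(`]s, t]) z.2.1.

Section one_integrand.
Variables (n : nat) (f : 'I_n -> elementary (T := T) (R := R)).
Hypothesis pf : forall k, is_predictable F (f k).

Lemma sint_wrt s t : 0 <= t -> measurable_wrt (F t) (sint f s t).
Proof.
by move=> t0; apply: wrt_sum => [|k]; [exact: sF|exact: (el_integral_wrt filF wn)].
Qed.

Lemma sint_add s t : 0 <= s -> s <= t ->
  {ae P, forall w, sint f 0 t w = sint f 0 s w + sint f s t w}.
Proof.
move=> s0 st.
have /filter_forall ae : forall k, {ae P, forall w, el_integral W (f k) 0 t w =
    el_integral W (f k) 0 s w + el_integral W (f k) s t w}.
  by move=> k; exact: (el_integral_add wn (pf k) s0 st).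
apply: filterS ae => w ae; rewrite /sint -big_split/=.
by apply: eq_bigr => k _; exact: ae.
Qed.

Lemma simple_integralE t : 0 <= t ->
  {ae P, forall w, simple_integral W f t w = sint f 0 t w}.
Proof.
move=> t0; have /filter_forall ae := fun k => el_integralE wn (pf k) t0.
apply: filterS ae => w ae; apply: eq_bigr => k _; exact: ae.
Qed.

Lemma sint_mean s t zeta K : 0 <= s -> measurable_wrt (F s) zeta ->
  (forall w, `|zeta w| <= K) ->
  L1 P (fun w => zeta w * sint f s t w) /\ \int[P]_w (zeta w * sint f s t w) = 0.
Proof.
move=> s0 mz zK.
have m k := el_integral_mean filF wn (pf k) t s0 mz zK.
have E w : zeta w * sint f s t w = \sum_(k < n) zeta w * el_integral W (f k) s t w.
  by rewrite mulr_sumr.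
split.
  by apply: eq_L1 (fun w => esym (E w)) _; apply: L1_sum => k _; exact: (m k).1.
rewrite (int_ext _ E) int_sum => [|k _]; last exact: (m k).1.
by apply: big1 => k _; exact: (m k).2.
Qed.

Lemma sint_bound : exists C : R, 0 <= C /\ forall s t, 0 <= s -> s <= t ->
  [/\ L2 P (sint f s t), L1 P (fun w => sint f s t w ^+ 4) &
      \int[P]_w sint f s t w ^+ 4 <= C * (t - s) ^+ 2].
Proof.
rewrite /sint; elim: (index_enum _) => [|k r [C [C0 IH]]].
  exists 0; split=> // s t s0 st; split.
  - by apply: eq_L2 (L2_0 P) => w; rewrite big_nil.
  - by apply: eq_L1 (L1_cst P 0) => w; rewrite big_nil expr0n.
  - by under int_ext do rewrite big_nil expr0n; rewrite int0 mul0r.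
have [C' [C'0 b]] := el_integral_bound filF wn (pf k).
exists (8 * (C' + C)); split; first by rewrite mulr_ge0// addr_ge0.
move=> s t s0 st; have [a1 a2 a3] := IH s t s0 st.
have [b1 b2 b3] := b s t s0 st.
pose u := el_integral W (f k) s t.
pose v w := \sum_(j <- r) el_integral W (f j) s t w.
have E w : \sum_(j <- k :: r) el_integral W (f j) s t w = u w + v w.
  by rewrite big_cons.
have uv2 : L2 P (fun w => u w + v w) by exact: L2D.
have l8 : L1 P (fun w => 8 * (u w ^+ 4 + v w ^+ 4)) by apply: L1Z; exact: L1D.
have l4 : L1 P (fun w => (u w + v w) ^+ 4).
  apply: (@L1_le _ _ _ _ _ (fun w => 8 * (u w ^+ 4 + v w ^+ 4))) => //.
    by apply: measurable_funX; case: uv2.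
  by move=> w; rewrite ger0_norm ?pow4D_le// exprn_even_ge0.
split.
- by apply: eq_L2 (fun w => esym (E w)) _.
- by apply: eq_L1 l4 => w; rewrite E.
- under int_ext do rewrite E.
  apply: (@le_trans _ _ (\int[P]_w (8 * (u w ^+ 4 + v w ^+ 4)))).
    by apply: int_le => // w; exact: pow4D_le.
  rewrite intZ; last exact: L1D.
  by rewrite intD// -mulrA ler_wpM2l// mulrDl lerD.
Qed.

Lemma measurable_strip_eval : measurable_fun setT (strip_eval f).
Proof.
apply: measurable_sum => k.
have [_ [mA _] _ _] := pf k.
apply: measurable_funM; first apply: measurable_funM.
- apply: measurableT_comp => //; exact: (el_coef_measurable filF (pf k)).
- apply: (measurableT_comp (measurable_indic _)) => //.
  exact: measurableT_comp.
- apply: (measurableT_comp (measurable_indic _)) => //.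
  exact: measurableT_comp.
Qed.

End one_integrand.

Lemma between_strip s t n (f : 'I_n -> elementary) n' (f' : 'I_n' -> elementary)
    (zeta : T -> R) (z : T * (R * R)) :
  zeta z.1 * between s t z * (strip_eval f z * strip_eval f' z) =
  \sum_(k < n) \sum_(l < n')
    (zeta z.1 * (el_coef (f k) z.1 * el_coef (f' l) z.1)) *
    \1_(el_strip (f k) s t `&` el_strip (f' l) s t) z.2.
Proof.
rewrite /strip_eval /simple_eval big_distrlr/= mulr_sumr.
apply: eq_bigr => k _; rewrite mulr_sumr; apply: eq_bigr => l _.
have E (e : elementary (T := T) (R := R)) : \1_(el_strip e s t) z.2 =
    between s t z * (\1_(`]el_start e, el_end e]) z.2.1 * \1_(el_space e) z.2.2) :> R.
  rewrite /between !indicE -!natrM; congr (_%:R); rewrite !mulnb; congr nat_of_bool.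
  apply/idP/idP.
    rewrite inE /el_strip/strip/= in_itv/= gt_max le_min.
    move=> [/andP[/andP[a b] /andP[c e']] h].
    by apply/and3P; split; apply/mem_set => //=; rewrite in_itv/= ?a ?b ?c ?e'.
  move=> /and3P[/set_mem/= + /set_mem/= + /set_mem h].
  rewrite !in_itv/= => /andP[a b] /andP[c e']; apply/mem_set; split=> //=.
  by rewrite in_itv/= gt_max le_min a b c e'.
rewrite indicI /= !E.
have bb : between s t z = between s t z * between s t z.
  by rewrite /between indicE; case: (_ \in _); rewrite ?mulr1 ?mulr0.
rewrite [in LHS]bb; ring.
Qed.

Lemma sint_cov n (f : 'I_n -> elementary) n' (f' : 'I_n' -> elementary) s t zeta K :
  (forall k, is_predictable F (f k)) -> (forall k, is_predictable F (f' k)) ->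
  0 <= s -> measurable_wrt (F s) zeta -> (forall w, `|zeta w| <= K) ->
  [/\ L1 P (fun w => zeta w * (sint f s t w * sint f' s t w)),
      L1 mu3 (fun z => zeta z.1 * between s t z * (strip_eval f z * strip_eval f' z)) &
      \int[P]_w (zeta w * (sint f s t w * sint f' s t w)) =
      \int[mu3]_z (zeta z.1 * between s t z * (strip_eval f z * strip_eval f' z))].
Proof.
move=> pf pf' s0 mz zK.
have m k l := el_integral_cov filF wn t (pf k) (pf' l) s0 mz zK.
have E w : zeta w * (sint f s t w * sint f' s t w) =
    \sum_(k < n) \sum_(l < n')
      zeta w * (el_integral W (f k) s t w * el_integral W (f' l) s t w).
  by rewrite /sint big_distrlr/= mulr_sumr; apply: eq_bigr => k _; rewrite mulr_sumr.
have lcc k l : L1 P (fun w => zeta w * (el_coef (f k) w * el_coef (f' l) w)).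
  have [_ _ _ [Kc cK]] := pf k; have [_ _ _ [Kc' cK']] := pf' l.
  apply: (@L1_bdd _ _ _ _ (K * (Kc * Kc'))).
    apply: measurable_funM; first exact: wrt_measurable (FM s0) mz.
    apply: measurable_funM; [exact: (el_coef_measurable filF (pf k))|].
    exact: (el_coef_measurable filF (pf' l)).
  by move=> w; rewrite !normrM !ler_pM// mulr_ge0.
have lD k l : L1 (planar R) (\1_(el_strip (f k) s t `&` el_strip (f' l) s t)) /\
   \int[planar R]_z \1_(el_strip (f k) s t `&` el_strip (f' l) s t) z =
   area (el_strip (f k) s t `&` el_strip (f' l) s t).
  have [_ [mA Aoo] _ _] := pf k; have [_ [mA' _] _ _] := pf' l.
  have mD : measurable (el_strip (f k) s t `&` el_strip (f' l) s t).
    by apply: measurableI; exact: measurable_strip.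
  have mS : measurable (el_strip (f k) s t) by exact: measurable_strip.
  split; last first.
    by rewrite /Rintegral integral_indic// setIT.
  apply/integrableP; split; first exact/measurable_EFinP.
  under eq_integral do rewrite /= ger0_norm//.
  rewrite integral_indic// setIT.
  apply: (@le_lt_trans _ _ (lebesgue2 (el_strip (f k) s t))).
    by apply: le_measure => //; rewrite ?inE//; exact: subIsetl.
  rewrite lebesgue2_strip// lte_mul_pinfty//.
  by rewrite lee_fin le_max lexx.
have i3 k l := int_prod_sep (lcc k l) (lD k l).1.
have l3 k l : L1 mu3 (fun z => (zeta z.1 * (el_coef (f k) z.1 * el_coef (f' l) z.1)) *
    \1_(el_strip (f k) s t `&` el_strip (f' l) s t) z.2) by exact: (i3 k l).1.
have E3 := @between_strip s t n f n' f' zeta.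
split.
- apply: eq_L1 (fun w => esym (E w)) _.
  by apply: L1_sum => k _; apply: L1_sum => l _; exact: (m k l).1.
- refine (@eq_L1 _ _ _ (P \x planar R)%E _ _ (fun z => esym (E3 z)) _).
  by apply: L1_sum => k _; apply: L1_sum => l _; exact: l3.
rewrite (int_ext _ E) (@int_ext _ _ _ (P \x planar R)%E _ _ E3) int_sum => [|k _]; last first.
  by apply: L1_sum => l _; exact: (m k l).1.
rewrite int_sum => [|k _]; last by apply: L1_sum => l _; exact: l3.
apply: eq_bigr => k _; rewrite int_sum => [|l _]; last exact: (m k l).1.
rewrite int_sum => [|l _]; last exact: l3.
apply: eq_bigr => l _; rewrite (m k l).2 -(lD k l).2.
by rewrite -(i3 k l).2.
Qed.

End sums_of_elementary_integrals.

(** * Taylor expansion along a grid *)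

(** Borel functions of finitely many real variables, tested on random vectors so
    that one notion serves every sub-sigma-algebra. *)
Definition borel_vec (R : realType) (I : Type) (f : (I -> R) -> R) : Prop :=
  forall d (T : measurableType d) (G : set (set T)) (z : I -> T -> R),
    sigma_algebra setT G -> (forall i, measurable_wrt G (z i)) ->
    measurable_wrt G (fun w => f (fun i => z i w)).

(** The parabolic size of a displacement: a time [dt] counts for [sqrt dt]. *)
Definition psize (R : realType) (m : nat) (dt : R) (dx : 'I_m -> R) : R :=
  Num.sqrt dt + \sum_(i < m) `|dx i|.

(** A second-order parabolic expansion of [U] on times up to [t0], with
    coefficients [al], [be], [ga]. *)
Record expansion (R : realType) (m : nat) (t0 C : R) (U : R -> ('I_m -> R) -> R)
    (al : 'I_m -> R -> ('I_m -> R) -> R) (be : 'I_m -> 'I_m -> R -> ('I_m -> R) -> R)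
    (ga : R -> ('I_m -> R) -> R) : Prop := {
  exp_taylor : forall v v' x x', 0 <= v -> v <= v' -> v' <= t0 ->
    `|U v' x' - U v x - \sum_(i < m) al i v x * (x' i - x i)
      - \sum_(i < m) \sum_(j < m) be i j v x * ((x' i - x i) * (x' j - x j))
      - ga v x * (v' - v)| <= C * psize (v' - v) (fun i => x' i - x i) ^+ 3;
  exp_U_borel : forall v, borel_vec (U v);
  exp_al_borel : forall i v, borel_vec (al i v);
  exp_be_borel : forall i j v, borel_vec (be i j v);
  exp_ga_borel : forall v, borel_vec (ga v);
  exp_al_bound : forall i v x, 0 <= v -> v <= t0 -> `|al i v x| <= C;
  exp_be_bound : forall i j v x, 0 <= v -> v <= t0 -> `|be i j v x| <= C;
  exp_ga_bound : forall v x, 0 <= v -> v <= t0 -> `|ga v x| <= C }.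

(** Martingale increments with Brownian fourth moments. *)
Record mart4 (R : realType) d (T : measurableType d) (P : probability T R)
    (F : R -> set (set T)) (m : nat) (C : R) (x : 'I_m -> R -> T -> R) : Prop := {
  mart4_adapted : forall i, adapted F (x i);
  mart4_L2 : forall i s t, 0 <= s -> s <= t -> L2 P (fun w => x i t w - x i s w);
  mart4_L1 : forall i s t, 0 <= s -> s <= t ->
    L1 P (fun w => (x i t w - x i s w) ^+ 4);
  mart4_bound : forall i s t, 0 <= s -> s <= t ->
    \int[P]_w (x i t w - x i s w) ^+ 4 <= C * (t - s) ^+ 2;
  mart4_mean : forall i s t zeta K, 0 <= s -> s <= t ->
    measurable_wrt (F s) zeta -> (forall w, `|zeta w| <= K) ->
    \int[P]_w (zeta w * (x i t w - x i s w)) = 0 }.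

Section taylor_steps.
Context d (T : measurableType d) (R : realType) (P : probability T R).
Variables (F : R -> set (set T)) (m : nat).
Hypothesis filF : is_filtration F.
Implicit Types (x : 'I_m -> R -> T -> R) (zeta : T -> R) (s t C K : R).

Let sF t : 0 <= t -> sigma_algebra setT (F t).
Proof. by case: filF => h _ _; exact: h. Qed.

Let FM t : 0 <= t -> F t `<=` measurable.
Proof. by case: filF => _ h _; exact: h. Qed.

Let Fle s t : 0 <= s -> s <= t -> F s `<=` F t.
Proof. by case: filF => _ _ h; exact: h. Qed.

Lemma psize_ge0 dt (dx : 'I_m -> R) : 0 <= psize dt dx.
Proof. by rewrite addr_ge0// sumr_ge0. Qed.

Definition increment x s t (w : T) : 'I_m -> R := fun i => x i t w - x i s w.

(** By Young's inequality the third moment, which has the order of the Taylor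
    remainder, is controlled by the fourth. *)
Lemma psize_moment C x : 0 <= C -> mart4 P F C x -> exists C' : R, 0 <= C' /\
  forall s t, 0 <= s -> s <= t ->
  [/\ measurable_fun setT (fun w => psize (t - s) (increment x s t w)),
      L1 P (fun w => psize (t - s) (increment x s t w) ^+ 3) &
      \int[P]_w psize (t - s) (increment x s t w) ^+ 3 <=
        C' * ((t - s) * Num.sqrt (t - s))].
Proof.
move=> C0 mx.
have [D [D0 hD]] : exists D : R, 0 <= D /\ forall s t, 0 <= s -> s <= t ->
  [/\ measurable_fun setT (fun w => psize (t - s) (increment x s t w)),
      L1 P (fun w => psize (t - s) (increment x s t w) ^+ 4) &
      \int[P]_w psize (t - s) (increment x s t w) ^+ 4 <= D * (t - s) ^+ 2].
  rewrite /psize /increment; elim: (index_enum _) => [|i r [D [D0 IH]]].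
    exists 1; split=> // s t s0 st.
    have E w : (Num.sqrt (t - s) + \sum_(i <- [::]) `|x i t w - x i s w|) ^+ 4 =
        (t - s) ^+ 2 :> R.
      rewrite big_nil addr0 (_ : 4 = 2 * 2)%N// exprM sqr_sqrtr// subr_ge0//.
    split.
    - by apply: (eq_measurable_fun (fun=> Num.sqrt (t - s))) => // w _; rewrite big_nil addr0.
    - by apply: eq_L1 (fun w => esym (E w)) _; exact: L1_cst.
    - by rewrite (int_ext _ E) int_cst mul1r.
  exists (8 * (C + D)); split; first by rewrite mulr_ge0// addr_ge0.
  move=> s t s0 st; have [m1 l1 i1] := IH s t s0 st.
  have l2 := mart4_L1 mx i s0 st; have i2 := mart4_bound mx i s0 st.
  pose u w := `|x i t w - x i s w|.
  pose v w := Num.sqrt (t - s) + \sum_(j <- r) `|x j t w - x j s w|.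
  have E w : Num.sqrt (t - s) + \sum_(j <- i :: r) `|x j t w - x j s w| = u w + v w.
    by rewrite big_cons /u /v addrCA.
  have u4 w : u w ^+ 4 = (x i t w - x i s w) ^+ 4.
    by rewrite /u -normrX ger0_norm// exprn_even_ge0.
  have mu_ : measurable_fun setT u.
    by apply: measurableT_comp => //; case: (mart4_L2 mx i s0 st).
  have muv : measurable_fun setT (fun w => u w + v w) by exact: measurable_funD.
  have l8 : L1 P (fun w => 8 * (u w ^+ 4 + v w ^+ 4)).
    by apply: L1Z; apply: L1D => //; apply: eq_L1 (fun w => esym (u4 w)) _.
  have l4 : L1 P (fun w => (u w + v w) ^+ 4).
    apply: (@L1_le _ _ _ _ _ (fun w => 8 * (u w ^+ 4 + v w ^+ 4))) => //.
      exact: measurable_funX.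
    by move=> w; rewrite ger0_norm ?pow4D_le// exprn_even_ge0.
  split.
  - by apply: (eq_measurable_fun (fun w => u w + v w)) => // w _; rewrite E.
  - by apply: eq_L1 l4 => w; rewrite E.
  - under int_ext do rewrite E.
    apply: (@le_trans _ _ (\int[P]_w (8 * (u w ^+ 4 + v w ^+ 4)))).
      by apply: int_le => // w; exact: pow4D_le.
    rewrite intZ; last by apply: L1D => //; apply: eq_L1 (fun w => esym (u4 w)) _.
    rewrite intD//; last by apply: eq_L1 (fun w => esym (u4 w)) _.
    by rewrite (int_ext _ u4) -mulrA ler_wpM2l// mulrDl lerD.
exists (1 + 3 * D); split; first by rewrite addr_ge0// mulr_ge0.
move=> s t s0 st; have [m1 l1 i1] := hD s t s0 st.
have n0 w := psize_ge0 (t - s) (increment x s t w).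
have m3 : measurable_fun setT (fun w => psize (t - s) (increment x s t w) ^+ 3).
  exact: measurable_funX.
have l3 : L1 P (fun w => psize (t - s) (increment x s t w) ^+ 3).
  apply: (@L1_le _ _ _ _ _ (fun w => 1 + psize (t - s) (increment x s t w) ^+ 4)) => //.
    by apply: L1D => //; exact: L1_cst.
  move=> w; rewrite ger0_norm ?exprn_ge0//.
  move: (psize _ _) (n0 w) => n n1.
  have [h|h] := leP n 1.
    by rewrite (le_trans (exprn_ile1 _ n1 h))// lerDl exprn_ge0.
  by rewrite (le_trans (ler_weXn2l (ltW h) (isT : 3 <= 4)%N))// lerDr.
split=> //.
have [st'|] := ltP s t; last first.
  move=> ts; have -> : t = s by apply/eqP; rewrite eq_le st ts.
  have E w : psize (s - s) (increment x s s w) ^+ 3 = 0 :> R.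
    rewrite /psize /increment subrr sqrtr0 add0r big1 ?expr0n// => i _.
    by rewrite subrr normr0.
  by rewrite (int_ext _ E) int0 subrr mul0r mulr0.
set r := Num.sqrt (t - s); have r0 : 0 < r by rewrite sqrtr_gt0 subr_gt0.
have rr : t - s = r ^+ 2 by rewrite sqr_sqrtr// subr_ge0.
have young n : 0 <= n -> n ^+ 3 <= (4 * r)^-1 * (r ^+ 4 + 3 * n ^+ 4).
  move=> nn; rewrite ler_pdivlMl ?mulr_gt0//.
  have h1 : 0 <= (r - n) ^+ 2 * (r ^+ 2 + 2 * (r * n) + 3 * n ^+ 2).
    have rn : 0 <= r * n by rewrite mulr_ge0// ltW.
    rewrite mulr_ge0 ?sqr_ge0//; have := sqr_ge0 r; have := sqr_ge0 n; nra.
  have E : (r - n) ^+ 2 * (r ^+ 2 + 2 * (r * n) + 3 * n ^+ 2) =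
    r ^+ 4 + 3 * n ^+ 4 - 4 * r * n ^+ 3 by ring.
  by rewrite E subr_ge0 in h1.
have l4 : L1 P (fun w => r ^+ 4 + 3 * psize (t - s) (increment x s t w) ^+ 4).
  by apply: L1D; [exact: L1_cst|exact: L1Z].
apply: (le_trans (int_le l3 (L1Z (4 * r)^-1 l4) (fun w => young _ (n0 w)))).
rewrite intZ// intD; [|exact: L1_cst|exact: L1Z].
rewrite int_cst intZ// ler_pdivrMl ?mulr_gt0//.
have -> : 4 * r * ((1 + 3 * D) * ((t - s) * r)) = 4 * (1 + 3 * D) * r ^+ 4.
  by rewrite rr; ring.
have i1' : \int[P]_w psize (t - s) (increment x s t w) ^+ 4 <= D * r ^+ 4.
  by rewrite (le_trans i1)// rr -exprM.
have r4 : 0 <= r ^+ 4 by rewrite exprn_even_ge0.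
have := mulr_ge0 D0 r4; nra.
Qed.

Section one_step.
Variables (C C' t0 CU : R) (x : 'I_m -> R -> T -> R).
Hypotheses (mx : mart4 P F C x) (CU0 : 0 <= CU).
Variables (U : R -> ('I_m -> R) -> R) (al : 'I_m -> R -> ('I_m -> R) -> R)
  (be : 'I_m -> 'I_m -> R -> ('I_m -> R) -> R) (ga : R -> ('I_m -> R) -> R).
Hypothesis eU : expansion t0 CU U al be ga.
Hypothesis hC' : forall s t, 0 <= s -> s <= t ->
  [/\ measurable_fun setT (fun w => psize (t - s) (increment x s t w)),
      L1 P (fun w => psize (t - s) (increment x s t w) ^+ 3) &
      \int[P]_w psize (t - s) (increment x s t w) ^+ 3 <=
        C' * ((t - s) * Num.sqrt (t - s))].

Let at_ (f : ('I_m -> R) -> R) t (w : T) : R := f (fun i => x i t w).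

Lemma at_wrt (f : ('I_m -> R) -> R) t : 0 <= t -> borel_vec f ->
  measurable_wrt (F t) (at_ f t).
Proof.
by move=> t_0 bf; apply: bf => [|i]; [exact: sF|exact: (mart4_adapted mx)].
Qed.

Lemma at_measurable f t : 0 <= t -> borel_vec f -> measurable_fun setT (at_ f t).
Proof. by move=> t_0 bf; apply: wrt_measurable (FM t_0) _; exact: at_wrt. Qed.

Definition second_order s t zeta : R :=
  \sum_(i < m) \sum_(j < m) \int[P]_w (zeta w * at_ (be i j s) s w *
     ((x i t w - x i s w) * (x j t w - x j s w)))
  + (t - s) * \int[P]_w (zeta w * at_ (ga s) s w).

(** The first-order term has mean zero by the martingale property. *)
Lemma taylor_step s t zeta K : 0 <= s -> s <= t -> t <= t0 ->
  measurable_wrt (F s) zeta -> (forall w, `|zeta w| <= K) ->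
  L1 P (fun w => zeta w * (at_ (U t) t w - at_ (U s) s w)) /\
  `|\int[P]_w (zeta w * (at_ (U t) t w - at_ (U s) s w)) - second_order s t zeta|
   <= K * CU * C' * ((t - s) * Num.sqrt (t - s)).
Proof.
move=> s0 st tt0 mz zK; have st0 := le_trans st tt0; have t_0 := le_trans s0 st.
have [mn ln in_] := hC' s0 st.
have mzT := wrt_measurable (FM s0) mz.
have za i : measurable_wrt (F s) (fun w => zeta w * at_ (al i s) s w).
  by apply: wrtM => //; [exact: sF|apply: at_wrt => //; exact: exp_al_borel eU _ _].
have zb i j : measurable_wrt (F s) (fun w => zeta w * at_ (be i j s) s w).
  by apply: wrtM => //; [exact: sF|apply: at_wrt => //; exact: exp_be_borel eU _ _ _].
have zg : measurable_wrt (F s) (fun w => zeta w * at_ (ga s) s w).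
  by apply: wrtM => //; [exact: sF|apply: at_wrt => //; exact: exp_ga_borel eU _].
have bza i w : `|zeta w * at_ (al i s) s w| <= K * CU.
  by rewrite normrM ler_pM//; exact: (exp_al_bound eU).
have bzb i j w : `|zeta w * at_ (be i j s) s w| <= K * CU.
  by rewrite normrM ler_pM//; exact: (exp_be_bound eU).
have bzg w : `|zeta w * at_ (ga s) s w| <= K * CU.
  by rewrite normrM ler_pM//; exact: (exp_ga_bound eU).
have la i : L1 P (fun w => zeta w * at_ (al i s) s w * (x i t w - x i s w)).
  apply: L1_Mbdd (bza i) _; first exact: wrt_measurable (FM s0) (za i).
  exact/L2_L1/(mart4_L2 mx).
have lb i j : L1 P (fun w => zeta w * at_ (be i j s) s w *
     ((x i t w - x i s w) * (x j t w - x j s w))).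
  apply: L1_Mbdd (bzb i j) _; first exact: wrt_measurable (FM s0) (zb i j).
  by apply: L2M; exact: (mart4_L2 mx).
have lg : L1 P (fun w => zeta w * at_ (ga s) s w).
  by apply: L1_bdd bzg; exact: wrt_measurable (FM s0) zg.
pose main w := \sum_(i < m) zeta w * at_ (al i s) s w * (x i t w - x i s w) +
  (\sum_(i < m) \sum_(j < m) zeta w * at_ (be i j s) s w *
     ((x i t w - x i s w) * (x j t w - x j s w)) +
   (t - s) * (zeta w * at_ (ga s) s w)).
have lmain : L1 P main.
  apply: L1D; first by apply: L1_sum => i _.
  apply: L1D; last exact: L1Z.
  by apply: L1_sum => i _; apply: L1_sum => j _.
have imain : \int[P]_w main w = second_order s t zeta.
  rewrite /main intD; [|by apply: L1_sum => i _|]; last first.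
    apply: L1D; last exact: L1Z.
    by apply: L1_sum => i _; apply: L1_sum => j _.
  rewrite int_sum// big1 ?add0r => [|i _]; last first.
    exact: (mart4_mean mx _ s0 st (za i) (bza i)).
  rewrite intD; [|by apply: L1_sum => i _; apply: L1_sum => j _|exact: L1Z].
  rewrite intZ// /second_order; congr (_ + _).
  rewrite int_sum => [|i _]; last by apply: L1_sum => j _.
  by apply: eq_bigr => i _; rewrite int_sum.
pose inc w := zeta w * (at_ (U t) t w - at_ (U s) s w).
have minc : measurable_fun setT inc.
  apply: measurable_funM => //; apply: measurable_funB; apply: at_measurable => //;
  exact: exp_U_borel eU _.
have err w : `|inc w - main w| <= K * CU * psize (t - s) (increment x s t w) ^+ 3.
  have := exp_taylor eU (fun i => x i s w) (fun i => x i t w) s0 st tt0.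
  set e := (X in `|X|) => he.
  have -> : inc w - main w = zeta w * e.
    rewrite /inc /main /e /at_.
    have -> : \sum_(i < m) zeta w * al i s (fun k => x k s w) * (x i t w - x i s w) =
      zeta w * \sum_(i < m) al i s (fun k => x k s w) * (x i t w - x i s w).
      by rewrite mulr_sumr; apply: eq_bigr => i _; rewrite mulrA.
    have -> : \sum_(i < m) \sum_(j < m) zeta w * be i j s (fun k => x k s w) *
        ((x i t w - x i s w) * (x j t w - x j s w)) =
      zeta w * \sum_(i < m) \sum_(j < m) be i j s (fun k => x k s w) *
        ((x i t w - x i s w) * (x j t w - x j s w)).
      rewrite mulr_sumr; apply: eq_bigr => i _; rewrite mulr_sumr.
      by apply: eq_bigr => j _; ring.
    by ring.
  by rewrite normrM -mulrA; apply: ler_pM.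
have lerr : L1 P (fun w => inc w - main w).
  apply: (@L1_le _ _ _ _ _ (fun w => K * CU * psize (t - s) (increment x s t w) ^+ 3)) => //.
    by apply: measurable_funB => //; exact: L1_measurable lmain.
  exact: L1Z.
have linc : L1 P inc.
  by apply: eq_L1 (L1D lerr lmain) => w; rewrite subrK.
split=> //; rewrite -imain -intB//.
have K0 : 0 <= K by exact: le_trans (zK point).
apply: (le_trans (abs_int_le_bound lerr (L1Z (K * CU) ln) err)).
rewrite intZ// -[leRHS]mulrA; apply: ler_wpM2l => //; exact: mulr_ge0.
Qed.

(** Summing [N] equal steps: the errors add up to [O(N^(-1/2))]. *)
Definition gridpt s t (N k : nat) : R := s + (t - s) * (k%:R / N%:R).

Lemma taylor_grid s t zeta K N : 0 <= s -> s <= t -> t <= t0 -> (0 < N)%N ->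
  measurable_wrt (F s) zeta -> (forall w, `|zeta w| <= K) ->
  L1 P (fun w => zeta w * (at_ (U t) t w - at_ (U s) s w)) /\
  `|\int[P]_w (zeta w * (at_ (U t) t w - at_ (U s) s w))
    - \sum_(k < N) second_order (gridpt s t N k) (gridpt s t N k.+1) zeta|
   <= K * CU * C' * ((t - s) * Num.sqrt ((t - s) / N%:R)).
Proof.
move=> s0 st tt0 N0 mz zK.
have Nr : 0 < N%:R :> R by rewrite ltr0n.
have ts0 : 0 <= t - s by rewrite subr_ge0.
have g0 : gridpt s t N 0 = s by rewrite /gridpt mul0r mulr0 addr0.
have gN : gridpt s t N N = t by rewrite /gridpt divff ?gt_eqF// mulr1 addrC subrK.
have gS k : gridpt s t N k.+1 - gridpt s t N k = (t - s) / N%:R.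
  rewrite /gridpt -natr1; field; exact: lt0r_neq0.
have gle k : gridpt s t N k <= gridpt s t N k.+1.
  by rewrite -subr_ge0 gS divr_ge0// ltW.
have gs k : s <= gridpt s t N k by rewrite lerDl mulr_ge0// divr_ge0// ?ltW.
have gt_ k : (k <= N)%N -> gridpt s t N k <= t.
  move=> kN; rewrite -[leRHS]gN lerD2l ler_wpM2l//.
  by rewrite ler_pM2r ?invr_gt0// ler_nat.
have gp k : 0 <= gridpt s t N k by exact: le_trans (gs k).
have step (k : 'I_N) : L1 P (fun w => zeta w * (at_ (U (gridpt s t N k.+1)) (gridpt s t N k.+1) w
    - at_ (U (gridpt s t N k)) (gridpt s t N k) w)) /\
  `|\int[P]_w (zeta w * (at_ (U (gridpt s t N k.+1)) (gridpt s t N k.+1) w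
    - at_ (U (gridpt s t N k)) (gridpt s t N k) w))
    - second_order (gridpt s t N k) (gridpt s t N k.+1) zeta|
   <= K * CU * C' * ((t - s) / N%:R * Num.sqrt ((t - s) / N%:R)).
  rewrite -!(gS k); apply: taylor_step => //.
  - by rewrite (le_trans (gt_ k.+1 (ltn_ord k))).
  - exact: wrt_sub (Fle s0 (gs k)) mz.
have tele w : zeta w * (at_ (U t) t w - at_ (U s) s w) =
  \sum_(k < N) zeta w * (at_ (U (gridpt s t N k.+1)) (gridpt s t N k.+1) w
    - at_ (U (gridpt s t N k)) (gridpt s t N k) w).
  transitivity (zeta w * (at_ (U (gridpt s t N N)) (gridpt s t N N) w -
    at_ (U (gridpt s t N 0)) (gridpt s t N 0) w)); first by rewrite gN g0.
  rewrite -mulr_sumr; congr (_ * _).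
  rewrite -(big_mkord xpredT (fun k => at_ (U (gridpt s t N k.+1)) (gridpt s t N k.+1) w
    - at_ (U (gridpt s t N k)) (gridpt s t N k) w)).
  by rewrite (telescope_sumr (fun k => at_ (U (gridpt s t N k)) (gridpt s t N k) w)).
split.
  by apply: eq_L1 (fun w => esym (tele w)) _; apply: L1_sum => k _; exact: (step k).1.
rewrite (int_ext _ tele) int_sum => [|k _]; last exact: (step k).1.
rewrite -sumrB; apply: (le_trans (ler_norm_sum _ _ _)).
apply: (le_trans (ler_sum _ (fun k _ => (step k).2))).
rewrite sumr_const card_ord -mulr_natr le_eqVlt; apply/orP; left; apply/eqP.
by field; exact: lt0r_neq0.
Qed.

End one_step.
End taylor_steps.

(** * The covariance of a stationary kernel *)

Section translation.
Context (R : realType).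
Local Notation leb := (@lebesgue_measure R).
Implicit Types (p q : R) (f g : R -> R).

Lemma lebesgue_measure_itvcc (a b : R) : a <= b ->
  lebesgue_measure (`[a, b]%classic : set R) = (b - a)%:E.
Proof.
move=> ab; rewrite lebesgue_measure_itv/= lte_fin; case: ltP => [_|ba].
  by rewrite -EFinB.
by have -> : a = b; [apply/eqP; rewrite eq_le ab ba|rewrite subrr].
Qed.

Lemma lebesgue_measure_itvoc (a b : R) : a <= b ->
  lebesgue_measure (`]a, b]%classic : set R) = (b - a)%:E.
Proof.
move=> ab; rewrite lebesgue_measure_itv/= lte_fin; case: ltP => [_|ba].
  by rewrite -EFinB.
by have -> : a = b; [apply/eqP; rewrite eq_le ab ba|rewrite subrr].
Qed.

Let shift_measurable p :
  @measurable_fun _ _ (measurableTypeR R) (measurableTypeR R) setT (fun y => y - p).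
Proof. by apply: measurable_funB. Qed.

Lemma lebesgue_measure_shift p (A : set R) : measurable A ->
  pushforward leb ((fun y => y - p) : _ -> measurableTypeR R) A = leb A.
Proof.
move=> mA; apply/esym/lebesgue_measure_unique => //= _ [[a b]] _ <-.
rewrite /pushforward.
have -> : (fun y => y - p) @^-1` `]a, b]%classic = `]a + p, b + p]%classic :> set R.
  by apply/seteqP; split=> y /=; rewrite !in_itv/= ltrBrDr lerBlDr.
rewrite !lebesgue_measure_itv/= !lte_fin ltrD2r; case: ifP => // _.
by rewrite -!EFinB; congr (_%:E); ring.
Qed.

Lemma ge0_integral_shift p (f : R -> \bar R) : measurable_fun setT f ->
  (forall y, 0 <= f y)%E -> (\int[leb]_y f (y - p)%R = \int[leb]_y f y)%E.
Proof.
move=> mf f0.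
have := @ge0_integral_pushforward _ _ (measurableTypeR R) (measurableTypeR R) R
  (fun y => y - p) (shift_measurable p) leb setT f measurableT mf (fun y _ => f0 y).
rewrite preimage_setT => <-.
by apply: eq_measure_integral => A mA _; first [exact: lebesgue_measure_shift|exact/esym/lebesgue_measure_shift].
Qed.

Lemma L1_shift p f : L1 leb f -> L1 leb (fun y => f (y - p)).
Proof.
move=> f1; have mf := L1_measurable f1; have /integrableP[_ foo] := f1.
apply/integrableP; split.
  apply/measurable_EFinP; apply: (@measurableT_comp _ _ _ (measurableTypeR R)) => //.
  exact: shift_measurable.
rewrite (@ge0_integral_shift p (fun y => `|(f y)%:E|)%E)//.
by apply: measurableT_comp => //; exact/measurable_EFinP.
Qed.

Lemma int_shift p f : L1 leb f -> \int[leb]_y f (y - p) = \int[leb]_y f y.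
Proof.
move=> f1; have mf := L1_measurable f1.
have mE : measurable_fun setT (EFin \o f) by exact/measurable_EFinP.
have := @integral_pushforward _ _ (measurableTypeR R) (measurableTypeR R) R
  (fun y => y - p) (shift_measurable p) leb setT (EFin \o f) mE (L1_shift p f1)
  measurableT.
rewrite preimage_setT /Rintegral => <-.
by congr fine; apply: eq_measure_integral => A mA _; first [exact: lebesgue_measure_shift|exact: (esym (lebesgue_measure_shift p mA))].
Qed.

End translation.

Section kernel_covariance.
Context (R : realType) (g : R -> R).
Hypothesis gC1 : C1_square_integrable g.
Local Notation leb := (@lebesgue_measure R).
Implicit Types p q : R.

Let g_cont : continuous g. Proof. by case: gC1. Qed.
Let g_der y : derivable g y 1. Proof. by case: gC1. Qed.
Let g'_cont : continuous (derive1 g). Proof. by case: gC1. Qed.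

Lemma measurable_kernel : measurable_fun setT g.
Proof. exact: continuous_measurable_fun. Qed.

Lemma kernel_L2 p : L2 leb (fun y => g (y - p)).
Proof.
have m : @measurable_fun _ _ (measurableTypeR R) (measurableTypeR R) setT (fun y => y - p).
  by apply: measurable_funB.
split; first by apply: (@measurableT_comp _ _ _ (measurableTypeR R)) => //; exact: measurable_kernel.
by apply: (@L1_shift _ p (fun y => g y ^+ 2)); case: gC1.
Qed.

Lemma int_kernelM p q : L1 leb (fun y => g (y - p) * g (y - q)) /\
  \int[leb]_y (g (y - p) * g (y - q)) = autocorrelation g (p - q).
Proof.
split; first exact: L2M (kernel_L2 p) (kernel_L2 q).
rewrite /autocorrelation.
have g0 : L2 leb g by apply: eq_L2 (kernel_L2 0) => y; rewrite subr0.
rewrite -(@int_shift R q (fun y => g (y - (p - q)) * g y)).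
  by apply: int_ext => y; congr (g _ * _); ring.
exact: L2M (kernel_L2 _) g0.
Qed.

Lemma int_kernel_sqr p : \int[leb]_y g (y - p) ^+ 2 = autocorrelation g 0.
Proof.
rewrite -(subrr p) -(int_kernelM p p).2.
by apply: int_ext => y; rewrite expr2.
Qed.

Lemma autocorrelation0_ge0 : 0 <= autocorrelation g 0.
Proof. by rewrite -(int_kernel_sqr 0); apply: int_ge0 => y; exact: sqr_ge0. Qed.

Lemma int_kernel_diff p q : \int[leb]_y (g (y - p) - g (y - q)) ^+ 2 =
  2 * (autocorrelation g 0 - autocorrelation g (p - q)).
Proof.
have lp := kernel_L2 p; have lq := kernel_L2 q; have [lpq ipq] := int_kernelM p q.
have E y : (g (y - p) - g (y - q)) ^+ 2 =
  g (y - p) ^+ 2 + (g (y - q) ^+ 2 - 2 * (g (y - p) * g (y - q))) by ring.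
have l2 := L1Z 2 lpq; have l3 := L1B lq.2 l2.
rewrite (@int_ext _ _ _ leb _ _ E) (intD lp.2 l3) (intB lq.2 l2) (intZ 2 lpq).
rewrite ipq !int_kernel_sqr; ring.
Qed.

Lemma autocorrelation_sym p : autocorrelation g (- p) = autocorrelation g p.
Proof.
have [_ e1] := int_kernelM 0 p; have [_ e2] := int_kernelM p 0.
rewrite sub0r in e1; rewrite subr0 in e2; rewrite -e1 -e2.
by apply: int_ext => y; rewrite mulrC.
Qed.

Lemma autocorrelation_le p : `|autocorrelation g p| <= autocorrelation g 0.
Proof.
have lp := kernel_L2 p; have l0 := kernel_L2 0.
have [lp0 ip0] := int_kernelM p 0; rewrite subr0 in ip0.
rewrite ler_norml; apply/andP; split; last first.
  have : 0 <= \int[leb]_y (g (y - p) - g (y - 0)) ^+ 2.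
    by apply: int_ge0 => y; exact: sqr_ge0.
  by rewrite int_kernel_diff subr0; lra.
have : 0 <= \int[leb]_y (g (y - p) + g (y - 0)) ^+ 2.
  by apply: int_ge0 => y; exact: sqr_ge0.
have E y : (g (y - p) + g (y - 0)) ^+ 2 =
  g (y - p) ^+ 2 + (g (y - 0) ^+ 2 + 2 * (g (y - p) * g (y - 0))) by ring.
have l2 := L1Z 2 lp0; have l3 := L1D l0.2 l2.
rewrite (@int_ext _ _ _ leb _ _ E) (intD lp.2 l3) (intD l0.2 l2) (intZ 2 lp0).
rewrite ip0 !int_kernel_sqr; lra.
Qed.

Lemma autocorrelation_gt0 : (exists y, g y <> 0) -> 0 < autocorrelation g 0.
Proof.
move=> [y /eqP gy]; have g2 : L1 leb (fun y => g y ^+ 2) by case: gC1.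
have gy0 : 0 < `|g y| / 2 by rewrite divr_gt0// normr_gt0.
have : \forall w \near y, `|g y - g w| < `|g y| / 2.
  have /cvgrPdist_lt gl : g w @[w --> y] --> g y by exact: g_cont.
  exact: gl.
move=> /nbhs_ballP[e /= e0 near_y].
pose A := `[y - e / 2, y + e / 2]%classic.
have big w : A w -> `|g y| / 2 <= `|g w|.
  rewrite /A/= in_itv/= => /andP[a b].
  have : ball y e w by rewrite /ball/= ltr_norml; apply/andP; split; lra.
  move=> /near_y/= h; have := ler_normB (g y) (g y - g w).
  by rewrite subKr; have := lerB_dist (g y) (g w); lra.
have mA : measurable A by exact: measurable_itv.
have lA : L1 leb (fun w => (`|g y| / 2) ^+ 2 * \1_A w).
  by apply: L1Z; exact: integrable_indic_itv.
have : 0 < \int[leb]_w ((`|g y| / 2) ^+ 2 * \1_A w).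
  rewrite intZ; last exact: integrable_indic_itv.
  rewrite mulr_gt0//; first exact: exprn_gt0.
  rewrite /Rintegral integral_indic// setIT.
  have yy : y - e / 2 <= y + e / 2 by lra.
  have E : e = fine (leb A).
    transitivity (fine (y + e / 2 - (y - e / 2))%:E); first by rewrite /=; lra.
    by congr fine; apply/esym; exact: (lebesgue_measure_itvcc yy).
  exact: (eq_ind _ (fun z => 0 < z) e0 _ E).
move=> /lt_le_trans; apply; rewrite -(int_kernel_sqr 0).
have l0 : L1 leb (fun y => g (y - 0) ^+ 2) by have [] := kernel_L2 0.
apply: (int_le lA l0) => w; rewrite subr0 indicE; case: (boolP (w \in A)) => [/set_mem Aw|_].
  rewrite mulr1 -(real_normK (num_real (g w))).
  by apply: lerXn2r; rewrite ?nnegrE ?big//; exact: ltW.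
by rewrite mulr0 sqr_ge0.
Qed.

Lemma increment_sqr_le u v : u <= v ->
  (g v - g u) ^+ 2 <= (v - u) * \int[leb]_w (\1_(`[u, v]) w * derive1 g w ^+ 2).
Proof.
rewrite le_eqVlt => /predU1P[->|uv]; first by rewrite !subrr expr0n mul0r.
pose I w := \1_(`[u, v]%classic) w : R.
have g'2 : L1 leb (fun w => derive1 g w ^+ 2) by case: gC1.
have mI : measurable_fun setT I by apply: measurable_indic; exact: measurable_itv.
have mg' : measurable_fun setT (derive1 g) by exact: continuous_measurable_fun.
have I1 w : `|I w| <= 1.
  by rewrite /I indicE; case: (_ \in _); rewrite ?normr1 ?normr0.
have lI2 : L1 leb (fun w => I w * derive1 g w ^+ 2) by exact: (@L1_Mbdd _ (measurableTypeR R) R leb 1 I (fun w => derive1 g w ^+ 2) mI I1 g'2).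
have lI : L1 leb I.
  exact: integrable_indic_itv.
have iI : \int[leb]_w I w = v - u.
  rewrite /Rintegral integral_indic// setIT.
  transitivity (fine (v - u)%:E); last by [].
  by congr fine; exact: (lebesgue_measure_itvcc (ltW uv)).
have lI3 : L1 leb (fun w => I w * derive1 g w).
  apply: (@L1_le _ (measurableTypeR R) R leb _ (fun w => I w + I w * derive1 g w ^+ 2)).
  - exact: measurable_funM.
  - exact: L1D.
  - move=> w; rewrite /I indicE; case: (_ \in _); rewrite ?mul1r ?mul0r ?normr0 ?addr0//.
    rewrite -(real_normK (num_real (derive1 g w))) -[true%:R]/(1 : R).
    by have := sqr_ge0 (`|derive1 g w| - 1); have := normr_ge0 (derive1 g w); nra.
have ftc : \int[leb]_w (I w * derive1 g w) = g v - g u.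
  rewrite -[RHS]/(fine ((g v)%:E - (g u)%:E)%E).
  rewrite -(@continuous_FTC2 _ (derive1 g) g _ _ uv); last 3 first.
  - exact: continuous_subspaceT.
  - split.
    + by move=> w _; exact: g_der.
    + by apply: cvg_at_right_filter; exact: g_cont.
    + by apply: cvg_at_left_filter; exact: g_cont.
  - by [].
  rewrite [in RHS]integral_mkcond; congr fine; apply: eq_integral => w _.
  by rewrite /patch /I indicE; case: ifPn => _; rewrite ?mul1r ?mul0r.
have vu0 : 0 < v - u by rewrite subr_gt0.
pose mm := (g v - g u) / (v - u).
have : 0 <= \int[leb]_w (I w * (derive1 g w - mm) ^+ 2).
  by apply: int_ge0 => w; rewrite mulr_ge0 ?sqr_ge0// /I indicE ler0n.
have E w : I w * (derive1 g w - mm) ^+ 2 =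
  I w * derive1 g w ^+ 2 - (2 * mm * (I w * derive1 g w) - mm ^+ 2 * I w) by ring.
have l2 := L1Z (2 * mm) lI3; have l3 := L1Z (mm ^+ 2) lI; have l4 := L1B l2 l3.
rewrite (@int_ext _ _ _ leb _ _ E) (intB lI2 l4) (intB l2 l3) (intZ _ lI3) (intZ _ lI).
rewrite ftc iI; set A := \int[leb]_w _.
have -> : 2 * mm * (g v - g u) - mm ^+ 2 * (v - u) = (g v - g u) ^+ 2 / (v - u).
  by rewrite /mm; field; rewrite gt_eqF.
rewrite subr_ge0 ler_pdivrMr// mulrC.
exact.
Qed.

(** Twice the drop of the covariance is the squared [L2]-modulus of continuity
    of the kernel, which is quadratic because the derivative is in [L2]. *)
Lemma autocorrelation_drop : exists L : R, 0 <= L /\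
  forall z, autocorrelation g 0 - autocorrelation g z <= L * z ^+ 2.
Proof.
have g'2 : L1 leb (fun w => derive1 g w ^+ 2) by case: gC1.
pose L := \int[leb]_w derive1 g w ^+ 2.
have L0 : 0 <= L by apply: int_ge0 => w; exact: sqr_ge0.
suff pos z : 0 <= z -> autocorrelation g 0 - autocorrelation g z <= L * z ^+ 2.
  exists L; split=> // z; have [z0|z0] := leP 0 z; first exact: pos.
  by rewrite -(autocorrelation_sym z) -sqrrN; apply: pos; rewrite oppr_ge0 ltW.
move=> z0.
pose h (yw : R * R) := (\1_(`[yw.1 - z, yw.1]%classic) yw.2 : R) * derive1 g yw.2 ^+ 2.
have mg' : measurable_fun setT (derive1 g) by exact: continuous_measurable_fun.
have hE (yw : R * R) : h yw = \1_([set yw : R * R | 0 <= yw.2 - (yw.1 - z)]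
    `&` [set yw : R * R | 0 <= yw.1 - yw.2]) yw * derive1 g yw.2 ^+ 2.
  rewrite /h !indicE; congr (_%:R * _); congr nat_of_bool; apply/idP/idP.
    rewrite inE/= in_itv/= => /andP[a b]; rewrite inE; split=> /=; rewrite subr_ge0//.
  rewrite inE => -[/=]; rewrite !subr_ge0 => a b.
  by rewrite inE/= in_itv/= a b.
have mh : measurable_fun setT h.
  rewrite (funext hE); apply: measurable_funM; last first.
    by apply: measurable_funX; apply: measurableT_comp.
  apply: measurable_indic; apply: measurableI.
  - rewrite -[X in measurable X]setTI.
    have mm : measurable_fun setT (fun yw : R * R => yw.2 - (yw.1 - z)).
      by apply: measurable_funB => //; apply: measurable_funB.
    have -> : [set yw : R * R | 0 <= yw.2 - (yw.1 - z)] =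
        (fun yw : R * R => yw.2 - (yw.1 - z)) @^-1` `[0, +oo[%classic.
      by apply/seteqP; split=> yw /=; rewrite in_itv/= andbT.
    by apply: mm => //; exact: measurable_itv.
  - rewrite -[X in measurable X]setTI.
    have mm : measurable_fun setT (fun yw : R * R => yw.1 - yw.2).
      by apply: measurable_funB.
    have -> : [set yw : R * R | 0 <= yw.1 - yw.2] =
        (fun yw : R * R => yw.1 - yw.2) @^-1` `[0, +oo[%classic.
      by apply/seteqP; split=> yw /=; rewrite in_itv/= andbT.
    by apply: mm => //; exact: measurable_itv.
have h0 yw : 0 <= h yw by rewrite /h mulr_ge0 ?sqr_ge0.
have g2int : (\int[leb]_w (derive1 g w ^+ 2)%:E = L%:E)%E by rewrite int_EFin.
have tonelli : (\int[leb]_y \int[leb]_w (h (y, w))%:E = (z * L)%:E)%E.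
  have mhE : @measurable_fun _ _ (measurableTypeR R * measurableTypeR R)%type _
      setT (EFin \o h) by exact/measurable_EFinP.
  have /= -> := @fubini_tonelli _ _ (measurableTypeR R) (measurableTypeR R) R leb leb
    (EFin \o h) mhE (fun yw => h0 yw).
  rewrite EFinM -g2int -ge0_integralZl//; last 2 first.
  - by apply/measurable_EFinP; exact: measurable_funX.
  - by move=> w _; rewrite lee_fin sqr_ge0.
  apply: eq_integral => w _; rewrite /h/=.
  under eq_integral do rewrite EFinM.
  rewrite ge0_integralZr//; last 2 first.
  - apply/measurable_EFinP.
    rewrite (_ : (fun y => _) = \1_(`[w, w + z]%classic)); first by exact: measurable_indic.
    apply/funext => y; rewrite !indicE; congr (_%:R); congr nat_of_bool.
    by apply/idP/idP; rewrite !inE/= !in_itv/= => /andP[a b]; apply/andP; split; lra.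
  - by rewrite lee_fin sqr_ge0.
  congr (_ * _)%E.
  have -> : (\int[leb]_y (\1_(`[(y - z)%R, y]) w)%:E =
      \int[leb]_y (\1_(`[w, (w + z)%R]) y)%:E)%E.
    apply: eq_integral => y _; rewrite !indicE; congr (_%:R%:E); congr nat_of_bool.
    by apply/idP/idP; rewrite !inE/= !in_itv/= => /andP[a b]; apply/andP; split; lra.
  have wz : w <= w + z by rewrite lerDl.
  rewrite integral_indic// setIT; transitivity ((w + z - w)%:E).
    exact: (lebesgue_measure_itvcc wz).
  by rewrite addrAC subrr add0r.
have le : 2 * (autocorrelation g 0 - autocorrelation g z) <= z * (z * L).
  have idiff := int_kernel_diff z 0; rewrite subr0 in idiff; rewrite -idiff.
  rewrite -lee_fin -int_EFin; last first.
    by have [] := L2B (kernel_L2 z) (kernel_L2 0).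
  have mhE : @measurable_fun _ _ (measurableTypeR R * measurableTypeR R)%type _
      setT (EFin \o h) by exact/measurable_EFinP.
  have mF := @measurable_fun_fubini_tonelli_F _ _ (measurableTypeR R)
    (measurableTypeR R) R leb (EFin \o h) mhE (fun yw => h0 yw).
  have F0 (y : measurableTypeR R) : setT y -> (0 <= fubini_F leb (EFin \o h) y)%E.
    by move=> _; apply: integral_ge0 => w _; rewrite lee_fin.
  have tz : (\int[leb]_y (z%:E * fubini_F leb (EFin \o h) y) = (z * (z * L))%:E)%E.
    by rewrite ge0_integralZl// EFinM -tonelli.
  rewrite -tz.
  apply: ge0_le_integral => //.
  - by move=> y _; rewrite lee_fin sqr_ge0.
  - apply/measurable_EFinP; have [_ l] := L2B (kernel_L2 z) (kernel_L2 0).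
    exact: L1_measurable l.
  - exact: measurable_funeM.
  - move=> y _; rewrite subr0.
    have yz : y - z <= y by rewrite gerBl.
    have := increment_sqr_le yz; rewrite opprB addrCA subrr addr0 => inc.
    have lhy : L1 leb (fun w => h (y, w)).
      have mI : @measurable_fun _ _ (measurableTypeR R) _ setT
          (fun w : R => \1_(`[y - z, y]%classic) w : R).
        by apply: measurable_indic; exact: measurable_itv.
      apply: (@L1_Mbdd _ (measurableTypeR R) R leb 1 _ (fun w => derive1 g w ^+ 2) mI _ g'2).
      by move=> w; rewrite indicE; case: (_ \in _); rewrite ?normr1 ?normr0.
    have -> : fubini_F leb (EFin \o h) y = (\int[leb]_w h (y, w))%:E.
      by rewrite -int_EFin.
    by rewrite -EFinM lee_fin -sqrrN opprB.
have : 0 <= L * z ^+ 2 by rewrite mulr_ge0 ?sqr_ge0.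
by rewrite expr2; nra.
Qed.

End kernel_covariance.

(** * Stochastic integrals as limits of simple ones *)

Lemma cvg0e_lt (R : realType) (u : nat -> \bar R) (e : R) : 0 < e ->
  u n @[n --> \oo] --> 0%E -> \forall n \near \oo, (u n < e%:E)%E.
Proof.
move=> e0 u0; apply: (u0 [set y | (y < e%:E)%E]).
apply: open_nbhs_nbhs; split; first exact: open_ereal_lt_ereal.
by rewrite /= lte_fin.
Qed.

Section joint_measurability.
Context d (T : measurableType d) (R : realType).

(** Freezing the time at a grid point gives a function that is measurable
    because it has countably many pieces; path continuity passes to the limit. *)
Lemma measurable_joint (f : R -> T -> R) : (forall t, measurable_fun setT (f t)) ->
  (forall w, continuous (f ^~ w)) ->
  measurable_fun setT (fun z : T * R => f z.2 z.1).
Proof.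
move=> mf cf.
pose f_ n (z : T * R) := f ((Num.floor (n.+1%:R * z.2))%:~R / n.+1%:R) z.1.
have n0 n : (0 : R) < n.+1%:R by [].
apply: (@measurable_fun_cvg _ _ _ _ f_) => [n|z _].
  move=> _ B mB; rewrite setTI.
  have -> : f_ n @^-1` B = \bigcup_(k : int)
      ((f (k%:~R / n.+1%:R) @^-1` B) `*` [set t : R | Num.floor (n.+1%:R * t) = k]).
    apply/seteqP; split=> [z /= Bz|z [k _ [/= Bz fz]]].
      by exists (Num.floor (n.+1%:R * z.2)).
    by rewrite /f_ /= fz.
  apply: countable_bigcupT_measurable => [|k]; first exact: countableP.
  apply: measurableX.
    by rewrite -[X in measurable X]setTI; exact: mf.
  have -> : [set t : R | Num.floor (n.+1%:R * t) = k] =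
      `[k%:~R / n.+1%:R, (k + 1)%:~R / n.+1%:R[%classic.
    apply/seteqP; split=> t /=.
      by move=> <-; rewrite in_itv/= ler_pdivrMr// ltr_pdivlMr// mulrC floor_le floorD1_gt.
    rewrite in_itv/= ler_pdivrMr// ltr_pdivlMr// => /andP[a b].
    by apply/floor_def; rewrite mulrC a b.
  exact: measurable_itv.
apply: (@cvg_comp _ _ _ (fun n => (Num.floor (n.+1%:R * z.2))%:~R / n.+1%:R)
  (f ^~ z.1) _ (nbhs z.2)); last exact: cf.
apply/cvgrPdist_lt => e e0; near=> n.
have ne : e^-1 < n.+1%:R.
  by near: n; apply: filterS (nbhs_infty_gtr e^-1) => n /lt_le_trans; apply; rewrite ler_nat.
have a := floor_le (n.+1%:R * z.2); have b := floorD1_gt (n.+1%:R * z.2).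
have a' : (Num.floor (n.+1%:R * z.2))%:~R / n.+1%:R <= z.2.
  by rewrite ler_pdivrMr// [leRHS]mulrC.
rewrite ger0_norm ?subr_ge0//.
rewrite ltrBlDr -(ltr_pM2r (n0 n)) mulrDl divfK ?gt_eqF//.
rewrite intrD -[1%:~R]/(1 : R) in b.
have : 1 < e * n.+1%:R by rewrite mulrC -ltr_pdivrMr// div1r.
by lra.
Unshelve. all: by end_near.
Qed.

End joint_measurability.

Section noise_integrals.
Context d (T : measurableType d) (R : realType) (P : probability T R).
Variables (F : R -> set (set T)) (W : set (R * R) -> T -> R).
Hypotheses (filF : is_filtration F) (wn : is_white_noise P F W).
Variable g : R -> R.
Hypothesis gC1 : C1_square_integrable g.

Local Notation leb := (@lebesgue_measure R).
Local Notation mu3 := (P \x planar R)%E.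
Local Notation mu2 := (P \x leb)%E.
Local Notation c := (autocorrelation g 0).

Implicit Types (x y : R -> T -> R) (s t : R).

Lemma measurable_autocorrelation : measurable_fun setT (autocorrelation g).
Proof.
have mg := measurable_kernel gC1.
pose h (py : R * R) : \bar R := ((g (py.2 - py.1) - g (py.2 - 0)) ^+ 2)%:E.
have mh : @measurable_fun _ _ (R * measurableTypeR R)%type _ setT h.
  apply/measurable_EFinP; apply: measurable_funX; apply: measurable_funB.
    by apply: (measurableT_comp mg); exact: measurable_funB.
  by apply: (measurableT_comp mg); exact: measurable_funB.
have mF := @measurable_fun_fubini_tonelli_F _ _ R (measurableTypeR R) R leb h mh
  (fun z => sqr_ge0 _).
have E p : autocorrelation g p = c - 2^-1 * fine (fubini_F leb h p).
  have := int_kernel_diff gC1 p 0; rewrite subr0 /Rintegral => ->; by field.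
rewrite (funext E); apply: measurable_funB => //; apply: measurable_funM => //.
exact: (measurableT_comp (fine_measurable measurableT) mF).
Qed.

Definition regular x : Prop := (forall t, measurable_fun setT (x t)) /\
  (forall w, continuous (x ^~ w)).

(** The integrand of the equation, on Omega x time x space. *)
Definition kernel_at x (z : T * (R * R)) : R := g (z.2.2 - x z.2.1 z.1).

Lemma measurable_fst_time : measurable_fun setT (fun z : T * (R * R) => (z.1, z.2.1)).
Proof.
apply/measurable_fun_pairP; split; first exact: measurable_fst.
exact: (measurableT_comp measurable_fst measurable_snd).
Qed.

Lemma measurable_kernel_at x : regular x -> measurable_fun setT (kernel_at x).
Proof.
move=> [mx cx]; apply: measurableT_comp; first exact: (measurable_kernel gC1).
apply: measurable_funB; first exact: measurableT_comp.
have := measurable_joint mx cx => mj.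
exact: (measurableT_comp mj measurable_fst_time).
Qed.

Lemma measurable_between s t : measurable_fun setT (between s t : T * (R * R) -> R).
Proof.
apply: (measurableT_comp (measurable_indic _)) => //; exact: measurableT_comp.
Qed.

Lemma between_norm s t (z : T * (R * R)) : `|between s t z| <= 1 :> R.
Proof. by rewrite /between indicE; case: (_ \in _); rewrite ?normr1 ?normr0. Qed.

Lemma between_sqr s t (z : T * (R * R)) : between s t z ^+ 2 = between s t z :> R.
Proof. by rewrite /between indicE; case: (_ \in _); rewrite ?expr1n ?expr0n. Qed.

Lemma ge0_integral_mu3 (h : T * (R * R) -> R) : measurable_fun setT h ->
  (forall z, 0 <= h z) ->
  (\int[mu3]_z (h z)%:E = \int[P]_w \int[leb]_v \int[leb]_y (h (w, (v, y)))%:E)%E.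
Proof.
move=> mh h0.
have mhE : measurable_fun setT (EFin \o h) by exact/measurable_EFinP.
rewrite (@fubini_tonelli1 _ _ T (measurableTypeR R * measurableTypeR R)%type R P
  (planar R) (EFin \o h) mhE (fun z => h0 z)).
apply: eq_integral => w _.
have mw : @measurable_fun _ _ (measurableTypeR R * measurableTypeR R)%type _
    setT (fun vy => (h (w, vy))%:E).
  by apply/measurable_EFinP; apply: (measurableT_comp mh); exact: pair1_measurable.
exact: (@fubini_tonelli1 _ _ (measurableTypeR R) (measurableTypeR R) R leb leb _ mw
  (fun z => h0 _)).
Qed.

Lemma ge0_integral_mu3_between s t (h : T * (R * R) -> R) : measurable_fun setT h ->
  (forall z, 0 <= h z) ->
  (\int[mu3]_z (between s t z * h z)%:E =
   \int[P]_w \int[leb]_(v in `[s, t]) \int[leb]_y (h (w, (v, y)))%:E)%E.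
Proof.
move=> mh h0; rewrite ge0_integral_mu3; last 2 first.
- by apply: measurable_funM => //; exact: measurable_between.
- by move=> z; rewrite mulr_ge0// /between indicE ler0n.
apply: eq_integral => w _.
have mw : @measurable_fun _ _ (measurableTypeR R * measurableTypeR R)%type _
    setT (fun vy => (h (w, vy))%:E).
  by apply/measurable_EFinP; apply: (measurableT_comp mh); exact: pair1_measurable.
have mF := @measurable_fun_fubini_tonelli_F _ _ (measurableTypeR R)
  (measurableTypeR R) R leb _ mw (fun vy => h0 _).
rewrite -integral_itv_obnd_cbnd; last exact: measurable_funTS mF.
rewrite [RHS]integral_mkcond; apply: eq_integral => v _.
rewrite /between/= patchE indicE; case: ifPn => _.
  by under eq_integral do rewrite mul1r.
by under eq_integral do rewrite mul0r; rewrite integral0.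
Qed.

Lemma planar_kernel_at s t x w : s <= t -> regular x ->
  L2 (planar R) (fun vy => between s t (w, vy) * kernel_at x (w, vy)) /\
  (\int[planar R]_vy ((between s t (w, vy) * kernel_at x (w, vy)) ^+ 2)%:E
    = (c * (t - s))%:E)%E.
Proof.
move=> st rx; have mk := measurable_kernel_at rx; have mb := measurable_between s t.
have mw : @measurable_fun _ _ (measurableTypeR R * measurableTypeR R)%type _
    setT (fun vy => between s t (w, vy) * kernel_at x (w, vy)).
  apply: (measurableT_comp (measurable_funM mb mk)); exact: pair1_measurable.
have mw2 : @measurable_fun _ _ (measurableTypeR R * measurableTypeR R)%type _
    setT (fun vy => ((between s t (w, vy) * kernel_at x (w, vy)) ^+ 2)%:E).
  by apply/measurable_EFinP; exact: measurable_funX.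
have I : (\int[planar R]_vy ((between s t (w, vy) * kernel_at x (w, vy)) ^+ 2)%:E
    = (c * (t - s))%:E)%E.
  rewrite (@fubini_tonelli1 _ _ (measurableTypeR R) (measurableTypeR R) R leb leb _ mw2
    (fun z => sqr_ge0 _)).
  transitivity (\int[leb]_(v in `]s, t]) (cst c%:E) v)%E.
    rewrite [RHS]integral_mkcond; apply: eq_integral => v _.
    rewrite /fubini_F /between/= patchE indicE; case: ifPn => _.
      under eq_integral do rewrite mul1r.
      have [_ l2] := kernel_L2 gC1 (x v w).
      by rewrite /kernel_at/= (int_EFin l2) int_kernel_sqr.
    by under eq_integral do rewrite mul0r expr0n; rewrite integral0.
  rewrite integral_cst//; transitivity (c%:E * (t - s)%:E)%E; last by [].
  by congr (_ * _)%E; exact: lebesgue_measure_itvoc.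
split=> //; split=> //.
have le : (\int[planar R]_vy ((between s t (w, vy) * kernel_at x (w, vy)) ^+ 2)%:E
    <= (c * (t - s))%:E)%E by rewrite I.
by have [] := @L1_ge0P _ _ _ (planar R) _ (c * (t - s))
  (measurable_funX 2 mw) (fun z => sqr_ge0 _) le.
Qed.

Lemma int_kernel_at s t x : s <= t -> regular x ->
  L2 mu3 (fun z => between s t z * kernel_at x z) /\
  \int[mu3]_z (between s t z * kernel_at x z) ^+ 2 = c * (t - s).
Proof.
move=> st rx; have mk := measurable_kernel_at rx; have mb := measurable_between s t.
have m2 : measurable_fun setT (fun z => between s t z * kernel_at x z).
  exact: measurable_funM.
have I : (\int[mu3]_z ((between s t z * kernel_at x z) ^+ 2)%:E = (c * (t - s))%:E)%E.
  have m2E : measurable_fun setT (fun z => ((between s t z * kernel_at x z) ^+ 2)%:E).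
    by apply/measurable_EFinP; exact: measurable_funX.
  rewrite (@fubini_tonelli1 _ _ T (measurableTypeR R * measurableTypeR R)%type R P
    (planar R) _ m2E (fun z => sqr_ge0 _)).
  transitivity (\int[P]_w (c * (t - s))%:E)%E; last first.
    by rewrite int_EFin ?int_cst//; exact: L1_cst.
  by apply: eq_integral => w _; exact: (planar_kernel_at w st rx).2.
have [] := @L1_ge0P _ _ _ mu3 (fun z => (between s t z * kernel_at x z) ^+ 2) (c * (t - s)).
- exact: measurable_funX.
- by move=> z; exact: sqr_ge0.
- by rewrite I.
by move=> l _; split; [split|rewrite /Rintegral I].
Qed.

(** Integrating out the space variable produces the covariance. *)
Lemma int_kernel_atM s t x y (phi : T * R -> R) K : s <= t -> regular x -> regular y ->
  measurable_fun setT phi -> (forall u, `|phi u| <= K) ->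
  [/\ L1 mu3 (fun z => phi (z.1, z.2.1) * (between s t z * kernel_at x z * (between s t z * kernel_at y z))),
    L1 mu2 (fun u => phi u * \1_(`]s, t]%classic) u.2 *
      autocorrelation g (x u.2 u.1 - y u.2 u.1)) &
  \int[mu3]_z (phi (z.1, z.2.1) * (between s t z * kernel_at x z * (between s t z * kernel_at y z))) =
  \int[mu2]_u (phi u * \1_(`]s, t]%classic) u.2 *
      autocorrelation g (x u.2 u.1 - y u.2 u.1))].
Proof.
move=> st rx ry mphi phiK.
have [x2 _] := int_kernel_at st rx; have [y2 _] := int_kernel_at st ry.
have mphi3 : measurable_fun setT (fun z : T * (R * R) => phi (z.1, z.2.1)).
  exact: (measurableT_comp mphi measurable_fst_time).
have l3 : L1 mu3 (fun z => phi (z.1, z.2.1) *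
    (between s t z * kernel_at x z * (between s t z * kernel_at y z))).
  apply: (@L1_Mbdd _ _ _ _ K) => //; exact: L2M.
have lw w : (planar R).-integrable setT (fun vy =>
    (phi (w, vy.1) * (between s t (w, vy) * kernel_at x (w, vy) *
      (between s t (w, vy) * kernel_at y (w, vy))))%:E).
  have [x2w _] := planar_kernel_at w st rx; have [y2w _] := planar_kernel_at w st ry.
  apply: (@L1_Mbdd _ (measurableTypeR R * measurableTypeR R)%type R (planar R) K
    (fun vy => phi (w, vy.1))) => //.
    apply: (measurableT_comp mphi).
    by apply/measurable_fun_pairP; split; [exact: measurable_cst|exact: measurable_fst].
  exact: L2M.
have inner w : (\int[planar R]_vy (phi (w, vy.1) * (between s t (w, vy) * kernel_at x (w, vy) *
      (between s t (w, vy) * kernel_at y (w, vy))))%:E =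
   \int[leb]_v (phi (w, v) * \1_(`]s, t]%classic) v *
      autocorrelation g (x v w - y v w))%:E)%E.
  rewrite -(@integral12_prod_meas1 _ _ (measurableTypeR R) (measurableTypeR R) R leb leb _ (lw w)).
  apply: eq_integral => v _; rewrite /fubini_F/= -(int_kernelM gC1 (x v w) (y v w)).2.
  rewrite EFinM -int_EFin; last exact: (int_kernelM gC1 _ _).1.
  rewrite -integralZl//; last exact: (int_kernelM gC1 _ _).1.
  apply: eq_integral => y' _; rewrite -EFinM; congr (_%:E).
  rewrite /between/kernel_at/= indicE; case: (_ \in _).
    by rewrite !mul1r mulr1.
  by rewrite !(mulr0, mul0r).
have mE : measurable_fun setT (fun u : T * R => phi u * \1_(`]s, t]%classic) u.2 *
      autocorrelation g (x u.2 u.1 - y u.2 u.1)).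
  apply: measurable_funM.
    apply: measurable_funM => //.
    exact: (measurableT_comp (measurable_indic (measurable_itv _)) measurable_snd).
  apply: (measurableT_comp measurable_autocorrelation).
  by case: rx ry => mx cx [my cy]; apply: measurable_funB; exact: measurable_joint.
have lI : L1 leb (\1_(`]s, t]%classic) : R -> R) by exact: integrable_indic_itv.
have [lsep _] := int_prod_sep (L1_cst P (K * c)) lI.
have l2 : L1 mu2 (fun u => phi u * \1_(`]s, t]%classic) u.2 *
      autocorrelation g (x u.2 u.1 - y u.2 u.1)).
  apply: (@L1_le _ (T * measurableTypeR R)%type R mu2 _ _ mE lsep) => u.
  rewrite normrM normrM (ger0_norm (_ : 0 <= \1_(_) u.2)); last by rewrite indicE ler0n.
  rewrite mulrAC; apply: ler_wpM2r; first by rewrite indicE ler0n.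
  by rewrite ler_pM//; exact: autocorrelation_le.
split=> //; apply: EFin_inj; rewrite -(int_EFin l3) -(int_EFin l2).
rewrite -(integral12_prod_meas1 l3) -(integral12_prod_meas1 l2).
by apply: eq_integral => w _; rewrite /fubini_F/= inner.
Qed.

End noise_integrals.

Section approximation.
Context d (T : measurableType d) (R : realType) (P : probability T R).
Variables (F : R -> set (set T)) (W : set (R * R) -> T -> R).
Hypotheses (filF : is_filtration F) (wn : is_white_noise P F W).
Variable g : R -> R.
Hypothesis gC1 : C1_square_integrable g.

Local Notation mu3 := (P \x planar R)%E.
Local Notation elem := (elementary (T := T) (R := R)).

Let sF t : 0 <= t -> sigma_algebra setT (F t).
Proof. by case: filF => h _ _; exact: h. Qed.

Let FM t : 0 <= t -> F t `<=` measurable.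
Proof. by case: filF => _ h _; exact: h. Qed.

Lemma simple_L2 n (f : 'I_n -> elem) s t : (forall k, is_predictable F (f k)) ->
  0 <= s -> L2 mu3 (fun z => between s t z * strip_eval f z).
Proof.
move=> pf s0; split.
  by apply: measurable_funM; [exact: measurable_between|exact: (measurable_strip_eval filF)].
have z1 (w : T) : `|cst 1 w : R| <= 1 by rewrite normr1.
have [_ l _] := sint_cov filF wn t pf pf s0 (wrt_cst (sF s0) 1) z1.
by apply: eq_L1 l => z; rewrite exprMn between_sqr mul1r -expr2.
Qed.

Lemma simple_isometry n (f : 'I_n -> elem) n' (f' : 'I_n' -> elem) s t :
  (forall k, is_predictable F (f k)) -> (forall k, is_predictable F (f' k)) ->
  0 <= s -> s <= t ->
  \int[P]_w (sint W f s t w - sint W f' s t w) ^+ 2 =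
  \int[mu3]_z (between s t z * strip_eval f z - between s t z * strip_eval f' z) ^+ 2.
Proof.
move=> pf pf' s0 st.
have z1 (w : T) : `|cst 1 w : R| <= 1 by rewrite normr1.
have cov m (h : 'I_m -> elem) m' (h' : 'I_m' -> elem) (ph : forall k, is_predictable F (h k))
    (ph' : forall k, is_predictable F (h' k)) :
  [/\ L1 P (fun w => sint W h s t w * sint W h' s t w),
      L1 mu3 (fun z => between s t z * strip_eval h z * (between s t z * strip_eval h' z)) &
      \int[P]_w (sint W h s t w * sint W h' s t w) =
      \int[mu3]_z (between s t z * strip_eval h z * (between s t z * strip_eval h' z))].
  have [l1 l3 e] := sint_cov filF wn t ph ph' s0 (wrt_cst (sF s0) 1) z1.
  have E z : 1 * between s t z * (strip_eval h z * strip_eval h' z) =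
      between s t z * strip_eval h z * (between s t z * strip_eval h' z).
    by rewrite mul1r -{1}between_sqr; ring.
  have E1 w : 1 * (sint W h s t w * sint W h' s t w) = sint W h s t w * sint W h' s t w.
    by rewrite mul1r.
  split; [exact: (@eq_L1 _ _ _ P _ _ E1 l1)|exact: (@eq_L1 _ _ _ mu3 _ _ E l3)|].
  by rewrite -(int_ext P E1) -(int_ext mu3 E).
have [a1 a2 a3] := cov _ _ _ _ pf pf; have [b1 b2 b3] := cov _ _ _ _ pf pf'.
have [c1 c2 c3] := cov _ _ _ _ pf' pf'.
have sq (a b : R) : (a - b) ^+ 2 = a * a - 2 * (a * b) + b * b by ring.
rewrite (int_ext P (fun w => sq _ _)) (int_ext mu3 (fun z => sq _ _)).
rewrite (intD (L1B a1 (L1Z 2 b1)) c1) (intB a1 (L1Z 2 b1)) (intZ 2 b1) a3 b3 c3.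
by rewrite (intD (L1B a2 (L1Z 2 b2)) c2) (intB a2 (L1Z 2 b2)) (intZ 2 b2).
Qed.

Lemma sqrD_le (a b : R) : (a + b) ^+ 2 <= 2 * (a ^+ 2 + b ^+ 2).
Proof. by have := sqr_ge0 (a - b); nra. Qed.

(** One simple integrand, chosen for the final time, serves all earlier times:
    by the isometry it is as good at time [v] as the one chosen for [v]. *)
Lemma simple_approximation x a t (kappa : R) : 0 <= t -> 0 < kappa -> regular x ->
  solves_noise_equation P F W g a x ->
  exists n (f : 'I_n -> elem), [/\ forall k, is_predictable F (f k),
    L2 mu3 (fun z => between 0 t z * strip_eval f z - between 0 t z * kernel_at g x z),
    \int[mu3]_z (between 0 t z * strip_eval f z - between 0 t z * kernel_at g x z) ^+ 2
      <= kappa &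
    forall v, 0 <= v -> v <= t -> L2 P (fun w => a + sint W f 0 v w - x v w) /\
      \int[P]_w (a + sint W f 0 v w - x v w) ^+ 2 <= 10 * kappa].
Proof.
move=> t0 k0 rx [ax sx].
have approx v : 0 <= v -> exists n (f : 'I_n -> elem),
  [/\ forall k, is_predictable F (f k),
    L2 mu3 (fun z => between 0 v z * strip_eval f z - between 0 v z * kernel_at g x z),
    \int[mu3]_z (between 0 v z * strip_eval f z - between 0 v z * kernel_at g x z) ^+ 2
      <= kappa,
    L2 P (fun w => a + sint W f 0 v w - x v w) &
    \int[P]_w (a + sint W f 0 v w - x v w) ^+ 2 <= kappa].
  move=> v0; have [N [f [pf c1 c2]]] := sx v v0.
  have [n [n1 n2]] : exists n,
    (\int[P]_w \int[lebesgue_measure]_(s in `[0%R, v]) \int[lebesgue_measure]_y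
         ((simple_eval (f n) s y w - g (y - x s w)) ^+ 2)%:E < kappa%:E)%E /\
    (\int[P]_w ((simple_integral W (f n) v w - (x v w - a)) ^+ 2)%:E < kappa%:E)%E.
    have [n _ h] : \forall n \near \oo,
      (\int[P]_w \int[lebesgue_measure]_(s in `[0%R, v]) \int[lebesgue_measure]_y
         ((simple_eval (f n) s y w - g (y - x s w)) ^+ 2)%:E < kappa%:E)%E /\
      (\int[P]_w ((simple_integral W (f n) v w - (x v w - a)) ^+ 2)%:E < kappa%:E)%E.
      by apply: filterS2 (cvg0e_lt k0 c1) (cvg0e_lt k0 c2) => n.
    by exists n; exact: (h n (leqnn n)).
  exists (N n), (f n); have pfn := pf n.
  pose D z := between 0 v z * strip_eval (f n) z - between 0 v z * kernel_at g x z.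
  have mD : measurable_fun setT D.
    apply: measurable_funB; apply: measurable_funM; try exact: measurable_between.
      exact: (measurable_strip_eval filF).
    exact: (measurable_kernel_at gC1).
  have mD' : measurable_fun setT (fun z => (strip_eval (f n) z - kernel_at g x z) ^+ 2).
    apply: measurable_funX; apply: measurable_funB.
      exact: (measurable_strip_eval filF).
    exact: (measurable_kernel_at gC1).
  have D2 z : D z ^+ 2 = between 0 v z * (strip_eval (f n) z - kernel_at g x z) ^+ 2.
    by rewrite /D -mulrBr exprMn between_sqr.
  have Dle : (\int[mu3]_z (D z ^+ 2)%:E <= kappa%:E)%E.
    under eq_integral do rewrite D2.
    rewrite (ge0_integral_mu3_between _ _ _ mD' (fun z => sqr_ge0 _)).
    exact: ltW.
  have [lD iD] := @L1_ge0P _ _ _ mu3 (fun z => D z ^+ 2) kappa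
    (measurable_funX 2 mD) (fun z => sqr_ge0 _) Dle.
  pose E w := a + sint W (f n) 0 v w - x v w.
  have mx : measurable_fun setT (x v) by exact: wrt_measurable (FM v0) (ax v v0).
  have ms : measurable_fun setT (sint W (f n) 0 v).
    exact: wrt_measurable (FM v0) (sint_wrt filF wn pfn 0 v0).
  have mE : measurable_fun setT E by apply: measurable_funB => //; exact: measurable_funD.
  have Ele : (\int[P]_w (E w ^+ 2)%:E <= kappa%:E)%E.
    apply: le_trans (ltW n2); rewrite le_eqVlt; apply/orP; left; apply/eqP.
    apply: ae_eq_integral => //.
    - by apply/measurable_EFinP; exact: measurable_funX.
    - apply/measurable_EFinP; apply: measurable_funX; apply: measurable_funB.
        apply: measurable_sum => k; have [p0 _ _ _] := pfn k.
        apply: measurable_funM; first exact: (el_coef_measurable filF (pfn k)).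
        apply: (white_noise_measurable wn).
        by have [] := noise_set_el (pfn k) (Num.min (el_end (f n k)) v) p0.
      exact: measurable_funB.
    - have := simple_integralE wn pfn v0; apply: filterS => w ew _ /=.
      by rewrite ew; congr (_ ^+ 2)%:E; rewrite /E; ring.
  have [lE iE] := @L1_ge0P _ _ _ P (fun w => E w ^+ 2) kappa
    (measurable_funX 2 mE) (fun z => sqr_ge0 _) Ele.
  by split=> //; split.
have [n [f [pf f3 i3 fE iE]]] := approx t t0.
exists n, f; split=> // v v0 vt; have [n' [f' [pf' f'3 i'3 f'E i'E]]] := approx v v0.
pose D w := sint W f 0 v w - sint W f' 0 v w.
have lf : L2 P (sint W f 0 v).
  by have [C [_ /(_ 0 v (lexx _) v0)[]]] := sint_bound filF wn pf.
have lf' : L2 P (sint W f' 0 v).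
  by have [C [_ /(_ 0 v (lexx _) v0)[]]] := sint_bound filF wn pf'.
have lD : L2 P D by exact: L2B.
have Eq w : D w + (a + sint W f' 0 v w - x v w) = a + sint W f 0 v w - x v w.
  by rewrite /D; ring.
split; first by apply: eq_L2 Eq _; exact: L2D.
have iD : \int[P]_w D w ^+ 2 <= 4 * kappa.
  rewrite /D (simple_isometry pf pf')//.
  pose A z := between 0 t z * strip_eval f z - between 0 t z * kernel_at g x z.
  pose B z := between 0 v z * strip_eval f' z - between 0 v z * kernel_at g x z.
  have lAB : L1 mu3 (fun z => 2 * (A z ^+ 2 + B z ^+ 2)).
    by apply: L1Z; apply: L1D; [exact: f3.2|exact: f'3.2].
  apply: (@le_trans _ _ (\int[mu3]_z (2 * (A z ^+ 2 + B z ^+ 2)))); last first.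
    rewrite intZ; last by apply: L1D; [exact: f3.2|exact: f'3.2].
    rewrite intD; [|exact: f3.2|exact: f'3.2].
    by rewrite /A /B; lra.
  apply: int_le lAB _.
    by have [] := L2B (simple_L2 v pf (lexx _)) (simple_L2 v pf' (lexx _)).
  move=> z; rewrite /A /B.
  have -> : between 0 v z * strip_eval f z - between 0 v z * strip_eval f' z =
    between 0 v z * (between 0 t z * strip_eval f z - between 0 t z * kernel_at g x z)
    + - (between 0 v z * strip_eval f' z - between 0 v z * kernel_at g x z).
    have bb : between 0 v z * between 0 t z = between 0 v z :> R.
      rewrite /between !indicE; case: (boolP (z.2.1 \in `]0, v]%classic)) => [/set_mem|_].
        rewrite /= in_itv/= => /andP[z0 zv]; rewrite mem_set ?mulr1//=.
        by rewrite in_itv/= z0 (le_trans zv vt).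
      by rewrite mul0r.
    by rewrite mulrBr !mulrA bb; ring.
  apply: (le_trans (sqrD_le _ _)); rewrite exprMn between_sqr sqrrN ler_wpM2l// lerD2r.
  by rewrite ler_piMl ?sqr_ge0// -[leLHS]ger0_norm ?between_norm// /between indicE.
under int_ext do rewrite -Eq.
apply: (@le_trans _ _ (\int[P]_w (2 * (D w ^+ 2 + (a + sint W f' 0 v w - x v w) ^+ 2)))).
  apply: int_le => [||w]; last exact: sqrD_le.
    exact: (L2D lD f'E).2.
  by apply: L1Z; apply: L1D; [exact: lD.2|exact: f'E.2].
rewrite intZ; last by apply: L1D; [exact: lD.2|exact: f'E.2].
by rewrite intD; [lra|exact: lD.2|exact: f'E.2].
Qed.

End approximation.

Lemma autocorrelation_lipschitz (R : realType) (g : R -> R) :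
  C1_square_integrable g -> exists L : R, 0 <= L /\
  forall z z', `|autocorrelation g z - autocorrelation g z'| <= L * `|z - z'|.
Proof.
move=> gC1; have [L [L0 drop]] := autocorrelation_drop gC1.
have c0 := autocorrelation0_ge0 gC1.
exists (2 * L + autocorrelation g 0); split; first by rewrite addr_ge0// mulr_ge0.
move=> z z'; have [->|zz] := eqVneq z z'; first by rewrite !subrr normr0 mulr0.
have d0 : 0 < `|z - z'| by rewrite normr_gt0 subr_eq0.
pose leb := @lebesgue_measure R.
have k2 p := kernel_L2 gC1 p.
have d2 := L2B (k2 z) (k2 z').
have -> : autocorrelation g z - autocorrelation g z' =
    \int[leb]_y ((g (y - z) - g (y - z')) * g (y - 0)).
  have [l1 i1] := int_kernelM gC1 z 0; have [l2 i2] := int_kernelM gC1 z' 0.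
  rewrite !subr0 in i1 i2; rewrite -i1 -i2 -(intB l1 l2).
  by apply: int_ext => y; rewrite mulrBl.
apply: (le_trans (abs_int_le (L2M d2 (k2 0)))).
apply: (le_trans (int_young d0 d2 (k2 0))).
rewrite (int_kernel_sqr gC1) (int_kernel_diff gC1) mulrDl.
rewrite mulrDl [autocorrelation g 0 * _]mulrC lerD2r ler_pdivrMl//.
have := drop (z - z'); rewrite -(real_normK (num_real (z - z'))); nra.
Qed.

Section covariation.
Context d (T : measurableType d) (R : realType) (P : probability T R).
Variables (F : R -> set (set T)) (W : set (R * R) -> T -> R).
Hypotheses (filF : is_filtration F) (wn : is_white_noise P F W).
Variable g : R -> R.
Hypothesis gC1 : C1_square_integrable g.

Local Notation leb := (@lebesgue_measure R).
Local Notation mu3 := (P \x planar R)%E.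
Local Notation mu2 := (P \x leb)%E.
Local Notation r := (autocorrelation g).
Local Notation elem := (elementary (T := T) (R := R)).

Let FM t : 0 <= t -> F t `<=` measurable.
Proof. by case: filF => _ h _; exact: h. Qed.

Lemma int_mu2_le (h : T * R -> R) p q M : p <= q -> measurable_fun setT h ->
  (forall u, 0 <= h u) ->
  (forall v, p < v -> v <= q ->
     L1 P (fun w => h (w, v)) /\ \int[P]_w h (w, v) <= M) ->
  L1 mu2 (fun u => \1_(`]p, q]%classic) u.2 * h u) /\
  \int[mu2]_u (\1_(`]p, q]%classic) u.2 * h u) <= M * (q - p).
Proof.
move=> pq mh h0 hM.
have mI : @measurable_fun _ _ (T * measurableTypeR R)%type _ setT
    (fun u => \1_(`]p, q]%classic) u.2 : R).
  exact: (measurableT_comp (measurable_indic (measurable_itv _)) measurable_snd).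
have m1 : @measurable_fun _ _ (T * measurableTypeR R)%type _ setT
    (fun u => \1_(`]p, q]%classic) u.2 * h u) by exact: measurable_funM.
have n1 (u : T * R) : 0 <= \1_(`]p, q]%classic) u.2 * h u.
  by rewrite mulr_ge0// indicE ler0n.
apply: L1_ge0P => //.
have m1E : @measurable_fun _ _ (T * measurableTypeR R)%type _ setT
    (fun u => (\1_(`]p, q]%classic) u.2 * h u)%:E) by exact/measurable_EFinP.
rewrite (@fubini_tonelli2 _ _ T (measurableTypeR R) R P leb _ m1E (fun u => n1 u)).
apply: (@le_trans _ _ (\int[leb]_(v in `]p, q]) (cst M%:E) v)%E); last first.
  rewrite integral_cst//; apply: (@le_trans _ _ (M%:E * (q - p)%:E)%E) => //.
  rewrite le_eqVlt; apply/orP; left; apply/eqP; congr (_ * _)%E.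
  exact: lebesgue_measure_itvoc.
rewrite [leRHS]integral_mkcond; apply: ge0_le_integral => //.
- by move=> v _; apply: integral_ge0 => w _; rewrite lee_fin.
- have := @measurable_fun_fubini_tonelli_G _ _ T (measurableTypeR R) R P _ m1E (fun u => n1 u).
  exact.
- by apply/measurable_restrict => //; exact: measurable_cst.
- move=> v _; rewrite patchE /fubini_G/=.
  case: (boolP (v \in `]p, q]%classic)) => [vI|vI]; rewrite indicE ?vI ?(negbTE vI).
    have /= := set_mem vI; rewrite in_itv/= => /andP[pv vq].
    under eq_integral do rewrite mul1r.
    by have [l iM] := hM v pv vq; rewrite int_EFin// lee_fin.
  by under eq_integral do rewrite mul0r; rewrite integral0.
Qed.

(** Increments of simple integrals close to [x] and [y] have nearly the
    covariation that the equation prescribes, frozen at the displacement [D]. *)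
Lemma sint_covariation x y n (f : 'I_n -> elem) n' (f' : 'I_n' -> elem) p q
    (phi D : T -> R) K L :
  regular x -> regular y ->
  (forall k, is_predictable F (f k)) -> (forall k, is_predictable F (f' k)) ->
  0 <= p -> p <= q -> measurable_wrt (F p) phi -> (forall w, `|phi w| <= K) ->
  measurable_fun setT D -> 0 <= L -> (forall z z', `|r z - r z'| <= L * `|z - z'|) ->
  L1 mu2 (fun u => \1_(`]p, q]%classic) u.2 * `|x u.2 u.1 - y u.2 u.1 - D u.1|) ->
  L1 P (fun w => phi w * r (D w)) /\
  `|\int[P]_w (phi w * (sint W f p q w * sint W f' p q w))
    - (q - p) * \int[P]_w (phi w * r (D w))| <=
  K * \int[mu3]_z (between p q z *
     `|strip_eval f z * strip_eval f' z - kernel_at g x z * kernel_at g y z|) +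
  K * L * \int[mu2]_u (\1_(`]p, q]%classic) u.2 * `|x u.2 u.1 - y u.2 u.1 - D u.1|).
Proof.
move=> rx ry pf pf' p0 pq mphi phiK mD L0 rL lD.
have mphiT := wrt_measurable (FM p0) mphi.
have [_ l3 ->] := sint_cov filF wn q pf pf' p0 mphi phiK.
have mphi2 : measurable_fun setT (fun u : T * R => phi u.1).
  exact: (measurableT_comp mphiT measurable_fst).
have mphi3 : measurable_fun setT (fun z : T * (R * R) => phi z.1).
  exact: (measurableT_comp mphiT measurable_fst).
have phiK2 (u : T * R) : `|phi u.1| <= K by exact: phiK.
have [k3 k2 k23] := int_kernel_atM P gC1 pq rx ry mphi2 phiK2.
pose G z := between p q z *
     (strip_eval f z * strip_eval f' z - kernel_at g x z * kernel_at g y z).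
have lG : L1 mu3 G.
  have a2 := simple_L2 (P := P) filF wn q pf p0; have b2 := simple_L2 (P := P) filF wn q pf' p0.
  have [c2 _] := int_kernel_at P gC1 pq rx; have [d2 _] := int_kernel_at P gC1 pq ry.
  apply: (@eq_L1 _ _ _ mu3 _ _ _ (L1B (L2M a2 b2) (L2M c2 d2))) => z.
  by rewrite /G -{5}between_sqr; ring.
have EG z : phi z.1 * G z =
  phi z.1 * between p q z * (strip_eval f z * strip_eval f' z) -
  phi z.1 * (between p q z * kernel_at g x z * (between p q z * kernel_at g y z)).
  rewrite /G; have := between_sqr p q z; rewrite expr2.
  move: (between p q z) (kernel_at g x z) (kernel_at g y z) => b u v b2.
  have -> : b * u * (b * v) = b * (u * v) by rewrite -[in RHS]b2; ring.
  by ring.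
have iG : \int[mu3]_z (phi z.1 * G z) =
    \int[mu3]_z (phi z.1 * between p q z * (strip_eval f z * strip_eval f' z)) -
    \int[mu2]_u (phi u.1 * \1_(`]p, q]%classic) u.2 * r (x u.2 u.1 - y u.2 u.1)).
  by rewrite (int_ext mu3 EG) (intB l3 k3) k23.
have mr : measurable_fun setT (fun w => r (D w)).
  exact: (measurableT_comp (measurable_autocorrelation gC1) mD).
have rc z : `|r z| <= r 0 := autocorrelation_le gC1 z.
have lr : L1 P (fun w => phi w * r (D w)).
  by apply: (@L1_bdd _ _ _ _ (K * r 0)) => [|w]; [exact: measurable_funM|rewrite normrM ler_pM].
have lI : L1 leb (\1_(`]p, q]%classic) : R -> R) by exact: integrable_indic_itv.
have [l2 e2] := int_prod_sep lr lI.
have iI : \int[leb]_v (\1_(`]p, q]%classic) v : R) = q - p.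
  rewrite /Rintegral integral_indic// setIT; transitivity (fine (q - p)%:E); last by [].
  by congr fine; exact: lebesgue_measure_itvoc.
split=> //.
have mID : @measurable_fun _ _ (T * measurableTypeR R)%type _ setT
    (fun u => x u.2 u.1 - y u.2 u.1 : R).
  by case: rx ry => mx cx [my cy]; apply: measurable_funB; exact: measurable_joint.
pose H (u : T * R) := \1_(`]p, q]%classic) u.2 * (r (x u.2 u.1 - y u.2 u.1) - r (D u.1)).
have EH u : phi u.1 * H u = phi u.1 * \1_(`]p, q]%classic) u.2 * r (x u.2 u.1 - y u.2 u.1) -
   phi u.1 * r (D u.1) * \1_(`]p, q]%classic) u.2 by rewrite /H; ring.
have iH : \int[mu2]_u (phi u.1 * H u) =
    \int[mu2]_u (phi u.1 * \1_(`]p, q]%classic) u.2 * r (x u.2 u.1 - y u.2 u.1)) -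
    (q - p) * \int[P]_w (phi w * r (D w)).
  by rewrite (int_ext mu2 EH) (intB k2 l2); congr (_ - _); rewrite -iI mulrC; exact: e2.
have lphiH : L1 mu2 (fun u => phi u.1 * H u).
  exact: (@eq_L1 _ _ _ mu2 _ _ (fun u => esym (EH u)) (L1B k2 l2)).
have -> : \int[mu3]_z (phi z.1 * between p q z * (strip_eval f z * strip_eval f' z)) -
    (q - p) * \int[P]_w (phi w * r (D w)) =
    \int[mu3]_z (phi z.1 * G z) + \int[mu2]_u (phi u.1 * H u).
  by rewrite iG iH addrA subrK.
apply: (le_trans (ler_normD _ _)); apply: lerD.
  have lGa : L1 mu3 (fun z => between p q z *
     `|strip_eval f z * strip_eval f' z - kernel_at g x z * kernel_at g y z|).
    apply: (@eq_L1 _ _ _ mu3 _ _ _ (L1_abs lG)) => z.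
    by rewrite /G normrM (ger0_norm (_ : 0 <= between p q z))// /between indicE ler0n.
  rewrite -(intZ K lGa); apply: abs_int_le_bound.
  - exact: (@L1_Mbdd _ _ _ mu3 K (fun z => phi z.1) G mphi3 (fun z => phiK z.1) lG).
  - exact: (@L1Z _ _ _ mu3 _ _ lGa).
  - move=> z; rewrite normrM ler_pM// /G normrM.
    by rewrite (ger0_norm (_ : 0 <= between p q z))// /between indicE ler0n.
rewrite -(intZ (K * L) lD); apply: abs_int_le_bound => //; first exact: (@L1Z _ _ _ mu2 _ _ lD).
move=> u; rewrite normrM -mulrA ler_pM// /H normrM.
rewrite ger0_norm ?indicE ?ler0n// [leRHS]mulrCA ler_wpM2l ?ler0n//.
Qed.

End covariation.

Lemma le_epsilonM (R : realType) (a b D : R) : 0 <= D ->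
  (forall e, 0 < e -> e <= 1 -> a <= b + D * e) -> a <= b.
Proof.
move=> D0 h; apply/ler_addgt0Pr => e e0.
pose e' := Num.min 1 (e / (D + 1)).
have D1 : 0 < D + 1 by lra.
have e'0 : 0 < e' by rewrite lt_min ltr01 divr_gt0.
have e'1 : e' <= 1 by rewrite ge_min lexx.
apply: (le_trans (h e' e'0 e'1)); rewrite lerD2l.
apply: (@le_trans _ _ ((D + 1) * e')); first by rewrite ler_wpM2r ?ltW//; lra.
by rewrite -ler_pdivlMl// mulrC ge_min lexx orbT.
Qed.

Section time_grids.
Context (R : realType) d (T : measurableType d).
Implicit Types s t p q : R.

Lemma between_add p q t (z : T * (R * R)) : p <= q -> q <= t ->
  between p q z + between q t z = between p t z :> R.
Proof.
move=> pq qt; rewrite /between !indicE !mem_setE !in_itv/=.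
have [pz|zp] := ltP p z.2.1; have [zq|qz] := leP z.2.1 q => /=.
- by rewrite (le_trans zq qt) addr0.
- by rewrite add0r.
- by rewrite addr0.
- by have := lt_le_trans qz (le_trans zp pq); rewrite ltxx.
Qed.

Lemma gridpt0 s t N : gridpt s t N 0 = s.
Proof. by rewrite /gridpt mul0r mulr0 addr0. Qed.

Lemma gridptN s t N : (0 < N)%N -> gridpt s t N N = t.
Proof. by move=> N0; rewrite /gridpt divff ?pnatr_eq0 -?lt0n// mulr1 addrC subrK. Qed.

Lemma gridptS s t N k : (0 < N)%N ->
  gridpt s t N k.+1 - gridpt s t N k = (t - s) / N%:R.
Proof.
by move=> N0; rewrite /gridpt -natr1; field; rewrite pnatr_eq0 -lt0n.
Qed.

Lemma gridpt_le s t N k l : s <= t -> (k <= l)%N -> gridpt s t N k <= gridpt s t N l.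
Proof.
move=> st kl; rewrite lerD2l ler_wpM2l ?subr_ge0//.
by rewrite ler_wpM2r ?invr_ge0// ler_nat.
Qed.

Lemma grid_between s t N (z : T * (R * R)) : s <= t -> (0 < N)%N ->
  \sum_(k < N) between (gridpt s t N k) (gridpt s t N k.+1) z = between s t z :> R.
Proof.
move=> st N0.
have h n : (n <= N)%N -> \sum_(k < n) between (gridpt s t N k) (gridpt s t N k.+1) z
    = between s (gridpt s t N n) z :> R.
  elim: n => [_|n IH nN].
    by rewrite big_ord0 gridpt0 /between set_itvoc0 indic0.
  rewrite big_ord_recr/= IH ?(ltnW nN)// between_add//; last exact: gridpt_le.
  by rewrite -[leLHS](gridpt0 s t N) gridpt_le.
by rewrite h// gridptN.
Qed.

End time_grids.

Section ito.
Context d (T : measurableType d) (R : realType) (P : probability T R).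
Variables (F : R -> set (set T)) (W : set (R * R) -> T -> R).
Hypotheses (filF : is_filtration F) (wn : is_white_noise P F W).
Variable g : R -> R.
Hypothesis gC1 : C1_square_integrable g.

Local Notation leb := (@lebesgue_measure R).
Local Notation mu3 := (P \x planar R)%E.
Local Notation mu2 := (P \x leb)%E.
Local Notation r := (autocorrelation g).
Local Notation elem := (elementary (T := T) (R := R)).

Let sF t : 0 <= t -> sigma_algebra setT (F t).
Proof. by case: filF => h _ _; exact: h. Qed.

Let FM t : 0 <= t -> F t `<=` measurable.
Proof. by case: filF => _ h _; exact: h. Qed.

Let Fle s t : 0 <= s -> s <= t -> F s `<=` F t.
Proof. by case: filF => _ _ h; exact: h. Qed.

Variables (m : nat) (a : 'I_m -> R).

Section simple.
Variables (n : 'I_m -> nat) (f : forall i, 'I_(n i) -> elem).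
Arguments f : clear implicits.
Hypothesis pf : forall i k, is_predictable F (f i k).

Arguments pf : clear implicits.

Let I i v w := a i + sint W (f i) 0 v w.

Lemma simple_increment i s t : 0 <= s -> s <= t ->
  {ae P, forall w, sint W (f i) s t w = I i t w - I i s w}.
Proof.
move=> s0 st; have := sint_add wn (pf i) s0 st.
by apply: filterS => w e; rewrite /I e; ring.
Qed.

Lemma simple_measurable i t : 0 <= t -> measurable_fun setT (I i t).
Proof.
move=> t0; apply: measurable_funD => //.
exact: wrt_measurable (FM t0) (sint_wrt filF wn (pf i) 0 t0).
Qed.

Lemma sint_measurable i s t : 0 <= t -> measurable_fun setT (sint W (f i) s t).
Proof. by move=> t0; exact: wrt_measurable (FM t0) (sint_wrt filF wn (pf i) s t0). Qed.

Lemma simple_mart4 : exists C : R, 0 <= C /\ mart4 P F C I.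
Proof.
have /choice[C hC] := fun i => sint_bound filF wn (pf i).
exists (\sum_(i < m) C i); split; first by apply: sumr_ge0 => i _; case: (hC i).
have CC i : C i <= \sum_(i < m) C i.
  by rewrite (bigD1 i)//= lerDl sumr_ge0// => j _; case: (hC j).
have mI i s t : 0 <= s -> s <= t -> measurable_fun setT (fun w => I i t w - I i s w).
  move=> s0 st; apply: measurable_funB; apply: simple_measurable => //.
  exact: le_trans st.
split.
- by move=> i t t0; apply: wrtD; [exact: sF|exact: wrt_cst (sF t0) _|exact: (sint_wrt filF wn (pf i))].
- move=> i s t s0 st; have [[_ l] _ _] := (hC i).2 s t s0 st; split; first exact: mI.
  apply: ae_eq_L1 l; first by apply: measurable_funX; exact: mI.
  by have := simple_increment i s0 st; apply: filterS => w ->.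
- move=> i s t s0 st; have [_ l _] := (hC i).2 s t s0 st.
  apply: ae_eq_L1 l; first by apply: measurable_funX; exact: mI.
  by have := simple_increment i s0 st; apply: filterS => w ->.
- move=> i s t s0 st; have [_ _ l] := (hC i).2 s t s0 st.
  apply: le_trans (ler_wpM2r (sqr_ge0 _) (CC i)); apply: le_trans l.
  rewrite le_eqVlt; apply/orP; left; apply/eqP; apply: ae_eq_int.
  + by apply: measurable_funX; exact: mI.
  + by apply: measurable_funX; apply: sint_measurable; exact: le_trans st.
  + by have := simple_increment i s0 st; apply: filterS => w ->.
- move=> i s t zeta K s0 st mz zK; have [_ e] := sint_mean filF wn (pf i) t s0 mz zK.
  have mzT := wrt_measurable (FM s0) mz.
  rewrite -e; apply: ae_eq_int.
  + by apply: measurable_funM => //; exact: mI.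
  + by apply: measurable_funM => //; apply: sint_measurable; exact: le_trans st.
  + by have := simple_increment i s0 st; apply: filterS => w ->.
Qed.

Variables (x : 'I_m -> R -> T -> R) (t0 e C' CU L eta : R).
Hypotheses (rx : forall i, regular (x i)) (e0 : 0 <= e) (CU0 : 0 <= CU) (L0 : 0 <= L).
Hypothesis rL : forall z z', `|r z - r z'| <= L * `|z - z'|.
Hypothesis xI : forall i v, 0 <= v -> v <= t0 ->
  L2 P (fun w => I i v w - x i v w) /\ \int[P]_w `|I i v w - x i v w| <= 4 * e.
Hypothesis hC' : forall s t, 0 <= s -> s <= t ->
  [/\ measurable_fun setT (fun w => psize (t - s) (increment I s t w)),
      L1 P (fun w => psize (t - s) (increment I s t w) ^+ 3) &
      \int[P]_w psize (t - s) (increment I s t w) ^+ 3 <=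
        C' * ((t - s) * Num.sqrt (t - s))].

Lemma simple_increment_le i s t : 0 <= s -> s <= t ->
  L1 P (fun w => I i t w - I i s w) /\
  \int[P]_w `|I i t w - I i s w| <= (C' + 1) * Num.sqrt (t - s).
Proof.
move=> s0 st; have [C [_ mI]] := simple_mart4; have [mp l3 i3] := hC' s0 st.
have l1 := L2_L1 (mart4_L2 mI i s0 st); split=> //.
have [st'|] := ltP s t; last first.
  move=> ts; have -> : t = s by apply/eqP; rewrite eq_le st ts.
  rewrite subrr sqrtr0 mulr0 le_eqVlt; apply/orP; left; apply/eqP.
  by rewrite -[RHS](int0 P); apply: int_ext => w; rewrite subrr normr0.
set D := t - s; set q := Num.sqrt D.
have D0 : 0 < D by rewrite subr_gt0.
have q0 : 0 < q by rewrite sqrtr_gt0.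
have qq : q ^+ 2 = D by rewrite sqr_sqrtr// ltW.
have le w : `|I i t w - I i s w| <= D^-1 * psize D (increment I s t w) ^+ 3 + q.
  apply: (@le_trans _ _ (psize D (increment I s t w))).
    rewrite /psize (bigD1 i)//= addrCA lerDl addr_ge0// sumr_ge0//.
  have := psize_ge0 D (increment I s t w); move: (psize _ _) => p p0.
  have [pq|qp] := leP p q.
    by rewrite (le_trans pq)// lerDr mulr_ge0 ?invr_ge0 ?exprn_ge0// ltW.
  rewrite -[leLHS]addr0 lerD ?(ltW q0)// ler_pdivlMl// -qq.
  by rewrite mulrC exprSr -expr2 ler_wpM2l// lerXn2r ?nnegrE// ltW.
have lq : L1 P (fun w => D^-1 * psize D (increment I s t w) ^+ 3 + q).
  by apply: L1D; [exact: L1Z|exact: L1_cst].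
apply: (le_trans (int_le (L1_abs l1) lq le)).
rewrite intD; [|exact: L1Z|exact: L1_cst].
rewrite intZ// int_cst mulrDl mul1r lerD2r ler_pdivrMl//.
by rewrite mulrCA -/q.
Qed.

(** Over a short step the second-order terms reproduce the generator, frozen
    at the start of the step, up to the errors of the approximation. *)
Lemma second_order_cell be ga p q zeta K : 0 <= p -> p <= q -> q <= t0 ->
  (forall i j, borel_vec (be i j p)) -> borel_vec (ga p) ->
  (forall i j z, `|be i j p z| <= CU) -> (forall z, `|ga p z| <= CU) ->
  (forall z : 'I_m -> R, `|\sum_(i < m) \sum_(j < m) be i j p z * r (z i - z j) + ga p z| <= eta) ->
  measurable_wrt (F p) zeta -> (forall w, `|zeta w| <= K) ->
  (C' + 1) * Num.sqrt (q - p) <= e ->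
  `|second_order P I be ga p q zeta| <=
    K * CU * \sum_(i < m) \sum_(j < m) \int[mu3]_z (between p q z *
      `|strip_eval (f i) z * strip_eval (f j) z - kernel_at g (x i) z * kernel_at g (x j) z|)
    + (K * CU * L * (10 * e) * m%:R ^+ 2 + K * eta) * (q - p).
Proof.
move=> p0 pq qt bbe bga beC gaC qeta mz zK small.
have [C [C0 mI]] := simple_mart4.
have q0 := le_trans p0 pq; have qp0 : 0 <= q - p by rewrite subr_ge0.
have K0 : 0 <= K := le_trans (normr_ge0 _) (zK point).
have mzT := wrt_measurable (FM p0) mz.
pose at_ (h : ('I_m -> R) -> R) w := h (fun i => I i p w).
have wrt_at h : borel_vec h -> measurable_wrt (F p) (at_ h).
  by move=> bh; exact: (at_wrt filF mI).
pose phi i j w := zeta w * at_ (be i j p) w.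
have wphi i j : measurable_wrt (F p) (phi i j).
  by apply: wrtM => //; [exact: sF|exact: wrt_at].
have phiK i j w : `|phi i j w| <= K * CU by rewrite normrM ler_pM//; exact: beC.
pose D i j w := I i p w - I j p w.
have mIp i := simple_measurable i p0.
have mD i j : measurable_fun setT (D i j) by exact: measurable_funB.
have e1 i v : p < v -> v <= q ->
    L1 P (fun w => x i v w - I i p w) /\ \int[P]_w `|x i v w - I i p w| <= 5 * e.
  move=> pv vq; have v0 := le_trans p0 (ltW pv).
  have [l2 h2] := xI i v0 (le_trans vq qt); have [l3 h3] := simple_increment_le i p0 (ltW pv).
  have l2' := L2_L1 l2.
  have E w : (I i v w - I i p w) - (I i v w - x i v w) = x i v w - I i p w by ring.
  have l4 : L1 P (fun w => x i v w - I i p w).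
    exact: (@eq_L1 _ _ _ P _ _ E (L1B l3 l2')).
  split=> //; have l5 := L1D (L1_abs l3) (L1_abs l2').
  apply: (@le_trans _ _ (\int[P]_w (`|I i v w - I i p w| + `|I i v w - x i v w|))).
    by apply: (int_le (L1_abs l4) l5) => w; rewrite -E ler_normB.
  rewrite (intD (L1_abs l3) (L1_abs l2')).
  have : Num.sqrt (v - p) <= Num.sqrt (q - p) by rewrite ler_wsqrtr// lerD2r.
  have D0 : 0 <= C' + 1.
    have [_ _ h1] := hC' (lexx 0) (ler01).
    have : 0 <= \int[P]_w psize (1 - 0) (increment I 0 1 w) ^+ 3.
      by apply: int_ge0 => w; rewrite exprn_ge0// psize_ge0.
    by move=> /le_trans/(_ h1); rewrite subr0 sqrtr1 !mulr1; lra.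
  move=> /(ler_wpM2l D0)/le_trans/(_ small) h5.
  by apply: (le_trans (lerD (le_trans h3 h5) h2)); lra.
have lD i j : L1 mu2 (fun u => \1_(`]p, q]%classic) u.2 * `|x i u.2 u.1 - x j u.2 u.1 - D i j u.1|) /\
   \int[mu2]_u (\1_(`]p, q]%classic) u.2 * `|x i u.2 u.1 - x j u.2 u.1 - D i j u.1|) <= 10 * e * (q - p).
  apply: (@int_mu2_le _ _ _ P (fun u => `|x i u.2 u.1 - x j u.2 u.1 - D i j u.1|)) => //.
    apply: measurableT_comp => //; apply: measurable_funB.
      by have [mi ci] := rx i; have [mj cj] := rx j; apply: measurable_funB; exact: measurable_joint.
    exact: (measurableT_comp (mD i j) measurable_fst).
  move=> v pv vq /=; have [li hi] := e1 i v pv vq; have [lj hj] := e1 j v pv vq.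
  have E w : (x i v w - I i p w) - (x j v w - I j p w) = x i v w - x j v w - D i j w.
    by rewrite /D; ring.
  have l4 : L1 P (fun w => x i v w - x j v w - D i j w).
    exact: (@eq_L1 _ _ _ P _ _ E (L1B li lj)).
  split; first exact: L1_abs l4.
  have l5 := L1D (L1_abs li) (L1_abs lj).
  apply: (@le_trans _ _ (\int[P]_w (`|x i v w - I i p w| + `|x j v w - I j p w|))).
    by apply: (int_le (L1_abs l4) l5) => w; rewrite -E ler_normB.
  rewrite (intD (L1_abs li) (L1_abs lj)); lra.
pose Gint i j := \int[mu3]_z (between p q z *
      `|strip_eval (f i) z * strip_eval (f j) z - kernel_at g (x i) z * kernel_at g (x j) z|).
have cov i j : L1 P (fun w => phi i j w * r (D i j w)) /\
  `|\int[P]_w (phi i j w * ((I i q w - I i p w) * (I j q w - I j p w)))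
    - (q - p) * \int[P]_w (phi i j w * r (D i j w))| <=
  K * CU * Gint i j + K * CU * L * (10 * e) * (q - p).
  have [l1 h1] := sint_covariation filF wn gC1 (rx i) (rx j) (pf i) (pf j) p0 pq
    (wphi i j) (phiK i j) (mD i j) L0 rL (lD i j).1.
  split=> //.
  have -> : \int[P]_w (phi i j w * ((I i q w - I i p w) * (I j q w - I j p w))) =
    \int[P]_w (phi i j w * (sint W (f i) p q w * sint W (f j) p q w)).
    have mphi := wrt_measurable (FM p0) (wphi i j).
    apply: ae_eq_int.
    - apply: measurable_funM => //; apply: measurable_funM; apply: measurable_funB => //;
      exact: simple_measurable.
    - by apply: measurable_funM => //; apply: measurable_funM; exact: sint_measurable.
    - have := simple_increment i p0 pq; have := simple_increment j p0 pq.
      by apply: filterS2 => w -> ->.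
  apply: (le_trans h1); rewrite lerD2l -!mulrA; do 3 apply: ler_wpM2l => //.
  by rewrite mulrA; exact: (lD i j).2.
have wg : measurable_wrt (F p) (fun w => zeta w * at_ (ga p) w).
  by apply: wrtM => //; [exact: sF|exact: wrt_at].
have lg : L1 P (fun w => zeta w * at_ (ga p) w).
  apply: (@L1_bdd _ _ _ _ (K * CU)); first exact: wrt_measurable (FM p0) wg.
  by move=> w; rewrite normrM ler_pM//; exact: gaC.
have Q : `|\sum_(i < m) \sum_(j < m) \int[P]_w (phi i j w * r (D i j w)) +
    \int[P]_w (zeta w * at_ (ga p) w)| <= K * eta.
  have E w : \sum_(i < m) \sum_(j < m) phi i j w * r (D i j w) + zeta w * at_ (ga p) w =
      zeta w * (\sum_(i < m) \sum_(j < m) at_ (be i j p) w * r (I i p w - I j p w) + at_ (ga p) w).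
    rewrite mulrDr mulr_sumr; congr (_ + _); apply: eq_bigr => i _.
    by rewrite mulr_sumr; apply: eq_bigr => j _; rewrite /phi mulrA.
  have ls : L1 P (fun w => \sum_(i < m) \sum_(j < m) phi i j w * r (D i j w)).
    by apply: L1_sum => i _; apply: L1_sum => j _; exact: (cov i j).1.
  have -> : \sum_(i < m) \sum_(j < m) \int[P]_w (phi i j w * r (D i j w)) +
    \int[P]_w (zeta w * at_ (ga p) w) =
    \int[P]_w (\sum_(i < m) \sum_(j < m) phi i j w * r (D i j w) + zeta w * at_ (ga p) w).
    rewrite intD// int_sum => [|i _]; last by apply: L1_sum => j _; exact: (cov i j).1.
    congr (_ + _); apply: eq_bigr => i _; rewrite int_sum// => j _; exact: (cov i j).1.
  apply: int_bdd; first exact: L1_measurable (L1D ls lg).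
  by move=> w; rewrite E normrM ler_pM//; exact: qeta.
have -> : second_order P I be ga p q zeta =
  \sum_(i < m) \sum_(j < m) (\int[P]_w (phi i j w * ((I i q w - I i p w) * (I j q w - I j p w)))
    - (q - p) * \int[P]_w (phi i j w * r (D i j w))) +
  (q - p) * (\sum_(i < m) \sum_(j < m) \int[P]_w (phi i j w * r (D i j w)) +
    \int[P]_w (zeta w * at_ (ga p) w)).
  rewrite /second_order mulrDr addrA; congr (_ + _); rewrite mulr_sumr -big_split/=.
  apply: eq_bigr => i _; rewrite mulr_sumr -big_split/=.
  by apply: eq_bigr => j _; rewrite subrK.
apply: (le_trans (ler_normD _ _)); rewrite [(_ + K * eta) * _]mulrDl addrA; apply: lerD; last first.
  by rewrite normrM ger0_norm// mulrC ler_wpM2r.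
apply: (le_trans (ler_norm_sum _ _ _)).
apply: (@le_trans _ _ (\sum_(i < m) \sum_(j < m)
   (K * CU * Gint i j + K * CU * L * (10 * e) * (q - p)))).
  apply: ler_sum => i _; apply: (le_trans (ler_norm_sum _ _ _)).
  by apply: ler_sum => j _; exact: (cov i j).2.
under eq_bigr => i _ do rewrite big_split/= sumr_const card_ord -mulr_sumr.
rewrite big_split/= -mulr_sumr sumr_const card_ord lerD2l -mulrnA -[_ *+ (m * m)]mulr_natr natrM expr2.
by rewrite le_eqVlt; apply/orP; left; apply/eqP; ring.
Qed.

End simple.

Variables (x : 'I_m -> R -> T -> R) (CU CL eta t0 : R).
Hypotheses (rx : forall i, regular (x i)) (CL0 : 0 <= CL)
  (sx : forall i, solves_noise_equation P F W g (a i) (x i)).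
Variables (U : R -> ('I_m -> R) -> R) (al : 'I_m -> R -> ('I_m -> R) -> R)
  (be : 'I_m -> 'I_m -> R -> ('I_m -> R) -> R) (ga : R -> ('I_m -> R) -> R).
Hypotheses (eU : expansion t0 CU U al be ga)
  (LU : forall v z z', 0 <= v -> v <= t0 ->
     `|U v z - U v z'| <= CL * \sum_(i < m) `|z i - z' i|)
  (qeta : forall v (z : 'I_m -> R), 0 <= v -> v <= t0 ->
     `|\sum_(i < m) \sum_(j < m) be i j v z * r (z i - z j) + ga v z| <= eta).

(** Ito's formula in the mean, with the drift under control. Simple integrands
    replace the kernel because their integrals have fourth moments; the error
    of this replacement is of order [e] and disappears in the limit. *)
Theorem ito_bound s t zeta K : 0 <= s -> s <= t -> t <= t0 ->
  measurable_wrt (F s) zeta -> (forall w, `|zeta w| <= K) ->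
  L1 P (fun w => zeta w * (U t (fun i => x i t w) - U s (fun i => x i s w))) /\
  `|\int[P]_w (zeta w * (U t (fun i => x i t w) - U s (fun i => x i s w)))|
    <= K * eta * (t - s).
Proof.
move=> s0 st tt0 mz zK; have t_0 := le_trans s0 st.
have K0 : 0 <= K := le_trans (normr_ge0 _) (zK point).
have CU0 : 0 <= CU.
  have := exp_ga_bound eU (fun=> 0) t_0 tt0; exact: le_trans.
have c0 := autocorrelation0_ge0 gC1; have ts0 : 0 <= t - s by rewrite subr_ge0.
have [L [L0 rL]] := autocorrelation_lipschitz gC1.
have mzT := wrt_measurable (FM s0) mz.
pose c := r 0; pose M := m%:R : R.
pose Delta w := zeta w * (U t (fun i => x i t w) - U s (fun i => x i s w)).
have mDelta : measurable_fun setT Delta.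
  apply: measurable_funM => //; apply: measurable_funB.
    apply: wrt_measurable (FM t_0) _; apply: (exp_U_borel eU); first exact: sF.
    by move=> i; have [ax _] := sx i; exact: ax.
  apply: wrt_measurable (FM s0) _; apply: (exp_U_borel eU); first exact: sF.
  by move=> i; have [ax _] := sx i; exact: ax.
pose D1 := K * CU * (M ^+ 2 * (4 + 2 * (c * t))) + K * CU * L * 10 * M ^+ 2 * (t - s) + 1
  + K * (CL * (M * 8)).
have main e : 0 < e -> e <= 1 -> L1 P Delta /\
    `|\int[P]_w Delta w| <= K * eta * (t - s) + D1 * e.
  move=> e0 e1; have e20 : 0 < e ^+ 2 by exact: exprn_gt0.
  have /choice[nf hf] : forall i, exists nf : {n & 'I_n -> elem},
    let f := projT2 nf in [/\ forall k, is_predictable F (f k),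
    L2 mu3 (fun z => between 0 t z * strip_eval f z - between 0 t z * kernel_at g (x i) z),
    \int[mu3]_z (between 0 t z * strip_eval f z - between 0 t z * kernel_at g (x i) z) ^+ 2
      <= e ^+ 2 &
    forall v, 0 <= v -> v <= t -> L2 P (fun w => a i + sint W f 0 v w - x i v w) /\
      \int[P]_w (a i + sint W f 0 v w - x i v w) ^+ 2 <= 10 * e ^+ 2].
    move=> i; have [n [f hf]] := simple_approximation filF wn gC1 t_0 e20 (rx i) (sx i).
    by exists (existT _ n f).
  pose f i := projT2 (nf i).
  pose I i v w := a i + sint W (f i) 0 v w.
  have pf i k : is_predictable F (f i k) by have [h _ _ _] := hf i; exact: h.
  have xI i v : 0 <= v -> v <= t ->
      L2 P (fun w => I i v w - x i v w) /\ \int[P]_w `|I i v w - x i v w| <= 4 * e.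
    move=> v0 vt; have [_ _ _ /(_ v v0 vt)[l2 h2]] := hf i; split=> //.
    rewrite -(ler_pXn2r (isT : (0 < 2)%N)) ?nnegrE ?mulr_ge0 ?(ltW e0)//; last exact: int_ge0.
    apply: (le_trans (sqr_int_abs_le l2)); apply: (le_trans h2).
    by rewrite exprMn ler_wpM2r ?(ltW e20)//; lra.
  have [C [C0 mI]] := simple_mart4 pf.
  have [C' [C'0 hC']] := psize_moment C0 mI.
  pose B := K * CU * C' * (t - s) + (C' + 1).
  have B0 : 0 <= B by rewrite !addr_ge0// !mulr_ge0.
  pose N := (Num.truncn ((t - s) * (B / e) ^+ 2)).+1.
  have Ne : B * Num.sqrt ((t - s) / N%:R) <= e.
    have NR : (t - s) * (B / e) ^+ 2 <= N%:R by rewrite ltW// truncnS_gt.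
    rewrite -(ler_pXn2r (isT : (0 < 2)%N)) ?nnegrE ?mulr_ge0 ?(ltW e0)//.
    rewrite exprMn sqr_sqrtr ?divr_ge0// mulrA ler_pdivrMr//.
    move: NR; rewrite exprMn exprVn mulrA ler_pdivrMr// => NR.
    by rewrite mulrC [leRHS]mulrC.
  have N0 : (0 < N)%N by [].
  have small k : (C' + 1) * Num.sqrt (gridpt s t N k.+1 - gridpt s t N k) <= e.
    rewrite gridptS//; apply: le_trans Ne; apply: ler_wpM2r => //.
    by rewrite /B lerDr !mulr_ge0.
  have [lI tI] := taylor_grid filF mI CU0 eU hC' s0 st tt0 N0 mz zK.
  pose G i j z := `|strip_eval (f i) z * strip_eval (f j) z
                    - kernel_at g (x i) z * kernel_at g (x j) z|.
  pose A i z := between 0 t z * strip_eval (f i) z - between 0 t z * kernel_at g (x i) z.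
  pose k i z := between 0 t z * kernel_at g (x i) z.
  have A2 i : L2 mu3 (A i) /\ \int[mu3]_z A i z ^+ 2 <= e ^+ 2 by have [_ h1 h2 _] := hf i.
  have k2 i : L2 mu3 (k i) /\ \int[mu3]_z k i z ^+ 2 = c * t.
    by have := int_kernel_at P gC1 t_0 (rx i); rewrite subr0.
  have GE i j z : between 0 t z * G i j z = `|A i z * A j z + A i z * k j z + k i z * A j z|.
    rewrite -[between 0 t z in LHS]ger0_norm; last by rewrite /between indicE.
    rewrite -normrM; congr `|_|; rewrite /A /k.
    have := between_sqr 0 t z; rewrite expr2; move: (between 0 t z) => b b2.
    move: (strip_eval _ _) (strip_eval _ _) (kernel_at _ _ _) (kernel_at _ _ _) => u1 u2 u3 u4.
    transitivity (b * b * (u2 * u1 - u4 * u3)); first by rewrite b2.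
    by ring.
  have lG i j p q : 0 <= p -> q <= t -> L1 mu3 (fun z => between p q z * G i j z).
    move=> p0 qt.
    have lt : L1 mu3 (fun z => between 0 t z * G i j z).
      apply: (@eq_L1 _ _ _ mu3 _ _ (fun z => esym (GE i j z))); apply: L1_abs.
      apply: L1D; first apply: L1D; apply: L2M; by [exact: (A2 _).1|exact: (k2 _).1].
    apply: (@eq_L1 _ _ _ mu3 (fun z => between p q z * (between 0 t z * G i j z))).
      move=> z; rewrite mulrA; congr (_ * _).
      rewrite /between !indicE !mem_setE !in_itv/=.
      have [pz|zp] := ltP p z.2.1; last by rewrite mul0r.
      have [zq|qz] := leP z.2.1 q; last by rewrite mul0r.
      by rewrite (le_lt_trans p0 pz) (le_trans zq qt) mulr1.
    exact: (@L1_Mbdd _ _ _ mu3 1 _ _ (@measurable_between _ _ _ p q) (@between_norm _ _ _ p q) lt).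
  have iG i j : \int[mu3]_z (between s t z * G i j z) <= (4 + 2 * (c * t)) * e.
    have [[li hi] [lj hj]] := (A2 i, A2 j); have [[li' hi'] [lj' hj']] := (k2 i, k2 j).
    have l1 := L1_abs (L2M li lj); have l2 := L1_abs (L2M li lj'); have l3 := L1_abs (L2M li' lj).
    apply: (@le_trans _ _ (\int[mu3]_z (`|A i z * A j z| + `|A i z * k j z| + `|k i z * A j z|))).
      apply: (int_le (lG i j s t s0 (lexx t)) (L1D (L1D l1 l2) l3)) => z.
      apply: (@le_trans _ _ (between 0 t z * G i j z)).
        apply: ler_wpM2r; first exact: normr_ge0.
        rewrite /between !indicE !mem_setE !in_itv/=.
        have [sz|zs] := ltP s z.2.1; last by rewrite ler0n.
        by rewrite (le_lt_trans s0 sz).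
      rewrite GE; apply: (le_trans (ler_normD _ _)); rewrite lerD2r; exact: ler_normD.
    rewrite (intD (L1D l1 l2) l3) (intD l1 l2).
    have h1 := int_young ltr01 li lj; have h2 := int_young e0 li lj'; have h3 := int_young e0 lj li'.
    have E3 : \int[mu3]_z `|k i z * A j z| = \int[mu3]_z `|A j z * k i z|.
      by apply: (@int_ext _ _ _ mu3) => z; rewrite mulrC.
    rewrite invr1 !mul1r in h1; rewrite hj' in h2; rewrite hi' in h3.
    have ee (u : R) : u <= e ^+ 2 -> e^-1 * u <= e.
      by move=> ue; rewrite ler_pdivrMl// -expr2.
    have e2e : e ^+ 2 <= e by rewrite expr2 ler_piMl// ltW.
    have ei := ee _ hi; have ej := ee _ hj.
    have h1' : \int[mu3]_z `|A i z * A j z| <= e + e.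
      by apply: (le_trans h1); apply: lerD; [exact: le_trans hi e2e|exact: le_trans hj e2e].
    have h2' := le_trans h2 (lerD ei (lexx _)); have h3' := le_trans h3 (lerD ej (lexx _)).
    rewrite E3; apply: (le_trans (lerD (lerD h1' h2') h3')).
    by rewrite le_eqVlt; apply/orP; left; apply/eqP; ring.
  have cells : `|\sum_(k < N) second_order P I be ga (gridpt s t N k) (gridpt s t N k.+1) zeta|
      <= K * CU * (M ^+ 2 * ((4 + 2 * (c * t)) * e)) +
         (K * CU * L * (10 * e) * M ^+ 2 + K * eta) * (t - s).
    have cell (l : 'I_N) : `|second_order P I be ga (gridpt s t N l) (gridpt s t N l.+1) zeta| <=
        K * CU * \sum_(i < m) \sum_(j < m)
          \int[mu3]_z (between (gridpt s t N l) (gridpt s t N l.+1) z * G i j z) +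
        (K * CU * L * (10 * e) * M ^+ 2 + K * eta) * ((t - s) / N%:R).
      have sl : s <= gridpt s t N l by rewrite -[leLHS](gridpt0 s t N) gridpt_le.
      have kt : gridpt s t N l.+1 <= t by rewrite -[leRHS](gridptN s t N0) gridpt_le.
      have kk : gridpt s t N l <= gridpt s t N l.+1 by rewrite gridpt_le.
      have k0 := le_trans s0 sl; have kt0 := le_trans (le_trans kk kt) tt0.
      rewrite -(gridptS s t l N0); apply: (second_order_cell pf rx CU0 L0 rL xI hC' k0 kk kt).
      - by move=> i j; exact: (exp_be_borel eU).
      - exact: (exp_ga_borel eU).
      - by move=> i j z; exact: (exp_be_bound eU).
      - by move=> z; exact: (exp_ga_bound eU).
      - by move=> z; exact: qeta.
      - exact: wrt_sub (Fle s0 sl) mz.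
      - exact: zK.
      - exact: small.
    apply: (le_trans (ler_norm_sum _ _ _)); apply: (le_trans (ler_sum _ (fun k _ => cell k))).
    rewrite big_split/= sumr_const card_ord -[_ *+ N]mulr_natr; apply: lerD; last first.
      by rewrite -[leLHS]mulrA divfK ?pnatr_eq0.
    rewrite -mulr_sumr; apply: ler_wpM2l; first exact: mulr_ge0.
    rewrite exchange_big/=; under eq_bigr => i _ do rewrite exchange_big/=.
    have -> : M ^+ 2 * ((4 + 2 * (c * t)) * e) =
        \sum_(i < m) \sum_(j < m) (4 + 2 * (c * t)) * e.
      by rewrite !sumr_const card_ord -mulrnA -[RHS]mulr_natl natrM expr2.
    apply: ler_sum => i _; apply: ler_sum => j _; apply: le_trans (iG i j).
    rewrite -(@int_sum _ _ _ mu3) => [|l _]; last first.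
      apply: lG; first by apply: (le_trans s0); rewrite -[leLHS](gridpt0 s t N) gridpt_le.
      by rewrite -[leRHS](gridptN s t N0) gridpt_le.
    rewrite le_eqVlt; apply/orP; left; apply/eqP; apply: (@int_ext _ _ _ mu3) => z.
    by rewrite -mulr_suml grid_between.
  pose DI w := zeta w * (U t (fun i => I i t w) - U s (fun i => I i s w)).
  have lEt v : 0 <= v -> v <= t -> L1 P (fun w => \sum_(i < m) `|I i v w - x i v w|) /\
      \int[P]_w \sum_(i < m) `|I i v w - x i v w| <= M * (4 * e).
    move=> v0 vt; have l i : L1 P (fun w => `|I i v w - x i v w|).
      exact: L1_abs (L2_L1 (xI i v v0 vt).1).
    split; first by apply: L1_sum => i _; exact: l.
    rewrite int_sum => [|i _]; last exact: l.
    have -> : M * (4 * e) = \sum_(i < m) 4 * e by rewrite sumr_const card_ord -[RHS]mulr_natl.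
    by apply: ler_sum => i _; exact: (xI i v v0 vt).2.
  have [lt it] := lEt t t_0 (lexx t); have [ls is_] := lEt s s0 st.
  have lB : L1 P (fun w => K * (CL * (\sum_(i < m) `|I i t w - x i t w| +
      \sum_(i < m) `|I i s w - x i s w|))).
    by apply: L1Z; apply: L1Z; apply: L1D.
  have near w : `|Delta w - DI w| <= K * (CL * (\sum_(i < m) `|I i t w - x i t w| +
      \sum_(i < m) `|I i s w - x i s w|)).
    have -> : Delta w - DI w = zeta w * ((U t (fun i => x i t w) - U t (fun i => I i t w)) -
       (U s (fun i => x i s w) - U s (fun i => I i s w))) by rewrite /Delta /DI; ring.
    rewrite normrM ler_pM//; apply: (le_trans (ler_normB _ _)); rewrite mulrDr; apply: lerD.
      rewrite distrC; exact: LU.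
    by rewrite distrC; apply: LU => //; exact: le_trans st tt0.
  have lDD : L1 P (fun w => Delta w - DI w).
    by apply: L1_le near => //; apply: measurable_funB => //; exact: L1_measurable lI.
  have lDelta : L1 P Delta by apply: eq_L1 (L1D lDD lI) => w; rewrite subrK.
  split=> //.
  have iDD : `|\int[P]_w Delta w - \int[P]_w DI w| <= K * (CL * (M * 8)) * e.
    rewrite -(intB lDelta lI); apply: (le_trans (abs_int_le_bound lDD lB near)).
    rewrite intZ; last by apply: L1Z; apply: L1D.
    rewrite intZ; last exact: L1D.
    rewrite intD// -!mulrA; do 2 apply: ler_wpM2l => //.
    by apply: (le_trans (lerD it is_)); rewrite le_eqVlt; apply/orP; left; apply/eqP; ring.
  have tI' : `|\int[P]_w DI w - \sum_(k < N) second_order P I be ga (gridpt s t N k) (gridpt s t N k.+1) zeta| <= e.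
    apply: (le_trans tI); apply: le_trans Ne; rewrite mulrA; apply: ler_wpM2r => //.
    by rewrite /B lerDl addr_ge0.
  have -> : \int[P]_w Delta w = (\int[P]_w Delta w - \int[P]_w DI w) +
     ((\int[P]_w DI w - \sum_(k < N) second_order P I be ga (gridpt s t N k) (gridpt s t N k.+1) zeta) +
     \sum_(k < N) second_order P I be ga (gridpt s t N k) (gridpt s t N k.+1) zeta) by ring.
  apply: (le_trans (ler_normD _ _)); apply: (le_trans (lerD iDD (ler_normD _ _))).
  apply: (le_trans (lerD (lexx _) (lerD tI' cells))).
  by rewrite le_eqVlt; apply/orP; left; apply/eqP; rewrite /D1; ring.
have [lD _] := main 1 ltr01 (lexx 1); split=> //.
apply: (@le_epsilonM _ _ _ D1) => [|e e0 e1]; last exact: (main e e0 e1).2.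
have M0 : 0 <= M by [].
have ct0 : 0 <= c * t by exact: mulr_ge0.
rewrite /D1 !addr_ge0// ?mulr_ge0// ?addr_ge0 ?mulr_ge0// ?sqr_ge0//.
Qed.

End ito.

(** * The heat kernel *)

Section mean_value_bounds.
Context (R : realType).
Implicit Types (f : R -> R) (x z : R).

Variable D : R -> Prop.
Hypothesis convD : forall a b z, D a -> D b -> a <= z -> z <= b -> D z.

Lemma mvt_bound f f' x x' B : D x -> D x' ->
  (forall z, D z -> `|z - x| <= `|x' - x| -> is_derive z 1 f (f' z) /\ `|f' z| <= B) ->
  `|f x' - f x| <= B * `|x' - x|.
Proof.
move=> Dx Dx' h.
have main a b : a < b -> (forall z, a <= z -> z <= b -> is_derive z 1 f (f' z) /\ `|f' z| <= B) ->
    `|f b - f a| <= B * `|b - a|.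
  move=> ab hab.
  have [c cab ->] : exists2 c, c \in `]a, b[%R & f b - f a = f' c * (b - a).
    apply: MVT => // [z|].
      by rewrite in_itv/= => /andP[az zb]; exact: (hab z (ltW az) (ltW zb)).1.
    apply: derivable_within_continuous => z; rewrite in_itv/= => /andP[az zb].
    by have [[]] := hab z az zb.
  move: cab; rewrite in_itv/= => /andP[ac cb].
  by rewrite normrM ler_wpM2r//; exact: (hab c (ltW ac) (ltW cb)).2.
have [xx|xx|->] := ltgtP x x'.
- apply: main => // z az zb; apply: h; first exact: convD Dx Dx' az zb.
  by rewrite !ger0_norm ?subr_ge0 ?(ltW xx)// lerD2r.
- rewrite distrC [`|x' - x|]distrC; apply: main => // z az zb; apply: h.
    exact: convD Dx' Dx az zb.
  by rewrite !ler0_norm ?subr_le0 ?(ltW xx)// lerN2 lerD2r.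
- by rewrite !subrr normr0 mulr0.
Qed.

Lemma taylor2_bound f f1 f2 x x' B : D x -> D x' ->
  (forall z, D z -> is_derive z 1 f (f1 z) /\ is_derive z 1 f1 (f2 z)) ->
  (forall z, D z -> `|f2 z| <= B) ->
  `|f x' - f x - f1 x * (x' - x)| <= B * `|x' - x| ^+ 2.
Proof.
move=> Dx Dx' df bf.
pose h z := f z - f1 x * (z - x).
have -> : f x' - f x - f1 x * (x' - x) = h x' - h x by rewrite /h; ring.
rewrite expr2 mulrA; apply: (@mvt_bound _ (fun z => f1 z - f1 x)) => // z Dz zx.
have [d1 d2] := df z Dz; split.
  by rewrite /h; apply: is_derive_eq; rewrite /GRing.scale/=; ring.
apply: (@le_trans _ _ (B * `|z - x|)); last first.
  by apply: ler_wpM2l => //; exact: le_trans (bf z Dz).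
apply: (@mvt_bound _ f2) => // u Du ux.
by split; [exact: (df u Du).2|exact: bf].
Qed.

Lemma taylor3_bound f f1 f2 f3 x x' B : D x -> D x' ->
  (forall z, D z -> [/\ is_derive z 1 f (f1 z), is_derive z 1 f1 (f2 z) &
                 is_derive z 1 f2 (f3 z)]) ->
  (forall z, D z -> `|f3 z| <= B) ->
  `|f x' - f x - f1 x * (x' - x) - f2 x * ((x' - x) ^+ 2 / 2)| <= B * `|x' - x| ^+ 3.
Proof.
move=> Dx Dx' df bf.
pose h z := f z - f2 x * ((z - x) ^+ 2 / 2) - f1 x * (z - x).
have -> : f x' - f x - f1 x * (x' - x) - f2 x * ((x' - x) ^+ 2 / 2) = h x' - h x.
  by rewrite /h; ring.
rewrite exprSr mulrA; apply: (@mvt_bound _ (fun z => f1 z - f1 x - f2 x * (z - x))) => // z Dz zx.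
have [d1 d2 d3] := df z Dz; split.
  by rewrite /h; apply: is_derive_eq; rewrite /GRing.scale/=; field.
apply: (@le_trans _ _ (B * `|z - x| ^+ 2)).
  apply: (@taylor2_bound f1 f2 f3) => // u Du.
  by have [_ d2' d3'] := df u Du.
by rewrite ler_wpM2l ?(le_trans _ (bf x Dx))// lerXn2r ?nnegrE.
Qed.

End mean_value_bounds.

Section gauss.
Context (R : realType).
Local Notation leb := (@lebesgue_measure R).
Local Notation phi := (normal_pdf (0 : R) 1 : R -> R).
Implicit Types z x : R.

Definition Phi (z : R) : R := Rintegral leb `]-oo, z] phi.

Let phi1 : L1 leb phi := L1_normal_pdf 1.

Let phi_on (D : set R) : measurable D -> leb.-integrable D (EFin \o phi).
Proof. by move=> mD; exact: integrableS phi1. Qed.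

Lemma is_derive_Phi (z : R) : is_derive z 1 Phi (phi z).
Proof.
have zz : z < z + 1 by rewrite ltrDl.
have [] := @continuous_FTC1 R phi -oo%O z (z + 1) zz (phi_on (measurable_itv _)) (ltNyr z)
  (@continuous_normal_pdf0 _ 1 (oner_neq0 _) z).
move=> d e; constructor; first exact: d.
by move: e; rewrite derive1E.
Qed.

Let half z : L1 leb (fun x => \1_(`]-oo, z]%classic) x * phi x).
Proof.
apply: (@L1_Mbdd _ (measurableTypeR R) R leb 1 _ phi) => // x.
by rewrite indicE; case: (_ \in _); rewrite ?normr1 ?normr0.
Qed.

Lemma PhiE z : Phi z = \int[leb]_x (\1_(`]-oo, z]%classic) x * phi x).
Proof.
rewrite /Phi /Rintegral integral_mkcond; congr fine; apply: eq_integral => x _.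
rewrite patchE indicE; case: (boolP (x \in _)) => _; first by rewrite mul1r.
by rewrite mul0r.
Qed.

Lemma Phi_ge0 z : 0 <= Phi z.
Proof. by rewrite PhiE; apply: int_ge0 => x; rewrite mulr_ge0 ?normal_pdf_ge0// indicE. Qed.

Lemma Phi_le1 z : Phi z <= 1.
Proof.
rewrite PhiE -[leRHS](@int_normal_pdf R 1); apply: (int_le (half z) phi1) => x.
by rewrite ler_piMl ?normal_pdf_ge0// indicE; case: (_ \in _); rewrite ?ler01.
Qed.

Let second_moment z : z ^- 2 = \int[leb]_x (z ^- 2 * (x ^+ 2 * phi x)).
Proof.
rewrite intZ; last exact: L1_power_normal_pdf.
by rewrite int_sqr_normal_pdf// expr1n mulr1.
Qed.

(** Chebyshev's inequality for the lower tail. *)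
Lemma Phi_le_sqr z : z < 0 -> Phi z <= z ^- 2.
Proof.
move=> z0; have zn : 0 < z ^+ 2 by rewrite exprn_even_gt0//= lt_eqF.
have l3 := L1Z (z ^- 2) (@L1_power_normal_pdf R 1 2 ltr01 isT).
rewrite PhiE second_moment; apply: (int_le (half z) l3) => x.
rewrite mulrA ler_wpM2r ?normal_pdf_ge0// indicE.
case: (boolP (x \in _)) => [/set_mem/=|_]; last by rewrite mulr_ge0 ?invr_ge0 ?sqr_ge0.
by rewrite in_itv/= => xz; rewrite ler_pdivlMl// mulr1; nra.
Qed.

Lemma Phi_ge_sqr z : 0 < z -> 1 - Phi z <= z ^- 2.
Proof.
move=> z0; have zn : 0 < z ^+ 2 by rewrite exprn_gt0.
have l3 := L1Z (z ^- 2) (@L1_power_normal_pdf R 1 2 ltr01 isT).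
rewrite PhiE second_moment -[X in X - _](@int_normal_pdf R 1) -(intB phi1 (half z)).
apply: (int_le (L1B phi1 (half z)) l3) => x.
rewrite -[X in X - _]mul1r -mulrBl mulrA ler_wpM2r ?normal_pdf_ge0// indicE.
case: (boolP (x \in _)) => [_|xz]; first by rewrite subrr mulr_ge0 ?invr_ge0 ?sqr_ge0.
have : z < x by rewrite ltNge; apply: contra xz => xz; apply: mem_set; rewrite /= in_itv.
by rewrite subr0 ler_pdivlMl// mulr1 => zx; nra.
Qed.

Lemma Phi_homo z z' : z <= z' -> Phi z <= Phi z'.
Proof.
move=> zz; rewrite !PhiE; apply: (int_le (half z) (half z')) => x.
rewrite ler_wpM2r ?normal_pdf_ge0// !indicE.
case: (boolP (x \in `]-oo, z]%classic)) => [/set_mem/=|_]; last exact: ler0n.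
by rewrite in_itv/= => xz; rewrite mem_set//= in_itv/= (le_trans xz).
Qed.

Definition psi (k : nat) (z : R) : R :=
  match k with
  | 0 => Phi z
  | 1 => phi z
  | 2 => - z * phi z
  | 3 => (z ^+ 2 - 1) * phi z
  | 4 => (3 * z - z ^+ 3) * phi z
  | _ => 0
  end.

Lemma is_derive_psi k z : (k <= 3)%N -> is_derive z 1 (psi k) (psi k.+1 z).
Proof.
have dphi : is_derive z 1 phi (- z * phi z).
  by apply: is_derive_eq (is_derive_normal_pdf z (oner_neq0 _)) _; rewrite expr1n divr1.
case: k => [|[|[|[|//]]]] _ /=; first exact: is_derive_Phi.
- exact: dphi.
- apply: is_derive_eq; rewrite /GRing.scale/=; ring.
- apply: is_derive_eq; rewrite /GRing.scale/=; ring.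
Qed.

Lemma psi_rec k z : (k <= 2)%N -> k%:R * psi k z + z * psi k.+1 z = - psi k.+2 z.
Proof. by case: k => [|[|[|//]]] _ /=; ring. Qed.

Lemma psi_bounded : exists C : R, 0 <= C /\ forall k z, `|psi k z| <= C.
Proof.
pose p1 : R := normal_peak 1; pose p2 : R := normal_peak 2.
have p10 : 0 <= p1 := normal_peak_ge0 1; have p20 : 0 <= p2 := normal_peak_ge0 2.
have e0 z : 0 <= phi z := normal_pdf_ge0 0 1 z.
have e1 z : phi z <= p1 := normal_pdf_ub 0 z (oner_neq0 _).
have e4 z : z ^+ 4 * phi z <= 32 * p2.
  have := normal_pdf_quartic z (ltr01 : 0 < 1 :> R); rewrite expr1n !mulr1 => /le_trans; apply.
  by rewrite ler_wpM2l//; apply: normal_pdf_ub.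
pose B := 1 + 4 * p1 + 128 * p2.
have pw z k : (k <= 4)%N -> `|z| ^+ k <= 1 + z ^+ 4.
  move=> k4; rewrite -[z ^+ 4]ger0_norm ?exprn_even_ge0// normrX.
  have [h|h] := leP `|z| 1.
    by rewrite (le_trans (exprn_ile1 _ _ h))// lerDl exprn_ge0.
  by rewrite (le_trans (ler_weXn2l (ltW h) k4))// lerDr.
exists B; split; first by rewrite /B !addr_ge0 ?mulr_ge0.
have bd z q : `|q| <= 4 + 4 * z ^+ 4 -> `|q * phi z| <= B.
  move=> qz; rewrite normrM (ger0_norm (e0 z)); have h1 := e1 z; have h4 := e4 z.
  apply: (le_trans (ler_wpM2r (e0 z) qz)); rewrite /B; lra.
move=> [|[|[|[|[|k]]]]] z /=.
- rewrite ger0_norm ?Phi_ge0//; apply: (le_trans (Phi_le1 z)).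
  by rewrite /B -addrA lerDl addr_ge0// mulr_ge0.
- rewrite -[phi z]mul1r; apply: bd; rewrite normr1.
  by have := pw z 0%N isT; rewrite expr0; lra.
- by apply: bd; rewrite normrN; have := pw z 1%N isT; have := pw z 0%N isT; rewrite expr1 expr0; lra.
- apply: bd; apply: (le_trans (ler_normB _ _)); rewrite normrX normr1.
  by have := pw z 2%N isT; have := pw z 0%N isT; rewrite expr0; lra.
- apply: bd; apply: (le_trans (ler_normB _ _)); rewrite normrM normrX ger0_norm//.
  by have := pw z 3%N isT; have := pw z 1%N isT; rewrite expr1; lra.
- by rewrite normr0 /B !addr_ge0 ?mulr_ge0.
Qed.

End gauss.

(** The reciprocal of sqrt (c tau), in a form that is easy to differentiate. *)
Definition rate (R : realType) (c tau : R) : R := expR (- (ln (c * tau) / 2)).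

(** [heat c k] is the [k]-th derivative in the starting point [x] of the
    probability that a Brownian motion with variance [c * tau] ends below [y].
    It is locked because comparing two instances by computation is hopeless. *)
HB.lock Definition heat (R : realType) (c : R) (k : nat) (y tau x : R) : R :=
  (- rate c tau) ^+ k * psi k (rate c tau * (y - x)).

Section heat_kernel.
Context (R : realType).
Variable c : R.
Hypothesis c0 : 0 < c.
Implicit Types tau x y : R.

Local Notation rate := (rate c).
Local Notation heat := (heat c).

Lemma rate_gt0 tau : 0 < rate tau.
Proof. exact: expR_gt0. Qed.

Lemma rate_sqr tau : 0 < tau -> rate tau ^+ 2 = (c * tau)^-1.
Proof.
move=> t0; have ct : 0 < c * tau by exact: mulr_gt0.
rewrite /rate expr2 -expRD -[X in expR X](_ : - ln (c * tau) = _); last by field.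
by rewrite expRN lnK.
Qed.

Lemma rate_le e tau : 0 < e -> e <= tau -> rate tau <= rate e.
Proof.
move=> e0 et; rewrite ler_expR lerN2 ler_wpM2r ?invr_ge0//.
have ce : 0 < c * e by exact: mulr_gt0.
have ct : 0 < c * tau by rewrite mulr_gt0// (lt_le_trans e0).
by rewrite ler_ln ?posrE//; apply: ler_wpM2l => //; exact: ltW.
Qed.

Lemma is_derive_rate tau : 0 < tau ->
  is_derive tau 1 rate (- (rate tau / (2 * tau))).
Proof.
move=> t0; have ct : 0 < c * tau by exact: mulr_gt0.
have d1 : is_derive tau 1 (fun u => c * u) c.
  by apply: is_derive_eq; rewrite /GRing.scale/= ; ring.
have d2 : is_derive tau 1 (fun u => ln (c * u)) ((c * tau)^-1 * c).
  exact: (@is_derive1_comp _ (@ln R) (fun u => c * u) _ _ _ (is_derive1_ln ct) d1).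
have d3 : is_derive tau 1 (fun u => - (ln (c * u) / 2)) (- ((c * tau)^-1 * c / 2)).
  by apply: is_derive_eq; rewrite /GRing.scale/=; ring.
have := @is_derive1_comp _ expR (fun u => - (ln (c * u) / 2)) _ _ _ (is_derive_expR _) d3.
move=> h; apply: is_derive_eq h _; rewrite -/(rate tau).
by field; rewrite !gt_eqF.
Qed.

Let heatE k y tau x : heat k y tau x = (- rate tau) ^+ k * psi k (rate tau * (y - x)).
Proof. by rewrite heat.unlock. Qed.

Lemma is_derive_heat_space k y tau x : (k <= 3)%N ->
  is_derive x 1 (heat k y tau) (heat k.+1 y tau x).
Proof.
move=> k3; have d1 : is_derive x 1 (fun u => rate tau * (y - u)) (- rate tau).
  by apply: is_derive_eq; rewrite /GRing.scale/=; ring.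
have d2 := @is_derive1_comp _ (psi k) _ _ _ _ (is_derive_psi _ k3) d1.
have : is_derive x 1 (fun u => (- rate tau) ^+ k * psi k (rate tau * (y - u)))
  ((- rate tau) ^+ k * (psi k.+1 (rate tau * (y - x)) * (- rate tau))).
  exact: (is_deriveZ ((- rate tau) ^+ k) d2).
rewrite (_ : (fun u => _) = heat k y tau); last by apply/funext => u; rewrite heatE.
by move=> h; apply: (is_derive_eq h); rewrite heatE exprS; ring.
Qed.

Lemma is_derive_heat_time k y tau x : (k <= 2)%N -> 0 < tau ->
  is_derive tau 1 (fun u => heat k y u x) (c / 2 * heat k.+2 y tau x).
Proof.
move=> k2 t0; have dr := is_derive_rate t0.
have d1 : is_derive tau 1 (fun u => rate u * (y - x)) (- (rate tau / (2 * tau)) * (y - x)).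
  by apply: is_derive_eq; rewrite /GRing.scale/=; ring.
have d2 := @is_derive1_comp _ (psi k) (fun u => rate u * (y - x)) _ _ _
  (is_derive_psi (rate tau * (y - x)) (leq_trans k2 (isT : 2 <= 3)%N)) d1.
have d3 : is_derive tau 1 (fun u => (- rate u) ^+ k)
    (- (k%:R / (2 * tau)) * (- rate tau) ^+ k).
  case: k k2 d2 => [|[|[|//]]] _ _.
  - rewrite (_ : (fun u => (- rate u) ^+ 0) = cst 1); last by apply/funext => u; rewrite expr0.
    by apply: is_derive_eq; rewrite !mul0r oppr0 mul0r.
  - by apply: is_derive_eq; field; rewrite gt_eqF.
  - by apply: is_derive_eq; rewrite /GRing.scale/=; field; rewrite gt_eqF.
rewrite (_ : (fun u => heat k y u x) =
  (fun u => (- rate u) ^+ k * psi k (rate u * (y - x)))); last first.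
  by apply/funext => u; rewrite heatE.
have h := is_deriveM d3 d2; apply: (is_derive_eq h).
have cr : c / 2 * rate tau ^+ 2 = (2 * tau)^-1.
  by rewrite rate_sqr//; field; rewrite !gt_eqF.
have -> : heat k.+2 y tau x = rate tau ^+ 2 * ((- rate tau) ^+ k * psi k.+2 (rate tau * (y - x))).
  by rewrite heatE !exprS; ring.
rewrite mulrA cr -[psi k.+2 _]opprK -psi_rec// /GRing.scale/=.
by field; rewrite gt_eqF.
Qed.

Section bounds.
Variables e t0 : R.
Hypotheses (e0 : 0 < e) (t00 : 0 <= t0).

Lemma heat_bounded : exists C : R, 0 <= C /\ forall k y tau x, (k <= 4)%N -> e <= tau ->
  `|heat k y tau x| <= C.
Proof.
have [C [C0 hC]] := psi_bounded R.
pose S := \sum_(k < 5) rate e ^+ k.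
have S0 : 0 <= S by apply: sumr_ge0 => k _; rewrite exprn_ge0// ltW// rate_gt0.
exists (S * C); split; first exact: mulr_ge0.
move=> k y tau x k4 et; rewrite heatE.
rewrite normrM normrX normrN (ger0_norm (ltW (rate_gt0 tau))).
apply: ler_pM => //; first by rewrite exprn_ge0// ltW// rate_gt0.
rewrite /S (bigD1 (Ordinal (k4 : k < 5)%N))//= -[leLHS]addr0 lerD//.
  by rewrite lerXn2r ?nnegrE ?(ltW (rate_gt0 _)) ?rate_le.
by apply: sumr_ge0 => l _; rewrite exprn_ge0// ltW// rate_gt0.
Qed.

Lemma heat_taylor : exists C : R, 0 <= C /\ forall y tau tau' x x',
  e <= tau -> e <= tau' -> `|tau' - tau| <= t0 ->
  let n := Num.sqrt `|tau' - tau| + `|x' - x| in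
  [/\ `|heat 0 y tau' x' - heat 0 y tau x - heat 1 y tau x * (x' - x)
        - heat 2 y tau x * ((x' - x) ^+ 2 / 2 + c / 2 * (tau' - tau))| <= C * n ^+ 3,
      `|heat 0 y tau' x' - heat 0 y tau x - heat 1 y tau x * (x' - x)| <= C * n ^+ 2 &
      `|heat 0 y tau' x' - heat 0 y tau x| <= C * n].
Proof.
have [B [B0 hB]] := heat_bounded.
pose q0 := Num.sqrt t0; have q00 : 0 <= q0 by exact: sqrtr_ge0.
pose C := B + c * B + c ^+ 2 * B * q0 + c * B * q0.
have cc : 0 <= c := ltW c0.
have C0 : 0 <= C by rewrite /C !addr_ge0 ?mulr_ge0 ?sqr_ge0.
exists C; split=> // y tau tau' x x' et et' tt n.
have tau0 : 0 < tau := lt_le_trans e0 et; have tau'0 : 0 < tau' := lt_le_trans e0 et'.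
set q := Num.sqrt `|tau' - tau|; set X := `|x' - x|.
have qE : `|tau' - tau| = q ^+ 2 by rewrite sqr_sqrtr.
have q1 : 0 <= q by exact: sqrtr_ge0.
have qq0 : q <= q0 by exact: ler_wsqrtr.
have X0 : 0 <= X by exact: normr_ge0.
have nE : n = q + X by [].
pose De z := e <= z.
have convDe (a b z : R) : De a -> De b -> a <= z -> z <= b -> De z.
  by move=> ea _ az _; exact: le_trans az.
have dt k z : (k <= 2)%N -> De z ->
    is_derive z 1 (fun u => heat k y u x') (c / 2 * heat k.+2 y z x').
  by move=> k2 ez; apply: is_derive_heat_time => //; exact: lt_le_trans ez.
have c2 : 0 <= c / 2 by rewrite divr_ge0.
have t1 : `|heat 0 y tau' x' - heat 0 y tau x'| <= c / 2 * B * q ^+ 2.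
  rewrite -qE; apply: (@mvt_bound _ _ convDe (fun u => heat 0 y u x')
    (fun u => c / 2 * heat 2 y u x') _ _ _ et et') => z ez _.
  by split; [exact: dt|rewrite normrM ger0_norm// ler_wpM2l// hB].
have t2 : `|heat 0 y tau' x' - heat 0 y tau x' - c / 2 * heat 2 y tau x' * (tau' - tau)|
    <= c / 2 * (c / 2 * B) * q ^+ 4.
  rewrite (_ : 4 = 2 * 2)%N// exprM -qE.
  apply: (@taylor2_bound _ De convDe (fun u => heat 0 y u x') (fun u => c / 2 * heat 2 y u x')
    (fun u => c / 2 * (c / 2 * heat 4 y u x')) tau tau' _ et et') => z ez; last first.
    rewrite normrM ger0_norm; last exact: c2.
    apply: ler_wpM2l; first exact: c2.
    rewrite normrM ger0_norm; last exact: c2.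
    by apply: ler_wpM2l; [exact: c2|exact: hB].
  split; first exact: (dt 0%N z isT ez).
  exact: (is_deriveZ (c / 2) (dt 2 z isT ez)).
have convT (a b z : R) : True -> True -> a <= z -> z <= b -> True by [].
have dx k z := @is_derive_heat_space k y tau z.
have x1 : `|heat 0 y tau x' - heat 0 y tau x| <= B * X.
  by apply: (@mvt_bound _ (fun=> True) convT (heat 0 y tau) (heat 1 y tau) x x' _ I I) => z _ _;
    split; [exact: dx|exact: hB].
have x2 : `|heat 0 y tau x' - heat 0 y tau x - heat 1 y tau x * (x' - x)| <= B * X ^+ 2.
  apply: (@taylor2_bound _ (fun=> True) convT (heat 0 y tau) (heat 1 y tau) (heat 2 y tau)
    x x' _ I I) => z _; last exact: hB.
  by split; exact: dx.
have x3 : `|heat 0 y tau x' - heat 0 y tau x - heat 1 y tau x * (x' - x)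
    - heat 2 y tau x * ((x' - x) ^+ 2 / 2)| <= B * X ^+ 3.
  apply: (@taylor3_bound _ (fun=> True) convT (heat 0 y tau) (heat 1 y tau) (heat 2 y tau)
    (heat 3 y tau) x x' _ I I) => z _; last exact: hB.
  by split; exact: dx.
have x4 : `|heat 2 y tau x' - heat 2 y tau x| <= B * X.
  by apply: (@mvt_bound _ (fun=> True) convT (heat 2 y tau) (heat 3 y tau) x x' _ I I) => z _ _;
    split; [exact: dx|exact: hB].
clear dx dt; move: t1 t2 x1 x2 x3 x4.
move: (heat 0 y tau' x') (heat 0 y tau x') (heat 0 y tau x) (heat 1 y tau x)
  (heat 2 y tau x') (heat 2 y tau x) => a0 a1 a2 b1 b2 b3 t1 t2 x1 x2 x3 x4.
have sq : 0 <= q * X by exact: mulr_ge0.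
have cB : 0 <= c * B by exact: mulr_ge0.
have ccB : 0 <= c ^+ 2 * B by rewrite mulr_ge0// sqr_ge0.
have cq : 0 <= c ^+ 2 * B * q0 by exact: mulr_ge0.
have cBq : 0 <= c * B * q0 by exact: mulr_ge0.
rewrite nE; split.
- have -> : a0 - a2 - b1 * (x' - x)
        - b3 * ((x' - x) ^+ 2 / 2 + c / 2 * (tau' - tau)) =
     (a0 - a1 - c / 2 * b2 * (tau' - tau)) +
     (a1 - a2 - b1 * (x' - x)
       - b3 * ((x' - x) ^+ 2 / 2)) +
     c / 2 * (b2 - b3) * (tau' - tau) by ring.
  have t3 : `|c / 2 * (b2 - b3) * (tau' - tau)| <= c / 2 * (B * X) * q ^+ 2.
    by rewrite normrM qE ler_wpM2r ?sqr_ge0// normrM ger0_norm// ler_wpM2l.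
  apply: (le_trans (ler_normD _ _)); apply: (le_trans (lerD (ler_normD _ _) t3)).
  apply: (le_trans (lerD (lerD t2 x3) (lexx _))).
  have q3 : q ^+ 4 <= q0 * q ^+ 3 by rewrite exprS ler_wpM2r// exprn_ge0.
  have h1 : c / 2 * (c / 2 * B) * q ^+ 4 <= c ^+ 2 * B * q0 * q ^+ 3.
    have -> : c / 2 * (c / 2 * B) * q ^+ 4 = c ^+ 2 * B * (q ^+ 4 / 4) by field.
    rewrite -[leRHS]mulrA ler_wpM2l//.
    by have := exprn_ge0 4 q1; lra.
  have h2 : q ^+ 3 <= (q + X) ^+ 3 by rewrite lerXn2r ?nnegrE ?addr_ge0// lerDl.
  have h3 : X ^+ 3 <= (q + X) ^+ 3 by rewrite lerXn2r ?nnegrE ?addr_ge0// lerDr.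
  have h4 : c / 2 * (B * X) * q ^+ 2 <= c * B * (q + X) ^+ 3.
    have -> : c / 2 * (B * X) * q ^+ 2 = c * B * (q ^+ 2 * X / 2) by field.
    apply: ler_wpM2l => //; have -> : (q + X) ^+ 3 = q ^+ 3 + 3 * (q ^+ 2 * X) + 3 * (q * X ^+ 2) + X ^+ 3 by ring.
    have := exprn_ge0 3 q1; have := exprn_ge0 3 X0; have := mulr_ge0 (sqr_ge0 q) X0.
    have := mulr_ge0 q1 (sqr_ge0 X); lra.
  have p3 : 0 <= (q + X) ^+ 3 by rewrite exprn_ge0// addr_ge0.
  have := ler_wpM2l cq h2; have := ler_wpM2l B0 h3; have := mulr_ge0 cBq p3.
  by rewrite /C !mulrDl; lra.
- have -> : a0 - a2 - b1 * (x' - x) =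
     (a0 - a1) +
     (a1 - a2 - b1 * (x' - x)) by ring.
  apply: (le_trans (ler_normD _ _)); apply: (le_trans (lerD t1 x2)).
  have h2 : q ^+ 2 <= (q + X) ^+ 2 by rewrite lerXn2r ?nnegrE ?addr_ge0// lerDl.
  have h3 : X ^+ 2 <= (q + X) ^+ 2 by rewrite lerXn2r ?nnegrE ?addr_ge0// lerDr.
  have p2 : 0 <= (q + X) ^+ 2 by exact: sqr_ge0.
  have := ler_wpM2l cB h2; have := ler_wpM2l B0 h3; have := mulr_ge0 cBq p2.
  have := mulr_ge0 cq p2; have := mulr_ge0 cB (sqr_ge0 q).
  by rewrite /C !mulrDl; lra.
- have -> : a0 - a2 =
     (a0 - a1) + (a1 - a2) by ring.
  apply: (le_trans (ler_normD _ _)); apply: (le_trans (lerD t1 x1)).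
  have h1 : c / 2 * B * q ^+ 2 <= c * B * q0 * q.
    have -> : c / 2 * B * q ^+ 2 = c * B * (q * q / 2) by field.
    by rewrite -[leRHS]mulrA ler_wpM2l//; nra.
  have qX : 0 <= q + X by exact: addr_ge0.
  have := mulr_ge0 cBq X0; have := mulr_ge0 cq qX; have := mulr_ge0 cB qX.
  have := mulr_ge0 B0 q1.
  by rewrite /C; lra.
Qed.

Lemma heat_lipschitz : exists C : R, 0 <= C /\ forall k y tau x x', (k <= 3)%N ->
  e <= tau -> `|heat k y tau x' - heat k y tau x| <= C * `|x' - x|.
Proof.
have [B [B0 hB]] := heat_bounded; exists B; split=> // k y tau x x' k3 et.
have convT (a b z : R) : True -> True -> a <= z -> z <= b -> True by [].
apply: (@mvt_bound _ (fun=> True) convT (heat k y tau) (heat k.+1 y tau) x x' _ I I) => z _ _.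
by split; [exact: is_derive_heat_space|exact: hB].
Qed.

End bounds.

Lemma continuous_heat k y tau : (k <= 3)%N -> continuous (heat k y tau).
Proof.
move=> k3 x; apply: differentiable_continuous; apply/derivable1_diffP.
by have [] := is_derive_heat_space y tau x k3.
Qed.

Lemma heat0E y tau x : heat 0 y tau x = Phi (rate tau * (y - x)).
Proof. by rewrite heatE expr0 mul1r. Qed.

Lemma heat_shift k y tau x z : heat k y tau (x + z) = heat k (y - z) tau x.
Proof. by rewrite !heatE; congr (_ * psi k (_ * _)); ring. Qed.

Lemma heat0_ge0 y tau x : 0 <= heat 0 y tau x.
Proof. by rewrite heatE expr0 mul1r Phi_ge0. Qed.

Lemma heat0_le1 y tau x : heat 0 y tau x <= 1.
Proof. by rewrite heatE expr0 mul1r Phi_le1. Qed.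

End heat_kernel.

(** * Second-order expansion of determinants *)

Section subset_expansion.
Context (R : realType) (m : nat).
Implicit Types (a b f p q d : 'I_m -> R) (J : {set 'I_m}).

Definition patched a J f : R := \prod_l (if l \in J then f l else a l).

Lemma patched1 a i f : patched a [set i]%SET f = f i * \prod_(l | l != i) a l.
Proof.
rewrite /patched (bigD1 i)//= finset.in_set1 eqxx; congr (_ * _).
by apply: eq_bigr => l li; rewrite finset.in_set1 (negbTE li).
Qed.

Lemma patched2 a i j f : j != i ->
  patched a [set i; j]%SET f = f i * (f j * \prod_(l | (l != i) && (l != j)) a l).
Proof.
move=> ji; rewrite /patched (bigD1 i)//= finset.in_set2 eqxx; congr (_ * _).
rewrite (bigD1 j)//= finset.in_set2 eqxx orbT; congr (_ * _).
by apply: eq_bigr => l /andP[li lj]; rewrite finset.in_set2 (negbTE li) (negbTE lj).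
Qed.

Lemma prod_bound a (Q : pred 'I_m) (C : R) : 1 <= C -> (forall l, `|a l| <= C) ->
  `|\prod_(l | Q l) a l| <= C ^+ m.
Proof.
move=> C1 aC; have C0 : 0 <= C := le_trans ler01 C1.
rewrite normr_prod big_mkcond/=.
have -> : C ^+ m = \prod_(l < m) C by rewrite prodr_const card_ord.
by apply: ler_prod => l _; case: (Q l); rewrite normr_ge0 aC || rewrite ler01 C1.
Qed.

Lemma prod_le1 a (Q : pred 'I_m) : (forall l, `|a l| <= 1) -> `|\prod_(l | Q l) a l| <= 1.
Proof. by move=> a1; rewrite -[leRHS](expr1n _ m); exact: prod_bound. Qed.

Lemma sum_set1 (X : {set 'I_m} -> R) :
  \sum_(J : {set 'I_m} | #|J| == 1%N) X J = \sum_i X [set i]%SET.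
Proof.
rewrite -(big_imset (idx := 0 : R) (aop := +%R) (A := predT) (h := fun i => [set i]%SET) X) /=; last first.
  by move=> i j _ _; exact: finset.set1_inj.
apply: eq_bigl => J; apply/cards1P/imsetP => [[i ->]|[i _ ->]]; by exists i.
Qed.

Lemma sum_set2 (X : {set 'I_m} -> R) :
  \sum_(J : {set 'I_m} | #|J| == 2%N) X J =
  2^-1 * \sum_i \sum_(j | j != i) X [set i; j]%SET.
Proof.
have -> : \sum_i \sum_(j | j != i) X [set i; j]%SET =
    \sum_(J : {set 'I_m} | #|J| == 2%N) \sum_(i in J) X J.
  rewrite [RHS](exchange_big_dep xpredT)//=; apply: eq_bigr => i _.
  rewrite -(big_imset (idx := 0 : R) (aop := +%R) (A := [pred j | j != i])
    (h := fun j => [set i; j]%SET) X) /=; last first.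
    move=> j k; rewrite !inE => ji ki e.
    have : j \in [set i; k]%SET by rewrite -e finset.in_set2 eqxx orbT.
    by rewrite finset.in_set2 (negbTE ji) => /eqP.
  apply: eq_bigl => J; apply/imsetP/andP => [[j]|[/cards2P[x [y [xy ->]]]]].
    by rewrite inE => ji ->; rewrite cards2 [i == j]eq_sym ji finset.in_set2 eqxx.
  rewrite finset.in_set2 => /orP[/eqP ->|/eqP ->].
    by exists y; rewrite // inE eq_sym.
  by exists x; [rewrite inE|rewrite finset.setUC].
rewrite [in RHS](eq_bigr (fun J => 2 * X J)); last first.
  by move=> J /eqP J2; rewrite sumr_const J2 mulr_natl.
by rewrite -mulr_sumr mulrA mulVf ?mul1r.
Qed.

Section expansion_of_product.
Variables (a b p q d : 'I_m -> R) (kappa n C : R).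
Hypotheses (C1 : 1 <= C) (n0 : 0 <= n) (a1 : forall l, `|a l| <= 1)
  (ab1 : forall l, `|a l + b l| <= 1) (pC : forall l, `|p l| <= C)
  (dn : forall l, `|d l| <= n) (bn : forall l, `|b l| <= C * n)
  (bn2 : forall l, `|b l - d l * p l| <= C * n ^+ 2)
  (bn3 : forall l, `|b l - d l * p l - (d l ^+ 2 / 2 - kappa) * q l| <= C * n ^+ 3).

Let C0 : 0 <= C := le_trans ler01 C1.

Lemma patched_many J : (2 < #|J|)%N -> `|patched a J b| <= 2 ^+ m * C ^+ 3 * n ^+ 3.
Proof.
move=> J3; pose y := Num.min 2 (C * n).
have Cn : 0 <= C * n by exact: mulr_ge0.
have y0 : 0 <= y by rewrite le_min Cn andbT.
have y2 : y <= 2 by rewrite ge_min lexx.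
have by_ l : `|b l| <= y.
  rewrite le_min bn andbT -[b l](addKr (a l)).
  by apply: (le_trans (ler_normD _ _)); rewrite normrN; have := a1 l; have := ab1 l; lra.
apply: (@le_trans _ _ (y ^+ #|J|)).
  rewrite /patched normr_prod -prodr_const [leRHS]big_mkcond/=.
  apply: ler_prod => l _; rewrite normr_ge0/=.
  by case: (l \in J); [exact: by_|exact: a1].
rewrite -(subnK J3) exprD -mulrA -exprMn; apply: ler_pM.
- exact: exprn_ge0.
- exact: exprn_ge0.
- apply: (@le_trans _ _ (2 ^+ (#|J| - 3))); first by rewrite lerXn2r// nnegrE.
  by rewrite ler_weXn2l ?ler1n// (leq_trans (leq_subr _ _))// -[leqRHS]card_ord max_card.
- by rewrite lerXn2r ?nnegrE// ge_min lexx orbT.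
Qed.

Lemma patched_single i : `|patched a [set i]%SET b - d i * patched a [set i]%SET p
    - (d i ^+ 2 / 2 - kappa) * patched a [set i]%SET q| <= C * n ^+ 3.
Proof.
rewrite !patched1; set w := \prod_(l | _) _.
have -> : b i * w - d i * (p i * w) - (d i ^+ 2 / 2 - kappa) * (q i * w) =
  w * (b i - d i * p i - (d i ^+ 2 / 2 - kappa) * q i) by ring.
by rewrite normrM -[leRHS]mul1r ler_pM// prod_le1.
Qed.

Lemma patched_pair i j : j != i ->
  `|patched a [set i; j]%SET b - d i * d j * patched a [set i; j]%SET p| <= 2 * C ^+ 2 * n ^+ 3.
Proof.
move=> ji; rewrite !(patched2 _ _ ji); set w := \prod_(l | _) _.
have -> : b i * (b j * w) - d i * d j * (p i * (p j * w)) =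
  w * ((b i - d i * p i) * b j + d i * p i * (b j - d j * p j)) by ring.
rewrite normrM -[leRHS]mul1r ler_pM// ?prod_le1//.
apply: (le_trans (ler_normD _ _)).
have h1 : `|(b i - d i * p i) * b j| <= C * n ^+ 2 * (C * n) by rewrite normrM ler_pM.
have h2 : `|d i * p i * (b j - d j * p j)| <= n * C * (C * n ^+ 2) by rewrite !normrM !ler_pM.
apply: (le_trans (lerD h1 h2)).
by rewrite le_eqVlt; apply/orP; left; apply/eqP; ring.
Qed.

(** Expanding the product over the set of factors that change, single factors
    give first-order terms, pairs give mixed second-order terms, and larger sets
    are of third order. *)
Lemma product_expansion :
  `|\prod_l (a l + b l) - \prod_l a l - \sum_i d i * patched a [set i]%SET p
    - \sum_i (d i ^+ 2 / 2 - kappa) * patched a [set i]%SET q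
    - 2^-1 * \sum_i \sum_(j | j != i) d i * d j * patched a [set i; j]%SET p|
  <= (m%:R + m%:R ^+ 2 + #|{set 'I_m}|%:R * 2 ^+ m) * C ^+ 3 * n ^+ 3.
Proof.
have n3 : 0 <= n ^+ 3 by exact: exprn_ge0.
have E : \prod_l (a l + b l) = \sum_(J : {set 'I_m}) patched a J b.
  under eq_bigr do rewrite addrC; rewrite bigA_distr; apply: eq_bigl => J; by rewrite inE.
have S : \sum_(J : {set 'I_m}) patched a J b = \prod_l a l +
   (\sum_i patched a [set i]%SET b + (2^-1 * \sum_i \sum_(j | j != i) patched a [set i; j]%SET b +
    \sum_(J : {set 'I_m} | (2 < #|J|)%N) patched a J b)).
  rewrite (bigID (fun J => #|J| == 0%N))/=; congr (_ + _).
    rewrite (eq_bigl (pred1 (finset.set0 : {set 'I_m}))) => [|J]; last by rewrite /= cards_eq0.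
    by rewrite big_pred1_eq /patched; apply: eq_bigr => l _; rewrite finset.in_set0.
  rewrite (bigID (fun J => #|J| == 1%N))/=; congr (_ + _).
    by rewrite -(sum_set1 (fun J => patched a J b)); apply: eq_bigl => J; case: #|J| => [|[]].
  rewrite (bigID (fun J => #|J| == 2%N))/=; congr (_ + _).
    by rewrite -(sum_set2 (fun J => patched a J b)); apply: eq_bigl => J; case: #|J| => [|[|[]]].
  by apply: eq_bigl => J; case: #|J| => [|[|[]]].
rewrite E S.
have -> (A B B1 B2 D D' X : R) : A + (B + (2^-1 * D + X)) - A - B1 - B2 - 2^-1 * D' =
  (B - B1 - B2) + (2^-1 * (D - D') + X) by ring.
have h1 : `|\sum_i patched a [set i]%SET b - \sum_i d i * patched a [set i]%SET p
    - \sum_i (d i ^+ 2 / 2 - kappa) * patched a [set i]%SET q| <= m%:R * (C * n ^+ 3).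
  rewrite -!sumrB; apply: (le_trans (ler_norm_sum _ _ _)).
  have -> : m%:R * (C * n ^+ 3) = \sum_(i < m) C * n ^+ 3.
    by rewrite sumr_const card_ord -[RHS]mulr_natl.
  by apply: ler_sum => i _; exact: patched_single.
have h2 : `|2^-1 * (\sum_i \sum_(j | j != i) patched a [set i; j]%SET b -
    \sum_i \sum_(j | j != i) d i * d j * patched a [set i; j]%SET p)|
    <= m%:R ^+ 2 * (C ^+ 2 * n ^+ 3).
  rewrite normrM ger0_norm// ler_pdivrMl// -sumrB; apply: (le_trans (ler_norm_sum _ _ _)).
  apply: (@le_trans _ _ (\sum_(i < m) \sum_(j < m) 2 * C ^+ 2 * n ^+ 3)).
    apply: ler_sum => i _; rewrite -sumrB; apply: (le_trans (ler_norm_sum _ _ _)).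
    rewrite big_mkcond/=; apply: ler_sum => j _; case: ifP => ji; first exact: patched_pair.
    by rewrite !mulr_ge0// exprn_ge0.
  rewrite !sumr_const card_ord -mulrnA -[_ *+ (m * m)]mulr_natr natrM.
  by rewrite le_eqVlt; apply/orP; left; apply/eqP; ring.
have h3 : `|\sum_(J : {set 'I_m} | (2 < #|J|)%N) patched a J b| <=
    #|{set 'I_m}|%:R * (2 ^+ m * C ^+ 3 * n ^+ 3).
  apply: (le_trans (ler_norm_sum _ _ _)).
  have -> : #|{set 'I_m}|%:R * (2 ^+ m * C ^+ 3 * n ^+ 3) =
      \sum_(J : {set 'I_m}) 2 ^+ m * C ^+ 3 * n ^+ 3.
    by rewrite sumr_const -[RHS]mulr_natl.
  rewrite big_mkcond/=; apply: ler_sum => J _; case: ifP => J3; first exact: patched_many.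
  by rewrite !mulr_ge0// exprn_ge0.
have c1 : C * n ^+ 3 <= C ^+ 3 * n ^+ 3.
  by apply: ler_wpM2r => //; rewrite -[leLHS]expr1; exact: ler_weXn2l.
have c2 : C ^+ 2 * n ^+ 3 <= C ^+ 3 * n ^+ 3.
  by apply: ler_wpM2r => //; exact: ler_weXn2l.
apply: (le_trans (ler_normD _ _)); apply: (le_trans (lerD h1 (ler_normD _ _))).
apply: (le_trans (lerD (lexx _) (lerD h2 h3))).
rewrite !mulrDl addrA; apply: lerD; last first.
  by rewrite le_eqVlt; apply/orP; left; apply/eqP; ring.
apply: lerD; rewrite -[leRHS]mulrA; apply: ler_wpM2l; rewrite ?ler0n//.
Qed.

End expansion_of_product.

Lemma product_lipschitz a b (C : R) : 1 <= C -> (forall l, `|a l| <= C) -> (forall l, `|b l| <= C) ->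
  `|\prod_l a l - \prod_l b l| <= C ^+ m * \sum_l `|a l - b l|.
Proof.
move=> C1 aC bC; have C0 : 0 <= C := le_trans ler01 C1.
suff : forall s : seq 'I_m, `|\prod_(l <- s) a l - \prod_(l <- s) b l| <=
    C ^+ size s * \sum_(l <- s) `|a l - b l|.
  by move=> /(_ (index_enum _)); rewrite /index_enum -enumT size_enum_ord.
elim=> [|l s IH]; first by rewrite !big_nil subrr normr0 mulr0.
rewrite !big_cons/= exprS.
have -> : a l * \prod_(j <- s) a j - b l * \prod_(j <- s) b j =
  a l * (\prod_(j <- s) a j - \prod_(j <- s) b j) + (a l - b l) * \prod_(j <- s) b j by ring.
have bs : `|\prod_(j <- s) b j| <= C ^+ size s.
  elim: (s) => [|k r IHr]; first by rewrite big_nil normr1.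
  by rewrite big_cons normrM/= exprS ler_pM.
apply: (le_trans (ler_normD _ _)); rewrite !normrM mulrDr addrC; apply: lerD.
  rewrite mulrC ler_wpM2r// (le_trans bs)// ler_peMl// exprn_ge0//.
by rewrite -mulrA ler_pM.
Qed.

End subset_expansion.

Section determinants.
Context (R : realType) (m : nat).
Implicit Types (A B M N : 'M[R]_m) (J : {set 'I_m}).

Definition patched_det A J M : R :=
  \det (\matrix_(l, k) (if l \in J then M l k else A l k)).

Lemma patched_detE A J M : patched_det A J M = \sum_(s : 'S_m) (-1) ^+ s *
  patched (fun l => A l (s l)) J (fun l => M l (s l)).
Proof.
by apply: eq_bigr => s _; congr (_ * _); apply: eq_bigr => l _; rewrite mxE.
Qed.

Lemma det_sum_bound (x : 'S_m -> R) (K : R) : (forall s, `|x s| <= K) ->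
  `|\sum_(s : 'S_m) (-1) ^+ s * x s| <= #|{: 'S_m}|%:R * K.
Proof.
move=> xK; apply: (le_trans (ler_norm_sum _ _ _)).
have -> : #|{: 'S_m}|%:R * K = \sum_(s : 'S_m) K by rewrite sumr_const -[RHS]mulr_natl.
by apply: ler_sum => s _; rewrite normrM normrX normrN1 expr1n mul1r.
Qed.

Lemma patched_det_bound A J M (C : R) : 1 <= C -> (forall l k, `|A l k| <= 1) ->
  (forall l k, `|M l k| <= C) -> `|patched_det A J M| <= #|{: 'S_m}|%:R * C ^+ m.
Proof.
move=> C1 A1 MC; rewrite patched_detE; apply: det_sum_bound => s.
apply: (@prod_bound _ _ _ xpredT) => // l; case: (l \in J) => //.
exact: le_trans (A1 _ _) C1.
Qed.

Lemma det_lipschitz M N (C : R) : 1 <= C -> (forall l k, `|M l k| <= C) ->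
  (forall l k, `|N l k| <= C) -> forall K : 'I_m -> R, (forall l k, `|M l k - N l k| <= K l) ->
  `|\det M - \det N| <= #|{: 'S_m}|%:R * (C ^+ m * \sum_l K l).
Proof.
move=> C1 MC NC K MNK.
have -> : \det M - \det N = \sum_(s : 'S_m) (-1) ^+ s * (\prod_l M l (s l) - \prod_l N l (s l)).
  by rewrite -sumrB; apply: eq_bigr => s _; rewrite mulrBr.
apply: det_sum_bound => s; apply: (le_trans (product_lipschitz C1 _ _)) => //.
by apply: ler_wpM2l; [exact: exprn_ge0 (le_trans ler01 C1)|apply: ler_sum].
Qed.

(** The determinant vanishes when the two rows agree, and is Lipschitz in them. *)
Lemma patched_det_close A M i j (C K : R) : 1 <= C -> j != i -> (forall l k, `|A l k| <= 1) ->
  (forall l k, `|M l k| <= C) -> (forall k, `|M i k - M j k| <= K) ->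
  `|patched_det A [set i; j]%SET M| <= #|{: 'S_m}|%:R * (C ^+ m * K).
Proof.
move=> C1 ji A1 MC MK; rewrite /patched_det; set X := \matrix_(l, k) _.
pose Y : 'M[R]_m := \matrix_(l, k) (if l == j then X i k else X l k).
have Y0 : \det Y = 0.
  apply: (determinant_alternate (i1 := i) (i2 := j)); first by rewrite eq_sym.
  by move=> k; rewrite !mxE eqxx eq_sym (negbTE ji).
have XC l k : `|X l k| <= C.
  by rewrite mxE; case: ifP => // _; exact: le_trans (A1 _ _) C1.
rewrite -[\det X]subr0 -Y0.
apply: (le_trans (det_lipschitz C1 XC _ (K := fun l => if l == j then K else 0) _)).
- by move=> l k; rewrite [Y l k]mxE; case: ifP.
- move=> l k; rewrite [Y l k]mxE; case: eqP => [->|_]; last by rewrite subrr normr0.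
  by rewrite distrC !mxE !finset.in_set2 !eqxx orbT/=; exact: MK.
- by rewrite -big_mkcond big_pred1_eq.
Qed.

(** Leibniz's formula reduces the determinant to products of entries, one from
    each row. *)
Lemma det_expansion (A A' p q : 'M[R]_m) (d : 'I_m -> R) (kappa n C : R) :
  1 <= C -> 0 <= n -> (forall l k, `|A l k| <= 1) -> (forall l k, `|A' l k| <= 1) ->
  (forall l k, `|p l k| <= C) -> (forall l, `|d l| <= n) ->
  (forall l k, `|A' l k - A l k| <= C * n) ->
  (forall l k, `|A' l k - A l k - d l * p l k| <= C * n ^+ 2) ->
  (forall l k, `|A' l k - A l k - d l * p l k - (d l ^+ 2 / 2 - kappa) * q l k| <= C * n ^+ 3) ->
  `|\det A' - \det A - \sum_i d i * patched_det A [set i]%SET p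
    - \sum_i (d i ^+ 2 / 2 - kappa) * patched_det A [set i]%SET q
    - 2^-1 * \sum_i \sum_(j | j != i) d i * d j * patched_det A [set i; j]%SET p|
  <= #|{: 'S_m}|%:R * ((m%:R + m%:R ^+ 2 + #|{set 'I_m}|%:R * 2 ^+ m) * C ^+ 3 * n ^+ 3).
Proof.
move=> C1 n0 A1 A'1 pC dn h1 h2 h3.
pose x (s : 'S_m) := let a l := A l (s l) in let p' l := p l (s l) in
  let q' l := q l (s l) in
  \prod_l (a l + (A' l (s l) - A l (s l))) - \prod_l a l - \sum_i d i * patched a [set i]%SET p'
    - \sum_i (d i ^+ 2 / 2 - kappa) * patched a [set i]%SET q'
    - 2^-1 * \sum_i \sum_(j | j != i) d i * d j * patched a [set i; j]%SET p'.
have -> : \det A' - \det A - \sum_i d i * patched_det A [set i]%SET p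
    - \sum_i (d i ^+ 2 / 2 - kappa) * patched_det A [set i]%SET q
    - 2^-1 * \sum_i \sum_(j | j != i) d i * d j * patched_det A [set i; j]%SET p =
    \sum_(s : 'S_m) (-1) ^+ s * x s.
  have s1 (g : 'I_m -> R) M : \sum_i g i * patched_det A [set i]%SET M =
      \sum_(s : 'S_m) (-1) ^+ s * \sum_i g i * patched (fun l => A l (s l)) [set i]%SET (fun l => M l (s l)).
    under eq_bigr => i _ do rewrite patched_detE mulr_sumr.
    rewrite exchange_big/=; apply: eq_bigr => s _; rewrite mulr_sumr.
    by apply: eq_bigr => i _; rewrite mulrCA.
  rewrite !s1.
  have -> : \sum_i \sum_(j | j != i) d i * d j * patched_det A [set i; j]%SET p =
      \sum_(s : 'S_m) (-1) ^+ s * \sum_i \sum_(j | j != i) d i * d j *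
        patched (fun l => A l (s l)) [set i; j]%SET (fun l => p l (s l)).
    under eq_bigr => i _ do under eq_bigr => j _ do rewrite patched_detE mulr_sumr.
    under eq_bigr => i _ do rewrite exchange_big/=.
    rewrite exchange_big/=; apply: eq_bigr => s _; rewrite mulr_sumr.
    apply: eq_bigr => i _; rewrite mulr_sumr; apply: eq_bigr => j _.
    by rewrite mulrCA.
  rewrite mulr_sumr -!sumrB; apply: eq_bigr => s _; rewrite /x !mulrBr; congr (_ - _ - _ - _ - _).
    by congr (_ * _); apply: eq_bigr => l _; rewrite addrC subrK.
  by rewrite mulrCA.
apply: det_sum_bound => s; apply: product_expansion => //.
by move=> l; rewrite addrC subrK.
Qed.

End determinants.

(** * The transition function of coalescing Brownian motions *)

Lemma borel_det (R : realType) (m : nat) (h : 'I_m -> 'I_m -> R -> R) :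
  (forall l k, measurable_fun setT (h l k)) ->
  borel_vec (fun z : 'I_m -> R => \det (\matrix_(l, k) h l k (z l))).
Proof.
move=> mh d T G z sG mz.
apply: (wrt_sum sG) => s; apply: (wrtM sG); first exact: wrt_cst.
apply: (wrt_prod sG) => l.
by apply: (eq_wrt (fun w => esym (mxE _ _ _ _))); apply: wrt_comp.
Qed.

Lemma eq_borel_vec (R : realType) (I : Type) (f g : (I -> R) -> R) :
  f =1 g -> borel_vec f -> borel_vec g.
Proof. by move=> fg bf d T G z sG mz; apply: eq_wrt (bf d T G z sG mz) => w. Qed.

Section transition.
Context (R : realType) (m : nat).
Variable c : R.
Hypothesis c0 : 0 < c.
Implicit Types (x y : 'I_m -> R) (tau : R).

Definition heat_mx k y tau x : 'M[R]_m := \matrix_(l, j) heat c k (y j) tau (x l).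

Definition shifted_mx y tau x : 'M[R]_m :=
  \matrix_(l, j) (heat c 0 (y j) tau (x l) - (l < j)%:R).

(** Warren's determinantal formula for the probability that coalescing Brownian
    motions started from the ordered points [x] are below [y] after [tau]. *)
Definition coalescing_cdf y tau x : R := \det (shifted_mx y tau x).

Lemma shifted_mx_le1 y tau x l k : `|shifted_mx y tau x l k| <= 1.
Proof.
rewrite mxE; have := heat0_ge0 c (y k) tau (x l); have := heat0_le1 c (y k) tau (x l).
by case: (l < k)%N => h1 h2; rewrite /= ?mulr1n ?mulr0n ler_norml; apply/andP; split; lra.
Qed.

Lemma coalescing_cdf_bound y tau x : `|coalescing_cdf y tau x| <= #|{: 'S_m}|%:R.
Proof.
rewrite -[leRHS]mulr1; apply: det_sum_bound => s.
by apply: (@prod_le1 _ _ _ xpredT) => l; exact: shifted_mx_le1.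
Qed.

Let row_coef J k y tau x := patched_det (shifted_mx y tau x) J (heat_mx k y tau x).

Lemma borel_patched J k y tau : (k <= 3)%N -> borel_vec (row_coef J k y tau).
Proof.
move=> k3.
apply: (@eq_borel_vec _ _ (fun z => \det (\matrix_(l, j)
  (if l \in J then heat c k (y j) tau (z l) else heat c 0 (y j) tau (z l) - (l < j)%:R)))).
  by move=> z; congr (\det _); apply/matrixP => l j; rewrite !mxE.
apply: (@borel_det _ _ (fun l j u => if l \in J then heat c k (y j) tau u
  else heat c 0 (y j) tau u - (l < j)%:R)) => l j; case: (l \in J).
  by apply: continuous_measurable_fun; exact: continuous_heat.
by apply: measurable_funB => //; apply: continuous_measurable_fun; exact: continuous_heat.
Qed.

Lemma borel_coalescing_cdf y tau : borel_vec (coalescing_cdf y tau).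
Proof.
apply: (@borel_det _ _ (fun l j u => heat c 0 (y j) tau u - (l < j)%:R)) => l j.
by apply: measurable_funB => //; apply: continuous_measurable_fun; exact: continuous_heat.
Qed.

Section fixed_horizon.
Variables e t0 : R.
Hypotheses (e0 : 0 < e) (t00 : 0 <= t0).
Implicit Types v : R.

Let U y v x := coalescing_cdf y (t0 + e - v) x.
Let al y i v x := row_coef [set i]%SET 1 y (t0 + e - v) x.
Let be y i j v x := if i == j then 2^-1 * row_coef [set i]%SET 2 y (t0 + e - v) x
  else 2^-1 * row_coef [set i; j]%SET 1 y (t0 + e - v) x.
Let ga y v x := - (c / 2) * \sum_i row_coef [set i]%SET 2 y (t0 + e - v) x.

(** The rows of the determinant solve the backward heat equation, so its drift
    is the Brownian generator; the mixed second derivatives have two equal rows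
    where two coordinates meet. *)
Theorem cdf_expansion : exists C : R, 0 <= C /\ forall y, exists al be ga,
  [/\ expansion t0 C (U y) al be ga,
    forall v x x', 0 <= v -> v <= t0 -> `|U y v x - U y v x'| <= C * \sum_i `|x i - x' i|,
    forall v x i j, 0 <= v -> v <= t0 -> i != j -> `|be i j v x| <= C * `|x i - x j| &
    forall v x, c * \sum_i be i i v x + ga v x = 0].
Proof.
have [B [B0 hB]] := heat_bounded c0 e0.
have [D [D0 hD]] := heat_taylor c0 t0 e0.
have [L [L0 hL]] := heat_lipschitz c0 e0.
pose N : R := #|{: 'S_m}|%:R; have N0 : 0 <= N by [].
pose K := 1 + B + D; have K1 : 1 <= K by rewrite /K -addrA lerDl addr_ge0.
have K0 : 0 <= K := le_trans ler01 K1.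
have BK : B <= K by rewrite /K addrAC lerDr addr_ge0.
have DK : D <= K by rewrite /K lerDr addr_ge0.
have Km : 0 <= K ^+ m by exact: exprn_ge0.
pose C1 := N * ((m%:R + m%:R ^+ 2 + #|{set 'I_m}|%:R * 2 ^+ m) * K ^+ 3).
pose C2 := N * K ^+ m.
have C10 : 0 <= C1 by rewrite !mulr_ge0 ?addr_ge0 ?mulr_ge0 ?exprn_ge0.
have C20 : 0 <= C2 by exact: mulr_ge0.
pose C := C1 + C2 + c * m%:R * C2 + N * D + C2 * L.
have cm : 0 <= c * m%:R * C2 by rewrite !mulr_ge0// ltW.
have ND : 0 <= N * D by exact: mulr_ge0.
have C2L : 0 <= C2 * L by exact: mulr_ge0.
have C0 : 0 <= C by rewrite /C !addr_ge0.
have C1C : C1 <= C by rewrite /C; lra.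
have C2C : C2 <= C by rewrite /C; lra.
exists C; split=> // y; exists (al y), (be y), (ga y).
have etau v : v <= t0 -> e <= t0 + e - v by move=> vt; lra.
have row_bound J k v x : (k <= 4)%N -> v <= t0 -> `|row_coef J k y (t0 + e - v) x| <= C2.
  move=> k4 vt; apply: patched_det_bound => // [l j|l j]; first exact: shifted_mx_le1.
  by rewrite mxE; apply: le_trans BK; apply: hB => //; exact: etau.
have half : `|2^-1 : R| = 2^-1 by rewrite ger0_norm.
split.
- split.
  + move=> v v' x x' v0 vv v't; set n := psize _ _.
    have vt := le_trans vv v't.
    pose tau := t0 + e - v; pose tau' := t0 + e - v'.
    have tt : tau' - tau = - (v' - v) by rewrite /tau /tau'; ring.
    have att : `|tau' - tau| = v' - v by rewrite tt normrN ger0_norm// subr_ge0.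
    have tt0 : `|tau' - tau| <= t0 by rewrite att; lra.
    have n0 : 0 <= n by exact: psize_ge0.
    have nl l : Num.sqrt `|tau' - tau| + `|x' l - x l| <= n.
      by rewrite att /n /psize lerD2l (bigD1 l)//= lerDl sumr_ge0.
    have nl0 l : 0 <= Num.sqrt `|tau' - tau| + `|x' l - x l| by rewrite addr_ge0.
    have ent l j : shifted_mx y tau' x' l j - shifted_mx y tau x l j =
        heat c 0 (y j) tau' (x' l) - heat c 0 (y j) tau (x l) by rewrite !mxE; ring.
    have up k l : D * (Num.sqrt `|tau' - tau| + `|x' l - x l|) ^+ k <= K * n ^+ k.
      by apply: ler_pM => //; first [exact: exprn_ge0|apply: lerXn2r; rewrite ?nnegrE].
    have tay l j := hD (y j) tau tau' (x l) (x' l) (etau v vt) (etau v' v't) tt0.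
    have hp l j : `|heat_mx 1 y tau x l j| <= K.
      by rewrite mxE; apply: le_trans BK; apply: hB => //; exact: etau.
    have hd l : `|x' l - x l| <= n.
      by apply: le_trans (nl l); rewrite lerDr.
    have h1 l j : `|shifted_mx y tau' x' l j - shifted_mx y tau x l j| <= K * n.
      by rewrite ent; have [_ _ h] := tay l j; apply: le_trans h (up 1%N l).
    have h2 l j : `|shifted_mx y tau' x' l j - shifted_mx y tau x l j
        - (x' l - x l) * heat_mx 1 y tau x l j| <= K * n ^+ 2.
      rewrite ent mxE [_ * heat _ _ _ _ _]mulrC; have [_ h _] := tay l j.
      exact: le_trans h (up 2%N l).
    have h3 l j : `|shifted_mx y tau' x' l j - shifted_mx y tau x l j
        - (x' l - x l) * heat_mx 1 y tau x l j
        - ((x' l - x l) ^+ 2 / 2 - c / 2 * (v' - v)) * heat_mx 2 y tau x l j| <= K * n ^+ 3.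
      rewrite ent !mxE [(x' l - x l) * _]mulrC [(_ - _) * heat _ _ _ _ _]mulrC.
      have [h _ _] := tay l j; rewrite tt mulrN in h.
      by have up3 := up 3%N l; rewrite tt in up3; exact: le_trans h up3.
    have main := det_expansion K1 n0 (shifted_mx_le1 y tau x) (shifted_mx_le1 y tau' x')
      hp hd h1 h2 h3.
    apply: (@le_trans _ _ (C1 * n ^+ 3)); last by rewrite ler_wpM2r// exprn_ge0.
    rewrite /C1 -[leRHS]mulrA; apply: le_trans main.
    rewrite le_eqVlt; apply/orP; left; apply/eqP; congr `|_|.
    rewrite /U /al /be /ga -/tau -/tau'.
    have e1 : \sum_(i < m) row_coef [set i]%SET 1 y tau x * (x' i - x i) =
        \sum_i (x' i - x i) * patched_det (shifted_mx y tau x) [set i]%SET (heat_mx 1 y tau x).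
      by apply: eq_bigr => i _; rewrite mulrC.
    have e2 : \sum_(i < m) \sum_(j < m) (if i == j then 2^-1 * row_coef [set i]%SET 2 y tau x
        else 2^-1 * row_coef [set i; j]%SET 1 y tau x) * ((x' i - x i) * (x' j - x j))
      + - (c / 2) * (\sum_i row_coef [set i]%SET 2 y tau x) * (v' - v) =
      \sum_i ((x' i - x i) ^+ 2 / 2 - c / 2 * (v' - v)) *
         patched_det (shifted_mx y tau x) [set i]%SET (heat_mx 2 y tau x) +
      2^-1 * \sum_i \sum_(j | j != i) (x' i - x i) * (x' j - x j) *
         patched_det (shifted_mx y tau x) [set i; j]%SET (heat_mx 1 y tau x).
      have -> : - (c / 2) * (\sum_i row_coef [set i]%SET 2 y tau x) * (v' - v) =
          \sum_i - (c / 2) * (v' - v) * row_coef [set i]%SET 2 y tau x.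
        by rewrite -mulr_sumr; ring.
      have pull (X : 'I_m -> R) : 2^-1 * \sum_i X i = \sum_i 2^-1 * X i by rewrite mulr_sumr.
      rewrite pull -!big_split/=; apply: eq_bigr => i _.
      rewrite (bigD1 i)//= eqxx (eq_bigr (fun j => 2^-1 * ((x' i - x i) * (x' j - x j) *
         patched_det (shifted_mx y tau x) [set i; j]%SET (heat_mx 1 y tau x)))); last first.
        by move=> j ji; rewrite eq_sym (negbTE ji) /row_coef; ring.
      rewrite -mulr_sumr /row_coef; set S := \sum_(j | _) _; move: (patched_det _ _ _) => Q.
      by rewrite addrAC; congr (_ + _); field.
    rewrite e1; move: e2; set X := \sum_i \sum_j _; set Y := _ * (v' - v).
    set Z := \sum_i _; set Z' := 2^-1 * _ => e2.
    by rewrite -[LHS]addrA -opprD e2 opprD addrA.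
  + by move=> v; exact: borel_coalescing_cdf.
  + by move=> i v; exact: borel_patched.
  + move=> i j v; rewrite /be; case: (i == j) => d T G z sG mz;
      by apply: (wrtM sG); [exact: wrt_cst|exact: borel_patched].
  + move=> v d T G z sG mz; apply: (wrtM sG); first exact: wrt_cst.
    by apply: (wrt_sum sG) => i; exact: borel_patched.
  + by move=> i v x _ vt; apply: le_trans (row_bound _ _ _ _ _ vt) C2C.
  + move=> i j v x _ vt; apply: le_trans C2C; rewrite /be.
    have h (z : R) : `|z| <= C2 -> `|2^-1 * z| <= C2.
      by move=> zC; rewrite normrM half ler_pdivrMl//; lra.
    by case: ifP => _; apply: h; exact: row_bound.
  + move=> v x _ vt; have c2 : 0 <= c / 2 by rewrite divr_ge0// ltW.
    rewrite normrM normrN (ger0_norm c2).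
    apply: (@le_trans _ _ (c * m%:R * C2)); last by rewrite /C; lra.
    rewrite -mulrA; apply: ler_pM => //; first by have := ltW c0; lra.
    apply: (le_trans (ler_norm_sum _ _ _)).
    have -> : m%:R * C2 = \sum_(i < m) C2 by rewrite sumr_const card_ord -[RHS]mulr_natl.
    by apply: ler_sum => i _; exact: row_bound.
- move=> v x x' _ vt.
  have := @det_lipschitz R m (shifted_mx y (t0 + e - v) x) (shifted_mx y (t0 + e - v) x') 1
    (lexx 1) (shifted_mx_le1 _ _ _) (shifted_mx_le1 _ _ _) (fun l => D * `|x l - x' l|).
  move=> /(_ _)/le_trans; apply.
    move=> l j; rewrite !mxE opprB addrA subrK.
    have := hD (y j) (t0 + e - v) (t0 + e - v) (x' l) (x l) (etau v vt) (etau v vt).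
    by rewrite subrr normr0 sqrtr0 add0r => /(_ t00)[].
  rewrite expr1n mul1r -mulr_sumr mulrA ler_wpM2r ?sumr_ge0//.
  by rewrite /C -/N; lra.
- move=> v x i j _ vt ij; rewrite /be (negbTE ij) normrM half.
  have := @patched_det_close R m (shifted_mx y (t0 + e - v) x) (heat_mx 1 y (t0 + e - v) x) i j K
    (L * `|x i - x j|) K1 _ (shifted_mx_le1 _ _ _).
  rewrite eq_sym => /(_ ij) h.
  have {}h : `|row_coef [set i; j]%SET 1 y (t0 + e - v) x| <= N * (K ^+ m * (L * `|x i - x j|)).
    apply: h => [l k|k]; first by rewrite mxE; apply: le_trans BK; apply: hB => //; exact: etau.
    by rewrite !mxE; apply: hL => //; exact: etau.
  rewrite ler_pdivrMl//; apply: (le_trans h).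
  have -> : N * (K ^+ m * (L * `|x i - x j|)) = C2 * L * `|x i - x j| by rewrite /C2; ring.
  by rewrite mulrA ler_wpM2r// /C; lra.
- move=> v x; rewrite /be /ga.
  under eq_bigr do rewrite eqxx.
  by rewrite -mulr_sumr; ring.
Qed.

End fixed_horizon.
End transition.

Section limits_of_cdf.
Context (R : realType) (m : nat).
Variable c : R.
Hypothesis c0 : 0 < c.
Implicit Types (x y : 'I_m -> R) (tau e : R).
Local Notation cdf := (coalescing_cdf c).

Lemma cdf_lipschitz e : 0 < e -> exists C : R, 0 <= C /\ forall y tau x x', e <= tau ->
  `|cdf y tau x - cdf y tau x'| <= C * \sum_i `|x i - x' i|.
Proof.
move=> e0; have [L [L0 hL]] := heat_lipschitz c0 e0.
exists (#|{: 'S_m}|%:R * L); split; first exact: mulr_ge0.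
move=> y tau x x' et.
have h := @det_lipschitz R m (shifted_mx c y tau x) (shifted_mx c y tau x') 1
  (lexx 1) (shifted_mx_le1 _ _ _ _) (shifted_mx_le1 _ _ _ _) (fun l => L * `|x l - x' l|).
apply: (le_trans (h _)) => [l j|].
  by rewrite !mxE opprB addrA subrK; exact: hL.
by rewrite expr1n mul1r -mulr_sumr mulrA.
Qed.

Lemma cdf_time e : 0 < e -> exists C : R, 0 <= C /\ forall y tau tau' x,
  e <= tau -> e <= tau' -> `|tau' - tau| <= 1 ->
  `|cdf y tau' x - cdf y tau x| <= C * Num.sqrt `|tau' - tau|.
Proof.
move=> e0; have [D [D0 hD]] := heat_taylor c0 1 e0.
exists (#|{: 'S_m}|%:R * (m%:R * D)); split; first by rewrite !mulr_ge0.
move=> y tau tau' x et et' tt.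
have h := @det_lipschitz R m (shifted_mx c y tau' x) (shifted_mx c y tau x) 1
  (lexx 1) (shifted_mx_le1 _ _ _ _) (shifted_mx_le1 _ _ _ _)
  (fun l => D * Num.sqrt `|tau' - tau|).
apply: (le_trans (h _)) => [l j|].
  have [_ _ h3] := hD (y j) tau tau' (x l) (x l) et et' tt.
  have sE t : shifted_mx c y t x l j = heat c 0 (y j) t (x l) - (l < j)%N%:R by rewrite mxE.
  have le (a b k B : R) : `|a - b| <= B * (Num.sqrt `|tau' - tau| + `|x l - x l|) ->
      `|a - k - (b - k)| <= B * Num.sqrt `|tau' - tau|.
    by rewrite subrr normr0 addr0 (_ : a - k - (b - k) = a - b)//; ring.
  exact: (eq_ind_r (fun z => z <= _) (le _ _ _ _ h3)
    (f_equal2 (fun a b : R => `|a - b|) (sE tau') (sE tau))).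
by rewrite expr1n mul1r sumr_const card_ord -[X in _ * X <= _]mulr_natl !mulrA.
Qed.

Definition sorted_vec x : Prop := forall i j : 'I_m, (i <= j)%N -> x i <= x j.

Definition step_mx y x : 'M[R]_m := \matrix_(l, j) ((x l < y j)%R%:R - (l < j)%N%:R).

(** As the time to go vanishes the entries become 0, 1 or -1. If all [x i] lie
    below [y i] the limit matrix is unitriangular; if [x k] is above [y k] it has
    a block of zeros too large for any permutation to avoid. *)
Lemma det_step_mx y x : sorted_vec y -> sorted_vec x -> (forall i j, x i != y j) ->
  \det (step_mx y x) = [forall i, x i <= y i]%:R.
Proof.
move=> sy sx xy; case: (boolP [forall i, x i <= y i]) => [/forallP below|].
  rewrite det_trig; last first.
    apply/is_trig_mxP => i j ij; rewrite mxE ij.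
    have -> : x i < y j by rewrite lt_neqAle xy (le_trans (below i))// sy// ltnW.
    by rewrite subrr.
  rewrite big1 // => i _; rewrite mxE ltnn subr0.
  by rewrite lt_neqAle xy below.
rewrite negb_forall => /existsP[k]; rewrite -ltNge => yx.
rewrite /determinant big1// => s _.
have [i /andP[ki sk]] : exists i : 'I_m, (k <= i)%N && (s i <= k)%N.
  apply/existsP; apply: contraT; rewrite negb_exists => /forallP h.
  pose A : {set 'I_m} := [set i : 'I_m | (k <= i)%N]%SET.
  pose B : {set 'I_m} := [set i : 'I_m | (k < i)%N]%SET.
  have : (#|A| <= #|B|)%N.
    rewrite -(card_imset A (@perm_inj _ s)); apply: subset_leq_card.
    apply/fintype.subsetP => j /imsetP[i]; rewrite inE => ki ->; rewrite inE.
    by have := h i; rewrite ki/= -ltnNge.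
  rewrite leqNgt => /negP[]; apply: proper_card; apply/fintype.properP; split.
    by apply/fintype.subsetP => j; rewrite !inE => /ltnW.
  by exists k; rewrite !inE ?leqnn// ltnn.
rewrite (bigD1 i)//= mxE.
have -> : (x i < y (s i)) = false.
  by apply/negbTE; rewrite -leNgt (le_trans (sy _ _ sk))// (le_trans (ltW yx))// sx.
by rewrite ltnNge (leq_trans sk ki) subrr !mul0r mulr0.
Qed.

Lemma heat0_step tau eta (y x : R) : 0 < tau -> 0 < eta -> eta <= `|x - y| ->
  `|heat c 0 y tau x - (x < y)%R%:R| <= c * tau / eta ^+ 2.
Proof.
move=> t0 h0 xy; have r0 := rate_gt0 c tau; have r2 := rate_sqr c0 t0.
have ct : 0 < c * tau by exact: mulr_gt0.
pose z := rate c tau * (y - x).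
have zz : z ^- 2 <= c * tau / eta ^+ 2.
  have -> : c * tau / eta ^+ 2 = (rate c tau ^+ 2 * eta ^+ 2)^-1.
    by rewrite r2; field; rewrite !gt_eqF.
  have d0 : 0 < `|x - y| by exact: lt_le_trans xy.
  have yx2 : eta ^+ 2 <= (y - x) ^+ 2.
    rewrite -[leRHS]real_normK ?num_real// distrC.
    by apply: lerXn2r; rewrite ?nnegrE ?(ltW h0) ?(ltW d0).
  have e20 : 0 < eta ^+ 2 by exact: exprn_gt0.
  have rr : 0 < rate c tau ^+ 2 by exact: exprn_gt0.
  have z20 : 0 < z ^+ 2 by rewrite /z exprMn mulr_gt0// (lt_le_trans e20).
  rewrite lef_pV2 ?posrE//; last exact: mulr_gt0.
  by rewrite /z exprMn ler_pM2l.
have -> : heat c 0 y tau x = Phi z by rewrite heat0E.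
apply: le_trans zz.
have [xy'|yx|E] := ltgtP x y.
- rewrite distrC ger0_norm ?subr_ge0 ?Phi_le1//; apply: Phi_ge_sqr.
  by rewrite mulr_gt0// subr_gt0.
- rewrite subr0 ger0_norm ?Phi_ge0//; apply: Phi_le_sqr.
  by rewrite pmulr_rlt0// subr_lt0.
- by move: xy; rewrite E subrr normr0 => /(lt_le_trans h0); rewrite ltxx.
Qed.

(** By Chebyshev's inequality the entries are close to those of the limit matrix. *)
Lemma cdf_terminal tau eta y x : 0 < tau -> 0 < eta -> sorted_vec y -> sorted_vec x ->
  (forall i j, eta <= `|x i - y j|) ->
  `|cdf y tau x - [forall i, x i <= y i]%:R| <= #|{: 'S_m}|%:R * (m%:R * (c * tau / eta ^+ 2)).
Proof.
move=> t0 h0 sy sx far.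
rewrite -det_step_mx//; last first.
  move=> i j; apply/eqP => E; have := far i j.
  by rewrite E subrr normr0 => /(lt_le_trans h0); rewrite ltxx.
have step1 l k : `|step_mx y x l k| <= 1.
  rewrite mxE; case: (x l < y k); case: (l < k)%N;
  by rewrite /= ?mulr1n ?mulr0n ler_norml; apply/andP; split; lra.
have h := @det_lipschitz R m (shifted_mx c y tau x) (step_mx y x) 1
  (lexx 1) (shifted_mx_le1 _ _ _ _) step1 (fun l => c * tau / eta ^+ 2).
apply: (le_trans (h _)) => [l j|].
  by rewrite !mxE opprB addrA subrK; exact: heat0_step.
by rewrite expr1n mul1r sumr_const card_ord -[X in _ * X <= _]mulr_natl.
Qed.

End limits_of_cdf.

(** * Families of flows *)

Lemma abs_int_le_ae d (T : measurableType d) (R : realType)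
    (mu : {measure set T -> \bar R}) (f g : T -> R) :
  L1 mu f -> L1 mu g -> (forall x, 0 <= g x) -> {ae mu, forall x, `|f x| <= g x} ->
  `|\int[mu]_x f x| <= \int[mu]_x g x.
Proof.
move=> lf lg g0 fg; apply: (le_trans (abs_int_le lf)).
have lf' := L1_abs lf.
rewrite -lee_fin -(int_EFin lf') -(int_EFin lg); apply: ae_ge0_le_integral => //.
- by case/integrableP : lf'.
- by move=> x _; rewrite lee_fin.
- by case/integrableP : lg.
- by apply: filterS fg => x h _; rewrite lee_fin.
Qed.

Section below.
Context (R : realType) (m : nat).
Implicit Types (x y : 'I_m -> R).

Definition below y x : R := [forall i, x i <= y i]%:R.

Lemma belowE y x : below y x = \prod_i \1_(`]-oo, y i]%classic) (x i).
Proof.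
rewrite /below; case: (boolP [forall i, x i <= y i]) => [/forallP h|].
  by rewrite big1// => i _; rewrite indicE mem_set//= in_itv/= h.
rewrite negb_forall => /existsP[i xi]; rewrite (bigD1 i)//= indicE memNset ?mul0r//=.
by rewrite in_itv/=; exact/negP.
Qed.

Lemma below_ge0 y x : 0 <= below y x. Proof. exact: ler0n. Qed.

Lemma below_le1 y x : below y x <= 1.
Proof. by rewrite /below; case: [forall i, _]. Qed.

Lemma below_norm y x : `|below y x| <= 1.
Proof. by rewrite ger0_norm ?below_ge0// below_le1. Qed.

Lemma borel_below y : borel_vec (below y).
Proof.
apply: (eq_borel_vec (fun x => esym (belowE y x))) => d T G z sG mz.
apply: (wrt_prod sG) => i.
apply: (wrt_comp sG (h := \1_(`]-oo, y i]%classic))) (mz i).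
by apply: measurable_indic; exact: measurable_itv.
Qed.

(** For ordered [x], being below [y] is being below the largest monotone
    minorant of [y]. *)
Definition monotone_minorant y (i : 'I_m) : R := \big[Num.min/y i]_(j < m | (i <= j)%N) y j.

Lemma monotone_minorantP y (i : 'I_m) z :
  (z <= monotone_minorant y i) <-> (forall j : 'I_m, (i <= j)%N -> z <= y j).
Proof.
rewrite /monotone_minorant; split=> [h j ij|h].
  by apply: (le_trans h); rewrite (bigD1 j)//= ge_min lexx.
elim/big_ind: _ => [|u v zu zv|j ij]; first exact: h.
  by rewrite le_min zu zv.
exact: h.
Qed.

Lemma sorted_monotone_minorant y : sorted_vec (monotone_minorant y).
Proof.
move=> i j ij; apply/monotone_minorantP => k jk.
by have /monotone_minorantP := lexx (monotone_minorant y i); apply; exact: leq_trans jk.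
Qed.

Lemma below_monotone_minorant y x : sorted_vec x -> below y x = below (monotone_minorant y) x.
Proof.
move=> sx; congr (_%:R); congr nat_of_bool; apply/forallP/forallP => h i.
  by apply/monotone_minorantP => j ij; exact: le_trans (sx _ _ ij) (h j).
by have /monotone_minorantP := h i; apply.
Qed.

End below.

(** All that the two systems have in common, and all that their
    finite-dimensional distributions depend on. By [flow_drift] the transition
    function of coalescing Brownian motions is asymptotically a martingale along
    [x]; by [flow_single] it is exactly one for single particles from time 0 on,
    which controls the tails and the probabilities of small balls. The filter
    serves to restrict the parameter to values for which the particles start in
    increasing order. *)
Record flow_family (R : realType) (I : Type) (FF : set_system I) (d : I -> measure_display)
    (T : forall th, measurableType (d th)) (P : forall th, probability (T th) R)
    (F : forall th, R -> set (set (T th))) (m : nat) (c : R) (b : 'I_m -> R)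
    (x : forall th, 'I_m -> R -> T th -> R) : Prop := {
  flow_filtration : \forall th \near FF,
    is_filtration (F th) /\ forall i, adapted (F th) (x th i);
  flow_start : forall delta, 0 < delta -> \forall th \near FF, forall i,
    {ae P th, forall w, `|x th i 0 w - b i| <= delta};
  flow_order : \forall th \near FF, forall t, 0 <= t ->
    {ae P th, forall w, sorted_vec (fun i => x th i t w)};
  flow_drift : forall e t delta, 0 < e -> 0 <= t -> 0 < delta ->
    \forall th \near FF, forall s y zeta, 0 <= s -> s <= t ->
    measurable_wrt (F th s) zeta -> (forall w, `|zeta w| <= 1) ->
    `|\int[P th]_w (zeta w * (coalescing_cdf c y e (fun i => x th i t w) -
        coalescing_cdf c y (e + t - s) (fun i => x th i s w)))| <= delta;
  flow_single : \forall th \near FF, forall i e t y, 0 < e -> 0 <= t ->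
    \int[P th]_w heat c 0 y e (x th i t w) = \int[P th]_w heat c 0 y (e + t) (x th i 0 w) }.

Section one_point.
Context d (T : measurableType d) (R : realType) (P : probability T R).
Variable c : R.
Hypothesis c0 : 0 < c.
Variable x : R -> T -> R.
Hypothesis mx : forall t, 0 <= t -> measurable_fun setT (x t).
Hypothesis single : forall e t y, 0 < e -> 0 <= t ->
  \int[P]_w heat c 0 y e (x t w) = \int[P]_w heat c 0 y (e + t) (x 0 w).

Lemma measurable_heat k y e t : (k <= 3)%N -> 0 <= t ->
  measurable_fun setT (fun w => heat c k y e (x t w)).
Proof.
move=> k3 t0; apply: (measurableT_comp _ (mx t0)).
by apply: continuous_measurable_fun; exact: continuous_heat.
Qed.

Lemma heat0_norm y e z : `|heat c 0 y e z| <= 1.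
Proof. by rewrite ger0_norm ?heat0_ge0// heat0_le1. Qed.

Lemma L1_heat0 y e t : 0 <= t -> L1 P (fun w => heat c 0 y e (x t w)).
Proof. by move=> t0; apply: L1_bdd (fun w => heat0_norm y e _); exact: measurable_heat. Qed.

(** The probability of a small interval is controlled by the modulus of
    continuity of the distribution function at a positive time. *)
Lemma small_ball t L : 0 < t -> 0 <= L ->
  (forall k y tau z z', (k <= 3)%N -> t <= tau ->
     `|heat c k y tau z' - heat c k y tau z| <= L * `|z' - z|) ->
  forall y eta, 0 < eta ->
  L1 P (fun w => \1_[set w | `|x t w - y| < eta] w : R) /\
  \int[P]_w \1_[set w | `|x t w - y| < eta] w <= 8 * L * eta.
Proof.
move=> t0 L0 hL; have t00 := ltW t0.
move=> y eta eta0; pose e := eta ^+ 2 / (4 * c).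
have e0 : 0 < e by rewrite divr_gt0 ?exprn_gt0 ?mulr_gt0.
have ce : c * e / eta ^+ 2 = 4^-1.
  by rewrite /e; field; rewrite !gt_eqF.
pose D w := heat c 0 (y + 2 * eta) e (x t w) - heat c 0 (y - 2 * eta) e (x t w).
have lD : L1 P D by apply: L1B; exact: L1_heat0.
have mA : measurable [set w | `|x t w - y| < eta].
  have mxy : measurable_fun setT (fun w => `|x t w - y|).
    by apply: measurableT_comp => //; apply: measurable_funB => //; exact: mx.
  have -> : [set w | `|x t w - y| < eta] = (fun w => `|x t w - y|) @^-1` `]-oo, eta[%classic.
    by apply/seteqP; split=> w /=; rewrite in_itv.
  by rewrite -[X in measurable X]setTI; apply: mxy => //; exact: measurable_itv.
have lI : L1 P (fun w => \1_[set w | `|x t w - y| < eta] w : R).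
  apply: (@L1_bdd _ _ _ _ 1); first exact: measurable_indic.
  by move=> w; rewrite indicE; case: (_ \in _); rewrite ?normr1 ?normr0.
split=> //.
have le w : 2^-1 * \1_[set w | `|x t w - y| < eta] w <= D w.
  rewrite indicE; case: (boolP (w \in _)) => [/set_mem/=|_].
    rewrite ltr_norml => /andP[a b]; rewrite mulr1.
    have h1 := @heat0_step R c c0 e eta (y + 2 * eta) (x t w) e0 eta0.
    have h2 := @heat0_step R c c0 e eta (y - 2 * eta) (x t w) e0 eta0.
    have {}h1 := h1 _; have {}h2 := h2 _; rewrite ce in h1 h2.
    have l1 : x t w < y + 2 * eta by lra.
    have l2 : (x t w < y - 2 * eta) = false by apply/negbTE; rewrite -leNgt; lra.
    rewrite l1 l2 in h1 h2.
    have {}h1 := h1 (ltac:(rewrite ltr0_norm; lra)).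
    have {}h2 := h2 (ltac:(rewrite gtr0_norm; lra)).
    move: h1 h2; rewrite /D subr0 !ler_norml => /andP[h1 _] /andP[_ h2].
    by move: h1 h2; rewrite /= mulr1n; move: (heat _ _ _ _ _) => u; move: (heat _ _ _ _ _) => v; lra.
  rewrite mulr0 /D subr_ge0 !heat0E; apply: Phi_homo.
  by rewrite ler_pM2l ?rate_gt0//; lra.
have h1 : 2^-1 * \int[P]_w \1_[set w | `|x t w - y| < eta] w <= \int[P]_w D w.
  by rewrite -(intZ 2^-1 lI); apply: int_le le => //; exact: L1Z.
have h2 : \int[P]_w D w <= 4 * eta * L.
  rewrite /D intB; [|exact: L1_heat0|exact: L1_heat0].
  rewrite (single (y + 2 * eta) e0 t00) (single (y - 2 * eta) e0 t00).
  rewrite -intB; [|exact: L1_heat0|exact: L1_heat0].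
  apply: (le_trans (ler_norm _)); apply: int_bdd.
    by apply: measurable_funB; exact: measurable_heat.
  move=> w; have -> : heat c 0 (y + 2 * eta) (e + t) (x 0 w) = heat c 0 (y - 2 * eta) (e + t) (x 0 w - 4 * eta).
    by rewrite heat_shift; congr (heat c 0 _ _ _); ring.
  have et : t <= e + t by rewrite lerDr ltW.
  apply: (le_trans (hL 0%N _ _ _ _ isT et)).
  rewrite mulrC ler_wpM2r// (_ : x 0 w - 4 * eta - x 0 w = - (4 * eta)); last by ring.
  by rewrite normrN ger0_norm// mulr_ge0// ltW.
by move: h1 h2; lra.
Qed.

(** The heat kernel with one unit of time to go dominates a multiple of the
    indicator of a tail, and Chebyshev's inequality bounds its mean. *)
Lemma tails t beta delta A : 0 <= t -> 0 <= beta -> 0 < delta ->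
  {ae P, forall w, `|x 0 w| <= beta} ->
  2 + 4 * c + beta + 4 * c * (1 + t) / delta <= A ->
  L1 P (fun w => 1 - \1_(`]- A, A]%classic) (x t w) : R) /\
  \int[P]_w (1 - \1_(`]- A, A]%classic) (x t w)) <= delta.
Proof.
move=> t0 b0 d0 xb hA.
pose eta := 1 + 4 * c; have eta0 : 0 < eta by rewrite /eta addr_gt0// mulr_gt0.
have ce : c * 1 / eta ^+ 2 <= 4^-1.
  by rewrite mulr1 ler_pdivrMr ?exprn_gt0// /eta; have := sqr_ge0 (4 * c); nra.
pose K := 4 * c * (1 + t) / delta.
have cc := ltW c0; have dd := ltW d0.
have K0 : 0 <= K by rewrite /K divr_ge0// !mulr_ge0// addr_ge0.
pose D := 1 + K; have D0 : 0 < D by rewrite /D ltr_pwDl.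
have Dd : c * (1 + t) / D ^+ 2 <= delta / 4.
  rewrite ler_pdivrMr ?exprn_gt0//.
  have -> : c * (1 + t) = delta / 4 * K by rewrite /K; field; rewrite gt_eqF.
  by apply: ler_wpM2l; [rewrite divr_ge0// ltW|rewrite /D; nra].
have AD : D <= A - eta - beta by rewrite /D /eta /K; lra.
pose y1 := - A + eta; pose y2 := A - eta.
have e1 : (0 : R) < 1 by [].
have tt1 : 0 < 1 + t by rewrite ltr_pwDl.
have h1 z : z <= - A -> 1 - 4^-1 <= heat c 0 y1 1 z.
  move=> zA; have := @heat0_step R c c0 1 eta y1 z e1 eta0.
  have l : z < y1 by rewrite /y1; lra.
  rewrite l => /(_ (ltac:(rewrite ltr0_norm /y1; lra)))/le_trans/(_ ce).
  rewrite ler_norml => /andP[+ _]; rewrite /= mulr1n.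
  by move: (heat _ _ _ _ _) => u; lra.
have h2 z : A <= z -> heat c 0 y2 1 z <= 4^-1.
  move=> zA; have := @heat0_step R c c0 1 eta y2 z e1 eta0.
  have l : (z < y2) = false by apply/negbTE; rewrite -leNgt /y2; lra.
  rewrite l => /(_ (ltac:(rewrite ger0_norm /y2; lra)))/le_trans/(_ ce).
  by rewrite subr0 ler_norml => /andP[_].
pose Dw w := heat c 0 y1 1 (x t w) + (1 - heat c 0 y2 1 (x t w)).
have l1 : L1 P (fun w => heat c 0 y1 1 (x t w)) by exact: L1_heat0.
have l2 : L1 P (fun w => 1 - heat c 0 y2 1 (x t w)).
  by apply: L1B; [exact: L1_cst|exact: L1_heat0].
have lD : L1 P (fun w => 2 * Dw w) by apply: L1Z; exact: L1D.
have mI : measurable_fun setT (fun w => 1 - \1_(`]- A, A]%classic) (x t w) : R).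
  apply: measurable_funB => //; apply: (measurableT_comp _ (mx t0)).
  by apply: measurable_indic; exact: measurable_itv.
have lI : L1 P (fun w => 1 - \1_(`]- A, A]%classic) (x t w) : R).
  apply: (@L1_bdd _ _ _ _ 1) => // w; rewrite indicE; case: (_ \in _);
  by rewrite /= ?subrr ?subr0 ?normr0 ?normr1.
split=> //.
have le w : 1 - \1_(`]- A, A]%classic) (x t w) <= 2 * Dw w.
  rewrite /Dw; have a1 := heat0_ge0 c y1 1 (x t w); have a2 := heat0_le1 c y2 1 (x t w).
  rewrite indicE; case: (boolP (_ \in _)) => [_|]; first by rewrite subrr; lra.
  have [xA _|xA] := leP (x t w) (- A); first by have := h1 _ xA; rewrite /= mulr0n; lra.
  have [xA'|xA' _] := leP (x t w) A.
    by rewrite mem_set//= in_itv/= xA xA'.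
  by have := h2 _ (ltW xA'); rewrite /= mulr0n; lra.
apply: (le_trans (int_le lI lD le)); rewrite intZ; last exact: L1D.
rewrite /Dw (intD l1 l2) intB; [|exact: L1_cst|exact: L1_heat0].
rewrite int_cst (single y1 e1 t0) (single y2 e1 t0).
have k1 : `|\int[P]_w heat c 0 y1 (1 + t) (x 0 w)| <= \int[P]_w (delta / 4).
  apply: abs_int_le_ae; [exact: L1_heat0|exact: L1_cst|by move=> _; rewrite divr_ge0// ltW|].
  apply: filterS xb => w; rewrite ler_norml => /andP[xb _]; apply: le_trans Dd.
  have := @heat0_step R c c0 (1 + t) D y1 (x 0 w) tt1 D0.
  have l : (x 0 w < y1) = false by apply/negbTE; rewrite -leNgt /y1; lra.
  by rewrite l subr0; apply; rewrite ger0_norm /y1; lra.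
have k2 : `|\int[P]_w (1 - heat c 0 y2 (1 + t) (x 0 w))| <= \int[P]_w (delta / 4).
  apply: abs_int_le_ae; last first.
  - apply: filterS xb => w; rewrite ler_norml => /andP[_ xb]; apply: le_trans Dd.
    have := @heat0_step R c c0 (1 + t) D y2 (x 0 w) tt1 D0.
    have l : x 0 w < y2 by rewrite /y2; lra.
    by rewrite l [`|1 - _|]distrC; apply; rewrite ler0_norm /y2; lra.
  - by move=> _; rewrite divr_ge0// ltW.
  - exact: L1_cst.
  - by apply: L1B; [exact: L1_cst|exact: L1_heat0].
rewrite !int_cst in k1 k2; rewrite intB in k2; [|exact: L1_cst|exact: L1_heat0].
rewrite int_cst in k2; have := le_trans (ler_norm _) k1; have := le_trans (ler_norm _) k2.
by lra.
Qed.

End one_point.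

Lemma small_choice (R : realType) (K delta : R) : 0 <= K -> 0 < delta ->
  exists eta, [/\ 0 < eta, eta <= 1 & K * eta <= delta].
Proof.
move=> K0 d0; have K1 : 0 < K + 1 by lra.
exists (Num.min 1 (delta / (K + 1))); split.
- by rewrite lt_min ltr01 divr_gt0.
- by rewrite ge_min lexx.
apply: (@le_trans _ _ ((K + 1) * (delta / (K + 1)))); last by rewrite mulrC divfK// gt_eqF.
apply: ler_pM => //; last by rewrite ge_min lexx orbT.
  by rewrite le_min ler01 divr_ge0// ltW.
by rewrite lerDl.
Qed.

Section flow_families.
Context (R : realType) (m : nat) (I : Type) (FF : set_system I).
Hypothesis FFF : Filter FF.
Variable c : R.
Hypothesis c0 : 0 < c.
Variable b : 'I_m -> R.
Implicit Types (s t e delta : R) (y : 'I_m -> R).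

Section one_family.
Variables (d : I -> measure_display) (T : forall th, measurableType (d th))
  (P : forall th, probability (T th) R) (F : forall th, R -> set (set (T th)))
  (x : forall th, 'I_m -> R -> T th -> R).
Arguments P : clear implicits.
Arguments F : clear implicits.
Arguments x : clear implicits.
Hypothesis flow : flow_family FF P F c b x.

Lemma flow_measurable th : (is_filtration (F th) /\ forall i, adapted (F th) (x th i)) ->
  forall i t, 0 <= t -> measurable_fun setT (x th i t).
Proof. by move=> [[_ FM _] ax] i t t0; exact: wrt_measurable (FM t t0) (ax i t t0). Qed.

Lemma borel_measurable th f t : (is_filtration (F th) /\ forall i, adapted (F th) (x th i)) ->
  0 <= t -> borel_vec f -> measurable_wrt (F th t) (fun w => f (fun i => x th i t w)).
Proof.
by move=> [[sF _ _] ax] t0 bf; apply: bf => [|i]; [exact: sF|exact: ax].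
Qed.

(** The drift condition moves the transition function with time [e] to go from
    [t] back to [s]. As [e] vanishes, its value at time [t] becomes an indicator
    except where some [x i] is near some [y j], which is unlikely by the
    small-ball estimate. *)
Lemma flow_step s t y delta : 0 <= s -> s < t -> 0 < delta ->
  \forall th \near FF, forall zeta, measurable_wrt (F th s) zeta -> (forall w, `|zeta w| <= 1) ->
  `|\int[P th]_w (zeta w * (below y (fun i => x th i t w) -
      coalescing_cdf c (monotone_minorant y) (t - s) (fun i => x th i s w)))| <= delta.
Proof.
move=> s0 st d0; have t0 : 0 < t := le_lt_trans s0 st; have t00 := ltW t0.
have ts : 0 < t - s by rewrite subr_gt0.
pose y' := monotone_minorant y; pose N : R := #|{: 'S_m}|%:R; have N0 : 0 <= N by [].
have [L [L0 hL]] := heat_lipschitz c0 t0.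
have [Ct [Ct0 hCt]] := @cdf_time R m c c0 _ ts.
pose M : R := m%:R; have M0 : 0 <= M by [].
have d4 : 0 < delta / 4 by rewrite divr_gt0.
have [eta [eta0 _ etaK]] := @small_choice _ ((1 + N) * (M ^+ 2 * (8 * L))) _
  (ltac:(by rewrite !mulr_ge0 ?addr_ge0 ?sqr_ge0)) d4.
have cc := ltW c0.
have [q1 [q10 q11 q1K]] := @small_choice _ (N * (M * (c / eta ^+ 2))) _
  (ltac:(by rewrite !mulr_ge0 ?invr_ge0 ?sqr_ge0)) d4.
have [q2 [q20 q21 q2K]] := small_choice Ct0 d4.
pose q := Num.min q1 q2; have q0 : 0 < q by rewrite lt_min q10.
have qq1 : q <= q1 by rewrite ge_min lexx.
have qq2 : q <= q2 by rewrite ge_min lexx orbT.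
have ql1 : q <= 1 := le_trans qq1 q11.
pose e := q ^+ 2; have e0 : 0 < e by exact: exprn_gt0.
have eq_ : e <= q by rewrite /e expr2 ler_piMl// ltW.
have sqe : Num.sqrt e = q by rewrite /e sqrtr_sqr ger0_norm// ltW.
near=> th => zeta mz z1.
have fil : is_filtration (F th) /\ forall i, adapted (F th) (x th i).
  by near: th; exact: (flow_filtration flow).
have ord : {ae P th, forall w, sorted_vec (fun i => x th i t w)}.
  by near: th; apply: filterS (flow_order flow) => th h; exact: h.
have drift : `|\int[P th]_w (zeta w * (coalescing_cdf c y' e (fun i => x th i t w) -
    coalescing_cdf c y' (e + t - s) (fun i => x th i s w)))| <= delta / 4.
  move: zeta mz z1; near: th.
  by apply: filterS (flow_drift flow e0 t00 d4) => th h zeta mz z1; apply: h => //; exact: ltW.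
have sing i : forall e t (y : R), 0 < e -> 0 <= t ->
    \int[P th]_w heat c 0 y e (x th i t w) = \int[P th]_w heat c 0 y (e + t) (x th i 0 w).
  move: i; near: th; by apply: filterS (flow_single flow) => th h i *; exact: h.
have mx := flow_measurable fil.
have mzT : measurable_fun setT zeta.
  by case: fil => [[_ FM _] _]; exact: wrt_measurable (FM s s0) mz.
have mT f u : 0 <= u -> borel_vec f -> measurable_fun setT (fun w => f (fun i => x th i u w)).
  by move=> u0 bf; case: (fil) => [[_ FM _] _]; exact: wrt_measurable (FM u u0) (borel_measurable fil u0 bf).
have mcdf e' u : 0 <= u -> measurable_fun setT (fun w => coalescing_cdf c y' e' (fun i => x th i u w)).
  by move=> u0; apply: mT => //; exact: borel_coalescing_cdf.
have cN e' z : `|coalescing_cdf c y' e' z| <= N by exact: coalescing_cdf_bound.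
pose f1 w := zeta w * (below y (fun i => x th i t w) - coalescing_cdf c y' e (fun i => x th i t w)).
pose f2 w := zeta w * (coalescing_cdf c y' e (fun i => x th i t w) -
    coalescing_cdf c y' (e + t - s) (fun i => x th i s w)).
pose f3 w := zeta w * (coalescing_cdf c y' (e + t - s) (fun i => x th i s w) -
    coalescing_cdf c y' (t - s) (fun i => x th i s w)).
have lf1 : L1 (P th) f1.
  apply: (@L1_Mbdd _ _ _ _ 1) => //; apply: (@L1_bdd _ _ _ _ (1 + N)).
    by apply: measurable_funB; [apply: mT => //; exact: borel_below|exact: mcdf].
  by move=> w; apply: (le_trans (ler_normB _ _)); rewrite lerD// below_norm.
have lc e1 e2 u1 u2 : 0 <= u1 -> 0 <= u2 -> L1 (P th) (fun w =>
    zeta w * (coalescing_cdf c y' e1 (fun i => x th i u1 w) - coalescing_cdf c y' e2 (fun i => x th i u2 w))).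
  move=> u10 u20; apply: (@L1_Mbdd _ _ _ _ 1) => //; apply: (@L1_bdd _ _ _ _ (N + N)).
    by apply: measurable_funB; exact: mcdf.
  by move=> w; apply: (le_trans (ler_normB _ _)); rewrite lerD.
have lf2 : L1 (P th) f2 by exact: lc.
have lf3 : L1 (P th) f3 by exact: lc.
have E w : zeta w * (below y (fun i => x th i t w) -
      coalescing_cdf c y' (t - s) (fun i => x th i s w)) = f1 w + (f2 w + f3 w).
  by rewrite /f1 /f2 /f3; ring.
have h3 : `|\int[P th]_w f3 w| <= delta / 4.
  apply: int_bdd; first exact: L1_measurable lf3.
  move=> w; rewrite normrM -[leRHS]mul1r; apply: ler_pM => //.
  have e1 : e + t - s - (t - s) = e by ring.
  have := hCt y' (t - s) (e + t - s) (fun i => x th i s w) (lexx _).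
  rewrite e1 (ger0_norm (ltW e0)) sqe => h; apply: (le_trans (h _ _)).
  - by rewrite -addrA lerDr ltW.
  - exact: le_trans eq_ ql1.
  - by apply: le_trans q2K; rewrite ler_wpM2l.
pose B i j w : R := \1_[set w | `|x th i t w - y' j| < eta] w.
have lB i j : L1 (P th) (B i j) /\ \int[P th]_w B i j w <= 8 * L * eta.
  by apply: (small_ball c0 (mx i) (sing i) t0 L0) => // k y0 tau z z' k3 tt; exact: hL.
pose g w := N * (M * (c * e / eta ^+ 2)) + (1 + N) * \sum_i \sum_j B i j w.
have lS : L1 (P th) (fun w => \sum_i \sum_j B i j w).
  by apply: L1_sum => i _; apply: L1_sum => j _; exact: (lB i j).1.
have lg : L1 (P th) g by apply: L1D; [exact: L1_cst|exact: L1Z].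
have B0 i j w : 0 <= B i j w by rewrite /B indicE ler0n.
have S0 w : 0 <= \sum_i \sum_j B i j w by do 2 apply: sumr_ge0 => ? _.
have a0 : 0 <= N * (M * (c * e / eta ^+ 2)).
  by rewrite !mulr_ge0 ?invr_ge0 ?sqr_ge0// ltW.
have h1 : `|\int[P th]_w f1 w| <= delta / 2.
  apply: (@le_trans _ _ (\int[P th]_w g w)).
    apply: abs_int_le_ae => // [w|]; first by rewrite addr_ge0// mulr_ge0// addr_ge0.
    apply: filterS ord => w sx; rewrite /f1 normrM -[leRHS]mul1r; apply: ler_pM => //.
    rewrite (below_monotone_minorant y sx) /g.
    have [far|] := boolP [forall i, forall j, eta <= `|x th i t w - y' j|].
      rewrite distrC; apply: (@le_trans _ _ (N * (M * (c * e / eta ^+ 2)))).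
        apply: cdf_terminal => //; first exact: sorted_monotone_minorant.
        by move=> i j; move/forallP/(_ i)/forallP: far.
      by rewrite lerDl mulr_ge0// addr_ge0.
    rewrite negb_forall => /existsP[i]; rewrite negb_forall => /existsP[j].
    rewrite -ltNge => close.
    apply: (@le_trans _ _ (1 + N)).
      by apply: (le_trans (ler_normB _ _)); rewrite lerD// below_norm.
    rewrite -[leLHS]mulr1 -[leLHS]add0r lerD// ler_wpM2l ?addr_ge0//.
    rewrite (bigD1 i)//= (bigD1 j)//= {1}/B indicE mem_set//= -addrA lerDl.
    by rewrite addr_ge0// !sumr_ge0// => k _; rewrite sumr_ge0.
  rewrite /g intD; [|exact: L1_cst|exact: L1Z].
  rewrite int_cst intZ// int_sum => [|i _]; last by apply: L1_sum => j _; exact: (lB i j).1.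
  have -> : delta / 2 = delta / 4 + delta / 4 by field.
  apply: lerD.
    have -> : N * (M * (c * e / eta ^+ 2)) = N * (M * (c / eta ^+ 2)) * e by ring.
    by apply: le_trans q1K; rewrite ler_wpM2l// ?(le_trans eq_)// !mulr_ge0 ?invr_ge0 ?sqr_ge0.
  apply: le_trans etaK; rewrite -mulrA; apply: ler_wpM2l; first by rewrite addr_ge0.
  have -> : M ^+ 2 * (8 * L) * eta = \sum_(i < m) \sum_(j < m) 8 * L * eta.
    rewrite !sumr_const card_ord -mulrnA -[RHS]mulr_natl natrM -/M; ring.
  apply: ler_sum => i _; rewrite int_sum => [|j _]; last exact: (lB i j).1.
  by apply: ler_sum => j _; exact: (lB i j).2.
rewrite (int_ext (P th) E) (intD lf1 (L1D lf2 lf3)) (intD lf2 lf3).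
apply: (le_trans (ler_normD _ _)); apply: (le_trans (lerD h1 (ler_normD _ _))).
apply: (le_trans (lerD (lexx _) (lerD drift h3))).
by rewrite le_eqVlt; apply/orP; left; apply/eqP; field.
Unshelve. all: by end_near.
Qed.

End one_family.
End flow_families.

Section lipschitz_functionals.
Context (R : realType) (m : nat).
Implicit Types (xi : nat -> 'I_m -> R) (G : (nat -> 'I_m -> R) -> R).

Definition lip_class (k : nat) (L B : R) G : Prop :=
  (forall xi, `|G xi| <= B) /\
  (forall xi xi', `|G xi - G xi'| <= L * \sum_(l < k.+1) \sum_(i < m) `|xi l i - xi' l i|).

Lemma lip_classM k L B G L' B' G' : 0 <= L -> 0 <= L' -> lip_class k L B G -> lip_class k L' B' G' ->
  lip_class k (B * L' + B' * L) (B * B') (fun xi => G xi * G' xi).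
Proof.
move=> L0 L'0 [GB GL] [GB' GL']; split=> [xi|xi xi'].
  by rewrite normrM ler_pM.
have -> : G xi * G' xi - G xi' * G' xi' = G xi * (G' xi - G' xi') + (G xi - G xi') * G' xi' by ring.
apply: (le_trans (ler_normD _ _)); rewrite !normrM mulrDl; apply: lerD.
  by rewrite -mulrA ler_pM.
by rewrite mulrC -mulrA ler_pM.
Qed.

(** Rounding the vectors to multiples of [n.+1^-1] leaves countably many values,
    for which measurability is clear; continuity removes the rounding. *)
Lemma lip_class_wrt k L B G d (T : measurableType d) (GG : set (set T)) (z : nat -> 'I_m -> T -> R) :
  0 <= L -> lip_class k L B G -> sigma_algebra setT GG ->
  (forall l i, (l <= k)%N -> measurable_wrt GG (z l i)) ->
  measurable_wrt GG (fun w => G (fun l i => z l i w)).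
Proof.
move=> L0 [_ GL] sG mz; apply/(measurable_wrtP sG).
set TG := g_sigma_algebraType GG.
have {}mz l i : (l <= k)%N -> measurable_fun setT (z l i : TG -> R).
  by move=> lk; apply/(measurable_wrtP sG); exact: mz.
pose CT := {ffun 'I_k.+1 * 'I_m -> int}.
pose u (n : nat) (w : TG) : CT := [ffun p : 'I_k.+1 * 'I_m => Num.floor (n.+1%:R * z p.1 p.2 w)].
pose v (n : nat) (f : CT) : nat -> 'I_m -> R := fun l i =>
  if insub l is Some l' then (f (l', i))%:~R / n.+1%:R else 0.
have mu n f : measurable [set w : TG | u n w = f].
  have -> : [set w : TG | u n w = f] = \bigcap_(p in [set: 'I_k.+1 * 'I_m])
      [set w : TG | Num.floor (n.+1%:R * z p.1 p.2 w) = f p].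
    apply/seteqP; split=> [w /= <- p _|w h]; first by rewrite /= ffunE.
    by apply/ffunP => p; rewrite ffunE; exact: (h p I).
  apply: fin_bigcap_measurable => // p _.
  have -> : [set w : TG | Num.floor (n.+1%:R * z p.1 p.2 w) = f p] =
      (z p.1 p.2) @^-1` `[(f p)%:~R / n.+1%:R, (f p + 1)%:~R / n.+1%:R[%classic.
    have n0 : (0 : R) < n.+1%:R by [].
    apply/seteqP; split=> w /=.
      by move=> <-; rewrite in_itv/= ler_pdivrMr// ltr_pdivlMr// mulrC floor_le floorD1_gt.
    rewrite in_itv/= ler_pdivrMr// ltr_pdivlMr// => /andP[a b].
    by apply/floor_def; rewrite mulrC a b.
  have lk : (p.1 <= k)%N by rewrite -ltnS.
  rewrite -[X in measurable X]setTI.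
  exact: (mz _ _ lk measurableT _ (measurable_itv _)).
pose f_ n (w : TG) := G (v n (u n w)).
apply: (@measurable_fun_cvg _ _ _ _ f_) => [n|w _].
  move=> _ D mD; rewrite setTI.
  have -> : f_ n @^-1` D = \bigcup_(f : CT) ([set w : TG | u n w = f] `&` [set w : TG | D (G (v n f))]).
    apply/seteqP; split=> [w /= Dw|w [f _ [/= uf Df]]]; first by exists (u n w).
    by rewrite /f_ /= uf.
  apply: countable_bigcupT_measurable => [|f]; first exact: countableP.
  apply: measurableI => //.
  have [h|h] := pselect (D (G (v n f))).
    by rewrite (_ : [set w : TG | _] = setT)//; apply/seteqP; split.
  by rewrite (_ : [set w : TG | _] = set0)//; apply/seteqP; split.
apply/cvgrPdist_le => e e0.
pose K := L * (k.+1%:R * m%:R); have K0 : 0 <= K by rewrite !mulr_ge0.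
near=> n.
have ne : K / e < n.+1%:R.
  by near: n; apply: filterS (nbhs_infty_gtr (K / e)) => n /lt_le_trans; apply; rewrite ler_nat.
have n0 : (0 : R) < n.+1%:R by [].
apply: (le_trans (GL _ _)).
apply: (@le_trans _ _ (L * \sum_(l < k.+1) \sum_(i < m) n.+1%:R^-1)).
  apply: ler_wpM2l => //; apply: ler_sum => l _; apply: ler_sum => i _.
  rewrite /v insubT// => lk; rewrite ffunE/=.
  have a := floor_le (n.+1%:R * z l i w); have b := floorD1_gt (n.+1%:R * z l i w).
  rewrite intrD -[1%:~R]/(1 : R) in b.
  rewrite -(ler_pM2r n0) mulVf ?gt_eqF// -[X in _ * X](ger0_norm (ltW n0)) -normrM mulrBl divfK ?gt_eqF//.
  by rewrite mulrC ger0_norm; lra.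
rewrite !sumr_const !card_ord -mulrnA -[_ *+ (m * k.+1)]mulr_natl natrM.
have -> : L * (m%:R * k.+1%:R * n.+1%:R^-1) = K / n.+1%:R by rewrite /K; ring.
by rewrite ler_pdivrMr// mulrC -ler_pdivrMr// ltW.
Unshelve. all: by end_near.
Qed.

End lipschitz_functionals.

Section convergence.
Context (R : realType) (m : nat) (I : Type) (FF : set_system I).
Hypothesis FFF : Filter FF.
Variable c : R.
Hypothesis c0 : 0 < c.
Variable b : 'I_m -> R.
Implicit Types (s t e delta : R) (y : 'I_m -> R).

Definition asymp (f g : I -> R) : Prop :=
  forall delta, 0 < delta -> \forall th \near FF, `|f th - g th| <= delta.

Lemma asymp_sum (J : finType) (f g : J -> I -> R) : (forall j, asymp (f j) (g j)) ->
  asymp (fun th => \sum_j f j th) (fun th => \sum_j g j th).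
Proof.
move=> fg delta d0; pose n := #|J|.
have dn : 0 < delta / n.+1%:R by rewrite divr_gt0.
have h : \forall th \near FF, forall j, `|f j th - g j th| <= delta / n.+1%:R.
  by apply: filter_forall => j; exact: fg.
apply: filterS h => th h; rewrite -sumrB; apply: (le_trans (ler_norm_sum _ _ _)).
apply: (@le_trans _ _ (\sum_(j : J) delta / n.+1%:R)); first by apply: ler_sum => j _.
rewrite sumr_const -/n -[_ *+ n]mulr_natl mulrCA ler_piMr ?(ltW d0)//.
by rewrite ler_pdivrMr// mul1r ler_nat.
Qed.

Lemma asympZ (k : R) f g : asymp f g -> asymp (fun th => k * f th) (fun th => k * g th).
Proof.
move=> fg delta d0; have k0 : 0 < `|k| + 1 by rewrite ltr_wpDl.
apply: filterS (fg (delta / (`|k| + 1)) _) => [th h|]; last by rewrite divr_gt0.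
rewrite -mulrBr normrM; apply: (le_trans (ler_wpM2l (normr_ge0 k) h)).
by rewrite mulrA ler_pdivrMr// mulrC ler_wpM2l ?(ltW d0)// lerDl.
Qed.

Definition flow_at (T : Type) (x : 'I_m -> R -> T -> R) (tt : nat -> R) (w : T) : nat -> 'I_m -> R :=
  fun l i => x i (tt l) w.

Variable tt : nat -> R.
Hypotheses (tt0 : tt 0 = 0) (ttS : forall k, tt k < tt k.+1).

Lemma grid_ge0 k : 0 <= tt k.
Proof. by elim: k => [|k IH]; [rewrite tt0|exact: le_trans IH (ltW (ttS k))]. Qed.

Lemma grid_le k l : (k <= l)%N -> tt k <= tt l.
Proof.
elim: l => [|l IH]; first by rewrite leqn0 => /eqP ->.
by rewrite leq_eqVlt ltnS => /predU1P[->//|/IH h]; exact: le_trans h (ltW (ttS l)).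
Qed.

Section one_family.
Variables (d : I -> measure_display) (T : forall th, measurableType (d th))
  (P : forall th, probability (T th) R) (F : forall th, R -> set (set (T th)))
  (x : forall th, 'I_m -> R -> T th -> R).
Arguments P : clear implicits.
Arguments F : clear implicits.
Arguments x : clear implicits.
Hypothesis flow : flow_family FF P F c b x.

Lemma lip_flow_wrt th k L B G : (is_filtration (F th) /\ forall i, adapted (F th) (x th i)) ->
  0 <= L -> lip_class k L B G -> measurable_wrt (F th (tt k)) (fun w => G (flow_at (x th) tt w)).
Proof.
move=> [[sF _ Fle] ax] L0 GL; apply: (lip_class_wrt L0 GL).
  by apply: sF; exact: grid_ge0.
move=> l i lk; apply: wrt_sub (ax i _ (grid_ge0 l)).
by apply: Fle; [exact: grid_ge0|exact: grid_le].
Qed.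

Lemma lip_flow_L1 th k L B G : (is_filtration (F th) /\ forall i, adapted (F th) (x th i)) ->
  0 <= L -> lip_class k L B G -> L1 (P th) (fun w => G (flow_at (x th) tt w)).
Proof.
move=> fil L0 GL; have mG := lip_flow_wrt fil L0 GL.
apply: (@L1_bdd _ _ _ _ B); last by move=> w; exact: GL.1.
by case: fil => [[_ FM _] _]; exact: wrt_measurable (FM _ (grid_ge0 k)) mG.
Qed.

Lemma flow_tails t delta : 0 <= t -> 0 < delta -> exists A0 : R, 0 < A0 /\ forall A, A0 <= A ->
  \forall th \near FF, forall i, L1 (P th) (fun w => 1 - \1_(`]- A, A]%classic) (x th i t w) : R) /\
   \int[P th]_w (1 - \1_(`]- A, A]%classic) (x th i t w)) <= delta.
Proof.
move=> t0 d0; pose beta := 1 + \sum_(i < m) `|b i|.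
have b0 : 0 <= beta by rewrite addr_ge0// sumr_ge0.
exists (2 + 4 * c + beta + 4 * c * (1 + t) / delta); split.
  have h1 : 0 <= 4 * c by rewrite mulr_ge0// ltW.
  have h2 : 0 <= 4 * c * (1 + t) / delta by rewrite divr_ge0 ?(ltW d0)// mulr_ge0// addr_ge0.
  by move: (_ / delta) h2 => u h2; lra.
move=> A hA; near=> th => i.
have fil : is_filtration (F th) /\ forall i, adapted (F th) (x th i).
  by near: th; exact: (flow_filtration flow).
have sing : forall e t (y : R), 0 < e -> 0 <= t ->
    \int[P th]_w heat c 0 y e (x th i t w) = \int[P th]_w heat c 0 y (e + t) (x th i 0 w).
  move: i; near: th; by apply: filterS (flow_single flow) => th h i *; exact: h.
apply: (tails c0 (flow_measurable fil i) sing t0 b0 d0) => //.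
have st : forall i, {ae P th, forall w, `|x th i 0 w - b i| <= 1}.
  by move: i sing => _ _; near: th; exact: (flow_start flow ltr01).
apply: filterS (st i) => w h; have -> : x th i 0 w = (x th i 0 w - b i) + b i by rewrite subrK.
apply: (le_trans (ler_normD _ _)); apply: lerD => //.
by rewrite (bigD1 i)//= lerDl sumr_ge0.
Unshelve. all: by end_near.
Qed.

(** The last time enters only through a Lipschitz function of the earlier ones,
    which is what an induction on the number of times needs. *)
Lemma flow_below k L B G y : 0 <= L -> 0 < B -> lip_class k L B G ->
  asymp (fun th => \int[P th]_w (G (flow_at (x th) tt w) * below y (flow_at (x th) tt w k.+1)))
    (fun th => \int[P th]_w (G (flow_at (x th) tt w) *
       coalescing_cdf c (monotone_minorant y) (tt k.+1 - tt k) (flow_at (x th) tt w k))).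
Proof.
move=> L0 B0 GL delta d0.
have dB : 0 < delta / B by rewrite divr_gt0.
near=> th.
have fil : is_filtration (F th) /\ forall i, adapted (F th) (x th i).
  by near: th; exact: (flow_filtration flow).
have step : forall zeta, measurable_wrt (F th (tt k)) zeta -> (forall w, `|zeta w| <= 1) ->
  `|\int[P th]_w (zeta w * (below y (fun i => x th i (tt k.+1) w) -
      coalescing_cdf c (monotone_minorant y) (tt k.+1 - tt k) (fun i => x th i (tt k) w)))| <= delta / B.
  by near: th; exact: (flow_step FFF c0 flow y (grid_ge0 k) (ttS k) dB).
have lG := lip_flow_L1 fil L0 GL; have mG := lip_flow_wrt fil L0 GL.
pose zeta w := B^-1 * G (flow_at (x th) tt w).
have z1 w : `|zeta w| <= 1.
  by rewrite normrM gtr0_norm ?invr_gt0// ler_pdivrMl// mulr1; exact: GL.1.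
have sFk : sigma_algebra setT (F th (tt k)) by case: fil => [[sF _ _] _]; apply: sF; exact: grid_ge0.
have mz : measurable_wrt (F th (tt k)) zeta by apply: (wrtM sFk) mG; exact: wrt_cst.
have mT f l : borel_vec f -> measurable_fun setT (fun w => f (flow_at (x th) tt w l)).
  move=> bf; case: (fil) => [[_ FM _] _].
  exact: wrt_measurable (FM _ (grid_ge0 l)) (borel_measurable fil (grid_ge0 l) bf).
have l1 : L1 (P th) (fun w => G (flow_at (x th) tt w) * below y (flow_at (x th) tt w k.+1)).
  apply: (eq_L1 (fun w => mulrC _ _)); apply: (@L1_Mbdd _ _ _ _ 1) => //.
    by apply: mT; exact: borel_below.
  by move=> w; exact: below_norm.
have l2 : L1 (P th) (fun w => G (flow_at (x th) tt w) *
    coalescing_cdf c (monotone_minorant y) (tt k.+1 - tt k) (flow_at (x th) tt w k)).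
  apply: (eq_L1 (fun w => mulrC _ _)); apply: (@L1_Mbdd _ _ _ _ #|{: 'S_m}|%:R) => //.
    by apply: mT; exact: borel_coalescing_cdf.
  by move=> w; exact: coalescing_cdf_bound.
rewrite -(intB l1 l2).
rewrite (@int_ext _ _ _ (P th) _ (fun w => B * (zeta w * (below y (fun i => x th i (tt k.+1) w) -
      coalescing_cdf c (monotone_minorant y) (tt k.+1 - tt k) (fun i => x th i (tt k) w))))); last first.
  by move=> w; rewrite /zeta -mulrA mulVKf ?gt_eqF// mulrBr.
rewrite intZ; last first.
  apply: (@eq_L1 _ _ _ (P th) _ _ _ (L1Z B^-1 (L1B l1 l2))) => w.
  by rewrite /zeta -mulrA -mulrBr.
rewrite normrM gtr0_norm// -ler_pdivlMl// mulrC; exact: step.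
Unshelve. all: by end_near.
Qed.

End one_family.

End convergence.

Section boxes.
Context (R : realType) (m : nat).
Implicit Types (u v x : 'I_m -> R) (A : R).

Definition box u v x : R :=
  \prod_i (\1_(`]-oo, v i]%classic) (x i) - \1_(`]-oo, u i]%classic) (x i)).

Lemma box_below u v x : box u v x = \sum_(J : {set 'I_m})
  (\prod_i (if i \in J then 1 else -1)) * below (fun i => if i \in J then v i else u i) x.
Proof.
rewrite /box bigA_distr; apply: eq_big => [J|J _]; first by rewrite inE.
rewrite belowE -big_split/=; apply: eq_bigr => i _.
by case: (i \in J); rewrite ?mul1r ?mulN1r.
Qed.

Variables (A : R) (N : nat).
Hypotheses (A0 : 0 < A) (N0 : (0 < N)%N).

Definition mesh : R := 2 * A / N%:R.
Definition cubept (j : nat) : R := - A + mesh * j%:R.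
Definition lower (kap : {ffun 'I_m -> 'I_N}) (i : 'I_m) : R := cubept (kap i).
Definition upper (kap : {ffun 'I_m -> 'I_N}) (i : 'I_m) : R := cubept (kap i).+1.

Lemma mesh_ge0 : 0 <= mesh.
Proof. by rewrite /mesh divr_ge0// mulr_ge0// ltW. Qed.

Lemma indic_ray (a z : R) : \1_(`]-oo, a]%classic) z = (z <= a)%R%:R :> R.
Proof.
rewrite indicE; congr (_%:R); congr nat_of_bool.
by apply/idP/idP => [/set_mem|h]; [|apply: mem_set]; rewrite /= in_itv.
Qed.

Lemma lower_upper kap i : upper kap i = lower kap i + mesh.
Proof. by rewrite /upper /lower /cubept -natr1 mulrDr mulr1 addrA. Qed.

Lemma box_sum x : \sum_(kap : {ffun 'I_m -> 'I_N}) box (lower kap) (upper kap) x =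
  \prod_i \1_(`]- A, A]%classic) (x i).
Proof.
rewrite /box -(bigA_distr_bigA (fun i (j : 'I_N) => \1_(`]-oo, cubept j.+1]%classic) (x i) -
  \1_(`]-oo, cubept j]%classic) (x i))); apply: eq_bigr => i _.
rewrite -(big_mkord xpredT (fun j => \1_(`]-oo, cubept j.+1]%classic) (x i) -
  \1_(`]-oo, cubept j]%classic) (x i))).
rewrite (telescope_sumr (fun j => \1_(`]-oo, cubept j]%classic) (x i)))// !indic_ray.
have -> : cubept 0 = - A by rewrite /cubept mulr0 addr0.
have -> : cubept N = A.
  by rewrite /cubept /mesh divfK ?pnatr_eq0 -?lt0n//; ring.
rewrite indicE; have [h1|h1] := leP (x i) (- A).
  have xA : x i <= A by move: A0 h1; lra.
  by rewrite xA subrr memNset//= in_itv/= ltNge h1.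
rewrite subr0; congr (_%:R); congr nat_of_bool.
by apply/idP/idP => [h|/set_mem]; [apply: mem_set|]; rewrite /= in_itv/= h1.
Qed.

Lemma box_ge0 kap x : 0 <= box (lower kap) (upper kap) x.
Proof.
apply: prodr_ge0 => i _; rewrite !indic_ray lower_upper subr_ge0 ler_nat.
have := mesh_ge0; case: (leP (x i) (lower kap i)) => //= h h0.
by rewrite (le_trans h)// lerDl.
Qed.

Lemma box_support kap x : box (lower kap) (upper kap) x != 0 ->
  forall i, `|x i - upper kap i| <= mesh.
Proof.
move=> /prodf_neq0 h i; have := h i isT; rewrite !indic_ray lower_upper.
have h0 := mesh_ge0.
have [xl|xl] := leP (x i) (lower kap i); first by rewrite (le_trans xl) ?lerDl// subrr eqxx.
have [xu _|] := leP (x i) (lower kap i + mesh); last by rewrite subrr eqxx.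
by rewrite ler_norml; lra.
Qed.

(** Inside the cube the cell indicators add up to one and each sees the function
    within its own cell only; outside, the bound [B] is all that is known. *)
Lemma box_approximation x G0 (g : {ffun 'I_m -> 'I_N} -> R) B e :
  `|G0| <= B -> 0 <= e ->
  (forall kap, (forall i, `|x i - upper kap i| <= mesh) -> `|G0 - g kap| <= e) ->
  `|G0 - \sum_kap g kap * box (lower kap) (upper kap) x| <=
    e + B * \sum_i (1 - \1_(`]- A, A]%classic) (x i)).
Proof.
move=> GB e0 h; pose p : R := \prod_i \1_(`]- A, A]%classic) (x i).
have B0 : 0 <= B := le_trans (normr_ge0 _) GB.
have i01 i : 0 <= 1 - \1_(`]- A, A]%classic) (x i) :> R.
  by rewrite indicE; case: (_ \in _); rewrite /= ?subrr ?subr0.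
have p0 : 0 <= p by apply: prodr_ge0 => i _; rewrite indicE.
have p1 : p <= 1.
  apply: (@le_trans _ _ (\prod_(i < m) 1)); last by rewrite big1_eq.
  by apply: ler_prod => i _; rewrite indicE ler0n lern1; case: (_ \in _).
have pS : 1 - p <= \sum_i (1 - \1_(`]- A, A]%classic) (x i)).
  have [/forallP al|] := boolP [forall i, x i \in `]- A, A]%classic].
    by rewrite /p big1 ?subrr ?sumr_ge0// => i _; rewrite indicE al.
  rewrite negb_forall => /existsP[i xi].
  rewrite (bigD1 i)//= {1}indicE (negbTE xi) /= mulr0n subr0.
  have S0 : 0 <= \sum_(j | j != i) (1 - \1_(`]- A, A]%classic) (x j)) :> R by exact: sumr_ge0.
  by move: p0 S0; lra.
have -> : G0 - \sum_kap g kap * box (lower kap) (upper kap) x =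
    \sum_kap (G0 - g kap) * box (lower kap) (upper kap) x + G0 * (1 - p).
  under [X in _ = X + _]eq_bigr do rewrite mulrBl.
  by rewrite sumrB -mulr_sumr box_sum -/p; ring.
apply: (le_trans (ler_normD _ _)); apply: lerD; last first.
  by rewrite normrM [X in _ * X]ger0_norm ?subr_ge0//; apply: ler_pM => //; rewrite subr_ge0.
apply: (le_trans (ler_norm_sum _ _ _)).
apply: (@le_trans _ _ (\sum_kap e * box (lower kap) (upper kap) x)).
  apply: ler_sum => kap _; rewrite normrM [X in _ * X <= _]ger0_norm ?box_ge0//.
  have [->|bn] := eqVneq (box (lower kap) (upper kap) x) 0; first by rewrite !mulr0.
  by apply: ler_wpM2r; [exact: box_ge0|apply: h; exact: box_support].
by rewrite -mulr_sumr box_sum -/p ler_piMr.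
Qed.

End boxes.

Section asymptotic_agreement.
Context (R : realType) (I : Type) (FF : set_system I).
Hypothesis FFF : Filter FF.
Implicit Types f g h : I -> R.

Lemma asymp_sym f g : asymp FF f g -> asymp FF g f.
Proof. by move=> fg e e0; apply: filterS (fg e e0) => th; rewrite distrC. Qed.

Lemma asymp_trans f g h : asymp FF f g -> asymp FF g h -> asymp FF f h.
Proof.
move=> fg gh e e0; have e2 : 0 < e / 2 by rewrite divr_gt0.
apply: filterS2 (fg _ e2) (gh _ e2) => th h1 h2.
by apply: (le_trans (ler_distD (g th) _ _)); rewrite [leRHS]splitr lerD.
Qed.

Lemma asymp_approx f g : (forall e, 0 < e -> exists f' g', [/\
    \forall th \near FF, `|f th - f' th| <= e, \forall th \near FF, `|g th - g' th| <= e &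
    asymp FF f' g']) -> asymp FF f g.
Proof.
move=> h e e0; have e3 : 0 < e / 3 by rewrite divr_gt0.
have [f' [g' [h1 h2 h3]]] := h _ e3.
apply: filterS3 h1 h2 (h3 _ e3) => th; rewrite !ler_norml; lra.
Qed.

End asymptotic_agreement.

Section finite_dimensional_agreement.
Context (R : realType) (m : nat) (I : Type) (FF : set_system I).
Hypothesis FFF : Filter FF.
Variable c : R.
Hypothesis c0 : 0 < c.
Variable b : 'I_m -> R.
Implicit Types (s t e delta : R) (y : 'I_m -> R).
Variable tt : nat -> R.
Hypotheses (tt0 : tt 0 = 0) (ttS : forall k, tt k < tt k.+1).

Definition freeze (k : nat) (v : 'I_m -> R) (xi : nat -> 'I_m -> R) : nat -> 'I_m -> R :=
  fun l => if l == k then v else xi l.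

Lemma lip_freeze k L B G v : 0 <= L -> lip_class k.+1 L B G ->
  lip_class k L B (fun xi => G (freeze k.+1 v xi)).
Proof.
move=> L0 [GB GL]; split=> // xi xi'; apply: (le_trans (GL _ _)).
apply: ler_wpM2l => //; rewrite big_ord_recr/= /freeze eqxx.
rewrite [X in _ + X <= _]big1 => [|i _]; last by rewrite subrr normr0.
rewrite addr0; apply: ler_sum => l _; apply: ler_sum => i _.
by rewrite /= ltn_eqF.
Qed.

Lemma lip_freeze_dist k L B G v xi e : 0 <= L -> lip_class k L B G ->
  (forall i, `|xi k i - v i| <= e) -> `|G xi - G (freeze k v xi)| <= L * (m%:R * e).
Proof.
move=> L0 [_ GL] h; apply: (le_trans (GL _ _)); apply: ler_wpM2l => //.
rewrite big_ord_recr/= big1 ?add0r => [|l _]; last first.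
  by apply: big1 => i _; rewrite /freeze ltn_eqF// subrr normr0.
rewrite /freeze eqxx; have -> : m%:R * e = \sum_(i < m) e.
  by rewrite sumr_const card_ord -[RHS]mulr_natl.
exact: ler_sum.
Qed.

Lemma lip_cdf k tau y : 0 < tau -> exists L : R, 0 <= L /\
  lip_class k L #|{: 'S_m}|%:R (fun xi => coalescing_cdf c y tau (xi k)).
Proof.
move=> t0; have [L [L0 hL]] := cdf_lipschitz m c0 t0.
exists L; split=> //; split=> [xi|xi xi']; first exact: coalescing_cdf_bound.
apply: (le_trans (hL y tau _ _ (lexx _))); apply: ler_wpM2l => //.
by rewrite big_ord_recr/= lerDr; do 2 apply: sumr_ge0 => ? _.
Qed.

Section one_family.
Variables (d : I -> measure_display) (T : forall th, measurableType (d th))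
  (P : forall th, probability (T th) R) (F : forall th, R -> set (set (T th)))
  (x : forall th, 'I_m -> R -> T th -> R).
Arguments P : clear implicits.
Arguments F : clear implicits.
Arguments x : clear implicits.
Hypothesis flow : flow_family FF P F c b x.

Lemma flow_start_mean L B G : 0 <= L -> lip_class 0 L B G ->
  asymp FF (fun th => \int[P th]_w G (flow_at (x th) tt w)) (fun=> G (fun=> b)).
Proof.
move=> L0 GL delta d0.
have [eta [eta0 _ etaK]] := @small_choice _ (L * m%:R) delta (mulr_ge0 L0 (ler0n _ _)) d0.
near=> th.
have fil : is_filtration (F th) /\ forall i, adapted (F th) (x th i).
  by near: th; exact: (flow_filtration flow).
have st : forall i, {ae P th, forall w, `|x th i 0 w - b i| <= eta}.
  by near: th; exact: (flow_start flow eta0).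
have lG : L1 (P th) (fun w => G (flow_at (x th) tt w)) by exact: (lip_flow_L1 tt0 ttS P fil L0 GL).
rewrite -[X in _ - X](int_cst (P th)) -(intB lG (L1_cst _ _)).
rewrite -[leRHS](int_cst (P th)); apply: abs_int_le_ae => [||_|]; [|exact: L1_cst|exact: ltW|].
  by apply: L1B => //; exact: L1_cst.
have {}st : {ae P th, forall w, forall i, `|x th i 0 w - b i| <= eta} by exact: filter_forall.
apply: filterS st => w h; apply: (le_trans (GL.2 _ _)); apply: le_trans etaK.
rewrite -mulrA; apply: ler_wpM2l => //; rewrite big_ord_recl big_ord0 addr0.
have -> : m%:R * eta = \sum_(i < m) eta by rewrite sumr_const card_ord -[RHS]mulr_natl.
by apply: ler_sum => i _; rewrite /flow_at tt0.
Unshelve. all: by end_near.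
Qed.

(** The mean of a functional of [k.+2] vectors whose last vector is rounded to
    a finite grid. *)
Definition gridded_mean (k : nat) (A : R) (N : nat) G th : R :=
  \sum_(kap : {ffun 'I_m -> 'I_N}) \sum_(J : {set 'I_m})
    (\prod_i (if i \in J then 1 else -1)) *
    \int[P th]_w (G (freeze k.+1 (upper A kap) (flow_at (x th) tt w)) *
      below (fun i => if i \in J then upper A kap i else lower A kap i) (flow_at (x th) tt w k.+1)).

Lemma flow_gridded k L B G delta : 0 <= L -> 0 < B -> lip_class k.+1 L B G -> 0 < delta ->
  exists A0 : R, 0 < A0 /\ forall A, A0 <= A -> exists N0 : nat, forall N, (N0 <= N)%N -> (0 < N)%N ->
  \forall th \near FF, `|\int[P th]_w G (flow_at (x th) tt w) -
    gridded_mean k A N G th| <= delta.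
Proof.
move=> L0 B0 GL d0; have d2 : 0 < delta / 2 by rewrite divr_gt0.
have [eta [eta0 _ etaK]] := @small_choice _ (B * m%:R) _ (mulr_ge0 (ltW B0) (ler0n _ _)) d2.
have tk := grid_ge0 tt0 ttS k.+1.
have [A0 [A00 hA]] := flow_tails FFF c0 flow tk eta0.
exists A0; split=> // A AA; have A_0 : 0 < A := lt_le_trans A00 AA.
pose K := L * (m%:R * (2 * A)); have K0 : 0 <= K by rewrite !mulr_ge0// ltW.
exists (Num.truncn (K / (delta / 2))).+1 => N N1 N0.
have Nr : (0 : R) < N%:R by rewrite ltr0n.
have small : L * (m%:R * mesh A N) <= delta / 2.
  have -> : L * (m%:R * mesh A N) = K / N%:R by rewrite /K /mesh; ring.
  rewrite ler_pdivrMr// mulrC -ler_pdivrMr//; apply: ltW.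
  by apply: lt_le_trans (truncnS_gt _) _; rewrite ler_nat.
have m0 := mesh_ge0 N A_0.
near=> th.
have fil : is_filtration (F th) /\ forall i, adapted (F th) (x th i).
  by near: th; exact: (flow_filtration flow).
have tl : forall i, L1 (P th) (fun w => 1 - \1_(`]- A, A]%classic) (x th i (tt k.+1) w) : R) /\
   \int[P th]_w (1 - \1_(`]- A, A]%classic) (x th i (tt k.+1) w)) <= eta.
  by near: th; exact: hA.
have lG : L1 (P th) (fun w => G (flow_at (x th) tt w)) by exact: (lip_flow_L1 tt0 ttS P fil L0 GL).
have mT f : borel_vec f -> measurable_fun setT (fun w => f (flow_at (x th) tt w k.+1)).
  move=> bf; case: (fil) => [[_ FM _] _].
  exact: wrt_measurable (FM _ tk) (borel_measurable fil tk bf).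
pose bnd w := L * (m%:R * mesh A N) + B * \sum_i (1 - \1_(`]- A, A]%classic) (x th i (tt k.+1) w)).
have lS : L1 (P th) (fun w => \sum_i (1 - \1_(`]- A, A]%classic) (x th i (tt k.+1) w)) : R).
  by apply: L1_sum => i _; exact: (tl i).1.
have lb : L1 (P th) bnd by apply: L1D; [exact: L1_cst|exact: L1Z].
pose H (kap : {ffun 'I_m -> 'I_N}) w := G (freeze k.+1 (upper A kap) (flow_at (x th) tt w)).
have lH kap : L1 (P th) (H kap).
  exact: (lip_flow_L1 tt0 ttS P fil L0 (lip_freeze _ L0 GL)).
pose z w := flow_at (x th) tt w k.+1.
have le w : `|G (flow_at (x th) tt w) - \sum_(kap : {ffun 'I_m -> 'I_N}) H kap w *
    box (lower A kap) (upper A kap) (z w)| <= bnd w.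
  apply: (box_approximation A_0 N0 (x := z w) (g := fun kap => H kap w)).
  - exact: GL.1.
  - by apply: mulr_ge0 => //; apply: mulr_ge0.
  - by move=> kap h; exact: (lip_freeze_dist L0 GL h).
pose u (kap : {ffun 'I_m -> 'I_N}) (J : {set 'I_m}) i := if i \in J then upper A kap i else lower A kap i.
have lHb kap y : L1 (P th) (fun w => H kap w * below y (z w)).
  apply: (eq_L1 (fun w => mulrC _ _)); apply: (@L1_Mbdd _ _ _ _ 1) => //.
    by apply: mT; exact: borel_below.
  by move=> w; exact: below_norm.
have lHc kap (J : {set 'I_m}) : L1 (P th) (fun w => (\prod_i (if i \in J then 1 else -1)) *
    (H kap w * below (u kap J) (z w))) by exact: L1Z.
have lHs kap : L1 (P th) (fun w => \sum_(J : {set 'I_m}) (\prod_i (if i \in J then 1 else -1)) *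
    (H kap w * below (u kap J) (z w))) by exact: L1_sum.
have lHS : L1 (P th) (fun w => \sum_(kap : {ffun 'I_m -> 'I_N}) \sum_(J : {set 'I_m})
    (\prod_i (if i \in J then 1 else -1)) * (H kap w * below (u kap J) (z w))) by exact: L1_sum.
have -> : gridded_mean k A N G th = \int[P th]_w \sum_(kap : {ffun 'I_m -> 'I_N}) \sum_(J : {set 'I_m})
    (\prod_i (if i \in J then 1 else -1)) * (H kap w * below (u kap J) (z w)).
  rewrite int_sum//; apply: eq_bigr => kap _; rewrite int_sum//; apply: eq_bigr => J _.
  by rewrite intZ.
rewrite -(intB lG lHS); apply: (@le_trans _ _ (\int[P th]_w bnd w)).
  apply: abs_int_le_bound => // [|w]; first exact: L1B.
  rewrite (eq_bigr (fun kap => H kap w * box (lower A kap) (upper A kap) (z w))) => [|kap _].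
    exact: le.
  by rewrite box_below mulr_sumr; apply: eq_bigr => J _; rewrite mulrCA.
rewrite /bnd intD; [|exact: L1_cst|exact: L1Z].
rewrite int_cst intZ// [leRHS]splitr; apply: lerD => //; apply: le_trans etaK.
rewrite -mulrA; apply: ler_wpM2l; first exact: ltW.
rewrite int_sum => [|i _]; last exact: (tl i).1.
have -> : m%:R * eta = \sum_(i < m) eta by rewrite sumr_const card_ord -[RHS]mulr_natl.
by apply: ler_sum => i _; exact: (tl i).2.
Unshelve. all: by end_near.
Qed.

End one_family.

Variables (d : I -> measure_display) (T : forall th, measurableType (d th))
  (P : forall th, probability (T th) R) (F : forall th, R -> set (set (T th)))
  (x : forall th, 'I_m -> R -> T th -> R).
Variables (d' : I -> measure_display) (T' : forall th, measurableType (d' th))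
  (P' : forall th, probability (T' th) R) (F' : forall th, R -> set (set (T' th)))
  (x' : forall th, 'I_m -> R -> T' th -> R).
Arguments P : clear implicits.
Arguments x : clear implicits.
Arguments P' : clear implicits.
Arguments x' : clear implicits.
Hypotheses (flow : flow_family FF P F c b x) (flow' : flow_family FF P' F' c b x').

(** The flow axioms determine the finite-dimensional distributions: the
    conditional law of the last vector given the previous ones is known through
    its distribution function, whose dependence on the present is Lipschitz, so
    one can peel off one time after the other. *)
Theorem flow_agreement k L B G : 0 <= L -> 0 < B -> lip_class k L B G ->
  asymp FF (fun th => \int[P th]_w G (flow_at (x th) tt w))
    (fun th => \int[P' th]_w G (flow_at (x' th) tt w)).
Proof.
elim: k L B G => [|k IH] L B G L0 B0 GL.
  apply: (asymp_trans FFF (flow_start_mean flow L0 GL)); apply: asymp_sym.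
  exact: (flow_start_mean flow' L0 GL).
apply: asymp_approx => e e0.
have [A1 [A10 h1]] := flow_gridded flow L0 B0 GL e0.
have [A2 [A20 h2]] := flow_gridded flow' L0 B0 GL e0.
pose A := Num.max A1 A2.
have [N1 {}h1] := h1 A (ltac:(by rewrite le_max lexx)).
have [N2 {}h2] := h2 A (ltac:(by rewrite le_max lexx orbT)).
pose N := (maxn N1 N2).+1.
exists (gridded_mean P x k A N G), (gridded_mean P' x' k A N G); split.
- by apply: h1 => //; rewrite /N leqW// leq_maxl.
- by apply: h2 => //; rewrite /N leqW// leq_maxr.
apply: asymp_sum => kap; apply: asymp_sum => J; apply: asympZ.
set y := fun i => if i \in J then _ else _.
have Gk := lip_freeze (upper A kap) L0 GL.
apply: (asymp_trans FFF (flow_below FFF c0 tt0 ttS flow y L0 B0 Gk)).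
apply: (asymp_trans FFF _ (asymp_sym FFF (flow_below FFF c0 tt0 ttS flow' y L0 B0 Gk))).
have [L' [L'0 cl]] := lip_cdf k (monotone_minorant y) (ltac:(by rewrite subr_gt0) : 0 < tt k.+1 - tt k).
have N0 : 0 < #|{: 'S_m}|%:R :> R by rewrite ltr0n; apply/card_gt0P; exists 1%g.
apply: IH (lip_classM L0 L'0 Gk cl).
- by rewrite addr_ge0// mulr_ge0// ltW.
- exact: mulr_gt0.
Qed.

End finite_dimensional_agreement.

(** * Order of two solutions *)

Section functions_of_a_linear_form.
Context (R : realType) (m : nat).
Variable sg : 'I_m -> R.
Hypothesis sg1 : forall k, `|sg k| <= 1.
Implicit Types x z : 'I_m -> R.

Definition lin z : R := \sum_k sg k * z k.

Lemma lin_norm z : `|lin z| <= \sum_k `|z k|.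
Proof.
apply: (le_trans (ler_norm_sum _ _ _)); apply: ler_sum => k _.
by rewrite normrM ler_piMl.
Qed.

Lemma linB x z : lin x - lin z = lin (fun k => x k - z k).
Proof. by rewrite /lin -sumrB; apply: eq_bigr => k _; rewrite mulrBr. Qed.

Lemma borel_lin f : measurable_fun setT f -> borel_vec (fun z => f (lin z)).
Proof.
move=> mf d T G z sG mz; apply: (wrt_comp sG mf); apply: (wrt_sum sG) => k.
by apply: (wrtM sG) => //; exact: wrt_cst.
Qed.

Lemma is_derive_measurable (f f' : R -> R) : (forall u : R, is_derive u 1 f (f' u)) ->
  measurable_fun setT f.
Proof.
move=> df; apply: continuous_measurable_fun => z.
by apply: differentiable_continuous; apply/derivable1_diffP; case: (df z).
Qed.

Lemma lin_expansion t0 C (f f1 f2 f3 : R -> R) : (forall u : R, is_derive u 1 f (f1 u)) ->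
  (forall u : R, is_derive u 1 f1 (f2 u)) -> (forall u : R, is_derive u 1 f2 (f3 u)) ->
  (forall u, [/\ `|f1 u| <= C, `|f2 u| <= C & `|f3 u| <= C]) ->
  expansion t0 C (fun _ z => f (lin z)) (fun k _ z => f1 (lin z) * sg k)
    (fun k l _ z => f2 (lin z) / 2 * (sg k * sg l)) (fun _ _ => 0).
Proof.
move=> d1 d2 d3 fC.
have C0 : 0 <= C by have [h _ _] := fC 0; exact: le_trans h.
have C1 (a b : R) : `|a| <= C -> `|b| <= 1 -> `|a * b| <= C.
  by move=> aC b1; rewrite normrM -[leRHS]mulr1 ler_pM.
split.
- move=> v v' x x' _ vv _.
  have -> : \sum_k f1 (lin x) * sg k * (x' k - x k) = f1 (lin x) * (lin x' - lin x).
    by rewrite linB mulr_sumr; apply: eq_bigr => k _; rewrite mulrA.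
  have -> : \sum_k \sum_l f2 (lin x) / 2 * (sg k * sg l) * ((x' k - x k) * (x' l - x l)) =
      f2 (lin x) * ((lin x' - lin x) ^+ 2 / 2).
    rewrite linB expr2 {1}/lin mulr_suml [in RHS]mulr_suml mulr_sumr; apply: eq_bigr => k _.
    by rewrite /lin mulr_sumr [in RHS]mulr_suml mulr_sumr; apply: eq_bigr => l _; field.
  rewrite mul0r subr0.
  have := @taylor3_bound R setT (fun _ _ _ _ _ _ _ => I) f f1 f2 f3 (lin x) (lin x') C I I.
  move=> h; apply: (le_trans (h _ _)) => // [z _|].
    by have [] := fC z.
  apply: ler_wpM2l => //; apply: lerXn2r; rewrite ?nnegrE ?psize_ge0//.
  by rewrite linB /psize; apply: (le_trans (lin_norm _)); rewrite lerDr sqrtr_ge0.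
- by move=> v; apply: borel_lin; exact: is_derive_measurable d1.
- move=> k v; apply: (@borel_lin (fun u => f1 u * sg k)); apply: measurable_funM => //.
  exact: is_derive_measurable d2.
- move=> k l v; apply: (@borel_lin (fun u => f2 u / 2 * (sg k * sg l))).
  by do 2 apply: measurable_funM => //; exact: is_derive_measurable d3.
- by move=> v; apply: (@borel_lin (fun=> 0)).
- by move=> k v z _ _; apply: C1 => //; have [] := fC (lin z).
- move=> k l v z _ _; rewrite -mulrA; apply: C1; first by have [] := fC (lin z).
  have h : `|sg k * sg l| <= 1 by rewrite normrM -[leRHS]mulr1 ler_pM.
  by rewrite normrM ger0_norm//; move: h; lra.
- by move=> v z _ _; rewrite normr0.
Qed.

End functions_of_a_linear_form.

Section ramp.
Context (R : realType).
Implicit Types (e u z : R).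

(** A smooth convex substitute for the positive part, of width [e]. *)
Definition ramp e z : R := z * psi 0 (z / e) + e * psi 1 (z / e).

Lemma is_derive_psi_scaled e k z : (k <= 3)%N ->
  is_derive z 1 (fun z => psi k (z / e)) (psi k.+1 (z / e) / e).
Proof.
move=> k3; have dk := is_derive_psi (z / e) k3.
have dz : is_derive z 1 (fun z : R => z / e) e^-1.
  by apply: is_derive_eq; rewrite /GRing.scale/=; ring.
apply: (@is_derive_eq _ _ _ _ _ _ _ _ (@is_derive1_comp _ (psi k) (fun z => z / e) z _ _ dk dz)).
by rewrite /GRing.scale/=.
Qed.

Lemma is_derive_ramp e z : 0 < e -> is_derive z 1 (ramp e) (psi 0 (z / e)).
Proof.
move=> e0; have d0 := @is_derive_psi_scaled e 0 z isT; have d1 := @is_derive_psi_scaled e 1 z isT.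
apply: is_derive_eq; rewrite /GRing.scale/= mulr1.
by rewrite /=; field; rewrite gt_eqF.
Qed.

Lemma psi_drift : exists C : R, 0 <= C /\ forall u, `|u ^+ 2 * psi 1 u| <= C.
Proof.
have [C [C0 hC]] := psi_bounded R; exists (C + C); split; first exact: addr_ge0.
move=> u; have -> : u ^+ 2 * psi 1 u = psi 3 u + psi 1 u by rewrite /=; ring.
by apply: (le_trans (ler_normD _ _)); rewrite lerD.
Qed.

Lemma ramp_ge e z : 0 < e -> 3 / 4 * Num.max z 0 - 2 * e <= ramp e z.
Proof.
move=> e0; rewrite /ramp/=; have pos : 0 <= e * normal_pdf 0 1 (z / e).
  by rewrite mulr_ge0 ?normal_pdf_ge0// ltW.
have P0 := Phi_ge0 (z / e); have P1 := Phi_le1 (z / e).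
have [z2|z2] := leP (2 * e) z.
  have zp : 0 < z by rewrite (lt_le_trans _ z2)// mulr_gt0.
  have ue : 2 <= z / e by rewrite ler_pdivlMr.
  have u0 : 0 < z / e by rewrite (lt_le_trans _ ue).
  have h := Phi_ge_sqr u0.
  have h' : (z / e) ^- 2 <= 4^-1.
    rewrite lef_pV2 ?posrE ?exprn_gt0//; apply: (@le_trans _ _ (2 ^+ 2)); first by rewrite expr2; lra.
    by rewrite lerXn2r ?nnegrE// ltW.
  rewrite (max_l (ltW zp)).
  have : 3 / 4 * z <= z * Phi (z / e) by rewrite mulrC ler_pM2l//; lra.
  by move: pos; lra.
have [z0|z0] := leP 0 z.
  have : 0 <= z * Phi (z / e) by rewrite mulr_ge0.
  by move: pos; lra.
rewrite mulr0 add0r.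
suff : - e <= z * Phi (z / e) by move: pos; lra.
have u0 : z / e < 0 by rewrite pmulr_llt0// invr_gt0.
have zE : z = e * (z / e) by rewrite mulrCA divff ?mulr1// gt_eqF.
rewrite {1}zE -mulrA -mulrN1 ler_pM2l//; set u := z / e in u0 P0 P1 *.
have [u1|u1] := leP (-1) u; first by nra.
have h := Phi_le_sqr u0.
have un : u != 0 by rewrite lt_eqF.
have : u * u ^- 2 <= u * Phi u by rewrite ler_nM2l.
have -> : u * u ^- 2 = u^-1 by field.
by apply: le_trans; rewrite -(ler_nM2l u0) divff// mulrN1; lra.
Qed.

Lemma ramp_le : exists C : R, 0 <= C /\ forall e z, 0 < e -> z <= 0 -> ramp e z <= e * C.
Proof.
have [C [C0 hC]] := psi_bounded R; exists C; split=> // e z e0 z0; rewrite /ramp.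
have h : psi 1 (z / e) <= C := le_trans (ler_norm _) (hC 1%N _).
have h' : z * psi 0 (z / e) <= 0 by rewrite mulr_le0_ge0// Phi_ge0.
by apply: (@le_trans _ _ (e * psi 1 (z / e))); [rewrite gerDr|rewrite ler_pM2l].
Qed.

End ramp.

Section order_of_solutions.
Context d (T : measurableType d) (R : realType) (P : probability T R).
Variables (F : R -> set (set T)) (W : set (R * R) -> T -> R).
Hypotheses (filF : is_filtration F) (wn : is_white_noise P F W).
Variable g : R -> R.
Hypothesis gC1 : C1_square_integrable g.
Local Notation r := (autocorrelation g).

Lemma int_ge0_ae (f : T -> R) : L1 P f -> {ae P, forall w, 0 <= f w} -> 0 <= \int[P]_w f w.
Proof.
move=> lf f0; rewrite (@ae_eq_int _ _ _ P f (fun w => `|f w|)); first exact: int_ge0.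
- exact: L1_measurable lf.
- exact: L1_measurable (L1_abs lf).
- by apply: filterS f0 => w h; rewrite ger0_norm.
Qed.

Lemma int0_ae (f : T -> R) : L1 P f -> (forall w, 0 <= f w) -> \int[P]_w f w <= 0 ->
  {ae P, forall w, f w = 0}.
Proof.
move=> lf f0 le; have I0 : \int[P]_w f w = 0.
  by apply/eqP; rewrite eq_le le int_ge0.
have mf : measurable_fun setT (EFin \o f) by apply/measurable_EFinP; exact: L1_measurable lf.
have := (@ae_eq_integral_abs _ T R P setT measurableT _ mf).1.
have -> : (\int[P]_(x in setT) `|(EFin \o f) x| = 0)%E.
  rewrite (eq_integral (fun w => (f w)%:E)) => [|w _]; last by rewrite /= ger0_norm.
  by rewrite (int_EFin lf) I0.
by move=> /(_ erefl); apply: filterS => w /(_ I)/= [].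
Qed.

(** The simple integrals over an empty time interval vanish. *)
Lemma solution_start x a : regular x -> solves_noise_equation P F W g a x ->
  {ae P, forall w, x 0 w = a}.
Proof.
move=> rx sx.
have sq (u v : R) : (u - v) ^+ 2 <= 2 * u ^+ 2 + 2 * v ^+ 2 by have := sqr_ge0 (u + v); nra.
have main e : 0 < e -> L2 P (fun w => a - x 0 w) /\ \int[P]_w (a - x 0 w) ^+ 2 <= 20 * e.
  move=> e0; have [n [f [pf _ _ h]]] := simple_approximation filF wn gC1 (lexx 0) e0 rx sx.
  have [l le] := h 0 (lexx _) (lexx _); have [C [_ hC]] := sint_bound filF wn pf.
  have [ls _ _] := hC 0 0 (lexx _) (lexx _).
  have s0 : \int[P]_w sint W f 0 0 w ^+ 2 <= 0.
    have z1 (w : T) : `|cst 1 w : R| <= 1 by rewrite normr1.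
    have sF : sigma_algebra setT (F 0) by case: filF => h' _ _; exact: h'.
    have [_ _ E] := sint_cov filF wn 0 pf pf (lexx 0) (wrt_cst sF 1) z1.
    rewrite (@int_ext _ _ _ P _ (fun w => cst 1 w * (sint W f 0 0 w * sint W f 0 0 w))) => [|w].
      rewrite E (@int_ext _ _ _ (P \x planar R)%E _ (fun=> 0)) ?int0// => z.
      by rewrite /between set_itvoc0 indic0 mulr0 mul0r.
    by rewrite mul1r expr2.
  have E w : a - x 0 w = (a + sint W f 0 0 w - x 0 w) - sint W f 0 0 w by ring.
  have l2 : L2 P (fun w => a - x 0 w) by apply: (eq_L2 (fun w => esym (E w))); exact: L2B.
  split=> //; apply: (@le_trans _ _ (\int[P]_w (2 * (a + sint W f 0 0 w - x 0 w) ^+ 2 +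
      2 * sint W f 0 0 w ^+ 2))).
    apply: int_le; [exact: l2.2|by apply: L1D; apply: L1Z; [exact: l.2|exact: ls.2]|].
    by move=> w; rewrite [a - _]E; exact: sq.
  rewrite intD; [|by apply: L1Z; exact: l.2|by apply: L1Z; exact: ls.2].
  by rewrite !intZ; [lra|exact: ls.2|exact: l.2].
have [l2 _] := main 1 ltr01.
have I0 : \int[P]_w (a - x 0 w) ^+ 2 <= 0.
  apply: (@le_epsilonM _ _ _ 20) => // e e0 _; rewrite add0r; exact: (main e e0).2.
have := int0_ae l2.2 (fun w => sqr_ge0 _) I0.
by apply: filterS => w /eqP; rewrite sqrf_eq0 subr_eq0 => /eqP.
Qed.

(** Two solutions driven by the same noise keep their order. The variance of
    their difference [D] grows at rate [2 (r 0 - r D) = O(D ^ 2)], so the drift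
    of a smoothed positive part of width [e] is [O(e)]. *)
Lemma solution_order x y a b t : regular x -> regular y ->
  solves_noise_equation P F W g a x -> solves_noise_equation P F W g b y ->
  a <= b -> 0 <= t -> {ae P, forall w, x t w <= y t w}.
Proof.
move=> rx ry sx sy ab t0.
pose z (k : 'I_2) := if k == ord0 then x else y.
pose az (k : 'I_2) := if k == ord0 then a else b.
pose sg (k : 'I_2) : R := if k == ord0 then 1 else -1.
have rz k : regular (z k) by rewrite /z; case: (k == _).
have sz k : solves_noise_equation P F W g (az k) (z k) by rewrite /z /az; case: (k == _).
have sg1 k : `|sg k| <= 1 by rewrite /sg; case: (k == _); rewrite ?normrN normr1.
have linE (v : 'I_2 -> R) : lin sg v = v ord0 - v (lift ord0 ord0).
  by rewrite /lin !big_ord_recl big_ord0 /sg /=; ring.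
have [Cp [Cp0 hCp]] := psi_bounded R.
have [Cd [Cd0 hCd]] := psi_drift R.
have [Cr [Cr0 hCr]] := ramp_le R.
have [L [L0 hL]] := autocorrelation_drop gC1.
pose D w := x t w - y t w.
pose h w := Num.min (Num.max (D w) 0) 1.
have mD : measurable_fun setT D by apply: measurable_funB; [exact: rx.1|exact: ry.1].
have h0 w : 0 <= h w by rewrite le_min ler01 le_max lexx orbT.
have lh : L1 P h.
  apply: (@L1_bdd _ _ _ _ 1) => [|w].
    by apply: measurable_minr => //; apply: measurable_maxr.
  by rewrite ger0_norm// ge_min lexx orbT.
have main e : 0 < e -> e <= 1 -> \int[P]_w h w <= 0 + 4 / 3 * (2 + Cr + L * Cd * t) * e.
  move=> e0 e1.
  pose C := Cp + Cp / e + Cp / e ^+ 2.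
  have i1 : 0 <= Cp / e by rewrite divr_ge0// ltW.
  have i2 : 0 <= Cp / e ^+ 2 by rewrite divr_ge0// exprn_ge0// ltW.
  have d1 (u : R) : is_derive u 1 (ramp e) (psi 0 (u / e)) by exact: is_derive_ramp.
  have d2 (u : R) : is_derive u 1 (fun u => psi 0 (u / e)) (psi 1 (u / e) / e) by exact: is_derive_psi_scaled.
  have d3 (u : R) : is_derive u 1 (fun u => psi 1 (u / e) / e) (psi 2 (u / e) / e ^+ 2).
    have := @is_derive_psi_scaled _ e 1 u isT => d3.
    apply: is_derive_eq; rewrite /GRing.scale/= ; field; exact: lt0r_neq0.
  have bd u : [/\ `|psi 0 (u / e)| <= C, `|psi 1 (u / e) / e| <= C & `|psi 2 (u / e) / e ^+ 2| <= C].
    have e2 : 0 < e ^+ 2 by exact: exprn_gt0.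
    have bde p k : 0 < k -> `|p| <= Cp -> `|p / k| <= Cp / k.
      by move=> k0 pC; rewrite normrM normfV (gtr0_norm k0) ler_pM2r ?invr_gt0.
    split; rewrite /C.
    - by apply: (le_trans (hCp _ _)); rewrite -addrA lerDl addr_ge0.
    - by apply: (le_trans (bde _ _ e0 (hCp _ _))); lra.
    - by apply: (le_trans (bde _ _ e2 (hCp _ _))); lra.
  have eU := lin_expansion sg1 t d1 d2 d3 bd.
  have LU v (u u' : 'I_2 -> R) : 0 <= v -> v <= t ->
      `|ramp e (lin sg u) - ramp e (lin sg u')| <= C * \sum_(i < 2) `|u i - u' i|.
    move=> _ _; apply: (le_trans (@mvt_bound R setT (fun _ _ _ _ _ _ _ => I) (ramp e)
      (fun u => psi 0 (u / e)) (lin sg u') (lin sg u) C I I _)).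
      by move=> s _ _; split; [exact: d1|have [] := bd s].
    rewrite linB; apply: ler_wpM2l; last exact: lin_norm.
    by rewrite /C !addr_ge0.
  have q v (u : 'I_2 -> R) : 0 <= v -> v <= t -> `|\sum_(i < 2) \sum_(j < 2)
      psi 1 (lin sg u / e) / e / 2 * (sg i * sg j) * r (u i - u j) + 0| <= L * Cd * e.
    move=> _ _; rewrite !big_ord_recl !big_ord0 /sg/= !subrr.
    set u0 := u ord0; set u1 := u _.
    rewrite -(opprB u0 u1) (autocorrelation_sym gC1) linE -/u0 -/u1; set s := u0 - u1.
    have -> : forall p : R, p / e / 2 * (1 * 1) * r 0 + (p / e / 2 * (1 * -1) * r s + 0) +
      (p / e / 2 * (-1 * 1) * r s + (p / e / 2 * (-1 * -1) * r 0 + 0) + 0) + 0 =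
      (p / e) * (r 0 - r s) by move=> p; field; rewrite gt_eqF.
    have p0 : 0 <= psi 1 (s / e) by exact: normal_pdf_ge0.
    have rs : 0 <= r 0 - r s.
      by rewrite subr_ge0; exact: le_trans (ler_norm _) (autocorrelation_le gC1 s).
    rewrite ger0_norm; last by rewrite mulr_ge0// divr_ge0// ltW.
    have hs := hL s; have hd := le_trans (ler_norm _) (hCd (s / e)).
    apply: (@le_trans _ _ (psi 1 (s / e) / e * (L * s ^+ 2))).
      by apply: ler_wpM2l => //; rewrite divr_ge0// ltW.
    have -> : psi 1 (s / e) / e * (L * s ^+ 2) = (L * e) * ((s / e) ^+ 2 * psi 1 (s / e)).
      by move: (psi 1 _) => p; field; rewrite gt_eqF.
    have -> : L * Cd * e = L * e * Cd by ring.
    by apply: ler_wpM2l => //; rewrite mulr_ge0// ltW.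
  have C0 : 0 <= C by rewrite /C !addr_ge0.
  have z1 (w : T) : `|cst 1 w : R| <= 1 by rewrite normr1.
  have sF : sigma_algebra setT (F 0) by case: filF => h' _ _; exact: h'.
  have [l le] := ito_bound filF wn gC1 rz C0 sz eU LU q (lexx 0) t0 (lexx t) (wrt_cst sF 1) z1.
  set f := (fun w => cst 1 w * _) in l; rewrite -[X in `|X|]/(\int[P]_w f w) in le.
  have lG : L1 P (fun w => f w - 3 / 4 * h w + (2 + Cr) * e).
    by apply: L1D; [apply: L1B => //; exact: L1Z|exact: L1_cst].
  have G0 : {ae P, forall w, 0 <= f w - 3 / 4 * h w + (2 + Cr) * e}.
    have sx0 := solution_start rx sx; have sy0 := solution_start ry sy.
    apply: filterS2 sx0 sy0 => w hx hy; rewrite /f /= mul1r !linE /z/= hx hy.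
    have := @ramp_ge _ e (D w) e0; have := hCr e (a - b) e0 (ltac:(lra)).
    have : h w <= Num.max (D w) 0 by rewrite /h ge_min lexx.
    rewrite -/(D w); lra.
  have := int_ge0_ae lG G0.
  rewrite intD; [|by apply: L1B => //; exact: L1Z|exact: L1_cst].
  rewrite int_cst intB//; last exact: L1Z.
  rewrite (intZ _ lh); move: (le_trans (ler_norm _) le); rewrite subr0 mul1r.
  move: (\int[P]_w f w) (\int[P]_w h w) => If Ih le1 le2.
  have -> : 0 + 4 / 3 * (2 + Cr + L * Cd * t) * e = 4 / 3 * ((2 + Cr) * e + L * Cd * e * t) by ring.
  by move: (L * Cd * e * t) ((2 + Cr) * e) le1 le2 => u v; lra.
have I0 : \int[P]_w h w <= 0.
  by apply: le_epsilonM main; rewrite mulr_ge0// !addr_ge0// !mulr_ge0.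
apply: filterS (int0_ae lh h0 I0) => w; rewrite /h minElt.
case: ltP => [_ /eqP|_ /eqP]; last by rewrite oner_eq0.
by rewrite maxElt /D; case: ltP => //; lra.
Qed.

End order_of_solutions.

Lemma autocorrelation_vanishes (R : realType) (h : R -> R) (kappa : R) :
  C1_square_integrable h -> autocorrelation h x @[x --> +oo] --> (0 : R) -> 0 < kappa ->
  exists M : R, 0 < M /\ forall u, M <= `|u| -> `|autocorrelation h u| <= kappa.
Proof.
move=> hC /cvgrPdist_le/(_ kappa) + k0 => /(_ k0)[M [Mr hM]].
exists (Num.max M 0 + 1); split; first by rewrite ltr_pwDr// le_max lexx orbT.
move=> u uM; have -> : autocorrelation h u = autocorrelation h `|u|.
  have [u0|u0] := leP 0 u; first by rewrite (ger0_norm u0).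
  by rewrite (ltr0_norm u0) (autocorrelation_sym hC).
have := hM `|u|; rewrite sub0r normrN; apply.
by apply: lt_le_trans uM; rewrite ltr_pwDr// le_max lexx.
Qed.

(** The heat kernel, run backwards, is a martingale along [x]: the property that
    makes [x] a Brownian motion of speed [c] as far as its law is concerned. *)
Definition heat_mean d (T : measurableType d) (R : realType) (P : probability T R)
    (F : R -> set (set T)) (c : R) (x : R -> T -> R) : Prop :=
  forall e s t y zeta, 0 < e -> 0 <= s -> s <= t ->
    measurable_wrt (F s) zeta -> (forall w, `|zeta w| <= 1) ->
    \int[P]_w (zeta w * (heat c 0 y e (x t w) - heat c 0 y (e + t - s) (x s w))) = 0.

Lemma heat_mean_start d (T : measurableType d) (R : realType) (P : probability T R)
    (F : R -> set (set T)) (c : R) (x : R -> T -> R) e t y : 0 < c ->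
  is_filtration F -> (forall t, 0 <= t -> measurable_fun setT (x t)) -> heat_mean P F c x ->
  0 < e -> 0 <= t ->
  \int[P]_w heat c 0 y e (x t w) = \int[P]_w heat c 0 y (e + t) (x 0 w).
Proof.
move=> c0 fil mx hm e0 t0; have sF : sigma_algebra setT (F 0) by case: fil => h' _ _; exact: h'.
have z1 (w : T) : `|cst 1 w : R| <= 1 by rewrite normr1.
have I0 := hm e 0 t y (cst 1) e0 (lexx 0) t0 (wrt_cst sF 1) z1.
apply/eqP; rewrite -subr_eq0; apply/eqP.
rewrite -intB; [|exact: L1_heat0|exact: L1_heat0].
by rewrite -[RHS]I0; apply: int_ext => w; rewrite mul1r subr0.
Qed.

Lemma cdf_1 (R : realType) (c y tau z : R) :
  coalescing_cdf c (fun=> y) tau (fun _ : 'I_1 => z) = heat c 0 y tau z.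
Proof. by rewrite /coalescing_cdf det_mx11 mxE ltnn subr0. Qed.

(** For one particle the generator is [c / 2] times the second derivative,
    whatever the correlation function is away from zero. *)
Lemma solution_heat_mean d (T : measurableType d) (R : realType) (P : probability T R)
    (F : R -> set (set T)) (W : set (R * R) -> T -> R) (g : R -> R) a x :
  is_filtration F -> is_white_noise P F W -> C1_square_integrable g ->
  0 < autocorrelation g 0 -> regular x -> solves_noise_equation P F W g a x ->
  heat_mean P F (autocorrelation g 0) x.
Proof.
move=> fil wn gC c0 rx sx e s t y zeta e0 s0 st mz z1; have t0 := le_trans s0 st.
have [C [C0 hC]] := cdf_expansion 1 c0 e0 t0.
have [al [be [ga [eU LU _ diag]]]] := hC (fun=> y).
have q v (z : 'I_1 -> R) : 0 <= v -> v <= t -> `|\sum_i \sum_j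
    be i j v z * autocorrelation g (z i - z j) + ga v z| <= 0.
  move=> _ _; have {}diag := diag v z.
  by rewrite !big_ord1 subrr mulrC; rewrite big_ord1 in diag; rewrite diag normr0.
have [_ le] := ito_bound fil wn gC (m := 1) (x := fun=> x) (fun=> rx) C0
  (a := fun=> a) (fun=> sx) eU LU q s0 st (lexx t) mz z1.
rewrite mulr0 mul0r normr_le0 in le; move/eqP: le => I0.
rewrite -[RHS]I0; apply: int_ext => w; rewrite !cdf_1.
have -> : t + e - t = e by ring.
by have -> : t + e - s = e + t - s by ring.
Qed.

Section interacting_flows.
Context (R : realType) (m : nat) (FF : set_system R).
Hypothesis FFF : Filter FF.
Variable h : R -> R.
Hypotheses (hC1 : C1_square_integrable h) (h_neq0 : exists y, h y <> 0)
  (h_pinfty : autocorrelation h x @[x --> +oo] --> (0 : R)).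
Variables (d : R -> measure_display) (T : forall th, measurableType (d th))
  (P : forall th, probability (T th) R) (F : forall th, R -> set (set (T th)))
  (W : forall th, set (R * R) -> T th -> R)
  (g : R -> R -> R) (a : R -> 'I_m -> R) (b : 'I_m -> R)
  (x : forall th, 'I_m -> R -> T th -> R).
Arguments P : clear implicits.
Arguments F : clear implicits.
Arguments W : clear implicits.
Arguments x : clear implicits.
Local Notation c := (autocorrelation h 0).
Hypotheses (large : forall M : R, \forall th \near FF, M <= th)
  (interacting : \forall th \near FF, [/\ C1_square_integrable (g th),
     forall z, autocorrelation h (th * z) = autocorrelation (g th) z,
     is_filtration (F th), is_white_noise (P th) (F th) (W th) &
     forall i, regular (x th i) /\ solves_noise_equation (P th) (F th) (W th) (g th) (a th i) (x th i)])
  (sorted_start : \forall th \near FF, sorted_vec (a th))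
  (start_cvg : forall delta, 0 < delta -> \forall th \near FF, forall i, `|a th i - b i| <= delta).

Let c0 : 0 < c := autocorrelation_gt0 hC1 h_neq0.

(** The second-order coefficient in a pair of directions vanishes on the
    diagonal, and the correlation between distinct particles is negligible away
    from it: what remains of the drift tends to zero. *)
Lemma interacting_drift e t delta : 0 < e -> 0 <= t -> 0 < delta ->
  \forall th \near FF, forall s y zeta, 0 <= s -> s <= t ->
    measurable_wrt (F th s) zeta -> (forall w, `|zeta w| <= 1) ->
    `|\int[P th]_w (zeta w * (coalescing_cdf c y e (fun i => x th i t w) -
        coalescing_cdf c y (e + t - s) (fun i => x th i s w)))| <= delta.
Proof.
move=> e0 t0 d0; have [C [C0 hC]] := cdf_expansion m c0 e0 t0.
have M20 : 0 <= m%:R ^+ 2 :> R by exact: sqr_ge0.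
have [kap [kap0 _ kapK]] := @small_choice _ (m%:R ^+ 2 * (2 * C) * t) delta
  (ltac:(by rewrite !mulr_ge0)) d0.
have [M [M0 hM]] := autocorrelation_vanishes hC1 h_pinfty kap0.
near=> th => s y zeta s0 st mz z1.
have [gC rg fil wn sol] : [/\ C1_square_integrable (g th),
     forall z, autocorrelation h (th * z) = autocorrelation (g th) z,
     is_filtration (F th), is_white_noise (P th) (F th) (W th) &
     forall i, regular (x th i) /\ solves_noise_equation (P th) (F th) (W th) (g th) (a th i) (x th i)].
  by near: th; exact: interacting.
have thM : M * c / kap + 1 <= th by near: th; exact: large.
have th0 : 0 < th by apply: lt_le_trans thM; rewrite ltr_wpDl// divr_ge0 ?mulr_ge0// ltW.
have [al [be [ga [eU LU off diag]]]] := hC y.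
have q v (z : 'I_m -> R) : 0 <= v -> v <= t -> `|\sum_i \sum_j
    be i j v z * autocorrelation (g th) (z i - z j) + ga v z| <= m%:R ^+ 2 * (2 * C * kap).
  move=> v0 vt; have {}diag := diag v z; have beC := exp_be_bound eU.
  have r0 : autocorrelation (g th) 0 = c by rewrite -rg mulr0.
  have -> : \sum_i \sum_j be i j v z * autocorrelation (g th) (z i - z j) + ga v z =
      \sum_i \sum_(j | j != i) be i j v z * autocorrelation (g th) (z i - z j).
    have -> : \sum_i \sum_j be i j v z * autocorrelation (g th) (z i - z j) =
        c * \sum_i be i i v z + \sum_i \sum_(j | j != i) be i j v z * autocorrelation (g th) (z i - z j).
      rewrite mulr_sumr -big_split/=; apply: eq_bigr => i _.
      by rewrite (bigD1 i)//= subrr r0 [c * _]mulrC.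
    by rewrite addrAC diag add0r.
  have -> : m%:R ^+ 2 * (2 * C * kap) = \sum_(i < m) \sum_(j < m) 2 * C * kap.
    by rewrite !sumr_const card_ord -mulrnA -[RHS]mulr_natl natrM expr2.
  have K0 : 0 <= 2 * C * kap by rewrite !mulr_ge0// ltW.
  apply: (le_trans (ler_norm_sum _ _ _)); apply: ler_sum => i _.
  apply: (le_trans (ler_norm_sum _ _ _)).
  rewrite [leRHS](bigID (fun j => j != i))/= -[leLHS]addr0; apply: lerD; last by apply: sumr_ge0.
  apply: ler_sum => j ji; rewrite normrM -rg.
  have [far|near] := leP M `|th * (z i - z j)|.
    apply: (@le_trans _ _ (C * kap)); first by apply: ler_pM => //; [exact: beC|exact: hM].
    by rewrite -mulrA ler_peMl ?mulr_ge0 ?ler1n// ltW.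
  have zz : `|z i - z j| <= M / th.
    by rewrite ler_pdivlMr// mulrC -[th]gtr0_norm// -normrM ltW.
  apply: (@le_trans _ _ (C * (M / th) * c)).
    apply: ler_pM => //; last exact: autocorrelation_le.
    by apply: (le_trans (off v z i j v0 vt (ltac:(by rewrite eq_sym)))); exact: ler_wpM2l.
  have -> : 2 * C * kap = C * (2 * kap) by ring.
  rewrite -mulrA; apply: ler_wpM2l => //.
  have -> : M / th * c = M * c / th by ring.
  rewrite ler_pdivrMr//; apply: (@le_trans _ _ (kap * th)).
    have h1 : M * c / kap <= th by apply: le_trans thM; rewrite lerDl.
    by move: h1; rewrite ler_pdivrMr// [th * _]mulrC.
  by rewrite ler_wpM2r ?(ltW th0)//; lra.
have [_ le] := ito_bound fil wn gC (fun i => (sol i).1) C0 (fun i => (sol i).2) eU LU q s0 st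
  (lexx t) mz z1.
have e1 : t + e - t = e by ring.
have e2 : t + e - s = e + t - s by ring.
rewrite e1 e2 in le; apply: (le_trans le); rewrite mul1r.
apply: le_trans kapK.
have -> : m%:R ^+ 2 * (2 * C) * t * kap = m%:R ^+ 2 * (2 * C * kap) * t by ring.
by apply: ler_wpM2l; [rewrite !mulr_ge0// ltW|lra].
Unshelve. all: by end_near.
Qed.

Lemma interacting_single : \forall th \near FF, forall i e t y, 0 < e -> 0 <= t ->
    \int[P th]_w heat c 0 y e (x th i t w) = \int[P th]_w heat c 0 y (e + t) (x th i 0 w).
Proof.
apply: filterS interacting => th [gC rg fil wn sol] i e t y e0 t0.
have [rx sx] := sol i.
have r0 : autocorrelation (g th) 0 = c by rewrite -rg mulr0.
apply: (heat_mean_start y c0 fil _ _ e0 t0); first by move=> u _; exact: rx.1.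
by rewrite -r0; apply: (solution_heat_mean fil wn gC _ rx sx); rewrite r0.
Qed.

Theorem interacting_flow : flow_family FF P F c b x.
Proof.
split.
- apply: filterS interacting => th [_ _ fil _ sol]; split=> // i.
  by have [_ []] := sol i.
- move=> delta d0; apply: filterS2 interacting (start_cvg d0) => th [gC _ fil wn sol] ab i.
  have [rx sx] := sol i.
  by apply: filterS (solution_start fil wn gC rx sx) => w ->.
- apply: filterS2 interacting sorted_start => th [gC _ fil wn sol] srt t t0.
  have le (i j : 'I_m) : {ae P th, forall w, (i <= j)%N -> x th i t w <= x th j t w}.
    have [ij|] := boolP (i <= j)%N; last by move=> _; apply: aeW.
    have [ri si] := sol i; have [rj sj] := sol j.
    by apply: filterS (solution_order fil wn gC ri rj si sj (srt _ _ ij) t0).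
  have le' (i : 'I_m) : {ae P th, forall w, forall j : 'I_m, (i <= j)%N -> x th i t w <= x th j t w}.
    exact: filter_forall.
  have : {ae P th, forall w, forall i j : 'I_m, (i <= j)%N -> x th i t w <= x th j t w}.
    exact: filter_forall.
  by apply: filterS.
- exact: interacting_drift.
- exact: interacting_single.
Qed.

End interacting_flows.

(** * Coalescing Brownian motions *)

Section brownian_increments.
Context d (T : measurableType d) (R : realType) (P : probability T R).
Variables (F : R -> set (set T)) (c : R) (B : R -> T -> R).
Hypotheses (filF : is_filtration F) (c0 : 0 <= c) (bm : is_BM P F c B).
Implicit Types (s t : R) (zeta : T -> R).

Let FM t : 0 <= t -> F t `<=` measurable.
Proof. by case: filF => _ h _; exact: h. Qed.

Lemma BM_adapted : adapted F B.
Proof. by case: bm. Qed.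

Lemma BM_measurable t : 0 <= t -> measurable_fun setT (B t).
Proof. by move=> t0; exact: wrt_measurable (FM t0) (BM_adapted t0). Qed.

Lemma BM_moments s t : 0 <= s -> s <= t ->
  [/\ L2 P (fun w => B t w - B s w), L1 P (fun w => (B t w - B s w) ^+ 4) &
      \int[P]_w (B t w - B s w) ^+ 4 <= 32 * c ^+ 2 * (t - s) ^+ 2].
Proof.
move=> s0; rewrite le_eqVlt => /predU1P[<-|st].
  have E k w : (B s w - B s w) ^+ k.+1 = 0 by rewrite subrr expr0n.
  split.
  - by apply: eq_L2 (L2_0 P) => w; rewrite subrr.
  - by apply: eq_L1 (L1_cst P 0) => w; rewrite E.
  - by rewrite (int_ext P (E 3%N)) int0 !subrr expr0n mulr0.
have t0 := le_trans s0 (ltW st).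
have v0 : 0 <= c * (t - s) by rewrite mulr_ge0// subr_ge0 ltW.
have mI : measurable_fun setT (fun w => B t w - B s w).
  by apply: measurable_funB; exact: BM_measurable.
case: bm => _ _ /(_ _ _ s0 st) ga _.
have [l2 _ _ l4 le] := centered_gaussian_moments v0 mI ga.
by split=> //; apply: (le_trans le); rewrite exprMn mulrA.
Qed.

Lemma BM_conditional s t zeta K : 0 <= s -> s <= t ->
  measurable_wrt (F s) zeta -> (forall w, `|zeta w| <= K) ->
  [/\ \int[P]_w (zeta w * (B t w - B s w)) = 0,
      L1 P (fun w => zeta w * (B t w - B s w) ^+ 2) &
      \int[P]_w (zeta w * (B t w - B s w) ^+ 2) = c * (t - s) * \int[P]_w zeta w].
Proof.
move=> s0; rewrite le_eqVlt => /predU1P[<-|st] mz zK.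
  have E k w : zeta w * (B s w - B s w) ^+ k.+1 = 0 by rewrite subrr expr0n mulr0.
  rewrite (int_ext P (E 0%N)) (int_ext P (E 1%N)) int0 subrr mulr0 mul0r; split=> //.
  by apply: eq_L1 (L1_cst P 0) => w; rewrite E.
have t0 := le_trans s0 (ltW st).
have v0 : 0 <= c * (t - s) by rewrite mulr_ge0// subr_ge0 ltW.
have mI : measurable_fun setT (fun w => B t w - B s w).
  by apply: measurable_funB; exact: BM_measurable.
have lz : L1 P zeta by apply: L1_bdd zK; exact: wrt_measurable (FM s0) mz.
case: bm => _ _ /(_ _ _ s0 st) ga /(_ _ _ s0 st) ind.
have [l2 m1 m2 _ _] := centered_gaussian_moments v0 mI ga.
have [_ e1] := independent_int (h := id) (FM s0) mz mI (@measurable_id _ _ _) ind lz (L2_L1 l2).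
have [l e2] := independent_int (h := fun u => u ^+ 2) (FM s0) mz mI
  (measurable_funX _ (@measurable_id _ _ _)) ind lz l2.2.
by split; [rewrite e1 m1 mulr0|exact: l|rewrite e2 m2 mulrC].
Qed.

End brownian_increments.

Section stopped_paths.
Context (R : realType).
Implicit Types (z D : R -> R) (s t u : R).

Lemma hitting_time0_le z u : 0 <= u -> z u = 0 -> (hitting_time0 z <= u%:E)%E.
Proof. by move=> u0 zu; apply: ereal_inf_lbound; exists u. Qed.

Lemma hitting_time0_ge0 z : (0 <= hitting_time0 z)%E.
Proof. by apply: le_ereal_inf_tmp => _ [t [t0 _] <-]; rewrite lee_fin. Qed.

Lemma stopped_before z t : (t%:E < hitting_time0 z)%E -> stopped_at0 z t = z t.
Proof. by move=> h; rewrite /stopped_at0 (min_l (ltW h)). Qed.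

Lemma stopped_after z t : (hitting_time0 z <= t%:E)%E ->
  stopped_at0 z t = z (fine (hitting_time0 z)).
Proof. by move=> h; rewrite /stopped_at0 (min_r h). Qed.

Lemma stopped_absorbed z s t : 0 <= s -> s <= t -> stopped_at0 z s = 0 -> stopped_at0 z t = 0.
Proof.
move=> s0 st; have [h|h] := leP (hitting_time0 z) s%:E.
  by rewrite !stopped_after// (le_trans h)// lee_fin.
rewrite stopped_before// => /(hitting_time0_le s0).
by rewrite leNgt h.
Qed.

Lemma zero_at_hitting_time z t : {within halfline R, continuous z} ->
  (hitting_time0 z <= t%:E)%E -> z (fine (hitting_time0 z)) = 0.
Proof.
move=> cz ht; have h0 := hitting_time0_ge0 z.
have hE : (fine (hitting_time0 z))%:E = hitting_time0 z.
  by rewrite fineK// ge0_fin_numE// (le_lt_trans ht) ?ltry.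
set h := fine _ in hE *; have hh0 : 0 <= h by rewrite fine_ge0.
apply/eqP; apply: contrapT => /negP zh.
have /subspace_continuousP/(_ h hh0)/cvgr_neq0/(_ zh) := cz.
rewrite near_withinE => /nbhs_ballP[e e0 he].
have : ((h + e)%:E <= hitting_time0 z)%E.
  apply: le_ereal_inf_tmp => _ [u [u0 zu] <-]; rewrite lee_fin leNgt; apply/negP => ue.
  have hu : h <= u by rewrite -lee_fin hE; exact: hitting_time0_le.
  have /he/(_ u0) : ball h e u by rewrite /ball/= ltr_norml; lra.
  by rewrite /from_subspace/= zu eqxx.
by rewrite -hE lee_fin gerDl leNgt e0.
Qed.

(** A change of sign would need a zero, by the intermediate value theorem, and
    the stopped path stays at zero once it is there. *)
Lemma stopped_difference z D s t : {within halfline R, continuous z} -> continuous D ->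
  (forall u, 0 <= u -> `|D u| = stopped_at0 z u) -> D 0 <= 0 -> 0 <= s -> s <= t ->
  [/\ D t <= 0, D s = 0 -> D t = 0 &
      D s != 0 -> D t != 0 -> (D t - D s) ^+ 2 = (z t - z s) ^+ 2].
Proof.
move=> cz cD Dz D0 s0 st; have t0 := le_trans s0 st.
have absorb u v : 0 <= u -> u <= v -> D u = 0 -> D v = 0.
  move=> u0 uv Du; apply/eqP; rewrite -normr_eq0 Dz ?(le_trans u0)//; apply/eqP.
  by apply: (stopped_absorbed u0 uv); rewrite -Dz// Du normr0.
have neg u : 0 <= u -> D u <= 0.
  move=> u0; rewrite leNgt; apply/negP => Du.
  have [|v] := @IVT R D 0 u 0 u0 (continuous_subspaceT cD).
    by rewrite ge_min D0 le_max (ltW Du) orbT.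
  rewrite in_itv/= => /andP[v0 vu] Dv.
  by move: Du; rewrite (absorb v u v0 vu Dv) ltxx.
split; [exact: neg|exact: absorb|].
move=> Ds Dt.
have free u : 0 <= u -> D u != 0 -> D u = - z u.
  move=> u0 Du; have hu : (u%:E < hitting_time0 z)%E.
    rewrite ltNge; apply/negP => h; move: Du.
    by rewrite -normr_eq0 Dz// stopped_after// (zero_at_hitting_time cz h) eqxx.
  by rewrite -(stopped_before hu) -Dz// ler0_norm ?opprK// neg.
by rewrite (free t t0 Dt) (free s s0 Ds); ring.
Qed.

End stopped_paths.

Section coalescing_drift.
Context d (T : measurableType d) (R : realType) (P : probability T R).
Variables (F : R -> set (set T)) (m : nat) (c : R) (x : 'I_m -> R -> T -> R).
Hypotheses (filF : is_filtration F) (c0 : 0 <= c) (bm : forall i, is_BM P F c (x i)).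
Implicit Types (s t : R) (zeta : T -> R).

Let gap (i j : 'I_m) (t : R) (w : T) : R := x i t w - x j t w.

Hypothesis pair : forall i j, i != j -> exists2 B : R -> T -> R, is_BM P F (2 * c) B &
  {ae P, forall w, forall s t, 0 <= s -> s <= t ->
    (gap i j s w = 0 -> gap i j t w = 0) /\
    (gap i j s w != 0 -> gap i j t w != 0 ->
       (gap i j t w - gap i j s w) ^+ 2 = (B t w - B s w) ^+ 2)}.

Let sF t : 0 <= t -> sigma_algebra setT (F t).
Proof. by case: filF => h _ _; exact: h. Qed.

Let FM t : 0 <= t -> F t `<=` measurable.
Proof. by case: filF => _ h _; exact: h. Qed.

Let Fle s t : 0 <= s -> s <= t -> F s `<=` F t.
Proof. by case: filF => _ _ h; exact: h. Qed.

Lemma brownian_mart4 : mart4 P F (32 * c ^+ 2) x.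
Proof.
split.
- by move=> i; exact: BM_adapted (bm i).
- by move=> i s t s0 st; have [] := BM_moments filF c0 (bm i) s0 st.
- by move=> i s t s0 st; have [] := BM_moments filF c0 (bm i) s0 st.
- by move=> i s t s0 st; have [] := BM_moments filF c0 (bm i) s0 st.
- by move=> i s t zeta K s0 st mz zK; have [] := BM_conditional filF c0 (bm i) s0 st mz zK.
Qed.

Definition met (i j : 'I_m) t (w : T) : R := (gap i j t w == 0)%:R.

Lemma measurable_met i j t : 0 <= t -> measurable_fun setT (met i j t).
Proof.
move=> t0; have mg : measurable_fun setT (gap i j t).
  by apply: measurable_funB; exact: (BM_measurable filF (bm _)).
have -> : met i j t = fun w => \1_[set 0] (gap i j t w).
  apply/funext => w; rewrite indicE /met; congr (_%:R); congr nat_of_bool.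
  by apply/eqP/idP => [h|/set_mem//]; exact: mem_set.
by apply: (measurableT_comp _ mg); exact: measurable_indic.
Qed.

Lemma L1_met i j t : 0 <= t -> L1 P (met i j t).
Proof.
move=> t0; apply: (@L1_bdd _ _ _ _ 1); first exact: measurable_met.
by move=> w; rewrite /met; case: (_ == _); rewrite ?normr1 ?normr0.
Qed.

(** A weight that vanishes when the two particles are together sees no
    correlation of their increments, except on the event that they meet within
    the time step. *)
Lemma meeting_covariation i j s t zeta K delta : i != j -> 0 <= s -> s < t -> 0 < delta ->
  measurable_wrt (F s) zeta -> (forall w, `|zeta w| <= K) ->
  (forall w, gap i j s w = 0 -> zeta w = 0) ->
  L1 P (fun w => zeta w * ((x i t w - x i s w) * (x j t w - x j s w))) /\
  `|\int[P]_w (zeta w * ((x i t w - x i s w) * (x j t w - x j s w)))| <=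
    K * (2560 * c ^+ 2 * delta * (t - s) +
         (t - s) / delta * (\int[P]_w met i j t w - \int[P]_w met i j s w)).
Proof.
move=> ij s0 st d0 mz zK z0; have st' := ltW st; have t0 := le_trans s0 st'.
have [B bB ae] := pair ij.
have c20 : 0 <= 2 * c by rewrite mulr_ge0.
have K0 : 0 <= K := le_trans (normr_ge0 _) (zK point).
pose dx i w := x i t w - x i s w; pose dB w := B t w - B s w.
pose dg w := gap i j t w - gap i j s w.
have dgE w : dg w = dx i w - dx j w by rewrite /dg /gap /dx; ring.
have [_ li ei] := BM_conditional filF c0 (bm i) s0 st' mz zK.
have [_ lj ej] := BM_conditional filF c0 (bm j) s0 st' mz zK.
have [_ lB eB] := BM_conditional filF c20 bB s0 st' mz zK.
have [l2i l4i b4i] := BM_moments filF c0 (bm i) s0 st'.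
have [l2j l4j b4j] := BM_moments filF c0 (bm j) s0 st'.
have [l2B l4B b4B] := BM_moments filF c20 bB s0 st'.
have mzT : measurable_fun setT zeta := wrt_measurable (FM s0) mz.
have lg2 : L2 P dg by apply: (eq_L2 (fun w => esym (dgE w))); exact: L2B.
have lzg : L1 P (fun w => zeta w * dg w ^+ 2) by apply: (L1_Mbdd mzT zK); exact: lg2.2.
have lc : L1 P (fun w => zeta w * (dx i w * dx j w)).
  by apply: (L1_Mbdd mzT zK); exact: L2M.
split; first exact: lc.
have E w : zeta w * (dx i w * dx j w) = 2^-1 * ((zeta w * dx i w ^+ 2 + zeta w * dx j w ^+ 2)
    - zeta w * dg w ^+ 2) by rewrite dgE; field.
have eC : \int[P]_w (zeta w * (dx i w * dx j w)) =
    2^-1 * \int[P]_w (zeta w * dB w ^+ 2 - zeta w * dg w ^+ 2).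
  rewrite (int_ext P E) intZ; last by apply: L1B => //; exact: L1D.
  rewrite (intB (L1D li lj) lzg) (intD li lj) (intB lB lzg) ei ej eB.
  by move: (\int[P]_w (zeta w * dg w ^+ 2)) => u; congr (_ * _); ring.
rewrite -/(dx i) -/(dx j) eC.
pose V w := dB w ^+ 2 + dg w ^+ 2.
have sum4 (p q : R) : (p + q) ^+ 2 <= 2 * p ^+ 2 + 2 * q ^+ 2 by have := sqr_ge0 (p - q); nra.
have V2 w : V w ^+ 2 <= 2 * dB w ^+ 4 + 16 * (dx i w ^+ 4 + dx j w ^+ 4).
  rewrite /V; apply: (le_trans (sum4 _ _)); rewrite -!exprM lerD2l dgE.
  have h : (dx i w - dx j w) ^+ 4 <= 8 * (dx i w ^+ 4 + dx j w ^+ 4).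
    have -> (p q : R) : (p - q) ^+ 4 = ((p - q) ^+ 2) ^+ 2 by rewrite -exprM.
    have h1 : (dx i w - dx j w) ^+ 2 <= 2 * dx i w ^+ 2 + 2 * dx j w ^+ 2.
      by have := sqr_ge0 (dx i w + dx j w); nra.
    apply: (@le_trans _ _ ((2 * dx i w ^+ 2 + 2 * dx j w ^+ 2) ^+ 2)).
      by rewrite lerXn2r ?nnegrE ?sqr_ge0// addr_ge0// mulr_ge0// sqr_ge0.
    have e4 (p : R) : (2 * p ^+ 2) ^+ 2 = 4 * p ^+ 4 by ring.
    by apply: (le_trans (sum4 _ _)); rewrite !e4; lra.
  by rewrite /=; lra.
pose q w := 2 * dB w ^+ 4 + 16 * (dx i w ^+ 4 + dx j w ^+ 4).
have lq : L1 P q by apply: L1D; apply: L1Z => //; exact: L1D.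
have iq : \int[P]_w q w <= 1280 * c ^+ 2 * (t - s) ^+ 2.
  rewrite /q intD; [|exact: L1Z|by apply: L1Z; exact: L1D].
  rewrite (intZ _ l4B) intZ ?intD//; last exact: L1D.
  by move: b4B b4i b4j; rewrite exprMn; move: (c ^+ 2) ((t - s) ^+ 2) => u v; lra.
(* The parameter of Young's inequality, which splits the mean of [V] on the
   meeting event into [eps * V ^+ 2] and the probability of that event. *)
pose eps := 2 * delta / (t - s).
have ts0 : 0 < t - s by rewrite subr_gt0.
have eps0 : 0 < eps by rewrite divr_gt0// mulr_gt0.
pose bnd w := K * (eps * q w + (2 * eps)^-1 * (met i j t w - met i j s w)).
have lm : L1 P (fun w => met i j t w - met i j s w) by apply: L1B; exact: L1_met.
have lb : L1 P (fun w => eps * q w + (2 * eps)^-1 * (met i j t w - met i j s w)).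
  by apply: L1D; exact: L1Z.
have ptw : {ae P, forall w, `|zeta w * dB w ^+ 2 - zeta w * dg w ^+ 2| <= `|bnd w|}.
  apply: filterS ae => w /(_ s t s0 st')[abs eqs].
  have q0 : 0 <= q w by rewrite /q addr_ge0// mulr_ge0// ?addr_ge0// exprn_even_ge0.
  have [gs|gs] := eqVneq (gap i j s w) 0; first by rewrite z0// !mul0r subrr normr0.
  have [gt_|gt_] := eqVneq (gap i j t w) 0; last first.
    by rewrite -(eqs gs gt_) subrr normr0.
  rewrite -mulrBr normrM; apply: le_trans (ler_norm _).
  rewrite /bnd /met (negbTE gs) gt_ eqxx /= subr0 mulr1; apply: ler_pM => //.
  apply: (@le_trans _ _ (V w)).
    rewrite /V; apply: (le_trans (ler_normB _ _)).
    by rewrite !ger0_norm ?sqr_ge0.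
  apply: (@le_trans _ _ (eps * V w ^+ 2 + (2 * eps)^-1)); last first.
    by rewrite lerD2r ler_pM2l//; exact: V2.
  have -> : eps * V w ^+ 2 + (2 * eps)^-1 = V w + (eps * (V w - (2 * eps)^-1) ^+ 2 + (4 * eps)^-1).
    by field; rewrite gt_eqF.
  have h1 : 0 <= (4 * eps)^-1 by rewrite invr_ge0 mulr_ge0// ltW.
  have h2 : 0 <= eps * (V w - (2 * eps)^-1) ^+ 2 by rewrite mulr_ge0 ?sqr_ge0// ltW.
  by rewrite lerDl addr_ge0.
have lbK : L1 P bnd by exact: L1Z.
have step : `|\int[P]_w (zeta w * dB w ^+ 2 - zeta w * dg w ^+ 2)| <= \int[P]_w bnd w.
  have b0 : {ae P, forall w, 0 <= bnd w}.
    apply: filterS ae => w /(_ s t s0 st')[abs _]; rewrite /bnd mulr_ge0// addr_ge0//.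
      by rewrite mulr_ge0 ?(ltW eps0)// /q addr_ge0// mulr_ge0// ?addr_ge0// exprn_even_ge0.
    apply: mulr_ge0; first by rewrite invr_ge0 mulr_ge0// ltW.
    rewrite /met subr_ge0 ler_nat.
    by case: eqP => // /abs ->; rewrite eqxx.
  rewrite [leRHS](@ae_eq_int _ _ _ P bnd (fun w => `|bnd w|)).
  - apply: abs_int_le_ae => //; [exact: L1B|exact: L1_abs].
  - exact: L1_measurable lbK.
  - exact: L1_measurable (L1_abs lbK).
  - by apply: filterS b0 => w h; rewrite ger0_norm.
rewrite normrM ger0_norm//; apply: (@le_trans _ _ (\int[P]_w bnd w)).
  by apply: le_trans step; rewrite ler_piMl//; lra.
rewrite /bnd intZ//; apply: ler_wpM2l => //.
rewrite intD; [|exact: L1Z|exact: L1Z].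
rewrite !intZ// intB; [|exact: L1_met|exact: L1_met].
apply: lerD.
  apply: (le_trans (ler_wpM2l (ltW eps0) iq)); rewrite /eps le_eqVlt; apply/orP; left; apply/eqP.
  by field; rewrite gt_eqF.
apply: ler_wpM2r.
  rewrite -intB; [|exact: L1_met|exact: L1_met].
  apply: int_ge0_ae => //; apply: filterS ae => w /(_ s t s0 st')[abs _].
  by rewrite /met subr_ge0 ler_nat; case: eqP => // /abs ->; rewrite eqxx.
rewrite /eps; have -> : (2 * (2 * delta / (t - s)))^-1 = 4^-1 * ((t - s) / delta).
  by field; rewrite !gt_eqF.
by rewrite ler_piMl ?divr_ge0 ?(ltW ts0) ?(ltW d0)//; lra.
Qed.


Section mean_formula.
Variables (t0 CU : R) (U : R -> ('I_m -> R) -> R) (al : 'I_m -> R -> ('I_m -> R) -> R)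
  (be : 'I_m -> 'I_m -> R -> ('I_m -> R) -> R) (ga : R -> ('I_m -> R) -> R).
Hypotheses (eU : expansion t0 CU U al be ga)
  (off : forall v (z : 'I_m -> R) i j, 0 <= v -> v <= t0 -> i != j -> z i = z j -> be i j v z = 0)
  (diag : forall v (z : 'I_m -> R), c * \sum_i be i i v z + ga v z = 0).

(** The diagonal terms cancel against [ga], because each particle has speed [c];
    the others are covariances with weights that vanish at the pairs that have
    met. *)
Lemma coalescing_second_order s t zeta K delta : 0 <= s -> s < t -> t <= t0 -> 0 < delta ->
  measurable_wrt (F s) zeta -> (forall w, `|zeta w| <= K) ->
  `|second_order P x be ga s t zeta| <= \sum_(i < m) \sum_(j < m | j != i)
    K * CU * (2560 * c ^+ 2 * delta * (t - s) +
         (t - s) / delta * (\int[P]_w met i j t w - \int[P]_w met i j s w)).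
Proof.
move=> s0 st tt0 d0 mz zK; have st' := ltW st; have st0 := le_trans st' tt0.
have K0 : 0 <= K := le_trans (normr_ge0 _) (zK point).
pose at_ (f : ('I_m -> R) -> R) w : R := f (fun i => x i s w).
have mat f : borel_vec f -> measurable_wrt (F s) (at_ f).
  by move=> bf; apply: bf => [|i]; [exact: sF|exact: (BM_adapted (bm i))].
pose phi i j w := zeta w * at_ (be i j s) w.
have mphi i j : measurable_wrt (F s) (phi i j).
  by apply: (wrtM (sF s0)) => //; apply: mat; exact: (exp_be_borel eU).
have phiK i j w : `|phi i j w| <= K * CU.
  by rewrite normrM ler_pM//; exact: (exp_be_bound eU).
have lphi i j : L1 P (phi i j).
  by apply: (@L1_bdd _ _ _ _ (K * CU)) => //; exact: wrt_measurable (FM s0) (mphi i j).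
have mga : measurable_wrt (F s) (fun w => zeta w * at_ (ga s) w).
  by apply: (wrtM (sF s0)) => //; apply: mat; exact: (exp_ga_borel eU).
have lga : L1 P (fun w => zeta w * at_ (ga s) w).
  apply: (@L1_bdd _ _ _ _ (K * CU)); first exact: wrt_measurable (FM s0) mga.
  by move=> w; rewrite normrM ler_pM//; exact: (exp_ga_bound eU).
have -> : second_order P x be ga s t zeta = \sum_(i < m) \sum_(j < m | j != i)
    \int[P]_w (phi i j w * ((x i t w - x i s w) * (x j t w - x j s w))).
  have dg i : \int[P]_w (phi i i w * ((x i t w - x i s w) * (x i t w - x i s w))) =
      (t - s) * (c * \int[P]_w phi i i w).
    have [_ _ e] := BM_conditional filF c0 (bm i) s0 st' (mphi i i) (phiK i i).
    rewrite (@int_ext _ _ _ P _ (fun w => phi i i w * (x i t w - x i s w) ^+ 2)) => [|w].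
      by rewrite e; ring.
    by rewrite expr2.
  have I0 : \sum_(i < m) c * \int[P]_w phi i i w + \int[P]_w (zeta w * at_ (ga s) w) = 0.
    have -> : \sum_(i < m) c * \int[P]_w phi i i w = \int[P]_w \sum_(i < m) c * phi i i w.
      by rewrite int_sum => [|i _]; [apply: eq_bigr => i _; rewrite intZ|exact: L1Z].
    rewrite -intD//; last by apply: L1_sum => i _; exact: L1Z.
    rewrite -[RHS](int0 P); apply: int_ext => w.
    transitivity (zeta w * (c * \sum_i be i i s (fun i => x i s w) + ga s (fun i => x i s w))).
      rewrite mulrDr; congr (_ + _); rewrite !mulr_sumr; apply: eq_bigr => i _.
      by rewrite /phi /at_ mulrCA.
    by rewrite diag mulr0.
  rewrite /second_order -[RHS]addr0 -[X in _ + X = _]/((t - s) * \int[P]_w (zeta w * at_ (ga s) w)).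
  have -> : \sum_(i < m) \sum_(j < m) \int[P]_w (phi i j w * ((x i t w - x i s w) * (x j t w - x j s w))) =
      (t - s) * \sum_(i < m) c * \int[P]_w phi i i w + \sum_(i < m) \sum_(j < m | j != i)
    \int[P]_w (phi i j w * ((x i t w - x i s w) * (x j t w - x j s w))).
    by rewrite mulr_sumr -big_split/=; apply: eq_bigr => i _; rewrite (bigD1 i)//= dg.
  by rewrite addrAC -mulrDr I0 mulr0 add0r addr0.
apply: (le_trans (ler_norm_sum _ _ _)); apply: ler_sum => i _.
apply: (le_trans (ler_norm_sum _ _ _)); apply: ler_sum => j ji.
have ij : i != j by rewrite eq_sym.
apply: (meeting_covariation ij s0 st d0 (mphi i j) (phiK i j) _).2 => w gw.
rewrite /phi /at_ off ?mulr0//; exact: subr0_eq.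
Qed.

(** The mean of [U] along coalescing Brownian motions is constant: over a fine
    grid the pairs meet at most once each, so the error terms sum to little. *)
Lemma coalescing_mean s t zeta K : 0 <= s -> s <= t -> t <= t0 ->
  measurable_wrt (F s) zeta -> (forall w, `|zeta w| <= K) ->
  \int[P]_w (zeta w * (U t (fun i => x i t w) - U s (fun i => x i s w))) = 0.
Proof.
move=> s0; rewrite le_eqVlt => /predU1P[<- _ _ _|st tt0 mz zK].
  by rewrite -[RHS](int0 P); apply: int_ext => w; rewrite subrr mulr0.
have st' := ltW st; have t_0 := le_trans s0 st'.
have K0 : 0 <= K := le_trans (normr_ge0 _) (zK point).
have CU0 : 0 <= CU.
  have := exp_ga_bound eU (fun=> 0) t_0 tt0; exact: le_trans.
have mx := brownian_mart4.
have c20 : 0 <= 32 * c ^+ 2 by rewrite mulr_ge0// sqr_ge0.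
have [C' [C'0 hC']] := psize_moment c20 mx.
set I := \int[P]_w _.
pose M : R := m%:R; have M0 : 0 <= M by [].
have ts0 : 0 < t - s by rewrite subr_gt0.
pose Q := 2560 * c ^+ 2.
have Q0 : 0 <= Q by apply: mulr_ge0; [exact: ler0n|exact: sqr_ge0].
have ts1 : 0 <= t - s := ltW ts0.
have KC0 : 0 <= K * CU by exact: mulr_ge0.
have QT0 : 0 <= K * CU * (Q * (t - s) + (t - s)).
  by apply: mulr_ge0 => //; apply: addr_ge0 => //; exact: mulr_ge0.
have KCT0 : 0 <= K * CU * C' * (t - s) by apply: mulr_ge0 => //; exact: mulr_ge0.
pose D := M ^+ 2 * (K * CU * (Q * (t - s) + (t - s))) + K * CU * C' * (t - s).
have D0 : 0 <= D.
  by apply: addr_ge0 => //; apply: mulr_ge0 => //; exact: exprn_ge0.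
suff : `|I| <= 0 by rewrite normr_le0 => /eqP.
apply: (le_epsilonM D0) => e e0 e1; rewrite add0r.
pose N := (Num.truncn ((1 + (t - s)) / e ^+ 2)).+1.
have e20 : 0 < e ^+ 2 by exact: exprn_gt0.
have Nr : 0 < N%:R :> R by [].
have Ne : 1 + (t - s) <= N%:R * e ^+ 2.
  by rewrite -ler_pdivrMr//; apply: ltW; exact: truncnS_gt.
have [_ tg] := taylor_grid filF mx CU0 eU hC' s0 st' tt0 (isT : (0 < N)%N) mz zK.
rewrite -/I in tg.
have gS k : gridpt s t N k.+1 - gridpt s t N k = (t - s) / N%:R by exact: gridptS.
have dt0 : 0 < (t - s) / N%:R by exact: divr_gt0.
have gp k : 0 <= gridpt s t N k by rewrite (le_trans s0)// lerDl mulr_ge0 ?(ltW ts0)// divr_ge0.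
have small : `|\sum_(k < N) second_order P x be ga (gridpt s t N k) (gridpt s t N k.+1) zeta| <=
    M ^+ 2 * (K * CU * (Q * (t - s) + (t - s))) * e.
  apply: (le_trans (ler_norm_sum _ _ _)).
  have stp (k : 'I_N) : `|second_order P x be ga (gridpt s t N k) (gridpt s t N k.+1) zeta| <=
      \sum_(i < m) \sum_(j < m | j != i) K * CU * (Q * e * ((t - s) / N%:R) +
         (t - s) / N%:R / e * (\int[P]_w met i j (gridpt s t N k.+1) w - \int[P]_w met i j (gridpt s t N k) w)).
    rewrite /Q -(gS k); apply: coalescing_second_order => //.
    - by rewrite -subr_gt0 gS.
    - by apply: le_trans tt0; rewrite -[leRHS](gridptN s t (isT : (0 < N)%N)); exact: gridpt_le.
    - apply: wrt_sub mz; apply: Fle => //; rewrite -[leLHS](gridpt0 s t N); exact: gridpt_le.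
  apply: (le_trans (ler_sum _ (fun k _ => stp k))).
  rewrite exchange_big/=.
  have -> : M ^+ 2 * (K * CU * (Q * (t - s) + (t - s))) * e =
      \sum_(i < m) \sum_(j < m) K * CU * (Q * (t - s) + (t - s)) * e.
    by rewrite !sumr_const card_ord -mulrnA -[RHS]mulr_natl natrM /M; ring.
  have B0 : 0 <= K * CU * (Q * (t - s) + (t - s)) * e.
    by apply: mulr_ge0 => //; exact: ltW.
  apply: ler_sum => i _; rewrite exchange_big/=.
  rewrite [leRHS](bigID (fun j => j != i))/= -[leLHS]addr0; apply: lerD; last exact: sumr_ge0.
  apply: ler_sum => j ji; rewrite -mulr_sumr big_split/= sumr_const card_ord -mulr_sumr.
  have -> : \sum_(k < N) (\int[P]_w met i j (gridpt s t N k.+1) w - \int[P]_w met i j (gridpt s t N k) w) =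
      \int[P]_w met i j t w - \int[P]_w met i j s w.
    rewrite -(big_mkord xpredT (fun k => \int[P]_w met i j (gridpt s t N k.+1) w -
      \int[P]_w met i j (gridpt s t N k) w)) telescope_sumr//.
    by rewrite gridpt0 gridptN.
  have d1 : \int[P]_w met i j t w - \int[P]_w met i j s w <= 1.
    have a1 : \int[P]_w met i j t w <= 1.
      apply: (le_trans (ler_norm _)); apply: int_bdd; first exact: measurable_met.
      by move=> w; rewrite /met; case: (_ == _); rewrite ?normr1 ?normr0.
    have a2 : 0 <= \int[P]_w met i j s w by apply: int_ge0 => w; rewrite /met.
    lra.
  rewrite -[leRHS]mulrA; apply: ler_wpM2l => //.
  rewrite [leRHS]mulrDl; apply: lerD.
    rewrite -[leLHS]mulr_natl le_eqVlt; apply/orP; left; apply/eqP.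
    by field; rewrite gt_eqF.
  apply: (@le_trans _ _ ((t - s) / N%:R / e * 1)).
    by rewrite ler_wpM2l// divr_ge0 ?(ltW dt0) ?(ltW e0).
  rewrite mulr1 -!mulrA; apply: ler_wpM2l; first exact: ltW.
  rewrite ler_pdivrMr// -[leLHS]mul1r ler_pdivrMr//.
  have : 1 <= N%:R * e ^+ 2 by apply: le_trans Ne; lra.
  by rewrite expr2; nra.
have err : K * CU * C' * ((t - s) * Num.sqrt ((t - s) / N%:R)) <= K * CU * C' * (t - s) * e.
  rewrite !mulrA; apply: ler_wpM2l => //.
  rewrite -[leRHS](ger0_norm (ltW e0)) -sqrtr_sqr; apply: ler_wsqrtr.
  by rewrite ler_pdivrMr// mulrC; apply: le_trans Ne; lra.
rewrite /D mulrDl.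
have -> : I = (I - \sum_(k < N) second_order P x be ga (gridpt s t N k) (gridpt s t N k.+1) zeta)
  + \sum_(k < N) second_order P x be ga (gridpt s t N k) (gridpt s t N k.+1) zeta by rewrite subrK.
apply: (le_trans (ler_normD _ _)); rewrite addrC; apply: lerD => //.
exact: le_trans tg err.
Qed.

End mean_formula.

End coalescing_drift.

Lemma BM_heat_mean d (T : measurableType d) (R : realType) (P : probability T R)
    (F : R -> set (set T)) (c : R) (x : R -> T -> R) : is_filtration F -> 0 < c ->
  is_BM P F c x -> heat_mean P F c x.
Proof.
move=> filF c0 bm e s t y zeta e0 s0 st mz z1; have t0 := le_trans s0 st.
have [C [C0 hC]] := cdf_expansion 1 c0 e0 t0.
have [al [be [ga [eU _ off diag]]]] := hC (fun=> y).
have := coalescing_mean (x := fun _ : 'I_1 => x) filF (ltW c0) (fun=> bm) _ eU _ diag s0 st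
  (lexx t) mz z1.
move=> h; have {h} I0 := h (ltac:(by move=> i' j'; rewrite !ord1 eqxx))
  (ltac:(by move=> v z i' j' _ _; rewrite !ord1 eqxx)).
rewrite -[RHS]I0; apply: int_ext => w; rewrite !cdf_1.
have -> : t + e - t = e by ring.
by have -> : t + e - s = e + t - s by ring.
Qed.

Section coalescing_flows.
Context (R : realType) (I : Type) (FF : set_system I).
Hypothesis FFF : Filter FF.
Context d (T : measurableType d) (P : probability T R).
Variables (F : R -> set (set T)) (m : nat) (c : R) (b : 'I_m -> R) (x : 'I_m -> R -> T -> R).
Hypotheses (filF : is_filtration F) (c0 : 0 < c) (bm : forall i, is_BM P F c (x i))
  (start : forall i, {ae P, forall w, x i 0 w = b i})
  (rx : forall i w, continuous (x i ^~ w))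
  (sb : sorted_vec b).
Hypothesis coalesce : forall i j, i != j -> exists2 B : R -> T -> R, is_BM P F (2 * c) B &
  {ae P, forall w, forall t, 0 <= t -> `|x i t w - x j t w| = stopped_at0 (B ^~ w) t}.

Let path (i j : 'I_m) : (i < j)%N -> exists2 B : R -> T -> R, is_BM P F (2 * c) B &
  {ae P, forall w, forall s t, 0 <= s -> s <= t ->
    [/\ x i t w - x j t w <= 0, x i s w - x j s w = 0 -> x i t w - x j t w = 0 &
      x i s w - x j s w != 0 -> x i t w - x j t w != 0 ->
       (x i t w - x j t w - (x i s w - x j s w)) ^+ 2 = (B t w - B s w) ^+ 2]}.
Proof.
move=> ij; have [B bB ae] := coalesce (ltac:(by rewrite neq_ltn ij) : i != j).
exists B => //; apply: filterS3 ae (start i) (start j) => w h hi hj s t s0 st.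
have cB : {within halfline R, continuous (B ^~ w)} by case: bB => _ /(_ w).
apply: (@stopped_difference _ (B ^~ w) (fun t => x i t w - x j t w) s t) => //.
  by move=> u; apply: cvgB; exact: rx.
by rewrite hi hj subr_le0; apply: sb; exact: ltnW.
Qed.

Let pair i j : i != j -> exists2 B : R -> T -> R, is_BM P F (2 * c) B &
  {ae P, forall w, forall s t, 0 <= s -> s <= t ->
    (x i s w - x j s w = 0 -> x i t w - x j t w = 0) /\
    (x i s w - x j s w != 0 -> x i t w - x j t w != 0 ->
       (x i t w - x j t w - (x i s w - x j s w)) ^+ 2 = (B t w - B s w) ^+ 2)}.
Proof.
rewrite neq_ltn => /orP[ij|ji].
  by have [B bB ae] := path ij; exists B => //; apply: filterS ae => w h s t s0 st; case: (h s t s0 st).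
have [B bB ae] := path ji; exists B => //; apply: filterS ae => w h s t s0 st.
have [_ h1 h2] := h s t s0 st; rewrite -(opprB (x j s w)) -(opprB (x j t w)); split.
  by move=> /eqP; rewrite oppr_eq0 => /eqP/h1 ->; rewrite oppr0.
by rewrite !oppr_eq0 => a1 a2; rewrite -(h2 a1 a2); ring.
Qed.

Theorem coalescing_flow : flow_family FF (fun=> P) (fun=> F) c b (fun=> x).
Proof.
have cc := ltW c0; split.
- by apply: nearW => th; split=> // i; exact: BM_adapted (bm i).
- move=> delta d0; apply: nearW => th i; apply: filterS (start i) => w ->.
  by rewrite subrr normr0 ltW.
- apply: nearW => th t t0.
  have le (i j : 'I_m) : {ae P, forall w, (i <= j)%N -> x i t w <= x j t w}.
    rewrite leq_eqVlt; have [/val_inj ->|_] := eqVneq (val i) (val j); first exact: aeW.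
    have [ij|_] := boolP (i < j)%N; last exact: aeW.
    have [B _ ae] := path ij; apply: filterS ae => w /(_ t t t0 (lexx t))[+ _ _] _.
    by rewrite subr_le0.
  have le' (i : 'I_m) : {ae P, forall w, forall j : 'I_m, (i <= j)%N -> x i t w <= x j t w}.
    exact: filter_forall.
  have : {ae P, forall w, forall i j : 'I_m, (i <= j)%N -> x i t w <= x j t w}.
    exact: filter_forall.
  by apply: filterS.
- move=> e t delta e0 t0 d0; apply: nearW => th s y zeta s0 st mz z1.
  have [C [C0 hC]] := cdf_expansion m c0 e0 t0.
  have [al [be [ga [eU _ off diag]]]] := hC y.
  have := coalescing_mean filF cc bm pair eU _ diag s0 st (lexx t) mz z1.
  have e1 : t + e - t = e by ring.
  have e2 : t + e - s = e + t - s by ring.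
  rewrite e1 e2 => -> => [|v z i j v0 vt ij zij]; first by rewrite normr0 ltW.
  apply/eqP; rewrite -normr_le0; apply: (le_trans (off v z i j v0 vt ij)).
  by rewrite zij subrr normr0 mulr0.
- apply: nearW => th i e t y e0 t0.
  apply: (heat_mean_start y c0 filF _ (BM_heat_mean filF c0 (bm i)) e0 t0) => u u0.
  exact: (BM_measurable filF (bm i)).
Qed.

End coalescing_flows.

(** * Path space *)

Section path_evaluation.
Context (R : realType) (m : nat).
Implicit Types (g f : path_space R m) (i : 'I_m) (s t : R).

Definition at_time g i t : R := g (exist _ (Num.max 0 t) (max0_halfline t)) 0 i.

Lemma continuous_at_time g i : continuous (at_time g i).
Proof.
have cp : continuous (fun t : R => (exist _ (Num.max 0 t) (max0_halfline t) : set_type (halfline R))).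
  apply/continuous_comp_initial => t.
  have mx (p q : R) : `|Num.max 0 p - Num.max 0 q| <= `|p - q|.
    have [h1|h1] := leP 0 p; have [h2|h2] := leP 0 q => //; last by rewrite subrr normr0.
      by rewrite subr0 ger0_norm// ger0_norm; lra.
    by rewrite sub0r normrN ger0_norm// ler0_norm; lra.
  apply/cvgrPdist_le => e e0; apply/nbhs_ballP; exists e => //= u tu.
  exact: le_trans (mx t u) (ltW tu).
move=> t; apply: (@continuous_comp _ _ _ (fun t : R => g (exist _ (Num.max 0 t) (max0_halfline t)))
  (fun v : 'rV[R]_m => v 0 i)).
  apply: (@continuous_comp _ _ _ (fun t : R => (exist _ (Num.max 0 t) (max0_halfline t) : set_type (halfline R)))
    (g : set_type (halfline R) -> 'rV[R]_m)); [exact: cp|exact: (@cts_fun _ _ g)].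
exact: coord_continuous.
Qed.

Definition close (N : nat) (delta : R) (v v' : R -> 'I_m -> R) : Prop :=
  forall i t, 0 <= t -> t <= N%:R -> `|v t i - v' t i| <= delta.

Definition trajectory g : R -> 'I_m -> R := fun t i => at_time g i t.

(** A compact set of times is bounded. *)
Lemma path_cvg (g_ : nat -> path_space R m) f :
  (forall N delta, 0 < delta -> \forall n \near \oo, close N delta (trajectory f) (trajectory (g_ n))) ->
  g_ n @[n --> \oo] --> f.
Proof.
move=> h; have key : (fun n => g_ n : {family compact, set_type (halfline R) -> 'rV[R]_m}) n @[n --> \oo] -->
    (f : {family compact, set_type (halfline R) -> 'rV[R]_m}).
  apply/fam_cvgP => A cA.
  have [N hN] : exists N : nat, forall u, A u -> sval u <= N%:R.
    have cv : compact ((sval : set_type (halfline R) -> R) @` A).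
      apply: continuous_compact cA; apply: continuous_subspaceT; exact: initial_continuous.
    have [M [_ hM]] := compact_bounded cv.
    exists (Num.truncn (M + 1)).+1 => u Au; apply: ltW; apply: le_lt_trans (truncnS_gt _).
    apply: (le_trans (ler_norm _)); apply: hM; first by rewrite ltrDl.
    by exists u.
  move=> U /uniform_nbhs[E [/= EE hE]].
  move: EE; rewrite -entourage_ballE => -[e /= e0 he].
  have e2 : 0 < e / 2 by rewrite divr_gt0.
  apply: filterS (h N _ e2) => n hn; apply: hE => u Au; apply: he => /=; split=> // k i; rewrite ord1.
  have u0 : 0 <= sval u by have := svalP u; rewrite inE.
  have E' (g : path_space R m) : g u 0 i = at_time g i (sval u).
    rewrite /at_time; congr (g _ 0 i); apply: val_inj => /=.
    by rewrite max_r.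
  rewrite /ball/= !E'; apply: (le_lt_trans (hn i _ u0 (hN u Au))).
  by rewrite ltr_pdivrMr// mulr_natr mulr2n ltrDl.
move=> U /= [V [[V' oV' VV'] Vf VU]].
have nb : nbhs (f : {family compact, set_type (halfline R) -> 'rV[R]_m}) V'.
  by apply: open_nbhs_nbhs; split=> //; rewrite -VV' in Vf.
have near : \forall n \near \oo, V' (g_ n) := key _ nb.
suff : \forall n \near \oo, U (g_ n) by [].
by apply: filterS near => n Vn; apply: VU; rewrite -VV'.
Qed.

Lemma at_time_open i t (A : set R) : open A -> open [set g : path_space R m | A (at_time g i t)].
Proof.
move=> oA; pose p : set_type (halfline R) := exist _ (Num.max 0 t) (max0_halfline t).
pose ev (h : {family compact, set_type (halfline R) -> 'rV[R]_m}) : R := h p 0 i.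
have cev : continuous ev.
  move=> h; apply: (@continuous_comp _ _ _ (fun h : {family compact, set_type (halfline R) -> 'rV[R]_m} => h p) (fun v : 'rV[R]_m => v 0 i)); last exact: coord_continuous.
  have := (@fam_cvgP _ _ compact (nbhs h) h (nbhs_filter h)).1 (fun U hU => hU) [set p]
    (@compact_set1 _ p).
  by rewrite (@uniform_set1 _ _ _ _ _ (nbhs_filter h)).
pose w (f : path_space R m) := (f : {family compact, set_type (halfline R) -> 'rV[R]_m}).
exists (ev @^-1` A) => //.
by apply: open_comp => // ? _; exact: cev.
Qed.

End path_evaluation.

Lemma heine (R : realType) (f : R -> R) (N : nat) (e : R) : continuous f -> 0 < e ->
  exists delta : R, 0 < delta /\ forall s t, 0 <= t -> t <= N%:R -> `|s - t| < delta -> `|f s - f t| <= e.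
Proof.
move=> cf e0; have /compact_near_coveringP cov := @segment_compact R 0 N%:R.
have h : \forall delta \near (0 : R)^'+, `[0, N%:R]%classic `<=`
    (fun t => forall s, `|s - t| < delta -> `|f s - f t| <= e).
  apply: cov => t _.
  have e2 : 0 < e / 2 by rewrite divr_gt0.
  have /cvgrPdist_le/(_ _ e2)/nbhs_ballP[eta /= eta0 h] := cf t.
  exists (ball t (eta / 2), [set delta : R | 0 < delta < eta / 2]).
    split; first by apply: nbhsx_ballx; rewrite divr_gt0.
    by near=> delta; apply/andP; split; near: delta; [exact: nbhs_right_gt|apply: nbhs_right_lt; rewrite divr_gt0].
  move=> [t' delta] [/= tt' /andP[d0 de]] s sd.
  have h1 := h t' (le_ball (ltW _) tt').
  have h2 := h s.
  have a1 : `|t - t'| < eta / 2 := tt'.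
  have b1 : ball t eta s by rewrite /ball/=; move: a1 sd; rewrite !ltr_norml; lra.
  have b2 : ball t eta t' by rewrite /ball/=; move: a1; rewrite !ltr_norml; lra.
  by have := h _ b1; have := h _ b2; rewrite !ler_norml; lra.
have [delta [d0 hd]] : exists delta : R, 0 < delta /\ `[0, N%:R]%classic `<=`
    (fun t => forall s, `|s - t| < delta -> `|f s - f t| <= e).
  near (0 : R)^'+ => delta.
  exists delta; split; first by near: delta; exact: nbhs_right_gt.
  by near: delta; exact: h.
exists delta; split=> // s t t0 tN; apply: hd.
by rewrite /= in_itv/= t0.
Unshelve. all: by end_near.
Qed.

Section penalisation.
Context (R : realType) (m : nat).
Variables (phi : path_space R m -> R) (K : R).
Hypotheses (cphi : continuous phi) (phiK : forall f, `|phi f| <= K).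
Implicit Types (g f : path_space R m) (v : R -> 'I_m -> R) (N : nat) (e delta : R).

Let K0 : 0 <= K := le_trans (normr_ge0 _) (phiK point).

Definition penalised N v : set R :=
  [set r | exists g delta, [/\ 0 <= delta, close N delta v (trajectory g) & r = phi g + N%:R * delta]].

(** An inf-convolution of the test function with the uniform distance on
    [0, N]: it is Lipschitz, defined for all functions of time, and increases to
    the test function as [N] grows. *)
Definition envelope N v : R := Num.min K (inf (penalised N v)).

Lemma close_sym N e v v' : close N e v v' -> close N e v' v.
Proof. by move=> h i t t0 tN; rewrite distrC; exact: h. Qed.

Lemma close_trans N e e' v v' v'' : close N e v v' -> close N e' v' v'' -> close N (e + e') v v''.
Proof.
move=> h h' i t t0 tN; apply: (le_trans (ler_distD (v' t i) _ _)).
by apply: lerD; [exact: h|exact: h'].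
Qed.

Lemma penalised_lbound N v : lbound (penalised N v) (- K).
Proof.
move=> _ [g [delta [d0 _ ->]]]; have := phiK g; rewrite ler_norml => /andP[h _].
by apply: (le_trans h); rewrite lerDl mulr_ge0.
Qed.

Lemma envelope_lipschitz_le N e v v' : 0 <= e -> close N e v v' ->
  envelope N v <= envelope N v' + N%:R * e.
Proof.
move=> e0 vv; have Ne : 0 <= N%:R * e by rewrite mulr_ge0.
have [E|] := pselect (penalised N v' = set0).
  have -> : envelope N v = envelope N v'; last by rewrite lerDl.
  rewrite /envelope E; suff -> : penalised N v = set0 by [].
  apply/seteqP; split=> // r [g [delta [d0 vg _]]].
  suff : penalised N v' (phi g + N%:R * (e + delta)) by rewrite E.
  exists g, (e + delta); split=> //; first exact: addr_ge0.
  exact: close_trans (close_sym vv) vg.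
move=> /eqP/set0P ne.
have le : inf (penalised N v) <= inf (penalised N v') + N%:R * e.
  rewrite -lerBlDr; apply: lb_le_inf => // _ [g [delta [d0 vg ->]]].
  rewrite lerBlDr -addrA -mulrDr; apply: ge_inf.
    by exists (- K); exact: penalised_lbound.
  exists g, (delta + e); split=> //; first exact: addr_ge0.
  by rewrite addrC; exact: close_trans vv vg.
rewrite /envelope addr_minl le_min !ge_min lerDl Ne le.
by rewrite orbT.
Qed.

Lemma envelope_lipschitz N e v v' : 0 <= e -> close N e v v' ->
  `|envelope N v - envelope N v'| <= N%:R * e.
Proof.
move=> e0 vv; have h1 := envelope_lipschitz_le e0 vv.
have h2 := envelope_lipschitz_le e0 (close_sym vv).
by rewrite ler_norml; move: (N%:R * e) h1 h2 => u; lra.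
Qed.

Lemma envelope_bound N v : `|envelope N v| <= K.
Proof.
rewrite ler_norml /envelope ge_min lexx andbT le_min; apply/andP; split.
  by move: K0; lra.
have [->|/eqP/set0P ne] := pselect (penalised N v = set0); first by rewrite inf0 oppr_le0.
by apply: lb_le_inf => //; exact: penalised_lbound.
Qed.

Lemma envelope_le N f : envelope N (trajectory f) <= phi f.
Proof.
rewrite /envelope ge_min; apply/orP; right; apply: ge_inf.
  by exists (- K); exact: penalised_lbound.
exists f, 0; split=> //; last by rewrite mulr0 addr0.
by move=> i t _ _; rewrite subrr normr0.
Qed.

(** Otherwise some paths would converge to [f] without their values converging. *)
Lemma uniform_neighbourhood f e : 0 < e -> exists N delta, 0 < delta /\
  forall g, close N delta (trajectory f) (trajectory g) -> `|phi f - phi g| <= e.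
Proof.
move=> e0; apply: contrapT => h.
have : forall n : nat, exists g, close n n.+1%:R^-1 (trajectory f) (trajectory g) /\ e < `|phi f - phi g|.
  move=> n; apply: contrapT => hn; apply: h; exists n, n.+1%:R^-1; split; first by rewrite invr_gt0.
  by move=> g fg; rewrite leNgt; apply/negP => eg; apply: hn; exists g.
move=> /choice[g_ hg].
have cg : g_ n @[n --> \oo] --> f.
  apply: path_cvg => N delta d0; near=> n => i t t0 tN.
  have nN : (N <= n)%N by near: n; exact: nbhs_infty_ge.
  have dn : delta^-1 < n%:R by near: n; exact: nbhs_infty_gtr.
  apply: (le_trans ((hg n).1 i t t0 (le_trans tN _))); first by rewrite ler_nat.
  rewrite invf_ple ?posrE//; apply: (le_trans (ltW dn)); by rewrite ler_nat.
have /cvgrPdist_le/(_ e e0)[n _ hn] : phi (g_ n) @[n --> \oo] --> phi f.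
  move=> U pU.
  have nb : nbhs f (phi @^-1` U) by exact: cphi.
  exact: (cg _ nb).
by have := hn n (leqnn n); rewrite leNgt (hg n).2.
Unshelve. all: by end_near.
Qed.

(** A competitor is close to [f], where the test function is nearly [phi f], or
    pays a penalty exceeding the range of the test function. *)
Lemma envelope_cvg f : envelope N (trajectory f) @[N --> \oo] --> phi f.
Proof.
apply/cvgrPdist_le => e e0.
have [N0 [delta [d0 hd]]] := uniform_neighbourhood f e0.
near=> N.
have NN : (N0 <= N)%N by near: N; exact: nbhs_infty_ge.
have dN : 2 * K / delta < N%:R by near: N; exact: nbhs_infty_gtr.
have le := envelope_le N f.
suff : phi f - e <= envelope N (trajectory f) by rewrite ler_norml; lra.
have fK := phiK f; rewrite /envelope le_min; apply/andP; split.
  by move: fK; rewrite ler_norml; lra.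
apply: lb_le_inf.
  exists (phi f), f, 0; split=> //; last by rewrite mulr0 addr0.
  by move=> i t _ _; rewrite subrr normr0.
move=> _ [g [delta' [d'0 fg ->]]].
have N0' : 0 <= N%:R * delta' by rewrite mulr_ge0.
have [dd|dd] := leP delta' delta.
  have : `|phi f - phi g| <= e.
    apply: hd => i t t0 tN; apply: le_trans dd; apply: fg => //.
    by apply: (le_trans tN); rewrite ler_nat.
  by rewrite ler_norml; move: (N%:R * delta') N0' => u; lra.
have : 2 * K <= N%:R * delta'.
  rewrite ltr_pdivrMr// in dN; apply: (le_trans (ltW dN)).
  by rewrite ler_wpM2l// ltW.
by have := phiK g; move: fK; rewrite !ler_norml; move: (N%:R * delta') => u; lra.
Unshelve. all: by end_near.
Qed.

End penalisation.

Section sampling.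
Context (R : realType).
Implicit Types (u : R -> R) (n N q : nat) (s t e : R).

Definition cell n t : nat := Num.truncn (t * n.+1%:R).

Lemma cell_bounds n t : 0 <= t -> (cell n t)%:R / n.+1%:R <= t /\ t < (cell n t).+1%:R / n.+1%:R.
Proof.
move=> t0; have n0 : (0 : R) < n.+1%:R by [].
rewrite ler_pdivrMr// ltr_pdivlMr//; apply/andP; apply: truncn_itv.
by rewrite mulr_ge0.
Qed.

Lemma cell_le n N t : 0 <= t -> t <= N%:R -> (cell n t <= N * n.+1)%N.
Proof.
move=> t0 tN; have [h _] := cell_bounds n t0.
rewrite -(ler_nat R) natrM; move: h; rewrite ler_pdivrMr// => h.
by apply: (le_trans h); rewrite ler_wpM2r.
Qed.

Lemma cell_refine n q t : 0 <= t -> (Num.truncn (t * (n.+1 * q.+1)%:R) %/ q.+1)%N = cell n t.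
Proof.
move=> t0; set l := Num.truncn _.
have [h1 h2] : l%:R <= t * (n.+1 * q.+1)%:R /\ t * (n.+1 * q.+1)%:R < l.+1%:R.
  by apply/andP; apply: truncn_itv; rewrite mulr_ge0.
apply/esym/eqP; rewrite /cell truncn_eq ?mulr_ge0//; apply/andP; split.
  rewrite -(ler_pM2r (ltr0Sn R q)) -mulrA -!natrM.
  by apply: le_trans h1; rewrite ler_nat leq_trunc_div.
rewrite -(ltr_pM2r (ltr0Sn R q)) -mulrA -!natrM.
by apply: (lt_le_trans h2); rewrite ler_nat ltn_ceil.
Qed.

Definition deviation n u t : R := `|u t - u ((cell n t)%:R / n.+1%:R)|.

Definition oscillation N n u : R := sup [set deviation n u t | t in `[0, N%:R]].

Lemma max_distance (I : finType) (a b : I -> R) e : 0 <= e -> (forall l, `|a l - b l| <= e) ->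
  `|\big[Num.max/0]_l a l - \big[Num.max/0]_l b l| <= e.
Proof.
move=> e0 ab; elim/big_ind2: _ => // [|p q r s pq rs]; first by rewrite subrr normr0.
move: pq rs; rewrite !ler_norml => /andP[p1 p2] /andP[r1 r2].
by case: (leP p r); case: (leP q s) => ? ?; apply/andP; split; lra.
Qed.

Lemma min1_distance (p q : R) : `|Num.min 1 p - Num.min 1 q| <= `|p - q|.
Proof.
by case: (leP 1 p); case: (leP 1 q) => h1 h2;
  rewrite ?subrr ?normr0//; move: h1 h2; rewrite ler_norml;
  case: (leP 0 (p - q)) => h3 h1 h2; rewrite ?(ger0_norm h3) ?(ltr0_norm h3); lra.
Qed.

Section continuous_function.
Variable u : R -> R.
Hypothesis cu : continuous u.

Lemma deviation_small N e : 0 < e -> \forall n \near \oo,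
  forall t, 0 <= t -> t <= N%:R -> deviation n u t <= e.
Proof.
move=> e0; have [delta [d0 hd]] := heine N cu e0.
near=> n => t t0 tN; rewrite /deviation distrC; apply: hd => //.
have [h1 h2] := cell_bounds n t0.
have dn : delta^-1 < n%:R by near: n; exact: nbhs_infty_gtr.
have : n.+1%:R^-1 < delta.
  by rewrite invf_plt ?posrE//; apply: (lt_trans dn); rewrite ltr_nat.
rewrite -natr1 mulrDl mul1r in h2.
move: h1 h2; set p := (cell n t)%:R / _; set r := n.+1%:R^-1 => h1 h2 h3.
by rewrite ler0_norm; lra.
Unshelve. all: by end_near.
Qed.

Lemma deviation_bounded N n : has_ubound [set deviation n u t | t in `[0, N%:R]].
Proof.
have cv : compact (u @` `[0, N%:R]).
  apply: continuous_compact; last exact: segment_compact.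
  exact: continuous_subspaceT.
have [M [_ hM]] := compact_bounded cv.
exists ((M + 1) + (M + 1)) => _ [t + <-]; rewrite /= in_itv/= => /andP[t0 tN].
apply: (le_trans (ler_normB _ _)); apply: lerD; apply: (hM (M + 1)); rewrite ?ltrDl//.
  by exists t => //=; rewrite in_itv/= t0.
have [h1 _] := cell_bounds n t0.
exists ((cell n t)%:R / n.+1%:R) => //=; rewrite in_itv/= (le_trans h1 tN) andbT.
by rewrite divr_ge0.
Qed.

Lemma deviation_le_oscillation N n t : 0 <= t -> t <= N%:R -> deviation n u t <= oscillation N n u.
Proof.
move=> t0 tN; apply: ub_le_sup; first exact: deviation_bounded.
by exists t => //=; rewrite in_itv/= t0.
Qed.

Lemma oscillation_ge0 N n : 0 <= oscillation N n u.
Proof. exact: le_trans (normr_ge0 _) (deviation_le_oscillation n (lexx 0) (ler0n R N)). Qed.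

Lemma oscillation_le N n e : (forall t, 0 <= t -> t <= N%:R -> deviation n u t <= e) ->
  oscillation N n u <= e.
Proof.
move=> h; apply: ge_sup.
  by exists (deviation n u 0), 0 => //=; rewrite in_itv/= lexx ler0n.
by move=> _ [t + <-]; rewrite /= in_itv/= => /andP[t0 tN]; exact: h.
Qed.

Lemma oscillation_cvg0 N : oscillation N n u @[n --> \oo] --> (0 : R).
Proof.
apply/cvgrPdist_le => e e0; apply: filterS (deviation_small N e0) => n h.
by rewrite sub0r normrN ger0_norm ?oscillation_ge0//; exact: oscillation_le.
Qed.

Definition sampled_oscillation N n q (a : nat -> R) : R :=
  \big[Num.max/0]_(l < (N * (n.+1 * q.+1)).+1) `|a l - a ((l %/ q.+1) * q.+1)%N|.

Let finer n q l : R := l%:R / (n.+1 * q.+1)%:R.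

Lemma sampled_oscillation_cvg N n :
  sampled_oscillation N n q (fun l => u (finer n q l)) @[q --> \oo] --> oscillation N n u.
Proof.
apply/cvgrPdist_le => e e0; have [delta [d0 hd]] := heine N cu e0.
near=> q.
have dn : delta^-1 < q%:R by near: q; exact: nbhs_infty_gtr.
pose M := (n.+1 * q.+1)%N; have M0 : (0 : R) < M%:R by rewrite ltr0n.
have small : M%:R^-1 < delta.
  rewrite invf_plt ?posrE//; apply: (lt_le_trans dn); rewrite ler_nat.
  by rewrite (leq_trans (leqnSn q))// leq_pmull.
have coarse l : finer n q ((l %/ q.+1) * q.+1)%N = (l %/ q.+1)%:R / n.+1%:R.
  by rewrite /finer !natrM -mulf_div divff ?pnatr_eq0// mulr1.
have dev l : (l <= N * M)%N -> `|u (finer n q l) - u (finer n q ((l %/ q.+1) * q.+1)%N)| <= oscillation N n u.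
  move=> lN; have t0 : 0 <= finer n q l by rewrite /finer divr_ge0.
  have := @deviation_le_oscillation N n (finer n q l) t0.
  rewrite /deviation coarse -(cell_refine n q t0) /finer divfK ?pnatr_eq0//.
  rewrite natrK; apply; rewrite ler_pdivrMr// -natrM ler_nat; exact: lN.
have le1 : sampled_oscillation N n q (fun l => u (finer n q l)) <= oscillation N n u.
  rewrite /sampled_oscillation; elim/big_ind: _ => [|p r pl rl|l _]; first exact: oscillation_ge0.
    by rewrite ge_max pl rl.
  by apply: dev; rewrite -ltnS.
have le2 : oscillation N n u <= sampled_oscillation N n q (fun l => u (finer n q l)) + e.
  apply: oscillation_le => t t0 tN; pose l := Num.truncn (t * M%:R).
  have [h1 h2] : l%:R <= t * M%:R /\ t * M%:R < l.+1%:R.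
    by apply/andP; apply: truncn_itv; rewrite mulr_ge0.
  have lN : (l < (N * M).+1)%N.
    by rewrite ltnS -(ler_nat R) natrM; apply: (le_trans h1); rewrite ler_wpM2r.
  rewrite /deviation -(cell_refine n q t0) -/M -/l -coarse.
  apply: (le_trans (ler_distD (u (finer n q l)) _ _)); rewrite addrC; apply: lerD.
    rewrite /sampled_oscillation (bigD1 (Ordinal lN))//= le_max lexx //.
  rewrite distrC; apply: hd => //; rewrite /finer -/M.
  move: h1 h2; rewrite -ler_pdivrMr// -ltr_pdivlMr// -natr1 mulrDl mul1r.
  set p := l%:R / _; move: small; set r := M%:R^-1 => h3 h1 h2.
  by rewrite ler0_norm; lra.
by rewrite ler_norml; lra.
Unshelve. all: by end_near.
Qed.

End continuous_function.

End sampling.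

(** Without other particles, being a Brownian motion in law is all that a flow
    family asks for. *)
Lemma single_flow (R : realType) (I : Type) (FF : set_system I) d (T : measurableType d)
    (P : probability T R) (F : R -> set (set T)) (c : R) (x : R -> T -> R) (a b : R) :
  Filter FF -> 0 < c -> is_filtration F -> adapted F x ->
  {ae P, forall w, x 0 w = a} -> heat_mean P F c x ->
  flow_family FF (fun=> P) (fun=> F) c (fun _ : 'I_1 => b) (fun _ _ t w => x t w + (b - a)).
Proof.
move=> FFF c0 fil ax x0 hm; split.
- apply: nearW => th; split=> // i t t0; case: (fil) => [sF _ _].
  by apply: (wrtD (sF t t0)); [exact: ax|exact: wrt_cst (sF t t0) _].
- move=> delta d0; apply: nearW => th i; apply: filterS x0 => w ->.
  have -> : a + (b - a) - b = 0 by ring.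
  by rewrite normr0 ltW.
- apply: nearW => th t t0; apply: aeW => w i j _; exact: lexx.
- move=> e t delta e0 t0 d0; apply: nearW => th s y zeta s0 st mz z1.
  rewrite (@int_ext _ _ _ P _ (fun w => zeta w * (heat c 0 (y ord0 - (b - a)) e (x t w) -
    heat c 0 (y ord0 - (b - a)) (e + t - s) (x s w)))); first by rewrite hm// normr0 ltW.
  move=> w; have cE tau u : coalescing_cdf c y tau (fun _ : 'I_1 => u + (b - a)) =
      heat c 0 (y ord0 - (b - a)) tau u.
    by rewrite /coalescing_cdf det_mx11 mxE ltnn subr0 heat_shift.
  by rewrite !cE.
- apply: nearW => th i e t y e0 t0; case: (fil) => [_ FM _].
  rewrite (int_ext P (fun w => heat_shift c 0 y e _ _)).
  rewrite [RHS](int_ext P (fun w => heat_shift c 0 y (e + t) _ _)).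
  by apply: (heat_mean_start _ c0 fil _ hm e0 t0) => u u0; exact: wrt_measurable (FM u u0) (ax u u0).
Qed.

Section sampled_oscillations.
Context (R : realType).
Implicit Types (N n q : nat) (a : nat -> R).

Lemma sampled_oscillation_shift N n q a (k : R) :
  sampled_oscillation N n q (fun l => a l + k) = sampled_oscillation N n q a.
Proof.
by apply: eq_bigr => l _; congr `|_|; ring.
Qed.

Lemma sampled_oscillation_ge0 N n q a : 0 <= sampled_oscillation N n q a.
Proof. by rewrite /sampled_oscillation; elim/big_ind: _ => // p r p0 r0; rewrite le_max p0. Qed.

Lemma lip_sampled_oscillation N n q : lip_class (N * (n.+1 * q.+1)) 2 1
  (fun xi : nat -> 'I_1 -> R => Num.min 1 (sampled_oscillation N n q (fun l => xi l ord0))).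
Proof.
set k := (N * _)%N; split=> [xi|xi xi'].
  rewrite ger0_norm ?ge_min ?lexx// le_min ler01 sampled_oscillation_ge0//.
apply: (le_trans (min1_distance _ _)).
set S := \sum_(l < k.+1) _.
have S0 : 0 <= S by do 2 apply: sumr_ge0 => ? _.
have one l : (l < k.+1)%N -> `|xi l ord0 - xi' l ord0| <= S.
  move=> lk; rewrite /S (bigD1 (Ordinal lk))//= big_ord1 lerDl.
  by do 2 apply: sumr_ge0 => ? _.
apply: max_distance => [|l]; first exact: mulr_ge0.
apply: (le_trans (ler_dist_dist _ _)).
have h1 := one l (ltn_ord l).
have h2 : `|xi ((l %/ q.+1) * q.+1)%N ord0 - xi' ((l %/ q.+1) * q.+1)%N ord0| <= S.
  by apply: one; apply: leq_ltn_trans (ltn_ord l); exact: leq_trunc_div.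
by move: h1 h2; rewrite !ler_norml; lra.
Qed.

End sampled_oscillations.

Section mean_oscillation.
Context (R : realType) d (T : measurableType d) (P : probability T R).
Variables (x : R -> T -> R).
Hypotheses (mx : forall t, 0 <= t -> measurable_fun setT (x t)) (cx : forall w, continuous (x ^~ w)).
Implicit Types (N n q : nat).

Definition sampled n q (w : T) (l : nat) : R := x (l%:R / (n.+1 * q.+1)%:R) w.

Lemma measurable_sampled_oscillation N n q :
  measurable_fun setT (fun w => Num.min 1 (sampled_oscillation N n q (sampled n q w))).
Proof.
apply: measurable_minr => //; rewrite /sampled_oscillation.
elim: (index_enum _) => [|l r IH].
  by under eq_fun do rewrite big_nil; exact: measurable_cst.
under eq_fun do rewrite big_cons; apply: measurable_maxr => //.
apply: measurableT_comp => //; apply: measurable_funB; apply: mx; exact: divr_ge0.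
Qed.

Lemma mean_oscillation_cvg N n :
  L1 P (fun w => Num.min 1 (oscillation N n (x ^~ w))) /\
  \int[P]_w Num.min 1 (sampled_oscillation N n q (sampled n q w)) @[q --> \oo] -->
    \int[P]_w Num.min 1 (oscillation N n (x ^~ w)).
Proof.
apply: (@int_dct _ _ _ P (fun q w => Num.min 1 (sampled_oscillation N n q (sampled n q w)))
    (fun w => Num.min 1 (oscillation N n (x ^~ w))) (fun=> 1)) => [q|w||q w].
- exact: measurable_sampled_oscillation.
- have /cvgrPdist_le h := @sampled_oscillation_cvg R (x ^~ w) (@cx w) N n.
  apply/cvgrPdist_le => e e0; apply: filterS (h e e0) => q; apply: le_trans.
  exact: min1_distance.
- exact: L1_cst.
- by rewrite ger0_norm ?ge_min ?lexx// le_min ler01 sampled_oscillation_ge0.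
Qed.

Lemma mean_oscillation_cvg0 N :
  \int[P]_w Num.min 1 (oscillation N n (x ^~ w)) @[n --> \oo] --> (0 : R).
Proof.
rewrite -(int0 P).
apply: (@int_dct _ _ _ P (fun n w => Num.min 1 (oscillation N n (x ^~ w))) _ (fun=> 1)
  _ _ _ _).2 => [n|w||n w].
- exact: L1_measurable (mean_oscillation_cvg N n).1.
- have /cvgrPdist_le h := @oscillation_cvg0 R (x ^~ w) (@cx w) N.
  apply/cvgrPdist_le => e e0; apply: filterS (h e e0) => n; apply: le_trans.
  rewrite -[X in `|X - _| <= _](_ : Num.min 1 0 = 0 :> R); first exact: min1_distance.
  by rewrite min_r.
- exact: L1_cst.
- by rewrite ger0_norm ?ge_min ?lexx// le_min ler01 oscillation_ge0.
Qed.

End mean_oscillation.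

(** Up to its starting point the process has the law of a Brownian motion, and
    oscillations ignore the starting point. The equality is exact: asymptotic
    agreement of two constants is equality. *)
Lemma mean_oscillation_law (R : realType) d (T : measurableType d) (P : probability T R)
    d' (T' : measurableType d') (P' : probability T' R) (F : R -> set (set T))
    (F' : R -> set (set T')) (c a a' : R) (x : R -> T -> R) (x' : R -> T' -> R) N n :
  0 < c -> is_filtration F -> is_filtration F' -> adapted F x -> adapted F' x' ->
  (forall w, continuous (x ^~ w)) -> (forall w, continuous (x' ^~ w)) ->
  {ae P, forall w, x 0 w = a} -> {ae P', forall w, x' 0 w = a'} ->
  heat_mean P F c x -> heat_mean P' F' c x' ->
  \int[P]_w Num.min 1 (oscillation N n (x ^~ w)) = \int[P']_w Num.min 1 (oscillation N n (x' ^~ w)).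
Proof.
move=> c0 fil fil' ax ax' cx cx' x0 x'0 hm hm'.
have mx t : 0 <= t -> measurable_fun setT (x t).
  by move=> t0; case: (fil) => [_ FM _]; exact: wrt_measurable (FM t t0) (ax t t0).
have mx' t : 0 <= t -> measurable_fun setT (x' t).
  by move=> t0; case: (fil') => [_ FM _]; exact: wrt_measurable (FM t t0) (ax' t t0).
have h := (mean_oscillation_cvg P mx cx N n).2.
have h' := (mean_oscillation_cvg P' mx' cx' N n).2.
suff E q : \int[P]_w Num.min 1 (sampled_oscillation N n q (sampled x n q w)) =
    \int[P']_w Num.min 1 (sampled_oscillation N n q (sampled x' n q w)).
  move: h; rewrite (funext E) => h.
  by rewrite -(cvg_lim (@Rhausdorff R) h) -(cvg_lim (@Rhausdorff R) h').
pose tt l : R := l%:R / (n.+1 * q.+1)%:R.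
have M0 : (0 : R) < (n.+1 * q.+1)%:R by rewrite ltr0n.
have tt0 : tt 0 = 0 by rewrite /tt mul0r.
have ttS k : tt k < tt k.+1 by rewrite ltr_pM2r ?invr_gt0// ltr_nat.
have FO : Filter (\oo : set_system nat) by exact: _.
have fl := @single_flow R nat \oo d T P F c x a 0 FO c0 fil ax x0 hm.
have fl' := @single_flow R nat \oo d' T' P' F' c x' a' 0 FO c0 fil' ax' x'0 hm'.
have := flow_agreement FO c0 tt0 ttS fl fl' (ler0n _ 2) ltr01 (@lip_sampled_oscillation R N n q).
rewrite /flow_at/= => ag.
have S1 w : sampled_oscillation N n q (fun l => x (tt l) w + (0 - a)) =
    sampled_oscillation N n q (sampled x n q w) by exact: sampled_oscillation_shift.
have S2 w : sampled_oscillation N n q (fun l => x' (tt l) w + (0 - a')) =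
    sampled_oscillation N n q (sampled x' n q w) by exact: sampled_oscillation_shift.
apply/eqP; rewrite -subr_eq0 -normr_le0; apply/ler_addgt0Pr => e e0; rewrite add0r.
have [k _ /(_ k (leqnn k))] := ag e e0.
rewrite (int_ext P (fun w => congr1 (Num.min 1) (S1 w))).
by rewrite (int_ext P' (fun w => congr1 (Num.min 1) (S2 w))).
Qed.

(** * Convergence of finite-dimensional distributions *)

Section sorting.
Context (R : realType) (m : nat).

Lemma sorting_perm (a : 'I_m -> R) : exists s : 'S_m, sorted_vec (fun i => a (s i)).
Proof.
pose r := relpre a (<=%O : rel R).
have rt : total r by move=> i j; exact: le_total.
have rtr : transitive r by move=> i j k; exact: le_trans.
pose l := sort r (enum 'I_m).
have sl : size l = m by rewrite size_sort size_enum_ord.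
have [i0|] := pselect (exists i0 : 'I_m, True); last first.
  by move=> no; exists 1%g => i; case: no; exists i.
case: i0 => i0 _.
have inj : injective (fun i : 'I_m => nth i0 l i).
  move=> i j /eqP; rewrite nth_uniq ?sl ?ltn_ord// ?sort_uniq ?enum_uniq//.
  by move/eqP/val_inj.
exists (perm inj) => i j ij; rewrite !permE.
have := sorted_leq_nth rtr (fun i => le_refl (a i)) i0 (sort_sorted rt (enum 'I_m)).
by apply => //; rewrite inE sl ltn_ord.
Qed.

End sorting.

Lemma lip_class_perm (R : realType) (m k : nat) (L B : R) (G : (nat -> 'I_m -> R) -> R) (s : 'S_m) :
  lip_class k L B G -> lip_class k L B (fun xi => G (fun l i => xi l (s i))).
Proof.
move=> [GB GL]; split=> // xi xi'; apply: (le_trans (GL _ _)).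
rewrite le_eqVlt; apply/orP; left; apply/eqP; congr (_ * _); apply: eq_bigr => l _.
by rewrite [RHS](reindex_inj (@perm_inj _ s)).
Qed.

Section from_interacting_to_coalescing.
Context (R : realType) (m : nat) (h : R -> R).
Hypotheses (hC1 : C1_square_integrable h) (h_neq0 : exists y, h y <> 0)
  (h_pinfty : autocorrelation h x @[x --> +oo] --> (0 : R)).
Variables (d : R -> measure_display) (T : forall th, measurableType (d th))
  (P : forall th, probability (T th) R) (F : forall th, R -> set (set (T th)))
  (W : forall th, set (R * R) -> T th -> R)
  (g : R -> R -> R) (a : R -> 'I_m -> R) (b : 'I_m -> R)
  (x : forall th, 'I_m -> R -> T th -> R).
Arguments P : clear implicits.
Arguments F : clear implicits.
Arguments W : clear implicits.
Arguments x : clear implicits.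
Local Notation c := (autocorrelation h 0).
Hypotheses (interacting : forall th, 1 <= th -> [/\ C1_square_integrable (g th),
     forall z, autocorrelation h (th * z) = autocorrelation (g th) z,
     is_filtration (F th), is_white_noise (P th) (F th) (W th) &
     forall i, regular (x th i) /\ solves_noise_equation (P th) (F th) (W th) (g th) (a th i) (x th i)])
  (a_cvg : forall i, a theta i @[theta --> +oo] --> b i).
Variables (d' : measure_display) (T' : measurableType d') (P' : probability T' R)
  (F' : R -> set (set T')) (y : 'I_m -> R -> T' -> R).
Hypotheses (filF' : is_filtration F') (bm : forall i, is_BM P' F' c (y i))
  (start : forall i, {ae P', forall w, y i 0 w = b i})
  (cy : forall i w, continuous (y i ^~ w))
  (coalesce : forall i j, i != j -> exists2 B : R -> T' -> R, is_BM P' F' (2 * c) B &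
    {ae P', forall w, forall t, 0 <= t -> `|y i t w - y j t w| = stopped_at0 (B ^~ w) t}).

Variable tt : nat -> R.
Hypotheses (tt0 : tt 0 = 0) (ttS : forall k, tt k < tt k.+1).

Let c0 : 0 < c := autocorrelation_gt0 hC1 h_neq0.
Let large : \forall th \near +oo, 1 <= th :> R.
Proof. exact: nbhs_pinfty_ge. Qed.

Let a_close delta : 0 < delta -> \forall th \near +oo, forall i, `|a th i - b i| <= delta.
Proof.
move=> d0; apply: filter_forall => i; have /cvgrPdist_le/(_ _ d0) := @a_cvg i.
by apply: filterS => th; rewrite distrC.
Qed.

(** Along the parameters whose starting points are put in order by [s], both
    systems are flow families; if the limit points are not put in order by [s],
    there are eventually no such parameters. *)
Lemma agreement_on_sorted (s : 'S_m) k L B G : 0 <= L -> 0 < B -> lip_class k L B G ->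
  asymp (within [set th | sorted_vec (fun i => a th (s i))] +oo)
    (fun th => \int[P th]_w G (flow_at (x th) tt w)) (fun=> \int[P']_w G (flow_at y tt w)).
Proof.
move=> L0 B0 GL; set FF := within _ _.
have FFF : Filter FF by exact: _.
have [sb|nsb] := pselect (sorted_vec (fun i => b (s i))); last first.
  move=> delta d0; rewrite /FF near_withinE.
  have [i [j [ij ba]]] : exists i j : 'I_m, (i <= j)%N /\ b (s j) < b (s i).
    apply: contrapT => no; apply: nsb => i j ij; rewrite leNgt; apply/negP => ba.
    by apply: no; exists i, j.
  have e0 : 0 < (b (s i) - b (s j)) / 4 by rewrite divr_gt0// subr_gt0.
  apply: filterS (a_close e0) => th ac srt.
  have := srt i j ij; have := ac (s i); have := ac (s j); rewrite !ler_norml.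
  by move: ba; lra.
pose Gs xi := G (fun l i => xi l ((s^-1)%g i)).
have GsL : lip_class k L B Gs by exact: lip_class_perm.
have near1 : \forall th \near FF, 1 <= th.
  by rewrite /FF near_withinE; apply: filterS large => th h' _.
have flow : flow_family FF P F c (fun i => b (s i)) (fun th i => x th (s i)).
  apply: (@interacting_flow R m FF FFF h hC1 h_neq0 h_pinfty d T P F W g (fun th i => a th (s i))).
  - move=> M; rewrite /FF near_withinE.
    by apply: filterS (nbhs_pinfty_ge (num_real M)) => th h' _.
  - by apply: filterS near1 => th /interacting[g1 g2 g3 g4 g5]; split=> // i; exact: g5.
  - by rewrite /FF near_withinE; apply: nearW.
  - move=> delta d0; rewrite /FF near_withinE; apply: filterS (a_close d0) => th ac _ i; exact: ac.
have flow' : flow_family FF (fun=> P') (fun=> F') c (fun i => b (s i)) (fun _ i => y (s i)).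
  apply: (@coalescing_flow R R FF FFF d' T' P' F' m c (fun i => b (s i)) (fun i => y (s i)) filF' c0
    (fun i => bm (s i)) (fun i => start (s i)) (fun i w => @cy (s i) w) sb) => i j ij.
  by apply: coalesce; rewrite (inj_eq perm_inj).
have E (z : 'I_m -> R) : (fun i => z (s ((s^-1)%g i))) = z.
  by apply/funext => i; rewrite permKV.
have := flow_agreement FFF c0 tt0 ttS flow flow' L0 B0 GsL.
have E1 th w : Gs (flow_at (fun i => x th (s i)) tt w) = G (flow_at (x th) tt w).
  by congr G; apply/funext => l; apply/funext => i; rewrite /flow_at permKV.
have E2 w : Gs (flow_at (fun i => y (s i)) tt w) = G (flow_at y tt w).
  by congr G; apply/funext => l; apply/funext => i; rewrite /flow_at permKV.
move=> ag delta d0; apply: filterS (ag delta d0) => th.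
by rewrite (int_ext (P th) (E1 th)) (int_ext P' E2).
Qed.

(** Finitely many permutations suffice to order the starting points. *)
Theorem finite_dimensional_convergence k L B G : 0 <= L -> 0 < B -> lip_class k L B G ->
  asymp (+oo : set_system R) (fun th => \int[P th]_w G (flow_at (x th) tt w))
    (fun=> \int[P']_w G (flow_at y tt w)).
Proof.
move=> L0 B0 GL delta d0.
have : \forall th \near +oo, forall s : 'S_m, sorted_vec (fun i => a th (s i)) ->
    `|\int[P th]_w G (flow_at (x th) tt w) - \int[P']_w G (flow_at y tt w)| <= delta.
  apply: filter_forall => s; have := agreement_on_sorted s L0 B0 GL d0.
  by rewrite near_withinE.
apply: filterS => th hs; have [s srt] := sorting_perm (a th); exact: hs srt.
Qed.

Lemma particle_oscillation th i N n : 1 <= th ->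
  \int[P th]_w Num.min 1 (oscillation N n (x th i ^~ w)) =
  \int[P']_w Num.min 1 (oscillation N n (y i ^~ w)).
Proof.
move=> th1; have [gC rg fil wn sol] := interacting th1; have [rx sx] := sol i.
have r0 : autocorrelation (g th) 0 = c by rewrite -rg mulr0.
have hm : heat_mean (P th) (F th) c (x th i).
  by rewrite -r0; apply: (solution_heat_mean fil wn gC _ rx sx); rewrite r0.
exact: (mean_oscillation_law N n c0 fil filF' sx.1 (BM_adapted (bm i)) rx.2 (@cy i)
  (solution_start fil wn gC rx sx) (start i) hm (BM_heat_mean filF' c0 (bm i))).
Qed.

End from_interacting_to_coalescing.

(** * Convergence on path space *)

Section borel_path_functionals.
Context (R : realType) (m : nat).

Lemma borel_path_measurable (f : borel_paths R m -> R) :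
  (forall A : set R, open A -> open [set g : path_space R m | A (f g)]) -> measurable_fun setT f.
Proof.
move=> oc; apply: (measurability _ (RGenOInfty.measurableE R)) => _ [_ [r ->] <-].
rewrite setTI; apply: sub_sigma_algebra; apply: oc; exact: interval_open.
Qed.

Lemma measurable_at_time i t : measurable_fun setT (fun g : borel_paths R m => at_time g i t).
Proof. by apply: borel_path_measurable => A; exact: at_time_open. Qed.

Lemma continuous_path_measurable (phi : path_space R m -> R) : continuous phi ->
  measurable_fun setT (phi : borel_paths R m -> R).
Proof. by move=> cphi; apply: borel_path_measurable => A oA; apply: open_comp => // ? _; exact: cphi. Qed.

Lemma regular_coord d (T : measurableType d) (X : {mfun T >-> borel_paths R m}) i :
  regular (Defs.coord X i).
Proof.
split=> [t|w]; last exact: (@continuous_at_time R m (X w) i).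
exact: (measurableT_comp (measurable_at_time i t) (measurable_funP X)).
Qed.

End borel_path_functionals.

Section portmanteau.
Context (R : realType) (m : nat).
Variables (phi : path_space R m -> R) (K : R).
Hypotheses (cphi : continuous phi) (phiK : forall f, `|phi f| <= K).
Implicit Types (N n : nat).

Let K0 : 0 <= K := le_trans (normr_ge0 _) (phiK point).

Definition step_envelope N n (xi : nat -> 'I_m -> R) : R :=
  envelope phi K N (fun t => xi (cell n t)).

Lemma lip_step_envelope N n : lip_class (N * n.+1) N%:R (K + 1) (step_envelope N n).
Proof.
split=> [xi|xi xi']; first by apply: (le_trans (envelope_bound phiK _ _)); rewrite lerDl.
apply: envelope_lipschitz => //; first by do 2 apply: sumr_ge0 => ? _.
move=> i t t0 tN; have ln := cell_le n t0 tN; rewrite -ltnS in ln.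
rewrite (bigD1 (Ordinal ln))//= (bigD1 i)//= -addrA lerDl addr_ge0// sumr_ge0// => l _.
exact: sumr_ge0.
Qed.

Let C N : R := N%:R + 2 * K.
Let C0 N : 0 <= C N.
Proof. by rewrite addr_ge0// mulr_ge0. Qed.

(** If all oscillations stay below one, this is the Lipschitz bound of the
    envelope; otherwise the sum is at least one and twice the bound [K] is paid. *)
Lemma step_envelope_error N n (u : 'I_m -> R -> R) : (forall i, continuous (u i)) ->
  `|envelope phi K N (fun t i => u i t) - step_envelope N n (fun l i => u i (l%:R / n.+1%:R))| <=
  C N * \sum_i Num.min 1 (oscillation N n (u i)).
Proof.
move=> cu; have o0 i : 0 <= Num.min 1 (oscillation N n (u i)).
  by rewrite le_min ler01 oscillation_ge0.
have S0 : 0 <= \sum_i Num.min 1 (oscillation N n (u i)) by exact: sumr_ge0.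
have [/existsP[i big]|] := boolP [exists i, 1 <= oscillation N n (u i)].
  have S1 : 1 <= \sum_i Num.min 1 (oscillation N n (u i)).
    by rewrite (bigD1 i)//= (min_l big) lerDl sumr_ge0.
  apply: (le_trans (ler_normB _ _)).
  have h := lerD (envelope_bound phiK N (fun t i => u i t)) (envelope_bound phiK N
    (fun t => (fun l i => u i (l%:R / n.+1%:R)) (cell n t))).
  apply: (le_trans h); apply: (@le_trans _ _ (C N * 1)); last by rewrite ler_wpM2l.
  by rewrite mulr1 /C; have : (0 : R) <= N%:R by []; lra.
rewrite negb_exists => /forallP small.
have mE i : Num.min 1 (oscillation N n (u i)) = oscillation N n (u i).
  by rewrite min_r//; have := small i; rewrite -ltNge => /ltW.
apply: (@le_trans _ _ (N%:R * \sum_i Num.min 1 (oscillation N n (u i)))); last first.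
  by rewrite ler_wpM2r// /C lerDl mulr_ge0.
apply: envelope_lipschitz => // i t t0 tN.
rewrite (bigD1 i)//= mE; apply: (le_trans (deviation_le_oscillation (cu i) n t0 tN)).
by rewrite lerDl sumr_ge0.
Qed.

Variables (d : R -> measure_display) (T : forall th, measurableType (d th))
  (P : forall th, probability (T th) R)
  (X : forall th, {mfun T th >-> borel_paths R m}).
Arguments P : clear implicits.
Arguments X : clear implicits.
Variables (d' : measure_display) (T' : measurableType d') (P' : probability T' R)
  (Y : {mfun T' >-> borel_paths R m}).

Hypotheses (fdd : forall tt : nat -> R, tt 0 = 0 -> (forall k, tt k < tt k.+1) ->
    forall k L B G, 0 <= L -> 0 < B -> lip_class k L B G ->
    asymp (+oo : set_system R)
      (fun th => \int[P th]_w G (flow_at (fun i => Defs.coord (X th) i) tt w))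
      (fun=> \int[P']_w G (flow_at (fun i => Defs.coord Y i) tt w)))
  (osc : forall th i N n, 1 <= th ->
    \int[P th]_w Num.min 1 (oscillation N n (Defs.coord (X th) i ^~ w)) =
    \int[P']_w Num.min 1 (oscillation N n (Defs.coord Y i ^~ w))).

Lemma L1_continuous_path d1 (T1 : measurableType d1) (P1 : probability T1 R)
  (Z : {mfun T1 >-> borel_paths R m}) : L1 P1 (fun w => phi (Z w)).
Proof.
apply: (@L1_bdd _ _ _ _ K) => //.
exact: (measurableT_comp (continuous_path_measurable cphi) (measurable_funP Z)).
Qed.

Lemma L1_oscillation d1 (T1 : measurableType d1) (P1 : probability T1 R)
  (Z : {mfun T1 >-> borel_paths R m}) i N n :
  L1 P1 (fun w => Num.min 1 (oscillation N n (Defs.coord Z i ^~ w))).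
Proof.
have [mZ cZ] := regular_coord Z i.
exact: (mean_oscillation_cvg P1 (fun t _ => mZ t) cZ N n).1.
Qed.

Lemma L1_step_envelope d1 (T1 : measurableType d1) (P1 : probability T1 R)
  (Z : {mfun T1 >-> borel_paths R m}) (tt : nat -> R) N n :
  L1 P1 (fun w => step_envelope N n (flow_at (fun i => Defs.coord Z i) tt w)).
Proof.
have lip := lip_step_envelope N n.
apply: (@L1_bdd _ _ _ _ (K + 1)); last by move=> w; exact: lip.1.
have sM := @sigma_algebra_measurable _ T1.
have := lip_class_wrt (ler0n R N) lip sM (z := fun l i => Defs.coord Z i (tt l)).
move=> h; apply: (@wrt_measurable _ T1 _ measurable) => //; apply: h => l i _ D mD.
by rewrite -[_ @^-1` _]setTI; exact: ((regular_coord Z i).1 (tt l) measurableT D mD).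
Qed.

Lemma envelope_sampling_cvg N w :
  step_envelope N n (flow_at (fun i => Defs.coord Y i) (fun l => l%:R / n.+1%:R) w) @[n --> \oo] -->
  envelope phi K N (trajectory (Y w)).
Proof.
apply/cvgrPdist_le => e e0.
have [eta [eta0 _ etaK]] := small_choice (mulr_ge0 (C0 N) (ler0n R m)) e0.
have : \forall n \near \oo, forall i, oscillation N n (Defs.coord Y i ^~ w) <= eta.
  apply: filter_forall => i.
  have /cvgrPdist_le/(_ _ eta0) := @oscillation_cvg0 R _ ((regular_coord Y i).2 w) N.
  by apply: filterS => n; rewrite sub0r normrN; apply: le_trans; exact: ler_norm.
apply: filterS => n on.
apply: (le_trans (step_envelope_error N n (u := fun i => Defs.coord Y i ^~ w) _)).
  by move=> i; exact: (regular_coord Y i).2.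
apply: le_trans etaK; rewrite -mulrA; apply: ler_wpM2l => //.
have -> : m%:R * eta = \sum_(i < m) eta by rewrite sumr_const card_ord -[RHS]mulr_natl.
by apply: ler_sum => i _; rewrite ge_min on orbT.
Qed.

Lemma mean_envelope N :
  L1 P' (fun w => envelope phi K N (trajectory (Y w))).
Proof.
apply: (@int_dct _ _ _ P' (fun n w => step_envelope N n (flow_at (fun i => Defs.coord Y i)
    (fun l => l%:R / n.+1%:R) w)) (fun w => envelope phi K N (trajectory (Y w))) (fun=> K + 1)
    _ _ _ _).1 => [n|w||n w].
- exact: L1_measurable (L1_step_envelope _ _ _ _ _).
- exact: envelope_sampling_cvg.
- exact: L1_cst.
- exact: (lip_step_envelope N n).1.
Qed.

Lemma mean_envelope_cvg :
  \int[P']_w envelope phi K N (trajectory (Y w)) @[N --> \oo] --> \int[P']_w phi (Y w).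
Proof.
apply: (@int_dct _ _ _ P' (fun N w => envelope phi K N (trajectory (Y w))) (fun w => phi (Y w))
    (fun=> K) _ _ _ _).2 => [N|w||N w].
- exact: L1_measurable (mean_envelope N).
- exact: envelope_cvg.
- exact: L1_cst.
- exact: envelope_bound.
Qed.

(** Half of the weak convergence: the test function is bounded below by its
    envelope, which up to the oscillations of the paths is a functional of
    finitely many times, and the mean oscillations do not depend on the
    parameter. *)
Lemma lower_semicontinuity e : 0 < e ->
  \forall th \near (+oo : set_system R), \int[P']_w phi (Y w) - e <= \int[P th]_w phi (X th w).
Proof.
move=> e0; have e4 : 0 < e / 4 by rewrite divr_gt0.
have /cvgrPdist_le/(_ _ e4)[N _ /(_ N (leqnn N)) hN] := mean_envelope_cvg.
have [eta [eta0 _ etaK]] := small_choice (mulr_ge0 (C0 N) (ler0n R m)) e4.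
pose o n i := \int[P']_w Num.min 1 (oscillation N n (Defs.coord Y i ^~ w)).
have [n hn] : exists n, forall i, o n i <= eta.
  have : \forall n \near \oo, forall i, o n i <= eta.
    apply: filter_forall => i.
    have /cvgrPdist_le/(_ _ eta0) := @mean_oscillation_cvg0 R _ _ P' _
      (fun t _ => (regular_coord Y i).1 t) (regular_coord Y i).2 N.
    by apply: filterS => n; rewrite sub0r normrN; apply: le_trans; exact: ler_norm.
  by move=> [n _ /(_ n (leqnn n)) h]; exists n.
have small : C N * \sum_i o n i <= e / 4.
  apply: le_trans etaK; rewrite -mulrA; apply: ler_wpM2l => //.
  have -> : m%:R * eta = \sum_(i < m) eta by rewrite sumr_const card_ord -[RHS]mulr_natl.
  exact: ler_sum.
pose tt l : R := l%:R / n.+1%:R.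
have tt0 : tt 0 = 0 by rewrite /tt mul0r.
have ttS k : tt k < tt k.+1 by rewrite ltr_pM2r ?invr_gt0// ltr_nat.
have K1 : 0 < K + 1 by rewrite ltr_wpDl.
have := fdd tt0 ttS (ler0n R N) K1 (lip_step_envelope N n) e4.
move=> ag; apply: filterS2 ag (nbhs_pinfty_ge (num_real 1)) => th close th1.
have osum d1 (T1 : measurableType d1) (P1 : probability T1 R) (Z : {mfun T1 >-> borel_paths R m}) :
    L1 P1 (fun w => C N * \sum_i Num.min 1 (oscillation N n (Defs.coord Z i ^~ w))) /\
    \int[P1]_w (C N * \sum_i Num.min 1 (oscillation N n (Defs.coord Z i ^~ w))) =
    C N * \sum_i \int[P1]_w Num.min 1 (oscillation N n (Defs.coord Z i ^~ w)).
  have l i := L1_oscillation P1 Z i N n.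
  have ls : L1 P1 (fun w => \sum_i Num.min 1 (oscillation N n (Defs.coord Z i ^~ w))) by exact: L1_sum.
  by split; [exact: L1Z|rewrite intZ// int_sum].
have err d1 (T1 : measurableType d1) (Z : {mfun T1 >-> borel_paths R m}) w :
    `|envelope phi K N (trajectory (Z w)) - step_envelope N n (flow_at (fun i => Defs.coord Z i) tt w)| <=
    C N * \sum_i Num.min 1 (oscillation N n (Defs.coord Z i ^~ w)).
  apply: (step_envelope_error N n (u := fun i => Defs.coord Z i ^~ w)) => i.
  exact: (regular_coord Z i).2.
have lo : \int[P']_w envelope phi K N (trajectory (Y w)) - C N * \sum_i o n i <=
    \int[P']_w step_envelope N n (flow_at (fun i => Defs.coord Y i) tt w).
  have [l1 <-] := osum _ _ P' Y; rewrite -intB//; last exact: mean_envelope.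
  apply: int_le; [by apply: L1B => //; exact: mean_envelope|exact: L1_step_envelope|move=> w].
  by have := err _ _ Y w; rewrite ler_norml; move: (C N * _) => u; lra.
have hi : \int[P th]_w step_envelope N n (flow_at (fun i => Defs.coord (X th) i) tt w) -
    C N * \sum_i o n i <= \int[P th]_w phi (X th w).
  have [l1 E] := osum _ _ (P th) (X th).
  have -> : C N * \sum_i o n i = \int[P th]_w (C N * \sum_i Num.min 1 (oscillation N n (Defs.coord (X th) i ^~ w))).
    by rewrite E; congr (_ * _); apply: eq_bigr => i _; rewrite osc.
  rewrite -intB//; last exact: L1_step_envelope.
  apply: int_le; [by apply: L1B => //; exact: L1_step_envelope|exact: L1_continuous_path|move=> w].
  have := err _ _ (X th) w; have := envelope_le phiK N (X th w); rewrite ler_norml.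
  by move: (C N * _) => u; lra.
move: hN close lo hi small; rewrite !ler_norml.
move: (C N * _) => u; move: (\int[P']_w phi _) (\int[P']_w envelope _ _ _ _) (\int[P']_w step_envelope _ _ _)
  (\int[P th]_w step_envelope _ _ _) (\int[P th]_w phi _) => I1 I2 I3 I4 I5.
by lra.
Qed.

End portmanteau.

Lemma int_distribution (R : realType) (m : nat) d (T : measurableType d) (P : probability T R)
    (X : {mfun T >-> borel_paths R m}) (phi : path_space R m -> R) (K : R) :
  continuous phi -> (forall f, `|phi f| <= K) ->
  (\int[distribution P X]_f (phi f)%:E)%E = (\int[P]_w phi (X w))%:E.
Proof.
move=> cphi phiK; have mphi := continuous_path_measurable cphi.
have l := L1_continuous_path cphi phiK P X.
rewrite /distribution (integral_pushforward (measurable_funP X) (f := fun f => (phi f)%:E))//.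
  by rewrite preimage_setT -(int_EFin l).
exact/measurable_EFinP.
Qed.

Theorem theorem2p3 (R : realType) (h : R -> R)
  (h_neq0 : exists y, h y <> 0)
  (h_C1 : C1_square_integrable h)
  (rho_pinfty : autocorrelation h x @[x --> +oo] --> (0 : R))
  (rho_ninfty : autocorrelation h x @[x --> -oo] --> (0 : R))
  (m : nat) (m_gt0 : (0 < m)%N)
  (d : R -> measure_display) (T : forall theta, measurableType (d theta))
  (P : forall theta, probability (T theta) R)
  (X : forall theta, {mfun T theta >-> borel_paths R m})
  (a : R -> 'I_m -> R) (b : 'I_m -> R)
  (X_interacting : forall theta, 1 <= theta ->
     is_interacting_BM (P theta) (fun x => autocorrelation h (theta * x)) (a theta)
       (X theta))
  (a_cvg : forall i, a theta i @[theta --> +oo] --> b i)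
  (d' : measure_display) (T' : measurableType d') (Q : probability T' R)
  (Y : {mfun T' >-> borel_paths R m})
  (Y_coalescing : is_coalescing_BM Q (autocorrelation h 0) b Y) :
  weakly_converges (fun theta => distribution (P theta) (X theta))
    (distribution Q Y).
Proof.
have [F' [filF' start bm coalesce]] := Y_coalescing.
have choose th : exists gFW : (R -> R) * ((R -> set (set (T th))) * (set (R * R) -> T th -> R)),
    1 <= th -> [/\ C1_square_integrable gFW.1,
      forall x, autocorrelation h (th * x) = autocorrelation gFW.1 x,
      is_filtration gFW.2.1, is_white_noise (P th) gFW.2.1 gFW.2.2 &
      forall i, solves_noise_equation (P th) gFW.2.1 gFW.2.2 gFW.1 (a th i) (Defs.coord (X th) i)].
  have [/X_interacting[g [F [W HX]]]|no] := pselect (1 <= th).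
    by exists (g, (F, W)).
  by exists (h, (fun=> set0, fun _ _ => 0)).
pose gFW th := sval (cid (choose th)).
pose g th := (gFW th).1; pose F th := (gFW th).2.1; pose W th := (gFW th).2.2.
have inter th : 1 <= th -> [/\ C1_square_integrable (g th),
     forall z, autocorrelation h (th * z) = autocorrelation (g th) z,
     is_filtration (F th), is_white_noise (P th) (F th) (W th) &
     forall i, regular (Defs.coord (X th) i) /\
       solves_noise_equation (P th) (F th) (W th) (g th) (a th i) (Defs.coord (X th) i)].
  move=> th1; have [h1 h2 h3 h4 h5] := svalP (cid (choose th)) th1.
  by split=> // i; split; [exact: regular_coord|exact: h5].
have cY i w : continuous (Defs.coord Y i ^~ w) := (regular_coord Y i).2 w.
have fdd tt tt0 ttS k L B G := @finite_dimensional_convergence R m h h_C1 h_neq0 rho_pinfty d T P F W g a b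
  (fun th i => Defs.coord (X th) i) inter a_cvg d' T' Q F' (fun i => Defs.coord Y i) filF' bm start
  cY coalesce tt tt0 ttS k L B G.
have osc th i N n := @particle_oscillation R m h h_C1 h_neq0 d T P F W g a b
  (fun th i => Defs.coord (X th) i) inter d' T' Q F' (fun i => Defs.coord Y i) filF' bm start
  cY th i N n.
move=> phi cphi [K phiK].
have cN : continuous (fun f : path_space R m => - phi f).
  move=> f U nU; have oc : {for phi f, continuous (fun z : R => - z)} by exact: opp_continuous.
  have nb : nbhs (phi f) ((fun z : R => - z) @^-1` U) by exact: oc.
  have := cphi f _ nb; exact.
have NK f : `|- phi f| <= K by rewrite normrN.
have E th := int_distribution (P th) (X th) cphi phiK.
rewrite (funext E) (int_distribution Q Y cphi phiK).
apply: cvg_EFin; first exact: nearW.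
apply/cvgrPdist_le => e e0.
have lo := lower_semicontinuity cphi phiK fdd osc e0.
have hi := lower_semicontinuity cN NK fdd osc e0.
have opp d1 (T1 : measurableType d1) (P1 : probability T1 R) (Z : {mfun T1 >-> borel_paths R m}) :
    \int[P1]_w - phi (Z w) = - \int[P1]_w phi (Z w).
  have l := L1_continuous_path cphi phiK P1 Z.
  by rewrite -mulN1r -intZ//; apply: int_ext => w; rewrite mulN1r.
apply: filterS2 lo hi => th; rewrite !opp /= ler_norml.
by lra.
Qed.
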